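(* Fix $N\ge4$ and consider the system $$\dot\phi_j=f(Z)e^{\mathrm{i}\phi_j}+g(Z)+\overline{f(Z)}e^{-\mathrm{i}\phi_j}+\epsilon h(\phi_j),\quad j=1,\dots,N,\qquad Z=\frac1N\sum_{j=1}^N e^{\mathrm{i}\phi_j},$$ for $\boldsymbol\phi=(\phi_1,\dots,\phi_N)\in\mathbb{T}^N_{\mathrm{ordered}}$, where $f:\mathbb{D}\to\mathbb{C}$, $g:\mathbb{D}\to\mathbb{R}$ are smooth and $h(\phi)=\sum_{n=2}^\infty (a_n\sin n\phi+b_n\cos n\phi)$ is a smooth real function with $\|h\|_{L^2}:=\sqrt{\sum_{n\ge2}(|a_n|^2+|b_n|^2)}=1$. Assume that $f,g,N$ are such that for $\epsilon=0$ the normally attracting invariant manifold $\mathcal{M}_\delta$ described in the context exists. For $\epsilon=0$, let $$\mathcal{M}=\bigcup_{\boldsymbol\lambda\in W}\mathcal{C}_{\boldsymbol\lambda}$$ denote the largest extension of $\mathcal{M}_\delta$ in $\mathbb{T}^N_{\mathrm{ordered}}$ such that $W\subset V$ is the largest open set for which for every $\boldsymbol\lambda\in W$ there exists a periodic orbit $\mathcal{C}_{\boldsymbol\lambda}\subset\mathcal{L}_{\boldsymbol\lambda}$ which is exponentially stable in $\mathcal{L}_{\boldsymbol\lambda}$, and $\mathcal{M}$ is a normally attracting invariant manifold. For every $\boldsymbol\lambda\in W$, fix a $\boldsymbol\theta=\boldsymbol\theta(\boldsymbol\lambda)\in\mathcal{C}_{\boldsymbol\lambda}$ and let $\boldsymbol\phi_{\boldsymbol\lambda}(t)$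 denote the solution of the system with $\epsilon=0$ and initial condition $\boldsymbol\phi_{\boldsymbol\lambda}(0)=\boldsymbol\theta$. Then: 1. The function $$\boldsymbol F_h(\boldsymbol\lambda):=\frac1{T(\boldsymbol\lambda)}\int_0^{T(\boldsymbol\lambda)}\left(D\boldsymbol\Lambda\cdot\boldsymbol h\right)\circ\boldsymbol\phi_{\boldsymbol\lambda}(t)\,\mathrm{d}t,\qquad \boldsymbol\lambda\in W,$$ where $T(\boldsymbol\lambda)$ is the period of $\boldsymbol\phi_{\boldsymbol\lambda}$, is continuously differentiable, well-defined, and independent of the choice of $\boldsymbol\theta(\boldsymbol\lambda)\in\mathcal{C}_{\boldsymbol\lambda}$. 2. For $N=4$, the function $F_h$ fulfills $F_h(\lambda)=-F_h(1-\lambda)$, and in particular $F_h(\lambda^* )=0$ with $\lambda^*=1/2$. 3. For any $N\ge4$, $\boldsymbol F_h(\boldsymbol\lambda^* )=\boldsymbol 0$.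
   Context: Notation: $\mathbb{D}=\{z\in\mathbb{C}:|z|<1\}$, $\mathbb{S}^1=\mathbb{R}/2\pi\mathbb{Z}$, $\mathbb{T}^N=(\mathbb{S}^1)^N$; smoothness on $\mathbb{D}$ is in the real sense. $\mathbb{T}^N_{\mathrm{ordered}}$ is the set of $\boldsymbol\theta\in\mathbb{T}^N$ with real representatives satisfying $\theta_1<\dots<\theta_N<\theta_1+2\pi$. $V=\{\boldsymbol\lambda\in(0,1)^{N-3}: 1>\lambda_1>\dots>\lambda_{N-3}>0\}$. Cross-ratio map $\boldsymbol\Lambda=(\Lambda_1,\dots,\Lambda_{N-3}):\mathbb{T}^N_{\mathrm{ordered}}\to V$, $$\Lambda_k(\boldsymbol\theta)=\frac{(e^{\mathrm{i}\theta_1}-e^{\mathrm{i}\theta_{k+3}})(e^{\mathrm{i}\theta_2}-e^{\mathrm{i}\theta_3})}{(e^{\mathrm{i}\theta_2}-e^{\mathrm{i}\theta_{k+3}})(e^{\mathrm{i}\theta_1}-e^{\mathrm{i}\theta_3})}.$$ Level sets: $\mathcal{L}_{\boldsymbol\lambda}=\{\boldsymbol\theta\in\mathbb{T}^N_{\mathrm{ordered}}:\boldsymbol\Lambda(\boldsymbol\theta)=\boldsymbol\lambda\}$; they are invariant under the system with $\epsilon=0$. The distinguished point is $\boldsymbol\lambda^*=\boldsymbol\Lambda(\boldsymbol\theta^* )$, where $\theta^*_j=-\pi+\frac{2\pi}{N}(j-1)$. With $\boldsymbol h(\boldsymbol\phi)=(h(\phi_1),\dots,h(\phi_N))$, one sets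 $(D\boldsymbol\Lambda\cdot\boldsymbol h)(\boldsymbol\phi)=\sum_{j=1}^N h(\phi_j)\,\frac{\partial\boldsymbol\Lambda}{\partial\theta_j}(\boldsymbol\phi)\in\mathbb{R}^{N-3}$. The manifold $\mathcal{M}_\delta$: it is assumed that the closed equation $\dot\alpha=\mathrm{i}(f(\alpha)\alpha^2+g(\alpha)\alpha+\overline{f(\alpha)})$ on $\mathbb{D}$ possesses a unique stable fixed point $\alpha_0\in\mathbb{D}$ (stable: the linearization has eigenvalues with negative real part), that $f(\alpha_0)\neq0$, and that $N$ is such that there is $\delta>0$ with closed $\delta$-neighborhood $\overline V_\delta(\boldsymbol\lambda^* )\subset V$ for which, for $\epsilon=0$, every level set $\mathcal{L}_{\boldsymbol\lambda}$ with $\boldsymbol\lambda\in\overline V_\delta(\boldsymbol\lambda^* )$ contains a unique periodic orbit $\mathcal{C}_{\boldsymbol\lambda}$ that is exponentially stable in $\mathcal{L}_{\boldsymbol\lambda}$, and $\mathcal{M}_\delta=\bigcup_{\boldsymbol\lambda\in\overline V_\delta(\boldsymbol\lambda^* )}\mathcal{C}_{\boldsymbol\lambda}$ is a compact normally attracting invariant manifold of dimension $N-2$ with invariant boundary. (This is known to hold for all sufficiently large $N$.) That $\mathcal{M}$ extends $\mathcal{M}_\delta$ means $\overline V_\delta(\boldsymbol\lambda^* )\subset W$, with the same orbits $\mathcal{C}_{\boldsymbol\lambda}$ for $\boldsymbol\lambda\in\overline V_\delta(\boldsymbol\lambda^* )$. Normally attracting invariant manifold: let $r\ge1$, and let $\Phi^t$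 be the flow of a $C^r$ vector field on the phase space $X$ (here $X=\mathbb{T}^N_{\mathrm{ordered}}$). A $C^r$-submanifold $\mathcal{M}\subset X$ is normally attracting invariant if (i) $\Phi^t(\mathcal{M})=\mathcal{M}$ for all $t\in\mathbb{R}$; (ii) there is a continuous splitting $T_{\mathcal{M}}X=T\mathcal{M}\oplus\mathcal{N}$ with continuous projections, invariant under the linearized flow $D\Phi^t=D\Phi^t_{\mathcal{M}}\oplus D\Phi^t_{\mathcal{N}}$; (iii) there are real $a<rb\le0$ and $C>0$ with $\|D\Phi^t_{\mathcal{M}}(x)\nu\|\le Ce^{bt}\|\nu\|$ for all $t\le0$, $(x,\nu)\in T\mathcal{M}$, and $\|D\Phi^t_{\mathcal{N}}(x)\nu\|\le Ce^{at}\|\nu\|$ for all $t\ge0$, $(x,\nu)\in\mathcal{N}$. The manifold may have a boundary; ''invariant boundary'' means that the boundary is invariant under the flow. *)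

(* Defs.v *)
From HB Require Import structures.
From mathcomp Require Export all_boot all_order all_algebra.
From mathcomp Require Export complex.
From mathcomp Require Export all_classical all_reals all_analysis.
Export Order.TTheory GRing.Theory Num.Theory.
Export numFieldNormedType.Exports.

Set Implicit Arguments.
Unset Strict Implicit.
Unset Printing Implicit Defensive.

Local Open Scope classical_set_scope.
Local Open Scope ring_scope.
Local Open Scope complex_scope.

Section Smoothness.
Context {R : realType}.

(* f is C^k on U: the value of f outside U is irrelevant when U is open. *)
Fixpoint Ck_on (V W : normedModType R) (k : nat) (U : set V) (f : V -> W)
    {struct k} : Prop :=
  match k with
  | 0 => forall x, U x -> {for x, continuous f}
  | k'.+1 => (forall x, U x -> differentiable f x) /\
             (forall v, Ck_on k' U (fun x => 'D_v f x))
  end.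

Definition smooth_on (V W : normedModType R) (U : set V) (f : V -> W) : Prop :=
  forall k, Ck_on k U f.

(* The identification of C with R^2, used for real differentiability. *)
Definition vec_of_C (z : R[i]) : 'rV[R]_2 :=
  \row_j (if j == 0 then complex.Re z else complex.Im z).
Definition C_of_vec (v : 'rV[R]_2) : R[i] := (v 0 0) +i* (v 0 1).

Definition disk : set (R[i]) := [set z | complex.Re z ^+ 2 + complex.Im z ^+ 2 < 1].

Definition smooth_disk_C (f : R[i] -> R[i]) : Prop :=
  smooth_on [set v | disk (C_of_vec v)] (fun v => vec_of_C (f (C_of_vec v))).

Definition smooth_disk_R (g : R[i] -> R) : Prop :=
  smooth_on [set v | disk (C_of_vec v)] (fun v => g (C_of_vec v) : R^o).

Definition expi (x : R) : R[i] := cos x +i* sin x.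

End Smoothness.

(* Points of T^N_ordered are represented by their real lifts
   theta_1 < ... < theta_N < theta_1 + 2 pi.  Two such lifts represent the same
   point iff they differ by a common multiple 2 pi k (1, ..., 1), so that
   T^N_ordered is the quotient of the open set [ordered] by these translations;
   the quotient map is a covering and a local isometry.  A subset of
   T^N_ordered is represented by its (translation-stable) full preimage. *)
Section Torus.
Context {R : realType} (N : nat).
Implicit Types (x y theta : 'rV[R]_N).

(* The coordinate number k, counted from 0. *)
Definition coord (m : nat) (v : 'rV[R]_m) (k : nat) : R :=
  if insub k is Some i then v 0 i else 0.

Definition ordered : set 'rV[R]_N := [set theta : 'rV[R]_N |
  (forall i j : 'I_N, (i < j)%N -> theta 0 i < theta 0 j) /\
  coord theta N.-1 < coord theta 0 + 2 * pi].

Definition translate (k : int) x : 'rV[R]_N := x + const_mx (2 * pi * k%:~R).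

Definition same_point x y : Prop := exists k : int, y = translate k x.

Definition torus_set (A : set 'rV[R]_N) : Prop :=
  A `<=` ordered /\ forall x y, same_point x y -> A x -> A y.

Definition torus_compact (A : set 'rV[R]_N) : Prop :=
  exists2 K : set 'rV[R]_N, compact K &
    A = [set y | exists2 x, K x & same_point x y].

End Torus.

(* Dynamics on T^N_ordered generated by (the lift of) a vector field X. *)
Section Dynamics.
Context {R : realType} (N : nat) (X : 'rV[R]_N -> 'rV[R]_N).
Implicit Types (x y : 'rV[R]_N) (phi : R -> 'rV[R]_N).

Definition solution_at phi (s : R) : Prop :=
  ordered (phi s) /\ is_derive (s : R^o) 1 (phi : R^o -> _) (X (phi s)).

Definition global_solution phi : Prop := forall s, solution_at phi s.

(* The solution starting at x exists up to time t (of either sign) and is at y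
   at that time; solutions need not be global, since the coefficients of X
   are only controlled inside the open disk. *)
Definition reaches x (t : R) y : Prop :=
  exists (phi : R -> 'rV[R]_N) (c d : R),
    [/\ c < 0 < d, c < t < d, forall s, c < s < d -> solution_at phi s,
        phi 0 = x & phi t = y].

Definition flow (t : R) x : 'rV[R]_N := xget 0 [set y | reaches x t y].

Definition lin_flow (t : R) x (nu : 'rV[R]_N) : 'rV[R]_N := 'd (flow t) x nu.

Definition flow_invariant (M : set 'rV[R]_N) : Prop :=
  forall t : R, (forall x, M x -> exists y, reaches x t y) /\
                flow t @` M = M.

(* T is the minimal period, on the torus. *)
Definition min_period phi (T : R) : Prop :=
  [/\ 0 < T, forall t, same_point (phi t) (phi (t + T)) &
      forall s, 0 < s < T -> ~ (forall t, same_point (phi t) (phi (t + s)))].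

Definition periodic_orbit (C : set 'rV[R]_N) : Prop :=
  exists phi T, [/\ global_solution phi, min_period phi T &
    C = [set x | exists t, same_point (phi t) x]].

Definition dist_to (C : set 'rV[R]_N) x : R := inf [set `|x - c| | c in C].

Definition exp_stable_in (L C : set 'rV[R]_N) : Prop :=
  exists eta K mu : R, [/\ 0 < eta, 0 < K, 0 < mu &
    forall x, L x -> dist_to C x < eta -> forall t, 0 <= t ->
      exists2 y, reaches x t y & dist_to C y <= K * expR (- mu * t) * dist_to C x].

End Dynamics.

Section Manifolds.
Context {R : realType} (N : nat).
Implicit Types (M U : set 'rV[R]_N) (psi : 'rV[R]_N -> 'rV[R]_N).

Definition Cr_diffeo (r : nat) (U U' : set 'rV[R]_N)
    (psi psi' : 'rV[R]_N -> 'rV[R]_N) : Prop :=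
  [/\ open U /\ open U', Ck_on r U psi, Ck_on r U' psi',
      forall x, U x -> U' (psi x) /\ psi' (psi x) = x &
      forall y, U' y -> U (psi' y) /\ psi (psi' y) = y].

(* R^d x {0}, or its half {y_1 >= 0} if [half]. *)
Definition model (d : nat) (half : bool) : set 'rV[R]_N := [set y : 'rV[R]_N |
  (forall i : 'I_N, (d <= i)%N -> y 0 i = 0) /\ (half -> 0 <= coord y 0)].

Definition chart (r d : nat) (half : bool) M U psi : Prop :=
  (exists U' psi', Cr_diffeo r U U' psi psi') /\
  (forall x, U x -> (M x <-> model d half (psi x))).

(* Embedded C^r submanifold of dimension d, possibly with boundary. *)
Definition submanifold (r d : nat) M : Prop :=
  forall x, M x -> exists half U psi, U x /\ chart r d half M U psi.

Definition boundary (r d : nat) M : set 'rV[R]_N := [set x | M x /\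
  exists U psi, [/\ U x, chart r d true M U psi & coord (psi x) 0 = 0]].

Definition tangent (r d : nat) M (x : 'rV[R]_N) : set 'rV[R]_N := [set v |
  exists half U psi, [/\ U x, chart r d half M U psi & model d false ('d psi x v)]].

(* For x in M, the matrix P x acts on row vectors as the projection of R^N onto
   the normal space {nu | nu P = nu} along the tangent space of M. *)
Definition invariant_splitting (r d : nat) (X : 'rV[R]_N -> 'rV[R]_N) M
    (P : 'rV[R]_N -> 'M[R]_N) : Prop :=
  [/\ {within M, continuous P},
      forall x y, M x -> same_point x y -> P y = P x,
      forall x, M x -> P x *m P x = P x /\
        (forall nu, tangent r d M x nu <-> nu *m P x = 0),
      forall t x nu, M x -> tangent r d M x nu ->
        tangent r d M (flow X t x) (lin_flow X t x nu) &
      forall t x nu, M x -> nu *m P x = nu ->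
        lin_flow X t x nu *m P (flow X t x) = lin_flow X t x nu].

Definition normally_attracting (r d : nat) (X : 'rV[R]_N -> 'rV[R]_N) M : Prop :=
  [/\ torus_set M, submanifold r d M, flow_invariant X M &
    exists P, invariant_splitting r d X M P /\
      exists a b C : R, [/\ a < r%:R * b, r%:R * b <= 0, 0 < C,
        forall t x nu, t <= 0 -> M x -> tangent r d M x nu ->
          `|lin_flow X t x nu| <= C * expR (b * t) * `|nu| &
        forall t x nu, 0 <= t -> M x -> nu *m P x = nu ->
          `|lin_flow X t x nu| <= C * expR (a * t) * `|nu|]].

End Manifolds.

Section System.
Context {R : realType} (N : nat).
Implicit Types (theta phi : 'rV[R]_N) (lam : 'rV[R]_(N - 3)).

Definition order_parameter phi : R[i] :=
  N%:R^-1 * \sum_(j < N) expi (phi 0 j).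

(* The first three summands add up to a real number. *)
Definition vector_field (f : R[i] -> R[i]) (g : R[i] -> R) (h : R -> R) (eps : R) phi
    : 'rV[R]_N :=
  let Z := order_parameter phi in
  \row_j (complex.Re (f Z * expi (phi 0 j) + (g Z)%:C + (f Z)^* * expi (- phi 0 j))
          + eps * h (phi 0 j)).

(* h = sum_{n >= 2} (a_n sin n x + b_n cos n x), smooth, of norm 1. *)
Definition normalized_forcing (a b : nat -> R) (h : R -> R) : Prop :=
  let sq k := \sum_(2 <= n < k) (`|a n| ^+ 2 + `|b n| ^+ 2) in
  [/\ smooth_on setT (h : R^o -> R^o),
      forall x, (fun k : nat => \sum_(2 <= n < k)
        (a n * sin (n%:R * x) + b n * cos (n%:R * x))) @ \oo --> h x,
      cvgn (sq : nat -> R^o) & Num.sqrt (limn (sq : nat -> R^o)) = 1].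

Definition V_set : set 'rV[R]_(N - 3) := [set lam : 'rV[R]_(N - 3) |
  (forall k, 0 < lam 0 k < 1) /\
  (forall k l : 'I_(N - 3), (k < l)%N -> lam 0 l < lam 0 k)].

(* The quotient is a real number; indices are shifted to start from 0. *)
Definition Lambda theta : 'rV[R]_(N - 3) :=
  let e (j : nat) : R[i] := expi (coord theta j) in
  \row_(k < N - 3) complex.Re (((e 0%N - e (k + 3)%N) * (e 1%N - e 2%N))
                               / ((e 1%N - e (k + 3)%N) * (e 0%N - e 2%N))).

Definition level lam : set 'rV[R]_N := [set theta | ordered theta /\ Lambda theta = lam].

Definition theta_star : 'rV[R]_N := \row_j (- pi + 2 * pi / N%:R * j%:R).
Definition lambda_star : 'rV[R]_(N - 3) := Lambda theta_star.

(* Euclidean closed ball; the library norm on row vectors is the max norm. *)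
Definition closed_nbhd_star (delta : R) : set 'rV[R]_(N - 3) := [set lam : 'rV[R]_(N - 3) |
  Num.sqrt (\sum_k (lam 0 k - lambda_star 0 k) ^+ 2) <= delta].

Definition alpha_field (f : R[i] -> R[i]) (g : R[i] -> R) (v : 'rV[R]_2) : 'rV[R]_2 :=
  let z := C_of_vec v in
  vec_of_C ('i * (f z * z ^+ 2 + (g z)%:C * z + (f z)^*)).

Definition stable_fixed_point (F : 'rV[R]_2 -> 'rV[R]_2) (v : 'rV[R]_2) : Prop :=
  [/\ disk (C_of_vec v), F v = 0 &
      forall mu : R[i], eigenvalue (map_mx (fun x : R => x%:C) ('J F v)) mu ->
        complex.Re mu < 0].

Definition stable_orbit (X : 'rV[R]_N -> 'rV[R]_N) lam (C : set 'rV[R]_N) : Prop :=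
  [/\ periodic_orbit X C, C `<=` level lam & exp_stable_in X (level lam) C].

Definition orbit_union (W : set 'rV[R]_(N - 3)) (C : 'rV[R]_(N - 3) -> set 'rV[R]_N)
    : set 'rV[R]_N := [set x | exists2 lam, W lam & C lam x].

(* M_delta, the union of the orbits C0 lam, exists for the unperturbed field X. *)
Definition M_delta_exists (r : nat) (f : R[i] -> R[i]) (g : R[i] -> R)
    (X : 'rV[R]_N -> 'rV[R]_N) (delta : R)
    (C0 : 'rV[R]_(N - 3) -> set 'rV[R]_N) : Prop :=
  let B := closed_nbhd_star delta in
  let M := orbit_union B C0 in
  [/\ exists2 v, unique (stable_fixed_point (alpha_field f g)) v &
        f (C_of_vec v) != 0,
      0 < delta /\ B `<=` V_set,
      forall lam, B lam -> unique (stable_orbit X lam) (C0 lam),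
      torus_compact M /\ normally_attracting r (N - 2) X M &
      flow_invariant X (boundary r (N - 2) M)].

Definition extension (r : nat) (X : 'rV[R]_N -> 'rV[R]_N) (delta : R)
    (C0 : 'rV[R]_(N - 3) -> set 'rV[R]_N)
    (W : set 'rV[R]_(N - 3)) (C : 'rV[R]_(N - 3) -> set 'rV[R]_N) : Prop :=
  [/\ open W /\ W `<=` V_set,
      closed_nbhd_star delta `<=` W,
      forall lam, closed_nbhd_star delta lam -> C lam = C0 lam,
      forall lam, W lam -> stable_orbit X lam (C lam) &
      normally_attracting r (N - 2) X (orbit_union W C)].

Definition largest_extension (r : nat) (X : 'rV[R]_N -> 'rV[R]_N) (delta : R)
    (C0 : 'rV[R]_(N - 3) -> set 'rV[R]_N)
    (W : set 'rV[R]_(N - 3)) (C : 'rV[R]_(N - 3) -> set 'rV[R]_N) : Prop :=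
  extension r X delta C0 W C /\
  forall W' C', extension r X delta C0 W' C' ->
    W' `<=` W /\ orbit_union W' C' `<=` orbit_union W C.

(* (D Lambda . h)(phi) *)
Definition DLambda_h (h : R -> R) phi : 'rV[R]_(N - 3) :=
  \sum_(j < N) h (phi 0 j) *: 'D_(delta_mx 0 j) (Lambda : 'rV[R]_N -> _) phi.

Definition solution_from (X : 'rV[R]_N -> 'rV[R]_N) theta
    (phi : R -> 'rV[R]_N) (T : R) : Prop :=
  [/\ global_solution X phi, phi 0 = theta & min_period phi T].

Definition F_integrable (h : R -> R) (phi : R -> 'rV[R]_N) (T : R) : Prop :=
  forall k, (@lebesgue_measure R).-integrable `[0, T]
    (EFin \o (fun t => DLambda_h h (phi t) 0 k)).

Definition F_h (h : R -> R) (phi : 'rV[R]_(N - 3) -> R -> 'rV[R]_N)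
    (T : 'rV[R]_(N - 3) -> R) lam : 'rV[R]_(N - 3) :=
  \row_k ((T lam)^-1 *
    Rintegral (@lebesgue_measure R) `[0, T lam]
      (fun t => DLambda_h h (phi lam t) 0 k)).

(* theta lam in C lam is a choice of initial points, phi lam the solution from
   theta lam and T lam its period. *)
Definition parametrization (X : 'rV[R]_N -> 'rV[R]_N)
    (W : set 'rV[R]_(N - 3)) (C : 'rV[R]_(N - 3) -> set 'rV[R]_N)
    (theta : 'rV[R]_(N - 3) -> 'rV[R]_N)
    (phi : 'rV[R]_(N - 3) -> R -> 'rV[R]_N) (T : 'rV[R]_(N - 3) -> R) : Prop :=
  forall lam, W lam ->
    C lam (theta lam) /\ solution_from X (theta lam) (phi lam) (T lam).

End System.

Arguments lambda_star R N : clear implicits.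

(* Main.v *)
(* Without forcing, the cross ratios are conserved and determine a configuration up to the
   three-dimensional Moebius group. If T is the return time of a stable orbit, then the
   differential of the time-T map contracts ker DLambda modulo the field. This estimate is
   robust, so the fixed points of the return map, modulo a shift of the angles by a multiple
   of 2 pi, are found by the inverse function theorem with the cross ratios as parameters:
   locally they form a smooth family, whose normal bundle is the range of the spectral
   projection along the eigenspace of 1 of the differential of the return map. Finitely many
   such families around the given closed ball and one around any further stable orbit can be
   glued to a normally attracting extension of M_delta, so by maximality W contains the cross
   ratios of every stable orbit. In particular F_h is an average along a smooth family of
   orbits, hence C^1, and W is invariant under symmetries of the system.

   Relabelling the oscillators cyclically is such a symmetry. It acts on V by a map G fixing
   lambda^*, and F_h (G lambda) = DG(lambda) F_h lambda. For N = 4 one has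
   G lambda = 1 - lambda; in general the differential of G at lambda^* has no fixed vector
   but 0, because a fixed vector is the image under DLambda of a cyclically invariant one,
   that is, of an infinitesimal rotation. *)

From HB Require Import structures.
Require Import Defs.
From mathcomp Require Import ring lra zify.

Set Implicit Arguments.
Unset Strict Implicit.
Unset Printing Implicit Defensive.

Local Open Scope classical_set_scope.
Local Open Scope ring_scope.

(* [lra] is slow in large contexts: only the inequalities are kept, together with the
   hypotheses shaped like those of the section TorusFlow, which cannot be cleared. *)
Ltac inequalities := repeat match goal with H : ?P |- _ =>
  lazymatch P with
  | is_true (@Order.le _ _ _ _) => fail
  | is_true (@Order.lt _ _ _ _) => fail
  | is_true (andb _ _) => fail
  | is_true (leq _ _) => fail
  | forall (k : int) _, _ = _ => fail
  | forall x, ordered x -> _ => fail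
  | smooth_on _ _ => fail
  | @eq (matrix _ _ _) _ _ => clear H
  | @eq (set _) _ _ => clear H
  | @eq _ _ _ => fail
  | open _ => fail
  | _ => clear H
  end end.
Ltac qlra := first [solve [inequalities; lra] | lra].

(** The hypotheses do not say how the orbits depend on the cross ratios; all regularity has to be
    extracted from metric stability inside single level sets. Two degeneracies obstruct the return
    equation flow_T y = y + 2 pi k: the field is fixed by the return differential A, and
    conservation of the cross ratios makes N - 3 of the equations redundant. Prescribing one angle
    removes the first; keeping three components of the equation and putting the cross ratios in
    place of the others removes the second. The eigenvalue 1 of A need not be semisimple, because
    the period may vary with the cross ratios. Hence the tangent space is the kernel of (1 - A)^2,
    backward growth along it is linear in time, and a slightly negative tangential exponent b
    absorbs it. Maximality of W only compares unions of orbits. It still forces each level set over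
    V to carry at most one stable orbit: an extension of M_delta may have several components, so one
    can be made to pass through any given stable orbit over V. *)

Section Differentiability.
Context {R : realType} {V W : normedModType R}.
Implicit Types (f g : V -> W) (x v : V).

Lemma differentiable_eps f x : differentiable f x ->
  forall e : R, 0 < e -> exists2 d : R, 0 < d &
    forall h, `|h| < d -> `|f (x + h) - f x - 'd f x h| <= e * `|h|.
Proof.
move=> /diff_locally /eqaddoP fx e e0.
have /nbhs_ballP[d /= d0 H] := fx _ e0.
exists d => // h hd; have := H h.
rewrite -ball_normE /= sub0r normrN => /(_ hd).
by rewrite /= !fctE /= opprD addrA [h + x]addrC.
Qed.

Lemma eps_differentiable f x (L : {linear V -> W}) : continuous L ->
  (forall e : R, 0 < e -> exists2 d : R, 0 < d &
    forall h, `|h| < d -> `|f (x + h) - f x - L h| <= e * `|h|) ->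
  differentiable f x /\ 'd f x = L :> (V -> W).
Proof.
move=> cL H.
have E : f \o shift x = cst (f x) + L +o_ 0 id.
  apply/eqaddoP => e e0; have [d d0 Hd] := H _ e0.
  apply/nbhs_ballP; exists d => // h; rewrite -ball_normE /= sub0r normrN => hd.
  by have := Hd h hd; rewrite !fctE /= opprD addrA [h + x]addrC.
have E2 := diff_unique cL E.
by split=> //; apply/diff_locallyP; rewrite E2; split.
Qed.

Lemma near_eq_differentiable f g x : (\near x, f x = g x) ->
  differentiable f x -> differentiable g x.
Proof.
move=> fg df.
have [] // := @eps_differentiable g x ('d f x) (diff_continuous df).
move=> e e0; have [d d0 H] := differentiable_eps df e0.
have /nbhs_ballP[d' /= d'0 H'] := fg.
have fgx : f x = g x by apply: H'; apply: ballxx.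
exists (Num.min d d'); first by rewrite lt_min d0.
move=> h; rewrite lt_min => /andP[h1 h2].
rewrite -fgx -H'; last by rewrite -ball_normE /= opprD addrA subrr sub0r normrN.
exact: H.
Qed.

End Differentiability.

(** * Maps of class C^k *)

Section CkGeneral.
Context {R : realType} {V : normedModType R}.
Implicit Types (U : set V).

Lemma nbhs_eqon (T : topologicalType) (Y : Type) (A : set T) (f g : T -> Y) x :
  open A -> (forall x, A x -> f x = g x) -> A x -> \near x, f x = g x.
Proof.
move=> oA fg Ax.
by apply: (filterS fg); apply: open_nbhs_nbhs.
Qed.

Lemma Ck_on_ext (W : normedModType R) k U (f g : V -> W) :
  open U -> (forall x, U x -> f x = g x) -> Ck_on k U f -> Ck_on k U g.
Proof.
move=> oU; elim: k f g => [|k IH] f g fg /=.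
  move=> cf x Ux.
  have H := nbhs_eqon oU fg Ux.
  rewrite /prop_for /continuous_at -(fg _ Ux).
  apply: cvg_trans (cf x Ux).
  by apply: near_eq_cvg; apply: filterS H.
move=> [df Df]; split.
  move=> x Ux; apply: near_eq_differentiable (df _ Ux).
  exact: nbhs_eqon Ux.
move=> v; apply: IH (Df v) => x Ux.
by apply: near_eq_derive; apply: nbhs_eqon Ux.
Qed.

Lemma Ck_on_sub (W : normedModType R) k U U' (f : V -> W) :
  U' `<=` U -> Ck_on k U f -> Ck_on k U' f.
Proof.
move=> sU; elim: k f => [|k IH] f /=; first by move=> H x /sU; apply: H.
by move=> [df Df]; split=> [x /sU /df //|v]; apply: IH.
Qed.

Lemma Ck_on_cont (W : normedModType R) k U (f : V -> W) x :
  Ck_on k U f -> U x -> {for x, continuous f}.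
Proof.
case: k => [|k] /=; first by apply.
by move=> [df _] /df; apply: differentiable_continuous.
Qed.

Lemma Ck_on_pred (W : normedModType R) k U (f : V -> W) :
  Ck_on k.+1 U f -> Ck_on k U f.
Proof.
elim: k f => [|k IH] f; first by move=> H x; apply: Ck_on_cont H.
move=> [df Df]; split=> // v.
by apply: IH; apply: Df.
Qed.

Lemma Ck_on_le (W : normedModType R) k l U (f : V -> W) :
  (k <= l)%N -> Ck_on l U f -> Ck_on k U f.
Proof.
move=> /subnK <-; elim: (l - k)%N => // n IH; rewrite addSn => H.
exact/IH/Ck_on_pred.
Qed.

Lemma Ck_on_local (W : normedModType R) k U (f : V -> W) :
  (forall x, U x -> exists2 A, open_nbhs x A & Ck_on k A f) -> Ck_on k U f.
Proof.
elim: k f => [|k IH] f H.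
  by move=> x Ux; have [A [_ Ax] HA] := H x Ux; apply: HA.
split.
  by move=> x Ux; have [A [_ Ax] [HA _]] := H x Ux; apply: HA.
move=> v; apply: IH => x Ux.
by have [A ? [_ HA]] := H x Ux; exists A => //; apply: HA.
Qed.

Lemma Ck_on_cst (W : normedModType R) k U (c : W) : Ck_on k U (fun=> c : W).
Proof.
elim: k c => [|k IH] c /=; first by move=> x _; apply: cst_continuous.
split=> [x _|v]; first exact: differentiable_cst.
have -> : (fun x : V => 'D_v (fun=> c) x) = fun=> (0 : W); last exact: IH.
by apply/funext => x; apply: (derive_cst c x v).
Qed.

Lemma Ck_on_lin (W : normedModType R) k U (f : {linear V -> W}) :
  continuous f -> Ck_on k U f.
Proof.
move=> cf; case: k => [|k] /=; first by move=> x _; apply: cf.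
split=> [x _|v]; first exact: linear_differentiable.
have -> : (fun x => 'D_v f x) = fun=> f v; last exact: Ck_on_cst.
apply/funext => x; rewrite deriveE ?diff_lin//; exact: linear_differentiable.
Qed.

Lemma Ck_on_add (W : normedModType R) k U (f g : V -> W) : open U ->
  Ck_on k U f -> Ck_on k U g -> Ck_on k U (fun x => f x + g x).
Proof.
move=> oU; elim: k f g => [|k IH] f g /=.
  by move=> cf cg x Ux; apply: cvgD; [apply: cf|apply: cg].
move=> [df Df] [dg Dg]; split.
  by move=> x Ux; apply: differentiableD; [apply: df|apply: dg].
move=> v; apply: Ck_on_ext oU _ (IH _ _ (Df v) (Dg v)) => x Ux.
by apply: esym; apply: (deriveD (f := f) (g := g));
  apply: diff_derivable; [exact: df|exact: dg].
Qed.

Lemma Ck_on_opp (W : normedModType R) k U (f : V -> W) : open U ->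
  Ck_on k U f -> Ck_on k U (fun x => - f x).
Proof.
move=> oU; elim: k f => [|k IH] f /=.
  by move=> cf x Ux; apply: cvgN; apply: cf.
move=> [df Df]; split.
  by move=> x Ux; apply: differentiableN; apply: df.
move=> v; apply: Ck_on_ext oU _ (IH _ (Df v)) => x Ux.
by apply: esym; apply: (deriveN (f := f)); apply/diff_derivable/df.
Qed.

Lemma Ck_on_sum (W : normedModType R) k U n (f : 'I_n -> V -> W) : open U ->
  (forall i, Ck_on k U (f i)) -> Ck_on k U (fun x => \sum_i f i x).
Proof.
move=> oU H.
have : forall s : seq 'I_n, Ck_on k U (fun x => \sum_(i <- s) f i x).
  elim=> [|i s IH].
    by apply: (Ck_on_ext oU _ (Ck_on_cst k U 0)) => x _; rewrite big_nil.
  apply: (Ck_on_ext oU _ (Ck_on_add oU (H i) IH)) => x _; by rewrite big_cons.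
by apply.
Qed.

Lemma Ck_on_mul k U (f g : V -> R^o) : open U ->
  Ck_on k U f -> Ck_on k U g -> Ck_on k U (fun x => f x * g x : R^o).
Proof.
move=> oU; elim: k f g => [|k IH] f g Hf Hg.
  by move=> x Ux; apply: cvgM; [apply: Hf|apply: Hg].
have fk := Ck_on_pred Hf; have gk := Ck_on_pred Hg.
move: Hf Hg => [df Df] [dg Dg]; split.
  by move=> x Ux; apply: differentiableM; [apply: df|apply: dg].
move=> v.
apply: Ck_on_ext oU _ (Ck_on_add oU (IH _ _ fk (Dg v)) (IH _ _ (gk) (Df v))).
move=> x Ux.
by apply: esym; apply: (deriveM (f := f) (g := g));
  apply: diff_derivable; [exact: df|exact: dg].
Qed.

Lemma Ck_on_inv k U (f : V -> R^o) : open U -> (forall x, U x -> f x != 0) ->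
  Ck_on k U f -> Ck_on k U (fun x => (f x)^-1 : R^o).
Proof.
move=> oU f0; elim: k => [|k IH] Hf.
  by move=> x Ux; apply: cvgV; [apply: f0|apply: Hf].
have fk := Ck_on_pred Hf.
move: Hf => [df Df]; split.
  by move=> x Ux; apply: differentiableV; [apply: df|apply: f0].
move=> v.
apply: Ck_on_ext oU _ (Ck_on_opp oU (Ck_on_mul oU (Ck_on_mul oU (IH fk) (IH fk)) (Df v))) => x Ux.
apply: esym; rewrite (_ : - _ = - (f x) ^- 2 *: 'D_v f x).
  by apply: (deriveV (f := f)); [exact: f0|exact/diff_derivable/df].
by rewrite scaleNr -exprVn expr2.
Qed.

Lemma Ck_on_scale k U (a : V -> R^o) (W : normedModType R) (w : W) : open U ->
  Ck_on k U a -> Ck_on k U (fun x => a x *: w).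
Proof.
move=> oU; elim: k a => [|k IH] a /=.
  by move=> ca x Ux; apply: cvgZr_tmp; apply: ca.
move=> [da Da]; split.
  by move=> x Ux; apply: differentiableZl; apply: da.
move=> v; apply: Ck_on_ext oU _ (IH _ (Da v)) => x Ux.
rewrite [RHS]deriveE; last by apply: differentiableZl; exact: da.
by rewrite diffZl ?deriveE//; exact: da.
Qed.

Lemma continuous_coord n (i : 'I_n) : continuous (fun w : 'rV[R]_n => w 0 i : R^o).
Proof. exact: coord_continuous. Qed.

Lemma Ck_on_coord k U n (f : V -> 'rV[R]_n) : open U ->
  Ck_on k U f <-> (forall i, Ck_on k U (fun x => f x 0 i : R^o)).
Proof.
move=> oU; split.
  elim: k f => [|k IH] f.
    move=> cf i x Ux.
    by apply: (@continuous_comp _ _ _ f (fun w : 'rV[R]_n => w 0 i : R^o));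
      [exact: cf|exact: continuous_coord].
  move=> [df Df] i; split.
    move=> x Ux.
    apply: (@differentiable_comp _ _ _ _ f (fun w : 'rV[R]_n => w 0 i : R^o)) => //.
      exact: df.
    exact: (@differentiable_coord R 1 n).
  move=> v; apply: Ck_on_ext oU _ (IH _ (Df v) i) => x Ux.
  by rewrite derive_mx ?mxE//; exact/diff_derivable/df.
move=> H.
apply: (@Ck_on_ext _ k U (fun x => \sum_i f x 0 i *: delta_mx 0 i)) => //.
  by move=> x _; rewrite -row_sum_delta.
by apply: Ck_on_sum => // i; apply: Ck_on_scale.
Qed.

End CkGeneral.

Section CkComp.
Context {R : realType}.

Lemma diff_row n (W : normedModType R) (g : 'rV[R]_n -> W) (y v : 'rV[R]_n) :
  differentiable g y ->
  'd g y v = \sum_i v 0 i *: 'D_(delta_mx 0 i) g y.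
Proof.
move=> dg; rewrite [in LHS](row_sum_delta v) linear_sum /=.
by apply: eq_bigr => i _; rewrite linearZ /= deriveE.
Qed.

Lemma derive_comp_row (V : normedModType R) n (W : normedModType R)
    (f : V -> 'rV[R]_n) (g : 'rV[R]_n -> W) x v :
  differentiable f x -> differentiable g (f x) ->
  'D_v (g \o f) x = \sum_i ('D_v f x) 0 i *: 'D_(delta_mx 0 i) g (f x).
Proof.
move=> df dg; rewrite deriveE; last exact: differentiable_comp.
by rewrite diff_comp //= diff_row // deriveE.
Qed.

(** By the chain rule the derivative of [g \o f] is a sum of products of coordinates of the
    derivative of [f] with partial derivatives of [g] taken along [f]. The induction therefore fixes
    [f] and runs over all [g]. *)
Lemma Ck_on_comp_real (V : normedModType R) k n (U : set V) (U' : set 'rV[R]_n)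
    (f : V -> 'rV[R]_n) (g : 'rV[R]_n -> R^o) : open U ->
  (forall x, U x -> U' (f x)) ->
  Ck_on k U f -> Ck_on k U' g -> Ck_on k U (g \o f).
Proof.
move=> oU fU; elim: k g => [|k IH] g Hf Hg.
  move=> x Ux; apply: continuous_comp; first exact: Hf.
  by apply: Hg; apply: fU.
have fk := Ck_on_pred Hf.
move: (Hf) (Hg) => [df Df] [dg Dg]; split.
  by move=> x Ux; apply: differentiable_comp; [exact: df|exact/dg/fU].
move=> v.
apply: (@Ck_on_ext _ _ _ k U (fun x => \sum_i (('D_v f x) 0 i *
    'D_(delta_mx 0 i) g (f x) : R^o))) => //.
  move=> x Ux; rewrite derive_comp_row //; [exact: df|exact/dg/fU].
apply: Ck_on_sum => // i; apply: Ck_on_mul => //.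
  by have /(Ck_on_coord _ _ oU) := Df v; apply.
exact: (IH _ fk (Dg _)).
Qed.

Lemma Ck_on_comp (V : normedModType R) k n m (U : set V) (U' : set 'rV[R]_n)
    (f : V -> 'rV[R]_n) (g : 'rV[R]_n -> 'rV[R]_m) : open U -> open U' ->
  (forall x, U x -> U' (f x)) ->
  Ck_on k U f -> Ck_on k U' g -> Ck_on k U (fun x => g (f x)).
Proof.
move=> oU oU' fU Hf /(Ck_on_coord _ _ oU') Hg.
apply/(Ck_on_coord _ _ oU) => i.
exact: (Ck_on_comp_real oU fU Hf (Hg i)).
Qed.

Lemma Ck_on_comp1 (V : normedModType R) k (U : set V) (f : V -> R^o)
    (h : R^o -> R^o) : open U ->
  Ck_on k U f -> Ck_on k setT h -> Ck_on k U (fun x => h (f x)).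
Proof.
move=> oU; elim: k h => [|k IH] h Hf Hh.
  by move=> x Ux; apply: continuous_comp; [exact: Hf|exact: Hh].
have fk := Ck_on_pred Hf.
move: (Hf) (Hh) => [df Df] [dh Dh]; split.
  by move=> x Ux; apply: differentiable_comp; [exact: df|exact: dh].
move=> v.
apply: (@Ck_on_ext _ _ _ k U (fun x => 'D_v f x * 'D_1 h (f x) : R^o)) => //.
  move=> x Ux.
  rewrite [RHS]deriveE; last by apply: differentiable_comp; [exact: df|exact: dh].
  rewrite diff_comp //=; [|exact: df|exact: dh].
  rewrite [in LHS]deriveE; last exact: df.
  rewrite [in LHS]deriveE; last exact: dh.
  by rewrite -[in RHS](mulr1 ('d f x v)) [in RHS]linearZ.
apply: Ck_on_mul => //; first exact: Df.
exact: (IH _ fk (Dh 1)).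
Qed.

Lemma Ck_sin_cos k (U : set R^o) :
  Ck_on k U (sin : R^o -> R^o) /\ Ck_on k U (cos : R^o -> R^o).
Proof.
suff [? ?] : Ck_on k setT (sin : R^o -> R^o) /\ Ck_on k setT (cos : R^o -> R^o).
  by split; apply: (@Ck_on_sub _ _ _ _ setT).
elim: k => [|k [IHs IHc]].
  by split=> x _; [apply: continuous_sin|apply: continuous_cos].
have Ds (v : R^o) (x : R^o) : 'D_v (sin : R^o -> R^o) x = cos x * v.
  rewrite deriveE; last exact/derivable1_diffP/derivable_sin.
  by rewrite -[in LHS](mulr1 v) linearZ /= -deriveE;
    [rewrite derive_val mulrC|exact/derivable1_diffP/derivable_sin].
have Dc (v : R^o) (x : R^o) : 'D_v (cos : R^o -> R^o) x = (- sin x) * v.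
  rewrite deriveE; last exact/derivable1_diffP/derivable_cos.
  by rewrite -[in LHS](mulr1 v) linearZ /= -deriveE;
    [rewrite derive_val mulrC|exact/derivable1_diffP/derivable_cos].
split; split.
- by move=> x _; apply/derivable1_diffP/derivable_sin.
- move=> v; apply: (@Ck_on_ext _ _ _ k setT (fun x : R^o => cos x * v : R^o)).
  + exact: openT.
  + by move=> x _; rewrite Ds.
  + by apply: Ck_on_mul; [exact: openT|done|exact: Ck_on_cst].
- by move=> x _; apply/derivable1_diffP/derivable_cos.
- move=> v; apply: (@Ck_on_ext _ _ _ k setT (fun x : R^o => (- sin x) * v : R^o)).
  + exact: openT.
  + by move=> x _; rewrite Dc.
  + apply: Ck_on_mul; [exact: openT| |exact: Ck_on_cst].
    by apply: Ck_on_opp => //; exact: openT.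
Qed.

Lemma mx_entry_le m n (A : 'M[R]_(m, n)) i j : `|A i j| <= `|A|.
Proof.
rewrite [leRHS]/Num.Def.normr/= mx_normrE.
exact: (le_bigmax _ _ (i, j)).
Qed.

Lemma mx_norm_le m n (A : 'M[R]_(m, n)) (c : R) : 0 <= c ->
  (forall i j, `|A i j| <= c) -> `|A| <= c.
Proof.
move=> c0 H; rewrite [leLHS]/Num.Def.normr/= mx_normrE.
by apply: bigmax_le => // -[i j] _; apply: H.
Qed.

Lemma mulmx_norm m n p (A : 'M[R]_(m, n)) (B : 'M[R]_(n, p)) :
  `|A *m B| <= n%:R * `|A| * `|B|.
Proof.
apply: mx_norm_le => [|i j]; first by rewrite !mulr_ge0.
rewrite mxE; apply: le_trans (ler_norm_sum _ _ _) _.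
rewrite -mulrA mulr_natl -[X in _ *+ X]card_ord -sumr_const.
by apply: ler_sum => k _; rewrite normrM ler_pM // mx_entry_le.
Qed.

Lemma bounded_linear_cont (V W : normedModType R) (f : {linear V -> W}) (c : R) :
  (forall x, `|f x| <= c * `|x|) -> continuous f.
Proof.
move=> H; apply/linear_bounded_continuous.
apply/bounded_funP => r; exists (`|c| * r) => x xr.
apply: le_trans (H x) _; apply: le_trans (ler_wpM2l (normr_ge0 c) xr).
by rewrite ler_wpM2r // ler_norm.
Qed.

Lemma row_linear_cont n (W : normedModType R) (f : {linear 'rV[R]_n -> W}) :
  continuous f.
Proof.
apply: (@bounded_linear_cont _ _ _ (\sum_i `|f (delta_mx 0 i)|)) => v.
rewrite [in leLHS](row_sum_delta v) linear_sum.
apply: le_trans (ler_norm_sum _ _ _) _.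
rewrite mulr_suml; apply: ler_sum => i _.
by rewrite linearZ normrZ mulrC ler_wpM2l // mx_entry_le.
Qed.

Lemma Ck_on_mulmx (V : normedModType R) k (U : set V) n m (f : V -> 'rV[R]_n)
   (B : 'M[R]_(n, m)) : open U ->
  Ck_on k U f -> Ck_on k U (fun x => f x *m B).
Proof.
move=> oU Hf.
apply: (@Ck_on_comp _ _ _ _ U setT f (mulmxr B)) => //; first exact: openT.
apply: Ck_on_lin; exact: row_linear_cont.
Qed.

End CkComp.

(** * Curves and mean value inequalities *)

Section Curves.
Context {R : realType}.

Lemma ball_shift (V : normedModType R) (x y z : V) (d : R) : `|y - x| < d ->
  `|z - y| < d - `|y - x| -> `|z - x| < d.
Proof.
by move=> _; rewrite ltrBrDr; apply: le_lt_trans; rewrite -(subrKA y); exact: ler_normD.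
Qed.

Lemma cder_eps (W : normedModType R) (phi : R -> W) (s : R) (w : W) :
  is_derive (s : R^o) 1 (phi : R^o -> W) w <->
  forall e : R, 0 < e -> exists2 d : R, 0 < d &
    forall h : R, `|h| < d -> `|phi (s + h) - phi s - h *: w| <= e * `|h|.
Proof.
split.
  move=> Hd.
  have df : differentiable (phi : R^o -> W) s by apply/derivable1_diffP; case: Hd.
  move=> e e0; have [d d0 H] := differentiable_eps df e0.
  exists d => // h hd; have := H h hd.
  have -> // : 'd (phi : R^o -> W) s h = h *: w.
  rewrite -[in LHS](mulr1 h) -[_ * _]/(h *: (1 : R^o)) linearZ /= -deriveE //.
  by rewrite derive_val.
move=> H.
have slin : linear ( *:%R ^~ w : R^o -> W) by move=> u y z; rewrite scalerDl scalerA.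
pose sM := GRing.isLinear.Build _ _ _ _ _ slin.
pose sL : {linear R^o -> W} := HB.pack ( *:%R ^~ w) sM.
have cL : continuous sL by exact: scalel_continuous.
have [df dE] := eps_differentiable (f := (phi : R^o -> W)) (x := s) cL H.
apply: DeriveDef; first exact/derivable1_diffP.
by rewrite deriveE // dE /= scale1r.
Qed.

Lemma cder_cont (W : normedModType R) (phi : R -> W) (s : R) (w : W) :
  is_derive (s : R^o) 1 (phi : R^o -> W) w -> {for s, continuous phi}.
Proof.
by case=> /derivable1_diffP /differentiable_continuous.
Qed.

Lemma cder_near (W : normedModType R) (phi psi : R -> W) (s : R) (w : W) (d : R) :
  0 < d -> (forall t, `|t - s| < d -> phi t = psi t) ->
  is_derive (s : R^o) 1 (phi : R^o -> W) w -> is_derive (s : R^o) 1 (psi : R^o -> W) w.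
Proof.
move=> d0 E; apply: near_eq_is_derive.
by apply/nbhs_ballP; exists d => // t; rewrite -ball_normE /= distrC => /E.
Qed.

Lemma cder_comp (V W : normedModType R) (f : V -> W) (phi : R -> V) (s : R) (w : V) :
  differentiable f (phi s) -> is_derive (s : R^o) 1 (phi : R^o -> V) w ->
  is_derive (s : R^o) 1 ((fun t => f (phi t)) : R^o -> W) ('d f (phi s) w).
Proof.
move=> df [dphi <-].
have dphi' : differentiable (phi : R^o -> V) s by exact/derivable1_diffP.
apply: DeriveDef.
  by apply/derivable1_diffP; apply: (@differentiable_comp _ _ _ _ (phi : R^o -> V) f).
rewrite deriveE; last by apply: (@differentiable_comp _ _ _ _ (phi : R^o -> V) f).
by rewrite (@diff_comp _ _ _ _ (phi : R^o -> V) f) //= deriveE.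
Qed.

Lemma cder_affine (W : normedModType R) (phi : R -> W) (a b s : R) (w : W) :
  is_derive (a * s + b : R^o) 1 (phi : R^o -> W) w ->
  is_derive (s : R^o) 1 ((fun t => phi (a * t + b)) : R^o -> W) (a *: w).
Proof.
move/cder_eps => H; apply/cder_eps => e e0.
have c0 : 0 < `|a| + 1 by rewrite ltr_pwDr.
have [d d0 Hd] := H (e / (`|a| + 1)) (divr_gt0 e0 c0).
exists (d / (`|a| + 1)); first exact: divr_gt0.
move=> h hd.
have le1 : `|a * h| <= (`|a| + 1) * `|h|.
  by rewrite normrM ler_wpM2r // lerDl.
have ahd : `|a * h| < d.
  by apply: le_lt_trans le1 _; rewrite mulrC -ltr_pdivlMr.
have := Hd _ ahd.
rewrite (_ : a * s + b + a * h = a * (s + h) + b); last by ring.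
rewrite scalerA [a * h]mulrC => /le_trans; apply.
rewrite [h * a]mulrC mulrAC ler_pdivrMr // -mulrA [leRHS]mulrCA mulrC.
rewrite mulrCA; apply: ler_wpM2l; first exact: ltW.
by rewrite [h * a]mulrC [_ * (_ + _)]mulrC.
Qed.

Lemma cder_shift (W : normedModType R) (phi : R -> W) (b s : R) (w : W) :
  is_derive (s + b : R^o) 1 (phi : R^o -> W) w ->
  is_derive (s : R^o) 1 ((fun t => phi (t + b)) : R^o -> W) w.
Proof.
move=> H; have := @cder_affine W phi 1 b s w.
rewrite mul1r scale1r => /(_ H).
by under eq_fun do rewrite mul1r.
Qed.

Lemma cder_coord n (phi : R -> 'rV[R]_n) (s : R) w : 
  is_derive (s : R^o) 1 (phi : R^o -> 'rV[R]_n) w <->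
  forall i, is_derive (s : R^o) 1 ((fun t => phi t 0 i) : R^o -> R^o) (w 0 i).
Proof.
split.
  move=> /cder_eps H i; apply/cder_eps => e e0; have [d d0 Hd] := H e e0.
  exists d => // h hd; apply: le_trans (Hd h hd).
  by have := mx_entry_le (phi (s + h) - phi s - h *: w) 0 i; rewrite !mxE.
move=> H; apply: DeriveDef.
  apply: ((derivable_mxP _ _ _).2) => i j; rewrite ord1.
  by have [] := H j.
rewrite derive_mx; last first.
  by apply: ((derivable_mxP _ _ _).2) => i j; rewrite ord1; have [] := H j.
apply/rowP => j; rewrite mxE; have [_ <-] := H j.
by congr derive.
Qed.

Lemma cderD (W : normedModType R) (f g : R -> W) s df dg :
  is_derive (s : R^o) 1 (f : R^o -> W) df -> is_derive (s : R^o) 1 (g : R^o -> W) dg ->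
  is_derive (s : R^o) 1 ((fun t => f t + g t) : R^o -> W) (df + dg).
Proof. by move=> Hf Hg; apply: (@is_deriveD _ _ _ (f : R^o -> W) g). Qed.

Lemma cderB (W : normedModType R) (f g : R -> W) s df dg :
  is_derive (s : R^o) 1 (f : R^o -> W) df -> is_derive (s : R^o) 1 (g : R^o -> W) dg ->
  is_derive (s : R^o) 1 ((fun t => f t - g t) : R^o -> W) (df - dg).
Proof. by move=> Hf Hg; apply: (@is_deriveB _ _ _ (f : R^o -> W) g). Qed.

Lemma cderZ (W : normedModType R) (c : R) (f : R -> W) s df :
  is_derive (s : R^o) 1 (f : R^o -> W) df ->
  is_derive (s : R^o) 1 ((fun t => c *: f t) : R^o -> W) (c *: df).
Proof. by move=> Hf; apply: (@is_deriveZ _ _ _ (f : R^o -> W) c). Qed.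

Lemma cder_cst (W : normedModType R) (c : W) (s : R) :
  is_derive (s : R^o) 1 ((fun t => c) : R^o -> W) 0.
Proof. exact: (@is_derive_cst _ R^o). Qed.

Lemma cder_sum (W : normedModType R) n (f : 'I_n -> R -> W) (s : R) (df : 'I_n -> W) :
  (forall i, is_derive (s : R^o) 1 (f i : R^o -> W) (df i)) ->
  is_derive (s : R^o) 1 ((fun t => \sum_i f i t) : R^o -> W) (\sum_i df i).
Proof.
move=> H.
suff : forall r : seq 'I_n, is_derive (s : R^o) 1
   ((fun t => \sum_(i <- r) f i t) : R^o -> W) (\sum_(i <- r) df i) by apply.
elim=> [|i r IH].
  rewrite big_nil; under eq_fun do rewrite big_nil; exact: cder_cst.
rewrite big_cons; under eq_fun do rewrite big_cons; exact: cderD.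
Qed.

Lemma real_mvt_le (f df : R -> R) (a b M : R) : a <= b ->
  (forall s, a <= s <= b -> is_derive (s : R^o) 1 (f : R^o -> R^o) (df s)) ->
  (forall s, a < s < b -> `|df s| <= M) -> `|f b - f a| <= M * (b - a).
Proof.
rewrite le_eqVlt => /predU1P[-> _ _|ab Hd HM].
  by rewrite !subrr normr0 mulr0.
have [] := @MVT R f df a b ab.
- by move=> x; rewrite in_itv /= => /andP[xa xb]; apply: Hd; rewrite !ltW.
- apply: derivable_within_continuous => x; rewrite in_itv /= => /andP[xa xb].
  by have [] := Hd x; rewrite ?xa ?xb.
move=> c; rewrite in_itv /= => cab ->.
have ba0 : 0 <= b - a by rewrite subr_ge0 ltW.
rewrite normrM (ger0_norm ba0).
by apply: ler_wpM2r => //; apply: HM.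
Qed.

(** The norm is the maximum norm, so the scalar mean value theorem applies to each coordinate with
    the same bound. *)
Lemma curve_mvt_le n (phi psi : R -> 'rV[R]_n) (a b M : R) : a <= b ->
  (forall s, a <= s <= b -> is_derive (s : R^o) 1 (phi : R^o -> 'rV[R]_n) (psi s)) ->
  (forall s, a < s < b -> `|psi s| <= M) -> 0 <= M ->
  `|phi b - phi a| <= M * (b - a).
Proof.
move=> ab Hd HM M0; apply: mx_norm_le => [|i j].
  by rewrite mulr_ge0 // subr_ge0.
rewrite ord1 !mxE.
apply: (real_mvt_le (f := fun t => phi t 0 j) (df := fun t => psi t 0 j)) => //.
  by move=> s /Hd /cder_coord /(_ j).
by move=> s /HM; apply: le_trans; apply: mx_entry_le.
Qed.

Lemma curve_mvt_abs n (phi psi : R -> 'rV[R]_n) (a b s t M : R) :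
  (forall s, a <= s <= b -> is_derive (s : R^o) 1 (phi : R^o -> 'rV[R]_n) (psi s)) ->
  (forall s, a <= s <= b -> `|psi s| <= M) -> 0 <= M ->
  a <= s <= b -> a <= t <= b ->
  `|phi t - phi s| <= M * `|t - s|.
Proof.
move=> Hd HM M0 /andP[as_ sb] /andP[at_ tb].
have [st|/ltW ts] := leP s t.
  rewrite (ger0_norm (x := t - s)) ?subr_ge0 //.
  apply: curve_mvt_le => // u /andP[u1 u2]; [apply: Hd|apply: HM]; qlra.
rewrite distrC (distrC t) (ger0_norm (x := s - t)) ?subr_ge0 //.
apply: curve_mvt_le => // u /andP[u1 u2]; [apply: Hd|apply: HM]; qlra.
Qed.

(* If |z'| <= L |z| + eps on an interval of length at most 1/(2L), the maximum of
   |z| absorbs the first term. *)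
Lemma absorb n (z dz : R -> 'rV[R]_n) (a b s t L eps : R) :
  (forall u, a <= u <= b -> is_derive (u : R^o) 1 (z : R^o -> 'rV[R]_n) (dz u)) ->
  (forall u, a <= u <= b -> `|dz u| <= L * `|z u| + eps) ->
  0 <= L -> 0 <= eps -> (b - a) * L <= 1 / 2 ->
  a <= s <= b -> a <= t <= b ->
  `|z t| <= 2 * `|z s| + 2 * (b - a) * eps.
Proof.
move=> Hd Hb L0 e0 small sab tab.
have ab : a <= b by case/andP: sab => *; qlra.
have cz : {within `[a, b], continuous (fun u => `|z u|)}.
  apply: continuous_in_subspaceT => u; rewrite inE /= in_itv /= => uab.
  apply: (@continuous_comp _ _ _ z (fun v => `|v|)); first exact: (cder_cont (Hd u uab)).
  exact: norm_continuous.
have [c cab Hc] := EVT_max ab cz.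
rewrite in_itv /= in cab.
have H : `|z c - z s| <= (L * `|z c| + eps) * `|c - s|.
  apply: (curve_mvt_abs Hd) => //; last by rewrite addr_ge0 // mulr_ge0.
  move=> u uab; apply: le_trans (Hb u uab) _.
  rewrite lerD2r ler_wpM2l //; apply: Hc; by rewrite in_itv.
have zt : `|z t| <= `|z c| by apply: Hc; rewrite in_itv.
have cs : `|c - s| <= b - a.
  by rewrite ler_norml; case/andP: cab => ? ?; case/andP: sab => ? ?; apply/andP; qlra.
have tri : `|z c| <= `|z c - z s| + `|z s|.
  by rewrite -{1}(subrK (z s) (z c)); apply: ler_normD.
have H2 : (L * `|z c| + eps) * `|c - s| <= (L * `|z c| + eps) * (b - a).
  by rewrite ler_wpM2l // addr_ge0 // mulr_ge0.
have H3 := ler_wpM2r (normr_ge0 (z c)) small.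
have : `|z c| <= `|z s| + (b - a) * L * `|z c| + eps * (b - a).
  apply: le_trans tri _; move: (le_trans H H2); rewrite mulrDl => H4; qlra.
move=> H5; qlra.
Qed.
End Curves.

(** * Continuation along intervals, limits, Picard iteration *)

Section Tools.
Context {R : realType}.

(** The hypothesis makes P constant near each point of A, so the set where P holds and its
    complement are both relatively open. *)
Lemma connected_locally_const (T : pseudoMetricType R) (A : set T) (P : T -> Prop) :
  connected A ->
  (forall s, A s -> exists2 e : R, 0 < e & forall s' s'', A s' -> A s'' ->
     ball s e s' -> ball s e s'' -> P s' -> P s'') ->
  forall s t, A s -> A t -> P s -> P t.
Proof.
move=> cA loc s t As At Ps.
have locI : forall x, exists e : R, A x -> 0 < e /\ forall s' s'', A s' -> A s'' ->
     ball x e s' -> ball x e s'' -> P s' -> P s''.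
  move=> x; have [Ax|nAx] := pselect (A x); last by exists 0.
  by have [e e0 H] := loc x Ax; exists e.
have [e He] := choice locI.
suff E : [set x | A x /\ P x] = A by have [] : [set x | A x /\ P x] t by rewrite E.
have key : forall Q : T -> Prop, (forall x y z, A x -> A y -> A z -> ball x (e x) y ->
     ball x (e x) z -> Q y -> Q z) ->
   exists2 C : set T, open C & [set x | A x /\ Q x] = A `&` C.
  move=> Q HQ; exists (\bigcup_(x in [set x | A x /\ Q x]) (ball x (e x))°).
    by apply: bigcup_open => x _; apply: open_interior.
  apply/seteqP; split => x /=.
    move=> [Ax Qx]; split=> //; exists x => //.
    by apply: nbhsx_ballx; have [] := He x Ax.
  move=> [Ax [y [Ay Qy] /interior_subset yx]]; split=> //.
  by apply: (HQ y y) => //; apply: ballxx; have [] := He y Ay.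
apply: cA.
- by exists s.
- by apply: key => x y z Ax Ay Az xy xz; have [_] := He x Ax; apply.
- have [C oC EC] := key (fun x => ~ P x) (fun x y z Ax Ay Az xy xz nPy Pz =>
    nPy ((He x Ax).2 z y Az Ay xz xy Pz)).
  exists (~` C); first exact: open_closedC.
  apply/seteqP; split => x /=.
    move=> [Ax Px]; split=> // Cx.
    have : [set x | A x /\ ~ P x] x by rewrite EC.
    by case.
  move=> [Ax nCx]; split=> //; apply: contrapT => nPx; apply: nCx.
  have : [set x | A x /\ ~ P x] x by [].
  by rewrite EC => -[].
Qed.

(** This is the continuation principle for times and parameters: it serves for uniqueness of
    solutions, smoothness of flows, uniform constants on compact intervals, and agreement of two
    families of orbits. *)
Lemma seg_locally_const (a b : R) (P : R -> Prop) : 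
  (forall s, a <= s <= b -> exists2 e : R, 0 < e & forall s' s'',
     a <= s' <= b -> a <= s'' <= b ->
     `|s - s'| < e -> `|s - s''| < e -> P s' -> P s'') ->
  forall s t, a <= s <= b -> a <= t <= b -> P s -> P t.
Proof.
move=> H s t sab tab.
apply: (@connected_locally_const R^o `[a, b]).
- exact: segment_connected.
- by move=> u; rewrite /= in_itv /= => /H [e e0 He]; exists e => // s' s'';
    rewrite /= !in_itv /=; apply: He.
- by rewrite /mkset /= in_itv.
- by rewrite /mkset /= in_itv.
Qed.

Definition clamp (a b t : R) : R := Num.max a (Num.min b t).

Lemma clamp_lip (a b s t : R) : `|clamp a b s - clamp a b t| <= `|s - t|.
Proof.
have h1 := ler_norm (s - t); have h2 := ler_norm (t - s).
rewrite distrC in h2.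
rewrite /clamp /Num.max /Num.min.
by case: (ltP b s) => ?; case: (ltP b t) => ?; do 2?[case: (ltP a) => ?];
  rewrite ler_norml; apply/andP; split; qlra.
Qed.

Lemma clamp_itv (a b t : R) : a <= b -> a <= clamp a b t <= b.
Proof.
by move=> ab; rewrite /clamp le_max lexx /= ge_max ab ge_min lexx.
Qed.

Lemma clamp_id (a b t : R) : a <= t <= b -> clamp a b t = t.
Proof.
move=> /andP[at_ tb].
by rewrite /clamp min_r // max_r.
Qed.

Lemma lipschitz_continuous (V W : normedModType R) (f : V -> W) (L : R) :
  (forall x y, `|f x - f y| <= L * `|x - y|) -> continuous f.
Proof.
move=> H x; apply/cvgrPdist_lt => /= e e0.
have c0 : 0 < `|L| + 1 by rewrite ltr_pwDr.
apply/nbhs_ballP; exists (e / (`|L| + 1)); first exact: divr_gt0.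
move=> y; rewrite -ball_normE /= ltr_pdivlMr // => xy.
apply: le_lt_trans (H _ _) _; apply: le_lt_trans xy.
rewrite mulrC ler_wpM2l //; apply: le_trans (ler_norm _) _; by rewrite lerDl.
Qed.

(** Entrywise, the intervals of radius [e k] around the k-th term are nested, so the supremum of
    their left ends lies in all of them. Convergence follows as soon as [e] tends to 0. *)
Lemma telescoping_limit m n (v : nat -> 'M[R]_(m, n)) (e : nat -> R) :
  (forall k, 0 <= e k) ->
  (forall k, `|v k.+1 - v k| <= e k - e k.+1) ->
  exists l, forall k, `|v k - l| <= e k.
Proof.
move=> e0 H.
have real : forall u : nat -> R, (forall k, `|u k.+1 - u k| <= e k - e k.+1) ->
    exists l, forall k, `|u k - l| <= e k.
  move=> u Hu.
  have lo : forall k, u k - e k <= u k.+1 - e k.+1.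
    by move=> k; have := Hu k; rewrite ler_norml => /andP[? ?]; qlra.
  have hi : forall k, u k.+1 + e k.+1 <= u k + e k.
    by move=> k; have := Hu k; rewrite ler_norml => /andP[? ?]; qlra.
  have lo' : forall k j, (k <= j)%N -> u k - e k <= u j - e j.
    move=> k j /subnK <-; elim: (j - k)%N => // i IH.
    by apply: le_trans IH _; rewrite addSn; apply: lo.
  have hi' : forall k j, (k <= j)%N -> u j + e j <= u k + e k.
    move=> k j /subnK <-; elim: (j - k)%N => // i IH.
    by apply: le_trans _ IH; rewrite addSn; apply: hi.
  have cross : forall k j, u k - e k <= u j + e j.
    move=> k j; have [kj|/ltnW jk] := leqP k j.
      by apply: le_trans (lo' _ _ kj) _; have := e0 j; qlra.
    by apply: le_trans _ (hi' _ _ jk); have := e0 k; qlra.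
  pose S := [set u k - e k | k in setT].
  have ubS j : ubound S (u j + e j) by move=> _ [k _ <-]; apply: cross.
  exists (sup S) => k; rewrite ler_norml.
  have h1 : u k - e k <= sup S.
    apply: sup_upper_bound; last by exists k.
    by split; [exists (u 0%N - e 0%N); exists 0%N|exists (u 0%N + e 0%N)].
  have h2 : sup S <= u k + e k.
    by apply: ge_sup => //; exists (u 0%N - e 0%N); exists 0%N.
  by apply/andP; qlra.
have entry i j : exists l, forall k, `|v k i j - l| <= e k.
  apply: real => k; apply: le_trans (H k).
  by have := mx_entry_le (v k.+1 - v k) i j; rewrite !mxE.
pose l i j := projT1 (cid (entry i j)).
have Hl i j k : `|v k i j - l i j| <= e k := projT2 (cid (entry i j)) k.
exists (\matrix_(i, j) l i j) => k; apply: mx_norm_le => // i j.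
by rewrite !mxE.
Qed.

Lemma geometric_small (q c e : R) : 0 <= q < 1 -> 0 < e ->
  exists k, forall m, (k <= m)%N -> c * q ^+ m < e.
Proof.
move=> /andP[q0 q1] e0.
have := @cvg_geometric R c q; rewrite ger0_norm // => /(_ q1).
move/cvgrPdist_lt => /(_ e e0) [k _ Hk]; exists k => m km.
have := Hk m km; rewrite /= sub0r normrN => /(le_lt_trans (ler_norm _)).
by rewrite /geometric.
Qed.

Lemma le_of_geometric (x y c : R) (q : R) : 0 <= q < 1 ->
  (forall k, x <= y + c * q ^+ k) -> x <= y.
Proof.
move=> q01 H; apply/ler_addgt0Pr => e e0.
have [k Hk] := geometric_small c q01 e0.
apply: le_trans (H k) _; rewrite lerD2l; apply: ltW; exact: Hk.
Qed.

Lemma antiderivative1 (u : R -> R) (c : R) : continuous u ->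
  exists F : R -> R, F 0 = 0 /\
    forall t, `|t| < c -> is_derive (t : R^o) 1 (F : R^o -> R^o) (u t).
Proof.
move=> cu.
have gen (F : R -> R) t : derivable F t 1 -> derive1 F t = u t ->
    is_derive (t : R^o) 1 ((fun x => F x - F 0) : R^o -> R^o) (u t).
  move=> dF EF; rewrite -[u t]subr0.
  have D0 : is_derive (t : R^o) 1 (F : R^o -> R^o) (u t).
    by apply: (DeriveDef dF); rewrite -derive1E.
  exact: (cderB D0 (@cder_cst R R^o (F 0) t)).
(* Integrating from - c keeps every t with |t| < c, in particular 0, inside the interval, so that
   the derivative there is two-sided. *)
pose F0 x := Rintegral (@lebesgue_measure R) `[- c, x] u.
exists (fun x => F0 x - F0 0); split; first by rewrite subrr.
move=> t; rewrite ltr_norml => /andP[t1 t2].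
have iu : (@lebesgue_measure R).-integrable `[- c, c] (EFin \o u).
  apply: continuous_compact_integrable; first exact: segment_compact.
  by apply: continuous_subspaceT.
have [dF EF] := continuous_FTC1_closed t2 iu t1 (cu t).
exact: (gen F0 t dF EF).
Qed.

Lemma antiderivative n (u : R -> 'rV[R]_n) (c : R) : continuous u ->
  exists F : R -> 'rV[R]_n, F 0 = 0 /\
    forall t, `|t| < c -> is_derive (t : R^o) 1 (F : R^o -> 'rV[R]_n) (u t).
Proof.
move=> cu.
have H i : exists F : R -> R, F 0 = 0 /\
    forall t, `|t| < c -> is_derive (t : R^o) 1 (F : R^o -> R^o) (u t 0 i).
  apply: antiderivative1 => t.
  by apply: (@continuous_comp _ _ _ u (fun w : 'rV[R]_n => w 0 i : R^o));
      [exact: cu|exact: continuous_coord].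
have [F HF] := choice H.
exists (fun t => \row_i F i t); split.
  by apply/rowP => i; rewrite !mxE; have [] := HF i.
move=> t tc; apply/cder_coord => i.
by under eq_fun do rewrite mxE; have [_] := HF i; apply.
Qed.

(** The Picard operator contracts by 1/2 in the supremum norm. Time is clamped to [-d, d], so that
    the iterates live on the whole line, and each of them is M-Lipschitz, which passes to the limit
    and gives its continuity. *)
Lemma picard n (Y : 'rV[R]_n -> 'rV[R]_n) (L M d : R) :
  0 <= L -> 0 <= M -> 0 < d -> d * L <= 1 / 2 ->
  (forall x y, `|Y x - Y y| <= L * `|x - y|) -> (forall x, `|Y x| <= M) ->
  forall x, exists phi : R -> 'rV[R]_n, phi 0 = x /\
    forall t, `|t| < d -> is_derive (t : R^o) 1 (phi : R^o -> 'rV[R]_n) (Y (phi t)).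
Proof.
move=> L0 M0 d0 dL lipY bY x.
have cY := lipschitz_continuous lipY.
(* The radius 2 d leaves the end points of [-d, d] in the interior, where the mean value inequality
   also asks for derivatives. *)
have Aex (u : R -> 'rV[R]_n) : exists F : R -> 'rV[R]_n, continuous u -> F 0 = 0 /\
    forall t, `|t| < 2 * d -> is_derive (t : R^o) 1 (F : R^o -> 'rV[R]_n) (u t).
  have [cu|ncu] := pselect (continuous u); last by exists (fun=> 0).
  by have [F HF] := antiderivative (2 * d) cu; exists F.
have [A HA] := choice Aex.
pose cl := clamp (- d) d.
have dd : - d <= d by qlra.
have cl_in t : - d <= cl t <= d by apply: clamp_itv.
have cl_lt t : - d <= t <= d -> `|t| < 2 * d.
  by move=> /andP[h1 h2]; rewrite ltr_norml; apply/andP; qlra.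
have cl0 : cl 0 = 0 by apply: clamp_id; apply/andP; qlra.
have in0 : - d <= 0 <= d by apply/andP; qlra.
pose Pic (g : R -> 'rV[R]_n) t := x + A (fun s => Y (g s)) (cl t).
have cYg (g : R -> 'rV[R]_n) : continuous g -> continuous (fun s => Y (g s)).
  by move=> cg s; apply: continuous_comp; [apply: cg|apply: cY].
have PicL g : continuous g -> forall s t, `|Pic g s - Pic g t| <= M * `|s - t|.
  move=> cg s t; have [A0 dA] := HA _ (cYg g cg).
  rewrite /Pic opprD addrACA subrr add0r.
  apply: (@le_trans _ _ (M * `|cl s - cl t|)); last by rewrite ler_wpM2l // clamp_lip.
  apply: (curve_mvt_abs (a := - d) (b := d) (psi := fun s => Y (g s))) => //.
  by move=> u /cl_lt; apply: dA.
have PicC g : continuous g -> continuous (Pic g).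
  by move=> /PicL; apply: lipschitz_continuous.
have PicK g g' r : continuous g -> continuous g' -> (forall t, `|g t - g' t| <= r) ->
    forall t, `|Pic g t - Pic g' t| <= r / 2.
  move=> cg cg' gg' t; have [A0 dA] := HA _ (cYg g cg).
  have [A0' dA'] := HA _ (cYg g' cg').
  have r0 : 0 <= r by apply: le_trans (gg' 0).
  rewrite /Pic opprD addrACA subrr add0r.
  pose z s := A (fun s => Y (g s)) s - A (fun s => Y (g' s)) s.
  have -> : A (fun s => Y (g s)) (cl t) - A (fun s => Y (g' s)) (cl t) = z (cl t) - z 0.
    by rewrite /z A0 A0' !subr0.
  apply: (@le_trans _ _ (L * r * `|cl t - 0|)).
    apply: (curve_mvt_abs (a := - d) (b := d) (psi := fun s => Y (g s) - Y (g' s))) => //.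
    - by move=> u /cl_lt ud; apply: cderB; [apply: dA|apply: dA'].
    - by move=> u _; apply: le_trans (lipY _ _) _; rewrite ler_wpM2l.
    - exact: mulr_ge0.
  have clt : `|cl t - 0| <= d by rewrite subr0 ler_norml; apply: cl_in.
  apply: (@le_trans _ _ (L * r * d)); first by rewrite ler_wpM2l // mulr_ge0.
  by have := ler_wpM2r r0 dL; qlra.
pose g k := iter k Pic (fun=> x).
have gC k : continuous (g k).
  by elim: k => [|k IH]; [move=> t; apply: cst_continuous|apply: PicC].
(* Successive iterates differ by at most M d / 2^k; [e k] is the sum of these bounds from k on. *)
pose e (k : nat) := 2 * (M * d) * (1 / 2) ^+ k.
have Md0 : 0 <= M * d by rewrite mulr_ge0 // ltW.
have e0 k : 0 <= e k by rewrite /e mulr_ge0 ?exprn_ge0 //; qlra.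
have gS k t : `|g k.+1 t - g k t| <= (M * d) * (1 / 2) ^+ k.
  elim: k t => [|k IH] t.
    rewrite expr0 mulr1.
    have [A0 dA] := HA _ (cYg _ (gC 0%N)).
    have -> : g 1%N t - g 0%N t = A (fun s => Y (g 0%N s)) (cl t) -
        A (fun s => Y (g 0%N s)) 0 by rewrite A0 subr0 /= /Pic addrC addKr.
    apply: (@le_trans _ _ (M * `|cl t - 0|)).
      apply: (curve_mvt_abs (a := - d) (b := d) (psi := fun s => Y (g 0%N s))) => //.
      by move=> u /cl_lt; apply: dA.
    by rewrite ler_wpM2l // subr0 ler_norml; apply: cl_in.
  have := PicK _ _ _ (gC k.+1) (gC k) IH t.
  by rewrite exprSr /=; move=> /le_trans; apply; qlra.
have lim t : exists l, forall k, `|g k t - l| <= e k.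
  apply: telescoping_limit => // k; apply: le_trans (gS k t) _.
  by rewrite /e exprSr; qlra.
have [gam Hg] := choice lim.
have half01 : 0 <= (1 / 2 : R) < 1 by apply/andP; qlra.
have gamL s t : `|gam s - gam t| <= M * `|s - t|.
  apply: (@le_of_geometric _ _ (4 * (M * d)) (1 / 2)) => // k.
  have -> : gam s - gam t = (g k.+1 s - g k.+1 t) - (g k.+1 s - gam s) + (g k.+1 t - gam t).
    by apply/rowP => j; rewrite !mxE; ring.
  apply: le_trans (ler_normD _ _) _.
  have h1 := Hg t k.+1; have h2 := Hg s k.+1.
  have h3 : `|g k.+1 s - g k.+1 t| <= M * `|s - t| := PicL _ (gC k) s t.
  have eS : e k.+1 = M * d * (1 / 2) ^+ k by rewrite /e exprSr; qlra.
  have h4 := ler_normB (g k.+1 s - g k.+1 t) (g k.+1 s - gam s).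
  rewrite eS in h1 h2.
  have X0 : 0 <= M * d * (1 / 2) ^+ k by rewrite -eS.
  qlra.
have gamC := lipschitz_continuous gamL.
have fixp t : gam t = Pic gam t.
  apply/eqP; rewrite -subr_eq0 -normr_le0.
  apply: (@le_of_geometric _ _ (2 * (M * d)) (1 / 2)) => // k; rewrite add0r.
  have -> : gam t - Pic gam t = (g k.+1 t - Pic gam t) - (g k.+1 t - gam t).
    by apply/rowP => j; rewrite !mxE; ring.
  apply: le_trans (ler_normB _ _) _.
  have h1 : `|g k.+1 t - Pic gam t| <= e k / 2 := PicK _ _ _ (gC k) gamC (fun t => Hg t k) t.
  have h2 := Hg t k.+1.
  have eS : e k.+1 = M * d * (1 / 2) ^+ k by rewrite /e exprSr; qlra.
  have eS' : e k = 2 * (M * d) * (1 / 2) ^+ k by [].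
  by rewrite eS in h2; qlra.
have [A0 dA] := HA _ (cYg _ gamC).
exists gam; split; first by rewrite fixp /Pic cl0 A0 addr0.
move=> t td.
have td2 : `|t| < 2 * d by qlra.
apply: (@cder_near _ _ (fun s => x + A (fun s => Y (gam s)) s) _ t _ (d - `|t|)).
- by rewrite subr_gt0.
- move=> s st; rewrite [RHS]fixp /Pic /cl clamp_id // -ler_norml.
  by have := ler_normD (s - t) t; rewrite subrK; qlra.
- by rewrite -[Y _]add0r; exact: (cderD (cder_cst _ _) (dA _ td2)).
Qed.

End Tools.

(** * Flows of smooth vector fields *)

Section LocalEstimates.
Context {R : realType}.

Lemma finite_eps n (P : 'I_n -> R -> Prop) :
  (forall i e e', 0 < e' -> e' <= e -> P i e -> P i e') ->
  (forall i, exists2 e, 0 < e & P i e) -> exists2 e, 0 < e & forall i, P i e.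
Proof.
move=> mono H.
have [e e0 He] : exists2 e, 0 < e & forall i, i \in enum 'I_n -> P i e.
  elim: (enum 'I_n) => [|i s [e e0 He]]; first by exists 1.
  have [e' e'0 He'] := H i.
  exists (Num.min e e'); first by rewrite lt_min e0.
  move=> j; rewrite inE => /predU1P[->|js].
    by apply: mono He'; rewrite ?lt_min ?e0 // ge_min lexx orbT.
  by apply: mono (He _ js); rewrite ?lt_min ?e0 // ge_min lexx.
by exists e => // i; apply: He; rewrite mem_enum.
Qed.

Lemma cder_line (W : normedModType R) (x v : W) (s : R) :
  is_derive (s : R^o) 1 ((fun t => x + t *: v) : R^o -> W) v.
Proof.
apply/cder_eps => e e0; exists 1 => // h _.
rewrite scalerDl addrA [X in X - _ - _]addrC addrK subrr normr0.
by apply: mulr_ge0 => //; apply: ltW.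
Qed.

Lemma derive_lin (V W : normedModType R) (f : {linear V -> W}) (x v : V) :
  continuous f -> 'D_v f x = f v.
Proof.
move=> cf; rewrite deriveE; last exact: linear_differentiable.
by rewrite diff_lin.
Qed.

Lemma segment_in_ball n (x0 x y : 'rV[R]_n) (r s : R) :
  `|x - x0| <= r -> `|y - x0| <= r -> 0 <= s <= 1 ->
  `|x + s *: (y - x) - x0| <= r.
Proof.
move=> hx hy /andP[s0 s1].
have -> : x + s *: (y - x) - x0 = (1 - s) *: (x - x0) + s *: (y - x0).
  by apply/rowP => j; rewrite !mxE; ring.
apply: le_trans (ler_normD _ _) _; rewrite !normrZ.
have s1' : 0 <= 1 - s by rewrite subr_ge0.
rewrite (ger0_norm s0) (ger0_norm s1').
have := ler_wpM2l s0 hy; have := ler_wpM2l s1' hx; qlra.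
Qed.

Lemma segment_mvt n m (f : 'rV[R]_n -> 'rV[R]_m) (x y : 'rV[R]_n) (M : R) :
  0 <= M ->
  (forall s, 0 <= s <= 1 -> differentiable f (x + s *: (y - x)) /\
     `|'d f (x + s *: (y - x)) (y - x)| <= M) ->
  `|f y - f x| <= M.
Proof.
move=> M0 H.
have := @curve_mvt_le R m (fun s => f (x + s *: (y - x)))
   (fun s => 'd f (x + s *: (y - x)) (y - x)) 0 1 M ler01.
rewrite scale1r scale0r addr0 [x + _]addrC subrK subr0 mulr1; apply => //.
- move=> s s01; apply: cder_comp; first by have [] := H s s01.
  exact: cder_line.
- by move=> s /andP[/ltW s0 /ltW s1]; have [] := H s; rewrite ?s0 ?s1.
Qed.

(** Continuity of the finitely many partial derivatives at x0 bounds the differential on a ball, and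
    balls are convex, so the mean value inequality along segments gives the Lipschitz bound. *)
Lemma loc_lip n m (X : 'rV[R]_n -> 'rV[R]_m) U x0 : open U -> Ck_on 1 U X -> U x0 ->
  exists r L : R, [/\ 0 < r, 0 <= L,
    forall x, `|x - x0| <= r -> U x,
    forall x v, `|x - x0| <= r -> `|'d X x v| <= L * `|v| &
    forall x y, `|x - x0| <= r -> `|y - x0| <= r -> `|X x - X y| <= L * `|x - y|].
Proof.
move=> oU [dX DX] Ux0.
have /nbhs_ballP[r0 /= r00 Hr0] := open_nbhs_nbhs (conj oU Ux0).
have [e e0 He] : exists2 e, 0 < e & forall i : 'I_n, forall x, `|x - x0| < e ->
    `|'D_(delta_mx 0 i) X x| <= `|'D_(delta_mx 0 i) X x0| + 1.
  apply: finite_eps.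
    by move=> i e e' _ ee' H x /lt_le_trans xe; apply: H; apply: xe.
  move=> i; have := DX (delta_mx 0 i) x0 Ux0; rewrite /prop_for /continuous_at.
  move/cvgrPdist_lt => /(_ 1 ltr01) /nbhs_ballP[e /= e0 He]; exists e => // x xe.
  have := He x; rewrite -ball_normE /= distrC => /(_ xe) H1.
  rewrite -lerBlDl; apply: ltW; apply: le_lt_trans H1.
  by rewrite distrC; apply: lerB_dist.
pose L := \sum_i (`|'D_(delta_mx 0 i) X x0| + 1).
have L0 : 0 <= L by apply: sumr_ge0 => i _; rewrite addr_ge0.
pose r := Num.min r0 e / 2.
have m0 : 0 < Num.min r0 e by rewrite lt_min r00.
have r_gt0 : 0 < r by rewrite /r divr_gt0.
have rr0 : r < r0 by have : Num.min r0 e <= r0 by [rewrite ge_min lexx]; rewrite /r; qlra.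
have re : r < e.
  by have : Num.min r0 e <= e by [rewrite ge_min lexx orbT]; rewrite /r; qlra.
have inU x : `|x - x0| <= r -> U x.
  move=> xr; apply: Hr0; rewrite -ball_normE /= distrC; exact: le_lt_trans rr0.
have bd x v : `|x - x0| <= r -> `|'d X x v| <= L * `|v|.
  move=> xr; rewrite diff_row; last exact/dX/inU.
  apply: le_trans (ler_norm_sum _ _ _) _; rewrite /L mulr_suml.
  apply: ler_sum => i _; rewrite normrZ mulrC; apply: ler_pM => //.
    by apply: He; apply: le_lt_trans re.
  exact: mx_entry_le.
exists r, L; split => // x y xr yr.
apply: segment_mvt; first exact: mulr_ge0.
move=> s s01; have sr := segment_in_ball yr xr s01.
by split; [exact/dX/inU|exact: bd].
Qed.

(** The mean value inequality is applied to X minus its differential at x; on the segment the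
    derivative of this difference is small because the partial derivatives are Lipschitz. *)
Lemma loc_quad n m (X : 'rV[R]_n -> 'rV[R]_m) U x0 : open U -> Ck_on 2 U X -> U x0 ->
  exists r C : R, [/\ 0 < r, 0 <= C,
    forall x, `|x - x0| <= r -> U x &
    forall x y, `|x - x0| <= r -> `|y - x0| <= r ->
      `|X y - X x - 'd X x (y - x)| <= C * `|y - x| ^+ 2].
Proof.
move=> oU HX Ux0; have [dX DX] := HX.
have [r0 [L0 [r00 L00 inU0 _ _]]] := loc_lip oU (Ck_on_pred HX) Ux0.
have Hi i : exists rL : R * R, [/\ 0 < rL.1, 0 <= rL.2 &
    forall x y, `|x - x0| <= rL.1 -> `|y - x0| <= rL.1 ->
    `|'D_(delta_mx 0 i) X x - 'D_(delta_mx 0 i) X y| <= rL.2 * `|x - y|].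
  by have [r [L [? ? ? _ ?]]] := loc_lip oU (DX (delta_mx 0 i)) Ux0; exists (r, L).
have [rL HrL] := choice Hi.
have [e e0 He] : exists2 e : R, 0 < e & forall i : 'I_n, e <= (rL i).1.
  apply: finite_eps => [i e e' _ h1 h2|i]; first exact: le_trans h2.
  by exists (rL i).1 => //; have [] := HrL i.
pose r := Num.min r0 e.
have rr0 : r <= r0 by rewrite ge_min lexx.
have re : r <= e by rewrite ge_min lexx orbT.
pose C := \sum_i (rL i).2.
have C0 : 0 <= C by apply: sumr_ge0 => i _; have [] := HrL i.
have inU x : `|x - x0| <= r -> U x by move=> xr; apply: inU0; apply: le_trans rr0.
exists r, C; split => //; first by rewrite lt_min r00.
move=> x y xr yr.
have dl z : differentiable ('d X x) z.
  by apply: linear_differentiable; apply/diff_continuous/dX/inU.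
pose f z := X z - 'd X x z.
have -> : X y - X x - 'd X x (y - x) = f y - f x.
  by rewrite /f linearB /=; apply/rowP => j; rewrite !mxE; ring.
apply: segment_mvt; first by rewrite mulr_ge0 // exprn_ge0.
move=> s s01; have sr := segment_in_ball xr yr s01.
set w := x + _ in sr *.
have dXw : differentiable X w by exact/dX/inU.
have dXx : differentiable X x by exact/dX/inU.
have df : differentiable f w by exact: differentiableB.
split=> //.
rewrite -deriveE // /f (deriveB (f := X)); last 2 first.
- exact: diff_derivable.
- exact: diff_derivable.
have E2 : 'D_(y - x) ('d X x) w = 'd X x (y - x).
  exact: (derive_lin w (y - x) (diff_continuous dXx)).
have E3 := etrans (deriveE (y - x) dXw) (diff_row (y - x) dXw).
have E4 := diff_row (y - x) dXx.
rewrite E3 E2 E4.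
rewrite -sumrB expr2 mulrA.
apply: le_trans (ler_norm_sum _ _ _) _.
rewrite /C !mulr_suml; apply: ler_sum => i _.
rewrite -scalerBr normrZ mulrC; apply: ler_pM => //; last exact: mx_entry_le.
have [_ L2 H] := HrL i.
apply: le_trans (H _ _ _ _) _; try by apply: le_trans (le_trans _ (le_trans re (He i))).
rewrite ler_wpM2l // /w addrC addKr normrZ.
by case/andP: s01 => s0 s1; rewrite ger0_norm // ler_piMl.
Qed.

End LocalEstimates.

Section LocalFlow.
Context {R : realType}.

Definition trajectory n (X : 'rV[R]_n -> 'rV[R]_n) (U : set 'rV[R]_n)
    (phi : R -> 'rV[R]_n) (c d : R) : Prop :=
  forall s, c < s < d -> U (phi s) /\ is_derive (s : R^o) 1 (phi : R^o -> _) (X (phi s)).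

(** A retraction of the whole space onto the ball of radius r, 1-Lipschitz for the maximum norm.
    Composition with it turns a locally Lipschitz field into a global one. *)
Definition box_clamp n (x0 : 'rV[R]_n) (r : R) (x : 'rV[R]_n) : 'rV[R]_n :=
  \row_j clamp (x0 0 j - r) (x0 0 j + r) (x 0 j).

Lemma box_clamp_lip n (x0 : 'rV[R]_n) r x y :
  `|box_clamp x0 r x - box_clamp x0 r y| <= `|x - y|.
Proof.
apply: mx_norm_le => // i j; rewrite ord1 !mxE; apply: le_trans (clamp_lip _ _ _ _) _.
by have := mx_entry_le (x - y) 0 j; rewrite !mxE.
Qed.

Lemma box_clamp_ball n (x0 : 'rV[R]_n) r x : 0 <= r -> `|box_clamp x0 r x - x0| <= r.
Proof.
move=> r0; apply: mx_norm_le => // i j; rewrite ord1 !mxE ler_norml.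
have /andP[] : x0 0 j - r <= clamp (x0 0 j - r) (x0 0 j + r) (x 0 j) <= x0 0 j + r.
  by apply: clamp_itv; qlra.
by move=> ? ?; apply/andP; qlra.
Qed.

Lemma box_clamp_id n (x0 : 'rV[R]_n) r x : `|x - x0| <= r -> box_clamp x0 r x = x.
Proof.
move=> xr; apply/rowP => j; rewrite !mxE clamp_id //.
have := le_trans (mx_entry_le (x - x0) 0 j) xr.
by rewrite !mxE ler_norml => /andP[? ?]; apply/andP; qlra.
Qed.

Lemma exists_small (L c : R) : 0 <= L -> 0 < c -> exists2 d : R, 0 < d & d * L <= c.
Proof.
move=> L0 c0; exists (c / (L + 1)).
  by rewrite divr_gt0 // ltr_pwDr.
have L1 : 0 < L + 1 by rewrite ltr_pwDr.
rewrite mulrAC ler_pdivrMr // ler_wpM2l ?ltW //; qlra.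
Qed.

(** The clamped field is globally Lipschitz and bounded, so [picard] applies to it. For short times
    its solutions stay in the ball, where it coincides with X. *)
Lemma local_flow n (X : 'rV[R]_n -> 'rV[R]_n) U x0 r0 : open U -> Ck_on 1 U X -> U x0 ->
  0 < r0 -> exists (Phi : 'rV[R]_n -> R -> 'rV[R]_n) (rho d : R), [/\ 0 < rho, 0 < d,
    forall x, `|x - x0| < rho -> Phi x 0 = x,
    forall x t, `|x - x0| < rho -> `|t| < d -> [/\ U (Phi x t), `|Phi x t - x0| < r0 &
       is_derive (t : R^o) 1 (Phi x : R^o -> _) (X (Phi x t))] &
    forall x y t, `|x - x0| < rho -> `|y - x0| < rho -> `|t| < d ->
      `|Phi x t - Phi y t| <= 2 * `|x - y|].
Proof.
move=> oU HX Ux0 r00.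
have [r1 [L [r10 L0 inU _ lipX]]] := loc_lip oU HX Ux0.
pose r := Num.min r1 r0 / 2.
have m0 : 0 < Num.min r1 r0 by rewrite lt_min r10.
have r_gt0 : 0 < r by rewrite /r divr_gt0.
have rr1 : r <= r1.
  by have : Num.min r1 r0 <= r1 by [rewrite ge_min lexx]; rewrite /r; qlra.
have rr0 : r < r0.
  by have : Num.min r1 r0 <= r0 by [rewrite ge_min lexx orbT]; rewrite /r; qlra.
pose Y x := X (box_clamp x0 r x).
have bc x : `|box_clamp x0 r x - x0| <= r1.
  by apply: le_trans rr1; apply: box_clamp_ball; apply: ltW.
have lipY x y : `|Y x - Y y| <= L * `|x - y|.
  apply: le_trans (lipX _ _ (bc x) (bc y)) _.
  by rewrite ler_wpM2l // box_clamp_lip.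
pose M := `|X x0| + L * r1.
have M0 : 0 <= M by rewrite /M addr_ge0 // mulr_ge0 // ltW.
have bY x : `|Y x| <= M.
  rewrite /Y -[X _](subrK (X x0)) addrC; apply: le_trans (ler_normD _ _) _.
  rewrite lerD2l; apply: le_trans (lipX _ _ (bc x) _) _; first by rewrite subrr normr0 ltW.
  by rewrite ler_wpM2l.
(* Two solutions are compared on an interval of length up to 2 d, where [absorb] asks for 2 d L <=
   1/2. *)
have q4 : 0 < 1 / 4 :> R by qlra.
have [d1 d10 Hd1] := exists_small L0 q4.
have r2 : 0 < r / 2 by qlra.
have [d2 d20 Hd2] := exists_small M0 r2.
pose d := Num.min d1 d2.
have d0 : 0 < d by rewrite lt_min d10.
have dd1 : d <= d1 by rewrite ge_min lexx.
have dd2 : d <= d2 by rewrite ge_min lexx orbT.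
have dL : d * L <= 1 / 4 by apply: le_trans Hd1; rewrite ler_wpM2r.
have dM : d * M <= r / 2 by apply: le_trans Hd2; rewrite ler_wpM2r.
have q : 1 / 4 <= 1 / 2 :> R by qlra.
have [Phi HPhi] := choice (fun x => picard L0 M0 d0 (le_trans dL q) lipY bY x).
exists Phi, (r / 2), d.
have stay x t : `|x - x0| < r / 2 -> `|t| < d -> `|Phi x t - x0| <= r.
  move=> xr td; have [P0 dP] := HPhi x.
  have tt s : - `|t| <= s <= `|t| -> `|s| < d.
    by rewrite -ler_norml => st; apply: le_lt_trans td.
  have H : `|Phi x t - Phi x 0| <= M * `|t - 0|.
    apply: (curve_mvt_abs (a := - `|t|) (b := `|t|) (psi := fun s => Y (Phi x s))) => //.
    - by move=> s /tt; apply: dP.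
    - by rewrite oppr_le0 normr_ge0.
    - by rewrite -ler_norml.
  rewrite P0 subr0 in H.
  have := ler_wpM2l M0 (ltW td).
  have := ler_normD (Phi x t - x) (x - x0); rewrite subrKA; qlra.
split => //.
- by move=> x _; have [] := HPhi x.
- move=> x t xr td; have st := stay x t xr td.
  split; [apply: inU; qlra|qlra|].
  by have [_ /(_ t td)] := HPhi x; rewrite /Y box_clamp_id.
- move=> x y t xr yr td.
  have tt s : - `|t| <= s <= `|t| -> `|s| < d.
    by rewrite -ler_norml => st; apply: le_lt_trans td.
  have [Px dPx] := HPhi x; have [Py dPy] := HPhi y.
  have := @absorb R n (fun s => Phi x s - Phi y s) (fun s => Y (Phi x s) - Y (Phi y s))
     (- `|t|) `|t| 0 t L 0.
  rewrite Px Py mulr0 addr0; apply => //.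
  + by move=> u /tt ud; apply: cderB; [apply: dPx|apply: dPy].
  + by move=> u _; rewrite addr0.
  + rewrite opprK; have := ler_wpM2r L0 (ltW td); qlra.
  + by rewrite oppr_le0 normr_ge0.
  + by rewrite -ler_norml.
Qed.

(** Near a time u at which the curves agree somewhere close by, both stay close to [phi u], where
    the field is Lipschitz; [absorb] with initial difference 0 extends the agreement, and
    [seg_locally_const] continues it. *)
Lemma trajectory_unique n (X : 'rV[R]_n -> 'rV[R]_n) U phi psi c d s0 :
  open U -> Ck_on 1 U X -> trajectory X U phi c d -> trajectory X U psi c d ->
  c < s0 < d -> phi s0 = psi s0 -> forall s, c < s < d -> phi s = psi s.
Proof.
move=> oU HX tphi tpsi s0cd E s scd.
pose a := Num.min s0 s; pose b := Num.max s0 s.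
have ca : c < a by rewrite /a lt_min; case/andP: s0cd => -> _; case/andP: scd.
have bd : b < d by rewrite /b gt_max; case/andP: s0cd => _ ->; case/andP: scd.
have cab u : a <= u <= b -> c < u < d by move=> /andP[? ?]; apply/andP; qlra.
apply: (@seg_locally_const R a b (fun s => phi s = psi s) _ s0 s) => //; last 2 first.
- by rewrite /a /b ge_min lexx le_max lexx.
- by rewrite /a /b ge_min lexx orbT le_max lexx orbT.
move=> u uab.
have [Uu du] := tphi u (cab u uab).
have [_ dpu] := tpsi u (cab u uab).
have [r [L [r_gt0 L0 inU _ lipX]]] := loc_lip oU HX Uu.
have r4 : 0 < r / 4 by qlra.
have := cder_cont du; rewrite /prop_for /continuous_at => /cvgrPdist_lt /(_ _ r4)
  /nbhs_ballP[e1 /= e10 He1].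
have := cder_cont dpu; rewrite /prop_for /continuous_at => /cvgrPdist_lt /(_ _ r4)
  /nbhs_ballP[e2 /= e20 He2].
have q4 : 0 < 1 / 4 :> R by qlra.
have [e3 e30 He3] := exists_small L0 q4.
pose e := Num.min e1 (Num.min e2 e3).
have e0 : 0 < e by rewrite !lt_min e10 e20.
have ee1 : e <= e1 by rewrite ge_min lexx.
have ee2 : e <= e2 by rewrite !ge_min lexx orbT.
have ee3 : e <= e3 by rewrite !ge_min lexx !orbT.
exists e => // s1 s2 s1ab s2ab us1 us2 E1.
pose a' := Num.min s1 s2; pose b' := Num.max s1 s2.
have in1 w : a' <= w <= b' -> `|u - w| < e.
  move: us1 us2; rewrite !ltr_distlC => /andP[l1 h1] /andP[l2 h2] /andP[l3 h3].
  by rewrite (lt_le_trans _ l3) ?(le_lt_trans h3) // ?lt_min ?gt_max ?l1 ?h1.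
have in2 w : a' <= w <= b' -> a <= w <= b.
  case/andP: s1ab => l1 h1; case/andP: s2ab => l2 h2 /andP[l3 h3].
  by rewrite (le_trans _ l3) ?(le_trans h3) // ?le_min ?ge_max ?l1 ?h1.
have p1 w : a' <= w <= b' -> `|phi w - phi u| < r / 4.
  by move=> /in1 h; rewrite distrC; apply: He1; apply: lt_le_trans ee1.
have p2 w : a' <= w <= b' -> `|psi w - psi u| < r / 4.
  by move=> /in1 h; rewrite distrC; apply: He2; apply: lt_le_trans ee2.
have s1in : a' <= s1 <= b' by rewrite /a' /b' ge_min lexx le_max lexx.
have s2in : a' <= s2 <= b' by rewrite /a' /b' ge_min lexx orbT le_max lexx orbT.
have up : `|psi u - phi u| < r / 2.
  have h1 := p1 _ s1in; have h2 := p2 _ s1in.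
  have := ler_normD (psi u - psi s1) (phi s1 - phi u).
  rewrite -E1 subrKA; rewrite -E1 distrC in h2; qlra.
have := @absorb R n (fun s => phi s - psi s) (fun s => X (phi s) - X (psi s))
     a' b' s1 s2 L 0.
rewrite E1 subrr normr0 !mulr0 addr0 normr_le0 subr_eq0 => H.
apply/eqP; apply: H => //.
- move=> w /in2 /cab wcd; apply: cderB.
    by have [] := tphi w wcd.
  by have [] := tpsi w wcd.
- move=> w wab; rewrite addr0; apply: lipX.
    by have := p1 w wab; qlra.
  have h2 := p2 w wab; have := ler_normD (psi w - psi u) (psi u - phi u).
  by rewrite subrKA; qlra.
- have h : b' - a' <= e *+ 2.
    have ha := in1 a'; have hb := in1 b'.
    have ab' : a' <= b' by case/andP: s1in => *; qlra.
    rewrite lexx ab' in ha; rewrite lexx ab' in hb.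
    have := ha isT; have := hb isT; rewrite !ltr_norml => /andP[? ?] /andP[? ?].
    by rewrite mulr2n; qlra.
  have := ler_wpM2r L0 h; have := ler_wpM2r L0 ee3; rewrite mulr2n; qlra.
Qed.

End LocalFlow.

Section SmoothLocalFlow.
Context {R : realType}.

Lemma cont_eps (V W : normedModType R) (f : V -> W) (x : V) :
  {for x, continuous f} <->
  (forall e : R, 0 < e -> exists2 d : R, 0 < d &
     forall y, `|y - x| < d -> `|f y - f x| < e).
Proof.
rewrite /prop_for /continuous_at; split.
  move=> /cvgrPdist_lt H e /H /nbhs_ballP[d d0 Hd]; exists d => // y yx.
  by rewrite distrC; apply: Hd; rewrite -ball_normE /= distrC.
move=> H; apply/cvgrPdist_lt => e /H [d d0 Hd].
apply/nbhs_ballP; exists d => // y; rewrite -ball_normE /= distrC => /Hd.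
by rewrite distrC.
Qed.

Lemma lsubmxE n m (z : 'rV[R]_(n + m)) : lsubmx z = z *m col_mx 1%:M 0.
Proof. by rewrite -{2}[z]hsubmxK mul_row_col mulmx1 mulmx0 addr0. Qed.

Lemma rsubmxE n m (z : 'rV[R]_(n + m)) : rsubmx z = z *m col_mx 0 1%:M.
Proof. by rewrite -{2}[z]hsubmxK mul_row_col mulmx1 mulmx0 add0r. Qed.

Lemma row_mxE n m (a : 'rV[R]_n) (b : 'rV[R]_m) :
  row_mx a b = a *m row_mx 1%:M 0 + b *m row_mx 0 1%:M.
Proof. by rewrite !mul_mx_row !mulmx1 !mulmx0 add_row_mx addr0 add0r. Qed.

Lemma Ck_on_row_mx (V : normedModType R) k (U : set V) n m (f : V -> 'rV[R]_n)
    (g : V -> 'rV[R]_m) : open U -> Ck_on k U f -> Ck_on k U g ->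
  Ck_on k U (fun x => row_mx (f x) (g x)).
Proof.
move=> oU Hf Hg; under eq_fun do rewrite row_mxE.
by apply: Ck_on_add => //; apply: Ck_on_mulmx.
Qed.

Lemma Ck_on_id k n (U : set 'rV[R]_n) : Ck_on k U (fun x : 'rV[R]_n => x).
Proof. by apply: (@Ck_on_lin _ _ _ k U idfun) => x; exact: cvg_id. Qed.

Lemma Ck_on_lsubmx (V : normedModType R) k (U : set V) n m (f : V -> 'rV[R]_(n + m)) :
  open U -> Ck_on k U f -> Ck_on k U (fun x => lsubmx (f x)).
Proof. by move=> oU Hf; under eq_fun do rewrite lsubmxE; apply: Ck_on_mulmx. Qed.

Lemma Ck_on_rsubmx (V : normedModType R) k (U : set V) n m (f : V -> 'rV[R]_(n + m)) :
  open U -> Ck_on k U f -> Ck_on k U (fun x => rsubmx (f x)).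
Proof. by move=> oU Hf; under eq_fun do rewrite rsubmxE; apply: Ck_on_mulmx. Qed.

Lemma row_mx_norm_lt n m (a : 'rV[R]_n) (b : 'rV[R]_m) (e : R) :
  `|a| < e -> `|b| < e -> `|row_mx a b| < e.
Proof.
move=> ae be; apply: (@le_lt_trans _ _ (Num.max `|a| `|b|)); last by rewrite gt_max ae.
apply: mx_norm_le => [|i j]; first by rewrite le_max normr_ge0.
rewrite mxE ord1; case: splitP => k _; rewrite le_max mx_entry_le ?orbT //.
Qed.

Lemma lsubmx_norm n m (z : 'rV[R]_(n + m)) : `|lsubmx z| <= `|z|.
Proof. by apply: mx_norm_le => // i j; rewrite mxE mx_entry_le. Qed.

Lemma rsubmx_norm n m (z : 'rV[R]_(n + m)) : `|rsubmx z| <= `|z|.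
Proof. by apply: mx_norm_le => // i j; rewrite mxE mx_entry_le. Qed.

Lemma cder_mulmx n m (phi : R -> 'rV[R]_n) (s : R) w (B : 'M[R]_(n, m)) :
  is_derive (s : R^o) 1 (phi : R^o -> _) w ->
  is_derive (s : R^o) 1 ((fun t => phi t *m B) : R^o -> _) (w *m B).
Proof.
move=> H; have cB : continuous (mulmxr B : 'rV[R]_n -> _) by exact: row_linear_cont.
have := @cder_comp R _ _ (mulmxr B) phi s w (linear_differentiable _ cB) H.
by have -> := congr1 (fun f => f w) (diff_lin (phi s) cB).
Qed.

Lemma open_lsubmx n m (U : set 'rV[R]_n) : open U ->
  open [set z : 'rV[R]_(n + m) | U (lsubmx z)].
Proof. by move=> oU; apply: open_comp => // z _; apply: continuous_lsubmx. Qed.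

Lemma open_dist n (x0 : 'rV[R]_n) (r : R) : open [set x : 'rV[R]_n | `|x - x0| < r].
Proof.
have := @ball_open R 'rV[R]_n x0 r.
by rewrite (_ : ball x0 r = [set x | `|x - x0| < r]) //; apply/seteqP; split=> x /=;
  rewrite -ball_normE /= distrC.
Qed.

#[local] Arguments open_dist {n} x0 r.

(* The variational equation: its second component solves w' = dX(x) w. *)
Definition variational n (X : 'rV[R]_n -> 'rV[R]_n) (z : 'rV[R]_(n + n)) : 'rV[R]_(n + n) :=
  row_mx (X (lsubmx z))
    (\sum_i rsubmx z 0 i *: 'D_(delta_mx 0 i) X (lsubmx z)).

Lemma Ck_on_variational n k (X : 'rV[R]_n -> 'rV[R]_n) U : open U -> Ck_on k.+1 U X ->
  Ck_on k [set z : 'rV[R]_(n + n) | U (lsubmx z)] (variational X).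
Proof.
move=> oU HX; have oU' := open_lsubmx (m := n) oU.
have Hl : Ck_on k [set z : 'rV[R]_(n + n) | U (lsubmx z)] (@lsubmx R 1 n n).
  by apply: Ck_on_lsubmx => //; apply: Ck_on_id.
apply: Ck_on_row_mx => //.
  by apply: (Ck_on_comp oU' oU _ Hl (Ck_on_pred HX)).
apply: Ck_on_sum => // i.
apply/(Ck_on_coord _ _ oU') => j.
apply: (@Ck_on_ext _ _ _ k _ (fun z => rsubmx z 0 i * ('D_(delta_mx 0 i) X (lsubmx z)) 0 j : R^o)) => //.
  by move=> z _; rewrite [in RHS]mxE.
apply: Ck_on_mul => //.
  have : Ck_on k [set z : 'rV[R]_(n + n) | U (lsubmx z)] (@rsubmx R 1 n n).
    by apply: Ck_on_rsubmx => //; apply: Ck_on_id.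
  by move/(Ck_on_coord _ _ oU'); apply.
have : Ck_on k [set z : 'rV[R]_(n + n) | U (lsubmx z)]
   (fun z => 'D_(delta_mx 0 i) X (lsubmx z)).
  by apply: (Ck_on_comp oU' oU _ Hl (HX.2 _)).
by move/(Ck_on_coord _ _ oU'); apply.
Qed.

Lemma quadratic_differentiable n m (f : 'rV[R]_n -> 'rV[R]_m) x (B : 'M[R]_(n, m)) (K r : R) :
  0 < r -> 0 <= K ->
  (forall v, `|v| < r -> `|f (x + v) - f x - v *m B| <= K * `|v| ^+ 2) ->
  differentiable f x /\ forall v, 'D_v f x = v *m B.
Proof.
move=> r0 K0 H.
have cB : continuous (mulmxr B : 'rV[R]_n -> _) by exact: row_linear_cont.
have [e e0|df dE] := eps_differentiable (f := f) (x := x) cB.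
  have [d d0 Hd] := exists_small K0 e0.
  exists (Num.min r d); first by rewrite lt_min r0.
  move=> h; rewrite lt_min => /andP[hr hd]; apply: le_trans (H h hr) _.
  rewrite expr2 mulrA; apply: ler_wpM2r => //; apply: le_trans Hd.
  by rewrite mulrC ler_wpM2r // ltW.
by split=> // v; rewrite deriveE // dE.
Qed.

(** Induction on k over all dimensions and fields: the space derivative of the flow is read off from
    the flow of [variational] in dimension n + n, which is C^k by the induction hypothesis. *)
Lemma smooth_local_flow k n (X : 'rV[R]_n -> 'rV[R]_n) U x0 : open U ->
  smooth_on U X -> U x0 ->
  exists (Phi : 'rV[R]_n -> R -> 'rV[R]_n) (rho d : R), [/\ 0 < rho, 0 < d,
    forall x, `|x - x0| < rho -> Phi x 0 = x,
    forall x t, `|x - x0| < rho -> `|t| < d -> U (Phi x t) /\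
       is_derive (t : R^o) 1 (Phi x : R^o -> _) (X (Phi x t)) &
    forall t, `|t| < d -> Ck_on k [set x | `|x - x0| < rho] (fun x => Phi x t)].
Proof.
elim: k n X U x0 => [|k IH] n X U x0 oU sX Ux0.
  have [Phi [rho [d [rho0 d0 P0 dP lP]]]] := local_flow oU (sX 1%N) Ux0 ltr01.
  exists Phi, rho, d; split => //.
    by move=> x t xr td; have [] := dP x t xr td.
  move=> t td x; rewrite /mkset => xr; apply/cont_eps => e e0.
  exists (Num.min (rho - `|x - x0|) (e / 2)).
    by rewrite lt_min subr_gt0 xr divr_gt0.
  move=> y; rewrite lt_min => /andP[y1 y2].
  apply: (@le_lt_trans _ _ (2 * `|y - x|)); last by qlra.
  apply: lP => //.
  by have := ler_normD (y - x) (x - x0); rewrite subrKA; qlra.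
have [rq [C [rq0 C0 _ HC]]] := loc_quad oU (sX 2%N) Ux0.
have [r1 [L [r10 L0 _ bL _]]] := loc_lip oU (sX 1%N) Ux0.
have m0 : 0 < Num.min rq r1 by rewrite lt_min rq0.
have [Phi [rho1 [d1 [rho10 d10 P0 dP lP]]]] := local_flow oU (sX 1%N) Ux0 m0.
have oU' := open_lsubmx (m := n) oU.
have [|Psi [rho2 [d2 [rho20 d20 Q0 dQ CQ]]]] := IH _ (variational X)
   [set z : 'rV[R]_(n + n) | U (lsubmx z)] (row_mx x0 0) oU'
   (fun k => Ck_on_variational oU (sX k.+1)).
  by rewrite /= row_mxKl.
have q4 : 0 < 1 / 4 :> R by qlra.
have [d3 d30 Hd3] := exists_small L0 q4.
pose rho := Num.min rho1 rho2; pose d := Num.min d1 (Num.min d2 d3).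
have rho0 : 0 < rho by rewrite lt_min rho10.
have d0 : 0 < d by rewrite !lt_min d10 d20.
have rr1 : rho <= rho1 by rewrite ge_min lexx.
have rr2 : rho <= rho2 by rewrite ge_min lexx orbT.
have dd1 : d <= d1 by rewrite ge_min lexx.
have dd2 : d <= d2 by rewrite !ge_min lexx orbT.
have dd3 : d <= d3 by rewrite !ge_min lexx !orbT.
(* The flow of [variational] is available only near (x0, 0). Its equation is linear in the second
   component, so the unit vectors are replaced by small multiples with factor c and the result is
   divided by c. *)
pose c := rho2 / 2.
have c0 : 0 < c by rewrite divr_gt0.
pose z (x : 'rV[R]_n) i : 'rV[R]_(n + n) := row_mx x (c *: delta_mx 0 i).
have zr x i : `|x - x0| < rho -> `|z x i - row_mx x0 0| < rho2.
  move=> xr; rewrite opp_row_mx add_row_mx oppr0 addr0; apply: row_mx_norm_lt.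
    exact: lt_le_trans rr2.
  rewrite normrZ gtr0_norm //; apply: (@le_lt_trans _ _ c); last by rewrite /c; qlra.
  rewrite ger_pMr //; apply: mx_norm_le => // a b; rewrite mxE.
  by case: (_ && _); rewrite ?normr1 ?normr0.
pose Wi x i t := c^-1 *: rsubmx (Psi (z x i) t).
have Phi_l x i t : `|x - x0| < rho -> `|t| < d -> lsubmx (Psi (z x i) t) = Phi x t.
  move=> xr td; have xr1 := lt_le_trans xr rr1.
  have [t1 t2] : - d < t /\ t < d by move: td; rewrite ltr_norml => /andP.
  apply: (@trajectory_unique R n X U (fun t => lsubmx (Psi (z x i) t)) (Phi x) (- d) d 0 oU (sX 1%N)).
  - move=> s; rewrite -ltr_norml => sd.
    have [Us ds] := dQ _ _ (zr x i xr) (lt_le_trans sd dd2).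
    split=> //; have := cder_mulmx (col_mx 1%:M 0) ds.
    rewrite -lsubmxE row_mxKl.
    by under eq_fun do rewrite -lsubmxE.
  - move=> s; rewrite -ltr_norml => sd.
    by have [] := dP x s xr1 (lt_le_trans sd dd1).
  - by apply/andP; qlra.
  - by rewrite Q0 ?P0 ?row_mxKl //; apply: zr.
  - by apply/andP.
have dWi x i t : `|x - x0| < rho -> `|t| < d ->
    is_derive (t : R^o) 1 (Wi x i : R^o -> _)
      (\sum_j Wi x i t 0 j *: 'D_(delta_mx 0 j) X (Phi x t)).
  move=> xr td; have [Us ds] := dQ _ _ (zr x i xr) (lt_le_trans td dd2).
  have := cderZ c^-1 (cder_mulmx (col_mx 0 1%:M) ds).
  rewrite -rsubmxE row_mxKr Phi_l // scaler_sumr.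
  under eq_fun do rewrite -rsubmxE.
  have -> // : \sum_j c^-1 *: (rsubmx (Psi (z x i) t) 0 j *: 'D_(delta_mx 0 j) X (Phi x t)) =
    \sum_j Wi x i t 0 j *: 'D_(delta_mx 0 j) X (Phi x t).
  by apply: eq_bigr => j _; rewrite scalerA [in RHS]mxE.
pose B x t : 'M[R]_n := \matrix_(i, j) Wi x i t 0 j.
have BE x t v : v *m B x t = \sum_i v 0 i *: Wi x i t.
  rewrite mulmx_sum_row; apply: eq_bigr => i _; congr (_ *: _).
  by apply/rowP => j; rewrite !mxE.
(* The remainder vanishes at time 0 and solves the linearized equation up to an error 4 C |v|^2, the
   flow being 2-Lipschitz in space. On an interval of length at most 2 d, [absorb] turns this into 2
   (2 d) (4 C) |v|^2. *)
have main x t v : `|x - x0| < rho -> `|t| < d -> `|v| < rho - `|x - x0| ->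
    `|Phi (x + v) t - Phi x t - v *m B x t| <= 16 * d * C * `|v| ^+ 2.
  move=> xr td vr.
  have yr : `|x + v - x0| < rho.
    by rewrite addrAC; have := ler_normD (x - x0) v; qlra.
  have xr1 := lt_le_trans xr rr1; have yr1 := lt_le_trans yr rr1.
  have tt s : - `|t| <= s <= `|t| -> `|s| < d.
    by rewrite -ler_norml => st; apply: le_lt_trans td.
  have eps0 : 0 <= 4 * C * `|v| ^+ 2 by rewrite !mulr_ge0 // exprn_ge0.
  have := @absorb R n (fun s => Phi (x + v) s - Phi x s - v *m B x s)
     (fun s => X (Phi (x + v) s) - X (Phi x s) -
        \sum_i v 0 i *: (\sum_j Wi x i s 0 j *: 'D_(delta_mx 0 j) X (Phi x s)))
     (- `|t|) `|t| 0 t L (4 * C * `|v| ^+ 2).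
  have -> : Phi (x + v) 0 - Phi x 0 - v *m B x 0 = 0.
    rewrite !P0 // [x + v]addrC addrK BE; apply/eqP; rewrite subr_eq0 eq_sym.
    rewrite [v in X in _ == X]row_sum_delta; apply/eqP/eq_bigr => i _; congr (_ *: _).
    by rewrite /Wi Q0 ?row_mxKr ?scalerA ?mulVf ?scale1r ?gt_eqF //; apply: zr.
  rewrite normr0 mulr0 add0r => H.
  apply: (le_trans (H _ _ _ _ _ _ _)) => //.
  - move=> s /tt sd.
    have [_ _ dy] := dP _ _ yr1 (lt_le_trans sd dd1).
    have [_ _ dx] := dP _ _ xr1 (lt_le_trans sd dd1).
    have D2 : is_derive (s : R^o) 1 ((fun s => v *m B x s) : R^o -> _)
        (\sum_i v 0 i *: (\sum_j Wi x i s 0 j *: 'D_(delta_mx 0 j) X (Phi x s))).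
      under eq_fun do rewrite BE.
      by apply: cder_sum => i; apply: cderZ; apply: dWi.
    exact: (cderB (cderB dy dx) D2).
  - move=> s /tt sd.
    have [Uy ny _] := dP _ _ yr1 (lt_le_trans sd dd1).
    have [Ux nx _] := dP _ _ xr1 (lt_le_trans sd dd1).
    have [nyq ny1] : `|Phi (x + v) s - x0| <= rq /\ `|Phi (x + v) s - x0| <= r1.
      by move: ny; rewrite lt_min => /andP[/ltW ? /ltW ?].
    have [nxq nx1] : `|Phi x s - x0| <= rq /\ `|Phi x s - x0| <= r1.
      by move: nx; rewrite lt_min => /andP[/ltW ? /ltW ?].
    have dX : differentiable X (Phi x s) by have [dX _] := sX 1%N; apply: dX.
    have E : \sum_i v 0 i *: (\sum_j Wi x i s 0 j *: 'D_(delta_mx 0 j) X (Phi x s)) =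
        'd X (Phi x s) (v *m B x s).
      rewrite (diff_row _ dX).
      under eq_bigr do rewrite scaler_sumr.
      rewrite exchange_big; apply: eq_bigr => j _ /=.
      rewrite mxE scaler_suml; apply: eq_bigr => i _.
      by rewrite scalerA; congr (_ *: _); rewrite [in RHS]mxE.
    rewrite E.
    have E2 : X (Phi (x + v) s) - X (Phi x s) - 'd X (Phi x s) (v *m B x s) =
      'd X (Phi x s) (Phi (x + v) s - Phi x s - v *m B x s) +
      (X (Phi (x + v) s) - X (Phi x s) - 'd X (Phi x s) (Phi (x + v) s - Phi x s)).
      have -> : 'd X (Phi x s) (Phi (x + v) s - Phi x s - v *m B x s) =
        'd X (Phi x s) (Phi (x + v) s - Phi x s) - 'd X (Phi x s) (v *m B x s).
        exact: linearB.
      by apply/rowP => j; rewrite !mxE; ring.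
    rewrite E2; apply: le_trans (ler_normD _ _) _; apply: lerD; first exact: bL.
    apply: le_trans (HC _ _ nxq nyq) _.
    rewrite [4 * C]mulrC -mulrA ler_wpM2l //.
    have := lP _ _ _ yr1 xr1 (lt_le_trans sd dd1).
    rewrite (_ : x + v - x = v) => [h2|]; last by rewrite addrC addKr.
    have -> : 4 * `|v| ^+ 2 = (2 * `|v|) ^+ 2 by ring.
    by rewrite ler_sqr // nnegrE // mulr_ge0.
  - by rewrite opprK; have := ler_wpM2r L0 (ltW td); have := ler_wpM2r L0 dd3; qlra.
  - by rewrite oppr_le0 normr_ge0.
  - by rewrite -ler_norml.
  - rewrite opprK; have := ler_wpM2r eps0 (ltW td); qlra.
have diffP x t : `|x - x0| < rho -> `|t| < d ->
    differentiable (fun x => Phi x t) x /\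
    forall v, 'D_v (fun x => Phi x t) x = \sum_i v 0 i *: Wi x i t.
  move=> xr td.
  have [||dd HD] := @quadratic_differentiable n n (fun x => Phi x t) x (B x t)
     (16 * d * C) (rho - `|x - x0|) _ _ (fun v => main x t v xr td).
  - by rewrite subr_gt0.
  - by rewrite !mulr_ge0 // ltW.
  by split=> // v; rewrite HD BE.
exists Phi, rho, d; split => //.
- by move=> x xr; apply: P0; apply: lt_le_trans rr1.
- move=> x t xr td.
  by have [] := dP x t (lt_le_trans xr rr1) (lt_le_trans td dd1).
move=> t td; split; first by move=> x xr; have [] := diffP x t xr td.
move=> v.
have oB := open_dist x0 rho.
apply: (@Ck_on_ext _ _ _ k _ (fun x => \sum_i v 0 i *: Wi x i t)) => //.
  by move=> x xr; have [_ ->] := diffP x t xr td.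
apply: Ck_on_sum => // i.
have HW : Ck_on k [set x | `|x - x0| < rho] (fun x => rsubmx (Psi (z x i) t)).
  apply: Ck_on_rsubmx => //.
  apply: (Ck_on_comp oB (open_dist (row_mx x0 0) rho2) (f := fun x => z x i)
    (g := fun z => Psi z t)).
  - by move=> x; apply: zr.
  - by apply: Ck_on_row_mx => //; [exact: Ck_on_id|exact: Ck_on_cst].
  - by apply: CQ; apply: lt_le_trans dd2.
apply: (@Ck_on_ext _ _ _ k _ (fun x => rsubmx (Psi (z x i) t) *m (v 0 i * c^-1)%:M)) => //.
  by move=> x _; rewrite mul_mx_scalar /Wi scalerA.
exact: Ck_on_mulmx.
Qed.

End SmoothLocalFlow.

(** * The flow on an open domain *)

Section Reach.
Context {R : realType} (n : nat) (X : 'rV[R]_n -> 'rV[R]_n) (U : set 'rV[R]_n).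

(** For the set of ordered lifts this is convertible to [reaches]. The general domain serves the
    auxiliary fields in which time or an integral is adjoined to the state. *)
Definition reach_in (x : 'rV[R]_n) (t : R) (y : 'rV[R]_n) : Prop :=
  exists (phi : R -> 'rV[R]_n) (c d : R),
    [/\ c < 0 < d, c < t < d, trajectory X U phi c d, phi 0 = x & phi t = y].

Definition flow_in (t : R) (x : 'rV[R]_n) : 'rV[R]_n := xget 0 [set y | reach_in x t y].

Hypotheses (oU : open U) (sX : smooth_on U X).

Lemma trajectory_shift phi c d b : trajectory X U phi c d ->
  trajectory X U (fun t => phi (t + b)) (c - b) (d - b).
Proof.
move=> H s /andP[s1 s2]; have [|Us ds] := H (s + b).
  by rewrite -ltrBlDr s1 -ltrBrDr s2.
by split=> //; apply: cder_shift.
Qed.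

Lemma trajectory_sub phi c d c' d' : trajectory X U phi c d -> c <= c' -> d' <= d ->
  trajectory X U phi c' d'.
Proof.
move=> H cc dd s /andP[s1 s2]; apply: H.
by rewrite (le_lt_trans cc s1) (lt_le_trans s2 dd).
Qed.

Lemma trajectory_reach phi c d s t : trajectory X U phi c d -> c < s < d ->
  c < s + t < d -> reach_in (phi s) t (phi (s + t)).
Proof.
move=> H /andP[s1 s2] /andP[t1 t2].
exists (fun t => phi (t + s)), (c - s), (d - s); split.
- by apply/andP; qlra.
- by apply/andP; qlra.
- exact: trajectory_shift.
- by rewrite add0r.
- by rewrite addrC.
Qed.

Lemma reach_domain x t y : reach_in x t y -> U x /\ U y.
Proof.
by move=> [phi [c [d [c0 ct H <- <-]]]]; split; [have [] := H 0 c0|have [] := H t ct].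
Qed.

Lemma two_trajectories phi psi c d c' d' s :
  trajectory X U phi c d -> trajectory X U psi c' d' -> c < s < d -> c' < s < d' ->
  phi s = psi s -> forall t, c < t < d -> c' < t < d' -> phi t = psi t.
Proof.
move=> Hp Hq /andP[s1 s2] /andP[s3 s4] E t /andP[t1 t2] /andP[t3 t4].
apply: (@trajectory_unique R n X U phi psi (Num.max c c') (Num.min d d') s oU (sX 1%N)) => //.
- by apply: trajectory_sub Hp _ _; rewrite ?le_max ?ge_min lexx.
- by apply: trajectory_sub Hq _ _; rewrite ?le_max ?ge_min lexx orbT.
- by rewrite gt_max lt_min s1 s2 s3 s4.
- by rewrite gt_max lt_min t1 t2 t3 t4.
Qed.

Lemma reach_unique x t y z : reach_in x t y -> reach_in x t z -> y = z.
Proof.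
move=> [phi [c [d [c0 ct Hp p0 <-]]]] [psi [c' [d' [c0' ct' Hq q0 <-]]]].
apply: (two_trajectories Hp Hq c0 c0') => //; by rewrite p0.
Qed.

Lemma flow_inE x t y : reach_in x t y -> flow_in t x = y.
Proof.
move=> H; rewrite /flow_in; apply: (xget_unique _ H) => z Hz.
exact: reach_unique Hz H.
Qed.

Lemma reach_flow x t y : reach_in x t y -> reach_in x t (flow_in t x).
Proof. by move=> H; rewrite (flow_inE H). Qed.

Lemma local_reach k y0 : U y0 ->
  exists (Phi : 'rV[R]_n -> R -> 'rV[R]_n) (rho d : R), [/\ 0 < rho, 0 < d,
    forall y t, `|y - y0| < rho -> `|t| < d -> reach_in y t (Phi y t) &
    forall t, `|t| < d -> Ck_on k [set y | `|y - y0| < rho] (fun y => Phi y t)].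
Proof.
move=> Uy; have [Phi [rho [d [rho0 d0 P0 dP CP]]]] := smooth_local_flow k oU sX Uy.
exists Phi, rho, d; split => // y t yr; rewrite ltr_norml => td.
have := @trajectory_reach (Phi y) (- d) d 0 t.
rewrite P0 // add0r; apply => //; last by apply/andP; qlra.
by move=> s; rewrite -ltr_norml => sd; apply: dP.
Qed.

Lemma reach0 x : U x -> reach_in x 0 x.
Proof.
move=> Ux; have [Phi [rho [d [rho0 d0 P0 dP _]]]] := smooth_local_flow 0 oU sX Ux.
have xx : `|x - x| < rho by rewrite subrr normr0.
exists (Phi x), (- d), d; split; rewrite ?P0 //; try by apply/andP; qlra.
by move=> s; rewrite -ltr_norml => sd; apply: dP.
Qed.

(** Two solutions that meet at time s coincide on the overlap of their intervals. The glued curve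
    therefore equals each of them on the whole of its own interval, which makes it differentiable
    across the seam. *)
Lemma reach_trans x s y t z : reach_in x s y -> reach_in y t z -> reach_in x (s + t) z.
Proof.
move=> [phi [c [d [/andP[c0 d0] /andP[cs sd] Hp p0 ps]]]].
move=> [psi [c' [d' [/andP[c0' d0'] /andP[ct' td'] Hq q0 qt]]]].
pose psi' t := psi (t - s).
have Hq' : trajectory X U psi' (c' + s) (d' + s).
  by have := trajectory_shift (b := - s) Hq; rewrite !opprK.
pose chi u := if (c < u < d) then phi u else psi' u.
have ov u : c < u < d -> c' + s < u < d' + s -> phi u = psi' u.
  have h1 : c < s < d by rewrite cs.
  have h2 : c' + s < s < d' + s by apply/andP; qlra.
  have h3 : phi s = psi' s by rewrite /psi' subrr q0 ps.
  exact: (two_trajectories Hp Hq' h1 h2 h3).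
have chi1 u : c < u < d -> chi u = phi u by rewrite /chi => ->.
have chi2 u : c' + s < u < d' + s -> chi u = psi' u.
  by move=> u1; rewrite /chi; case: ifP => // u2; apply: ov.
exists chi, (Num.min c (c' + s)), (Num.max d (d' + s)); split.
- by rewrite gt_min lt_max c0 d0.
- rewrite gt_min lt_max; apply/andP; split; apply/orP; right; qlra.
- move=> u; rewrite gt_min lt_max => /andP[u1 u2].
  have cases : (c < u < d) \/ (c' + s < u < d' + s).
    case/orP: u1 => u1; case/orP: u2 => u2.
    + by left; apply/andP.
    + have [ud|du] := ltP u d; first by left; apply/andP.
      by right; apply/andP; qlra.
    + have [cu|uc] := ltP c u; first by left; apply/andP.
      by right; apply/andP; qlra.
    + by right; apply/andP.
  case: cases => uu.
    have [Uu du] := Hp u uu; rewrite chi1 //; split=> //.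
    case/andP: uu => u3 u4.
    apply: (@cder_near _ _ phi _ u _ (Num.min (u - c) (d - u))) => //.
      by rewrite lt_min !subr_gt0 u3.
    move=> w; rewrite lt_min !ltr_norml => /andP[/andP[? ?] /andP[? ?]].
    by rewrite chi1 //; apply/andP; qlra.
  have [Uu du] := Hq' u uu; rewrite chi2 //; split=> //.
  case/andP: uu => u3 u4.
  apply: (@cder_near _ _ psi' _ u _ (Num.min (u - (c' + s)) (d' + s - u))) => //.
    by rewrite lt_min !subr_gt0 u3.
  move=> w; rewrite lt_min !ltr_norml => /andP[/andP[? ?] /andP[? ?]].
  by rewrite chi2 //; apply/andP; qlra.
- by rewrite chi1 // c0.
- by rewrite chi2 ?/psi' 1?addrC ?addKr //; apply/andP; qlra.
Qed.

Lemma reach_opp x t y : reach_in x t y -> reach_in y (- t) x.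
Proof.
move=> [phi [c [d [c0 ct Hp p0 pt]]]].
have := @trajectory_reach phi c d t (- t) Hp ct.
by rewrite subrr p0 pt; apply.
Qed.

(** Smoothness is transported along the solution through x0: around each of its points the local
    flow exists for a common short time, and composing with it carries the property P from one time
    to nearby ones. *)
Lemma flow_local k x0 t y0 : reach_in x0 t y0 ->
  exists2 rho : R, 0 < rho &
    (forall x, `|x - x0| < rho -> reach_in x t (flow_in t x)) /\
    Ck_on k [set x | `|x - x0| < rho] (flow_in t).
Proof.
move=> [phi [c [d [/andP[c0 d0] /andP[ct td] Hp p0 pt]]]].
pose P s := exists2 rho : R, 0 < rho &
    (forall x, `|x - x0| < rho -> reach_in x s (flow_in s x)) /\
    Ck_on k [set x | `|x - x0| < rho] (flow_in s).
pose a := Num.min 0 t; pose b := Num.max 0 t.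
have cab u : a <= u <= b -> c < u < d.
  by move=> /andP[u1 u2]; rewrite (lt_le_trans _ u1) ?(le_lt_trans u2) // ?gt_max ?lt_min ?c0 ?d0.
apply: (@seg_locally_const R a b P _ 0 t).
- move=> u /cab ucd; have [Uu du] := Hp u ucd.
  have [Phi [r1 [d1 [r10 d10 rP CP]]]] := local_reach k Uu.
  have [e1 e10 He1] := (cont_eps phi u).1 (cder_cont du) r1 r10.
  exists (Num.min e1 (d1 / 2)); first by rewrite lt_min e10 divr_gt0.
  move=> s1 s2 /cab s1cd _; rewrite !lt_min => /andP[us1 us1'] /andP[us2 us2'] [rho rho0 [Hr Hc]].
  have rs1 : reach_in x0 s1 (phi s1).
    have := @trajectory_reach phi c d 0 s1 Hp; rewrite add0r p0 c0; exact.
  have cf : {for x0, continuous (flow_in s1)}.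
    by apply: (Ck_on_cont Hc); rewrite /= subrr normr0.
  have r1' : 0 < r1 - `|phi s1 - phi u|.
    by rewrite subr_gt0; apply: He1; rewrite distrC.
  have [e2 e20 He2] := (cont_eps _ _).1 cf _ r1'.
  have ss : `|s2 - s1| < d1.
    by have := ler_normD (s2 - u) (u - s1); rewrite subrKA (distrC s2 u); qlra.
  have mem x : `|x - x0| < e2 -> `|flow_in s1 x - phi u| < r1.
    move=> /He2; rewrite (flow_inE rs1) => h.
    by have := ler_normD (flow_in s1 x - phi s1) (phi s1 - phi u); rewrite subrKA; qlra.
  pose rho' := Num.min rho e2.
  have step x : `|x - x0| < rho' -> reach_in x s2 (Phi (flow_in s1 x) (s2 - s1)).
    rewrite lt_min => /andP[xr xe].
    rewrite -[s2 in reach_in _ s2](subrK s1) addrC.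
    by apply: reach_trans (Hr _ xr) _; apply: rP => //; apply: mem.
  exists rho'; first by rewrite lt_min rho0.
  split; first by move=> x /step; apply: reach_flow.
  have oB := @open_dist R n x0 rho'.
  apply: (@Ck_on_ext _ _ _ k _ (fun x => Phi (flow_in s1 x) (s2 - s1))) => //.
    by move=> x /step /flow_inE ->.
  apply: (Ck_on_comp oB (@open_dist R n (phi u) r1) (f := flow_in s1) (g := fun y => Phi y (s2 - s1))).
  + by move=> x; rewrite /= lt_min => /andP[_]; apply: mem.
  + by apply: Ck_on_sub Hc => x; rewrite /= lt_min => /andP[].
  + exact: CP.
- by rewrite /a /b ge_min lexx le_max lexx.
- by rewrite /a /b ge_min lexx orbT le_max lexx orbT.
have Ux0 : U x0 by rewrite -p0; have [] := Hp 0; rewrite ?c0.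
have /nbhs_ballP[r /= r0 Hr] := open_nbhs_nbhs (conj oU Ux0).
have HrU x : `|x - x0| < r -> U x by move=> xr; apply: Hr; rewrite -ball_normE /= distrC.
exists r => //; split.
  by move=> x /HrU /reach0; apply: reach_flow.
apply: (@Ck_on_ext _ _ _ k _ (fun x => x)); first exact: open_dist.
  by move=> x /HrU /reach0 /flow_inE ->.
exact: Ck_on_id.
Qed.

End Reach.

Section MatrixEntries.
Context {R : realType}.

Lemma sub_mxE m n (A B : 'M[R]_(m, n)) i j : (A - B) i j = A i j - B i j.
Proof. by rewrite mxE [X in _ + X]mxE. Qed.

Lemma scalar_mx00 (t : R) : (t%:M : 'M[R]_1) 0 0 = t.
Proof. by rewrite mxE eqxx mulr1n. Qed.

End MatrixEntries.

Section Joint.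
Context {R : realType} (n : nat) (X : 'rV[R]_n -> 'rV[R]_n) (U : set 'rV[R]_n).
Hypotheses (oU : open U) (sX : smooth_on U X).

(* Running this field for time 1 from (t, x) amounts to running X for time t from x. *)
Definition suspension (z : 'rV[R]_(1 + n)) : 'rV[R]_(1 + n) :=
  row_mx 0 (lsubmx z 0 0 *: X (rsubmx z)).

Lemma open_rsubmx : open [set z : 'rV[R]_(1 + n) | U (rsubmx z)].
Proof. by apply: open_comp => // z _; apply: continuous_rsubmx. Qed.

Lemma smooth_suspension : smooth_on [set z : 'rV[R]_(1 + n) | U (rsubmx z)] suspension.
Proof.
move=> k; have oU' := open_rsubmx.
apply: Ck_on_row_mx => //; first exact: Ck_on_cst.
have Hr : Ck_on k [set z : 'rV[R]_(1 + n) | U (rsubmx z)] (@rsubmx R 1 1 n).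
  by apply: Ck_on_rsubmx => //; apply: Ck_on_id.
have Hl : Ck_on k [set z : 'rV[R]_(1 + n) | U (rsubmx z)] (@lsubmx R 1 1 n).
  by apply: Ck_on_lsubmx => //; apply: Ck_on_id.
apply/(Ck_on_coord _ _ oU') => j.
apply: (@Ck_on_ext _ _ _ k _ (fun z => lsubmx z 0 0 * X (rsubmx z) 0 j : R^o)) => //.
  by move=> z _; rewrite [in RHS]mxE.
apply: Ck_on_mul => //; first by move/(Ck_on_coord _ _ oU') : Hl; apply.
by have /(Ck_on_coord _ _ oU') := Ck_on_comp oU' oU (fun z h => h) Hr (sX k); apply.
Qed.

Lemma suspension_reach x t y : reach_in X U x t y ->
  reach_in suspension [set z : 'rV[R]_(1 + n) | U (rsubmx z)]
    (row_mx t%:M x) 1 (row_mx t%:M y).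
Proof.
move=> [phi [c [d [/andP[c0 d0] /andP[ct td] Hp p0 pt]]]].
pose m := Num.min (Num.min (- c) d) (Num.min (t - c) (d - t)).
have m0 : 0 < m by rewrite !lt_min oppr_gt0 c0 d0 !subr_gt0 ct td.
(* The curve has to be defined for s slightly outside [0, 1]; [eta] is so small that t s then stays
   within the interval of existence, on which 0 and t have the margin [m]. *)
have [eta eta0 Heta] := exists_small (normr_ge0 t) (divr_gt0 m0 (ltr0n _ 2)).
have : m <= - c /\ m <= d by rewrite !ge_min !lexx !orbT.
move=> [m1 m2].
have : m <= t - c /\ m <= d - t by rewrite !ge_min !lexx !orbT.
move=> [m3 m4].
have key s : - eta < s < 1 + eta -> c < t * s < d.
  move=> /andP[s1 s2].
  have h : `|eta * t| <= m / 2 by rewrite normrM (gtr0_norm eta0).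
  move: h; rewrite ler_norml => /andP[h1 h2].
  have h2' : m / 2 < m by qlra.
  have [t0|t0] := leP 0 t.
    have := ler_wpM2l t0 (ltW s1); have := ler_wpM2l t0 (ltW s2).
    by rewrite mulrDr mulr1 mulrN mulrC [t * eta]mulrC => ? ?; apply/andP; qlra.
  have := ler_wnM2l (ltW t0) (ltW s1); have := ler_wnM2l (ltW t0) (ltW s2).
  by rewrite mulrDr mulr1 mulrN [t * eta]mulrC => ? ?; apply/andP; qlra.
exists (fun s => row_mx t%:M (phi (t * s))), (- eta), (1 + eta); split.
- by apply/andP; qlra.
- by apply/andP; qlra.
- move=> s /key tscd; have [Us ds] := Hp _ tscd.
  rewrite /= /suspension row_mxKr row_mxKl mxE eqxx mulr1n; split=> //.
  have D1 : is_derive (s : R^o) 1 ((fun s => phi (t * s)) : R^o -> _) (t *: X (phi (t * s))).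
    have := @cder_affine R _ phi t 0 s; rewrite addr0 => /(_ _ ds).
    by under eq_fun do rewrite addr0.
  have D2 := cderD (cder_mulmx (row_mx 1%:M 0 : 'M[R]_(1, 1 + n)) (@cder_cst R _ (t%:M : 'rV[R]_1) s))
     (cder_mulmx (row_mx 0 1%:M : 'M[R]_(n, 1 + n)) D1).
  have E s' : t%:M *m row_mx 1%:M 0 + phi (t * s') *m row_mx 0 1%:M = row_mx t%:M (phi (t * s')).
    by rewrite [RHS]row_mxE.
  move: D2; under eq_fun do rewrite E.
  by rewrite -row_mxE.
- by rewrite mulr0 p0.
- by rewrite mulr1 pt.
Qed.

(** Regularity in the pair (t, x) is regularity in space of the time 1 map of [suspension], to which
    [flow_local] applies. *)
Lemma flow_joint k x0 t0 y0 : reach_in X U x0 t0 y0 ->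
  exists2 rho : R, 0 < rho &
    (forall t x, `|t - t0| < rho -> `|x - x0| < rho -> reach_in X U x t (flow_in X U t x)) /\
    Ck_on k [set z : 'rV[R]_(1 + n) | `|z - row_mx t0%:M x0| < rho]
      (fun z => flow_in X U (lsubmx z 0 0) (rsubmx z)).
Proof.
move=> H; have [_ Uy0] := reach_domain H.
have [Phi [r1 [d1 [r10 d10 rP _]]]] := local_reach oU sX 0 Uy0.
have [r2 r20 [Hr2 C2]] := flow_local oU sX 0 H.
have c2 : {for x0, continuous (flow_in X U t0)}.
  by apply: (Ck_on_cont C2); rewrite /= subrr normr0.
have [e e0 He] := (cont_eps _ _).1 c2 _ r10.
have [r3 r30 [Hr3 C3]] := flow_local open_rsubmx smooth_suspension k (suspension_reach H).
pose rho := Num.min (Num.min d1 r2) (Num.min e r3).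
have rho0 : 0 < rho by rewrite !lt_min d10 r20 e0 r30.
have ex t x : `|t - t0| < rho -> `|x - x0| < rho -> reach_in X U x t (flow_in X U t x).
  rewrite !lt_min => /andP[/andP[td _] _] /andP[/andP[_ xr] /andP[xe _]].
  have := He x xe; rewrite (flow_inE oU sX H) => h.
  have := reach_trans oU sX (Hr2 _ xr) (rP _ _ h td).
  by rewrite addrC subrK; apply: reach_flow.
exists rho => //; split=> //.
have oB := @open_dist R (1 + n) (row_mx t0%:M x0) rho.
apply: (@Ck_on_ext _ _ _ k _ (fun z => rsubmx (flow_in suspension [set z | U (rsubmx z)] 1 z))) => //.
  move=> z zr.
  have zl : `|lsubmx z 0 0 - t0| < rho.
    apply: le_lt_trans zr.
    have := le_trans (mx_entry_le (lsubmx (z - row_mx t0%:M x0)) 0 0) (lsubmx_norm _).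
    by rewrite linearB /= row_mxKl sub_mxE scalar_mx00.
  have zr' : `|rsubmx z - x0| < rho.
    apply: le_lt_trans zr.
    have := rsubmx_norm (z - row_mx t0%:M x0).
    by rewrite linearB /= row_mxKr.
  have := suspension_reach (ex _ _ zl zr').
  have -> : row_mx (lsubmx z 0 0)%:M (rsubmx z) = z.
    rewrite -[RHS]hsubmxK; congr row_mx; apply/rowP => i; by rewrite !ord1 mxE eqxx mulr1n.
  by move/(flow_inE open_rsubmx smooth_suspension) => ->; rewrite row_mxKr.
apply: Ck_on_rsubmx => //.
apply: Ck_on_sub C3 => z; rewrite /= => /lt_le_trans; apply.
by rewrite !ge_min lexx !orbT.
Qed.

End Joint.

(** * Determinants and inverses of matrices depending on a point *)

Section CkMatrices.
Context {R : realType} {V : normedModType R}.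
Variables (k : nat) (U : set V).
Hypothesis oU : open U.

Lemma Ck_on_bigsum (I : Type) (s : seq I) (f : I -> V -> R^o) :
  (forall i, Ck_on k U (f i)) -> Ck_on k U (fun x => \sum_(i <- s) f i x : R^o).
Proof.
move=> H; elim: s => [|i s IH].
  by apply: (Ck_on_ext oU _ (Ck_on_cst k U (0 : R^o))) => x _; rewrite big_nil.
by apply: (Ck_on_ext oU _ (Ck_on_add oU (H i) IH)) => x _; rewrite big_cons.
Qed.

Lemma Ck_on_bigprod (I : Type) (s : seq I) (f : I -> V -> R^o) :
  (forall i, Ck_on k U (f i)) -> Ck_on k U (fun x => \prod_(i <- s) (f i x : R) : R^o).
Proof.
move=> H; elim: s => [|i s IH].
  by apply: (Ck_on_ext oU _ (Ck_on_cst k U (1 : R^o))) => x _; rewrite big_nil.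
by apply: (Ck_on_ext oU _ (Ck_on_mul oU (H i) IH)) => x _; rewrite big_cons.
Qed.

Lemma Ck_on_det n (M : V -> 'M[R]_n) :
  (forall i j, Ck_on k U (fun x => M x i j : R^o)) ->
  Ck_on k U (fun x => \det (M x) : R^o).
Proof.
move=> H; rewrite /determinant.
apply: Ck_on_bigsum => s; apply: Ck_on_mul => //; first exact: Ck_on_cst.
exact: Ck_on_bigprod.
Qed.

Lemma Ck_on_invmx n (M : V -> 'M[R]_n) :
  (forall i j, Ck_on k U (fun x => M x i j : R^o)) ->
  (forall x, U x -> M x \in unitmx) ->
  forall i j, Ck_on k U (fun x => invmx (M x) i j : R^o).
Proof.
move=> H Hu i j.
apply: (@Ck_on_ext _ _ _ k U (fun x => (\det (M x))^-1 * cofactor (M x) j i : R^o)) => //.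
  by move=> x Ux; rewrite /invmx Hu // !mxE.
apply: Ck_on_mul => //.
  apply: Ck_on_inv => //; last exact: Ck_on_det.
  by move=> x Ux; rewrite -unitfE -unitmxE Hu.
rewrite /cofactor; apply: Ck_on_mul => //; first exact: Ck_on_cst.
apply: Ck_on_det => i' j'.
by apply: (@Ck_on_ext _ _ _ k U (fun x => M x (lift j i') (lift i j'))) => // x _; rewrite !mxE.
Qed.

End CkMatrices.

(** * Inverse function theorem *)

Section InverseFunction.
Context {R : realType}.

(** Row convention: the differential sends v to v *m [jac F x], so the Jacobian of a composition is
    the product in the order in which the maps are applied. *)
Definition jac n m (F : 'rV[R]_n -> 'rV[R]_m) (x : 'rV[R]_n) : 'M[R]_(n, m) :=
  \matrix_(i, j) ('D_(delta_mx 0 i) F x) 0 j.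

Lemma jacP n m (F : 'rV[R]_n -> 'rV[R]_m) x v : differentiable F x ->
  'D_v F x = v *m jac F x.
Proof.
move=> dF; have -> := etrans (deriveE v dF) (diff_row v dF).
rewrite mulmx_sum_row; apply: eq_bigr => i _; congr (_ *: _).
by apply/rowP => j; rewrite !mxE.
Qed.

Lemma jac_eps n m (F : 'rV[R]_n -> 'rV[R]_m) x : differentiable F x ->
  forall e : R, 0 < e -> exists2 d : R, 0 < d &
    forall v, `|v| < d -> `|F (x + v) - F x - v *m jac F x| <= e * `|v|.
Proof.
move=> dF e e0; have [d d0 Hd] := differentiable_eps dF e0.
exists d => // v vd; rewrite -jacP // deriveE //; exact: Hd.
Qed.

Lemma eps_jac n m (F : 'rV[R]_n -> 'rV[R]_m) x (M : 'M[R]_(n, m)) :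
  (forall e : R, 0 < e -> exists2 d : R, 0 < d &
    forall v, `|v| < d -> `|F (x + v) - F x - v *m M| <= e * `|v|) ->
  differentiable F x /\ forall v, 'D_v F x = v *m M.
Proof.
move=> H; have cM : continuous (mulmxr M : 'rV[R]_n -> 'rV[R]_m) by exact: row_linear_cont.
have [dF EF] := eps_differentiable (f := F) (x := x) cM H.
by split=> // v; rewrite deriveE // EF.
Qed.

Lemma mulmxr_bound n m (B : 'M[R]_(n, m)) : exists2 c : R, 0 < c &
  forall v : 'rV[R]_n, `|v *m B| <= c * `|v|.
Proof.
exists (n%:R * `|B| + 1); first by rewrite ltr_pwDr // mulr_ge0.
move=> v; apply: le_trans (mulmx_norm _ _) _; rewrite mulrAC ler_wpM2r //.
by rewrite lerDl.
Qed.

Lemma derive_mulmx n m p (F : 'rV[R]_n -> 'rV[R]_m) (B : 'M[R]_(m, p)) x :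
  differentiable F x -> differentiable (fun x => F x *m B) x /\
    forall v, 'D_v (fun x => F x *m B) x = 'D_v F x *m B.
Proof.
move=> dF; have [c c0 cb] := mulmxr_bound B.
have [|d1 d2] := @eps_jac n p (fun x => F x *m B) x (jac F x *m B).
  move=> e e0; have [d d0 Hd] := jac_eps dF (divr_gt0 e0 c0).
  exists d => // v vd; rewrite mulmxA -!mulmxBl; apply: le_trans (cb _) _.
  by rewrite mulrC -ler_pdivlMr // mulrAC; apply: Hd.
by split=> // v; rewrite d2 mulmxA -jacP.
Qed.

Lemma segment_mvtD n m (f : 'rV[R]_n -> 'rV[R]_m) (x0 x y : 'rV[R]_n) (r M : R) :
  0 <= M -> (forall z, `|z - x0| <= r -> differentiable f z) ->
  (forall z v, `|z - x0| <= r -> `|'D_v f z| <= M * `|v|) ->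
  `|x - x0| <= r -> `|y - x0| <= r -> `|f y - f x| <= M * `|y - x|.
Proof.
move=> M0 df Hf xr yr; apply: segment_mvt; first exact: mulr_ge0.
move=> s s01; have zr := segment_in_ball xr yr s01.
by split; [exact: df|rewrite -(deriveE _ (df _ zr)); apply: Hf].
Qed.

Lemma unit_of_injective n (J : 'M[R]_n) : (forall v : 'rV[R]_n, v *m J = 0 -> v = 0) ->
  J \in unitmx.
Proof.
move=> H; rewrite -row_free_unit -kermx_eq0; apply/eqP/row_matrixP => i.
rewrite row0; apply: H; apply/eqP.
by have := mulmx_ker J => /(congr1 (row i)); rewrite row_mul row0 => ->.
Qed.

Lemma jac_close n m (F : 'rV[R]_n -> 'rV[R]_m) U x0 : open U -> Ck_on 1 U F -> U x0 ->
  forall e : R, 0 < e -> exists2 r : R, 0 < r & forall x v, `|x - x0| <= r ->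
    [/\ U x & `|'D_v F x - 'D_v F x0| <= e * `|v|].
Proof.
move=> oU [dF DF] Ux0 e e0.
have /nbhs_ballP[r0 /= r00 Hr0] := open_nbhs_nbhs (conj oU Ux0).
have c0 : 0 < n%:R + 1 :> R by rewrite ltr_pwDr.
have [d d0 Hd] : exists2 d, 0 < d & forall i : 'I_n, forall x, `|x - x0| < d ->
    `|'D_(delta_mx 0 i) F x - 'D_(delta_mx 0 i) F x0| <= e / (n%:R + 1).
  apply: finite_eps.
    by move=> i e1 e2 _ ee' H x /lt_le_trans xe; apply: H; apply: xe.
  move=> i; have /cont_eps H := DF (delta_mx 0 i) x0 Ux0.
  have [d d0 Hd] := H _ (divr_gt0 e0 c0).
  by exists d => // x /Hd /ltW.
pose r := Num.min r0 d / 2.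
have m0 : 0 < Num.min r0 d by rewrite lt_min r00.
have rr0 : r < r0 by have : Num.min r0 d <= r0 by [rewrite ge_min lexx]; rewrite /r; qlra.
have rd : r < d.
  by have : Num.min r0 d <= d by [rewrite ge_min lexx orbT]; rewrite /r; qlra.
exists r; first by rewrite /r divr_gt0.
move=> x v xr.
have Ux : U x by apply: Hr0; rewrite -ball_normE /= distrC; apply: le_lt_trans rr0.
split=> //.
have -> := etrans (deriveE v (dF _ Ux)) (diff_row v (dF _ Ux)).
have -> := etrans (deriveE v (dF _ Ux0)) (diff_row v (dF _ Ux0)).
rewrite -sumrB; apply: le_trans (ler_norm_sum _ _ _) _.
apply: (@le_trans _ _ (\sum_(i < n) `|v| * (e / (n%:R + 1)))).
  apply: ler_sum => i _; rewrite -scalerBr normrZ; apply: ler_pM => //.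
    exact: mx_entry_le.
  by apply: Hd; apply: le_lt_trans rd.
rewrite sumr_const card_ord -[X in X <= _]mulr_natl mulrCA mulrC ler_wpM2r //.
rewrite mulrCA ler_piMr ?ltW // ltr_pdivrMr // mul1r; qlra.
Qed.

(** Newton iteration with the derivative frozen at x0: [h] contracts by 1/2 on a ball, and F x = y
    is the fixed point equation x = h x + y J^-1. *)
Theorem inverse_function n k (F : 'rV[R]_n -> 'rV[R]_n) U x0 : open U ->
  Ck_on k.+1 U F -> U x0 -> (forall v, 'D_v F x0 = 0 -> v = 0) ->
  exists (G : 'rV[R]_n -> 'rV[R]_n) (rho eps : R), [/\ 0 < rho, 0 < eps,
    forall x, `|x - x0| < rho -> U x,
    forall x x', `|x - x0| < rho -> `|x' - x0| < rho -> F x = F x' -> x = x' &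
    (forall y, `|y - F x0| < eps -> `|G y - x0| < rho /\ F (G y) = y) /\
    Ck_on k.+1 [set y | `|y - F x0| < eps] G].
Proof.
move=> oU HF Ux0 inj0; have [dF DF] := HF.
have HF1 : Ck_on 1 U F by apply: Ck_on_le HF.
pose J := jac F x0.
have Ju : J \in unitmx.
  by apply: unit_of_injective => v; rewrite /J -jacP; [exact: inj0|exact: dF].
have [c c0 cb] := mulmxr_bound (invmx J).
have e0 : 0 < 1 / (2 * c) by rewrite divr_gt0 // mulr_gt0.
have [rho rho0 Hrho] := jac_close oU HF1 Ux0 e0.
have inU x : `|x - x0| <= rho -> U x by move=> xr; have [] := Hrho x 0 xr.
pose h x := x - F x *m invmx J.
have dh x : `|x - x0| <= rho -> differentiable h x /\
    forall v, 'D_v h x = v - 'D_v F x *m invmx J.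
  move=> xr; have dFx := dF _ (inU x xr).
  have [d1 d2] := derive_mulmx (invmx J) dFx.
  split; first exact: differentiableB.
  move=> v; rewrite /h (deriveB (f := fun x => x) (g := fun x => F x *m invmx J));
    [|exact: derivable_id|exact: diff_derivable].
  by rewrite (derive_id x v) d2.
have Dh z v : `|z - x0| <= rho -> `|'D_v h z| <= 1 / 2 * `|v|.
  move=> zr; have [_ ->] := dh z zr.
  have [_ H] := Hrho z v zr.
  have -> : v - 'D_v F z *m invmx J = - (('D_v F z - 'D_v F x0) *m invmx J).
    have -> : 'D_v F x0 = v *m J by rewrite /J -jacP //; exact: dF.
    by rewrite mulmxBl mulmxK // opprB.
  rewrite normrN; apply: le_trans (cb _) _.
  have := ler_wpM2l (ltW c0) H; congr (_ <= _).
  by field; apply/eqP; qlra.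
have half x y : `|x - x0| <= rho -> `|y - x0| <= rho -> `|h y - h x| <= 1 / 2 * `|y - x|.
  have q2 : 0 <= 1 / 2 :> R by qlra.
  exact: (segment_mvtD q2 (fun z zr => (dh z zr).1) Dh).
have Fh x : F x = (x - h x) *m J by rewrite /h opprB addrC subrK mulmxKV.
have inj x x' : `|x - x0| <= rho -> `|x' - x0| <= rho -> F x = F x' -> x = x'.
  move=> xr xr' E; have := half _ _ xr' xr.
  have -> : h x - h x' = x - x' by rewrite /h E opprB addrA subrK.
  by move=> H; apply/eqP; rewrite -subr_eq0 -normr_le0; have := normr_ge0 (x - x'); qlra.
(* The first step then has length at most rho / 4, and the geometric series keeps all iterates
   within rho / 2 of x0. *)
pose eps := rho / (4 * c).
have eps0 : 0 < eps by rewrite divr_gt0 // mulr_gt0.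
have ceps : c * eps = rho / 4 by rewrite /eps; field; apply/eqP; qlra.
have half01 : 0 <= (1 / 2 : R) < 1 by apply/andP; qlra.
have exG y : exists x, `|y - F x0| < eps -> `|x - x0| <= rho / 2 /\ F x = y.
  have [yr|nyr] := pselect (`|y - F x0| < eps); last by exists 0.
  pose it q := iter q (fun x => h x + y *m invmx J) x0.
  have itS q : it q.+1 = h (it q) + y *m invmx J by [].
  have h1 : `|it 1%N - it 0%N| <= rho / 4.
    have -> : it 1%N - it 0%N = (y - F x0) *m invmx J.
      by rewrite itS /it /= /h mulmxBl; apply/rowP => j; rewrite !mxE; ring.
    apply: le_trans (cb _) _; rewrite -ceps ler_wpM2l ?ltW //.
  have main q : `|it q - x0| <= rho / 2 * (1 - (1 / 2) ^+ q) /\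
      `|it q.+1 - it q| <= rho / 4 * (1 / 2) ^+ q.
    elim: q => [|q [IH1 IH2]].
      by rewrite /it /= subrr normr0 expr0 subrr mulr0 mulr1; split.
    have p0 : 0 <= (1 / 2 : R) ^+ q by rewrite exprn_ge0 //; qlra.
    have rp : 0 <= rho * (1 / 2) ^+ q by rewrite mulr_ge0 // ltW.
    have A1 : `|it q.+1 - x0| <= rho / 2 * (1 - (1 / 2) ^+ q.+1).
      have := ler_normD (it q.+1 - it q) (it q - x0); rewrite subrKA exprS; qlra.
    split=> //.
    have B1 : `|it q - x0| <= rho by qlra.
    have B2 : `|it q.+1 - x0| <= rho by move: A1; rewrite exprS; qlra.
    have := half _ _ B1 B2; rewrite [it q.+2]itS.
    have -> : h (it q.+1) + y *m invmx J - it q.+1 = h (it q.+1) - h (it q).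
      by rewrite {2}itS opprD addrACA subrr addr0.
    by rewrite exprS; qlra.
  have [l Hl] : exists l, forall q, `|it q - l| <= rho / 2 * (1 / 2) ^+ q.
    apply: telescoping_limit.
      by move=> q; rewrite mulr_ge0 ?exprn_ge0 //; qlra.
    by move=> q; have [_] := main q; rewrite exprS; qlra.
  have lr : `|l - x0| <= rho / 2.
    by have := Hl 0%N; rewrite expr0 mulr1 distrC.
  exists l => _; split=> //.
  have lr1 : `|l - x0| <= rho by qlra.
  have E : l = h l + y *m invmx J.
    apply/eqP; rewrite -subr_eq0 -normr_le0.
    apply: (@le_of_geometric _ _ _ (rho / 2) (1 / 2)) => // q; rewrite add0r.
    have p0 : 0 <= (1 / 2 : R) ^+ q by rewrite exprn_ge0 //; qlra.
    have rp : 0 <= rho * (1 / 2) ^+ q by rewrite mulr_ge0 // ltW.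
    have B1 : `|it q - x0| <= rho by have [] := main q; qlra.
    have C1 := half _ _ lr1 B1.
    have C2 := Hl q; have C3 := Hl q.+1; rewrite exprS in C3.
    have -> : l - (h l + y *m invmx J) = (h (it q) - h l) - (it q.+1 - l).
      by rewrite itS; apply/rowP => j; rewrite !mxE; ring.
    have := ler_normB (h (it q) - h l) (it q.+1 - l); qlra.
  by rewrite Fh [X in X - _]E addrC addKr mulmxKV.
have [G HG] := choice exG.
have GF y : `|y - F x0| < eps -> F (G y) = y by move=> /HG [].
have Gr y : `|y - F x0| < eps -> `|G y - x0| < rho by move=> /HG []; qlra.
pose B := [set y | `|y - F x0| < eps].
have oB : open B by exact: open_dist.
have GL y y' : B y -> B y' -> `|G y - G y'| <= 2 * c * `|y - y'|.
  move=> yB yB'.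
  have := half _ _ (ltW (Gr _ yB')) (ltW (Gr _ yB)).
  have E : G y - G y' = (h (G y) - h (G y')) + (y - y') *m invmx J.
    rewrite -{3}(GF _ yB) -{3}(GF _ yB') /h mulmxBl.
    by apply/rowP => j; rewrite !mxE; ring.
  have := ler_normD (h (G y) - h (G y')) ((y - y') *m invmx J); rewrite -E.
  have := cb (y - y'); qlra.
have injD x : `|x - x0| <= rho -> jac F x \in unitmx.
  move=> xr; apply: unit_of_injective => v Ev.
  have dFx := dF _ (inU x xr).
  have := Dh x v xr; have [_ ->] := dh x xr.
  rewrite (jacP v dFx) Ev mul0mx subr0 => H.
  by apply/eqP; rewrite -normr_le0; have := normr_ge0 v; qlra.
have dG y : B y -> differentiable G y /\ forall v, 'D_v G y = v *m invmx (jac F (G y)).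
  move=> yB; apply: eps_jac => e e1.
  have xr := ltW (Gr _ yB); have dFx := dF _ (inU _ xr).
  have [c' c'0 cb'] := mulmxr_bound (invmx (jac F (G y))).
  have cc : 0 < 2 * c * c' by rewrite !mulr_gt0.
  have [d d0 Hd] := jac_eps dFx (divr_gt0 e1 cc).
  exists (Num.min (eps - `|y - F x0|) (d / (2 * c))).
    by rewrite lt_min subr_gt0 yB divr_gt0 // mulr_gt0.
  move=> w; rewrite lt_min => /andP[w1 w2].
  have ywB : B (y + w).
    by rewrite /B /= addrAC; have := ler_normD (y - F x0) w; qlra.
  pose u := G (y + w) - G y.
  have uw : `|u| <= 2 * c * `|w|.
    by have := GL _ _ ywB yB; rewrite [y + w]addrC addrK [w + y]addrC.
  have ud : `|u| < d.
    by apply: le_lt_trans uw _; rewrite mulrC -ltr_pdivlMr // mulr_gt0.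
  have E1 : G y + u = G (y + w) by rewrite /u addrC subrK.
  have E2 : y + w - y = w by rewrite addrC addKr.
  have := Hd u ud; rewrite E1 !GF // E2 => H.
  rewrite -/u; clearbody u.
  have -> : u - w *m invmx (jac F (G y)) =
     - ((w - u *m jac F (G y)) *m invmx (jac F (G y))).
    by rewrite mulmxBl (mulmxK (injD _ xr)) opprB.
  rewrite normrN; apply: le_trans (cb' _) _.
  apply: (@le_trans _ _ (c' * (e / (2 * c * c') * (2 * c * `|w|)))).
    apply: ler_wpM2l; first exact: ltW.
    apply: le_trans H _; apply: ler_wpM2l => //; apply: divr_ge0; exact: ltW.
  rewrite le_eqVlt; apply/orP; left; apply/eqP; field.
  by apply/andP; split; apply/eqP; qlra.
(* Bootstrap: the derivative of G is the inverse of the Jacobian of F taken along G, so regularity l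
   of G gives regularity l + 1, up to the class of F. *)
have CG l : (l <= k.+1)%N -> Ck_on l B G.
  elim: l => [|l IH] lk.
    move=> y yB; apply/cont_eps => e e1.
    have c2 : 0 < 2 * c by rewrite mulr_gt0.
    exists (Num.min (eps - `|y - F x0|) (e / (2 * c))).
      by rewrite lt_min subr_gt0 yB divr_gt0.
    move=> z; rewrite lt_min => /andP[z1 z2].
    have zB : B z.
      by rewrite /B /=; have := ler_normD (z - y) (y - F x0); rewrite subrKA; qlra.
    apply: le_lt_trans (GL _ _ zB yB) _.
    by rewrite mulrC -ltr_pdivlMr.
  have Gl := IH (ltnW lk).
  split; first by move=> y /dG [].
  move=> v.
  apply: (@Ck_on_ext _ _ _ l B (fun y => v *m invmx (jac F (G y)))) => //.
    by move=> y /dG [_ ->].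
  apply/(Ck_on_coord _ _ oB) => j.
  apply: (@Ck_on_ext _ _ _ l B (fun y => \sum_i v 0 i * invmx (jac F (G y)) i j : R^o)) => //.
    by move=> y _; rewrite mxE.
  apply: Ck_on_bigsum => // i; apply: Ck_on_mul => //; first exact: Ck_on_cst.
  have ju y (yB : B y) : jac F (G y) \in unitmx := injD _ (ltW (Gr y yB)).
  apply: (Ck_on_invmx (M := fun y => jac F (G y)) oB _ ju).
  move=> i' j'.
  have HD : Ck_on l U ('D_(delta_mx 0 i') F) by apply: Ck_on_le (DF _); rewrite -ltnS.
  have /(Ck_on_coord _ _ oB) /(_ j') := Ck_on_comp oB oU (fun y yB => inU _ (ltW (Gr y yB))) Gl HD.
  by apply: Ck_on_ext => // y _; rewrite mxE.
exists G, rho, eps; split => //.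
- by move=> x /ltW; apply: inU.
- by move=> x x' /ltW xr /ltW xr'; apply: inj.
- by split; [move=> y yB; split; [exact: Gr|exact: GF]|exact: CG].
Qed.

End InverseFunction.

Local Open Scope complex_scope.

(** * Half-angle sines and real cross ratios *)

Section Trigonometry.
Context {R : realType}.
Implicit Types (a b u w : R).

Lemma ReD (x y : R[i]) : complex.Re (x + y) = complex.Re x + complex.Re y.
Proof. by case: x y => ? ? [? ?]. Qed.
Lemma ImD (x y : R[i]) : complex.Im (x + y) = complex.Im x + complex.Im y.
Proof. by case: x y => ? ? [? ?]. Qed.
Lemma ReM (x y : R[i]) :
  complex.Re (x * y) = complex.Re x * complex.Re y - complex.Im x * complex.Im y.
Proof. by case: x y => ? ? [? ?]. Qed.
Lemma ImM (x y : R[i]) :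
  complex.Im (x * y) = complex.Re x * complex.Im y + complex.Im x * complex.Re y.
Proof. by case: x y => ? ? [? ?]. Qed.

Lemma Re_sum n (F : 'I_n -> R[i]) : complex.Re (\sum_i F i) = \sum_i complex.Re (F i).
Proof. by elim/big_rec2: _ => //= i x y _ <-; rewrite ReD. Qed.
Lemma Im_sum n (F : 'I_n -> R[i]) : complex.Im (\sum_i F i) = \sum_i complex.Im (F i).
Proof. by elim/big_rec2: _ => //= i x y _ <-; rewrite ImD. Qed.

Lemma natCV (n : nat) : (n%:R^-1 : R[i]) = (n%:R^-1 : R)%:C.
Proof. by rewrite fmorphV rmorph_nat. Qed.

Lemma expiD a b : expi (a + b) = expi a * expi b :> R[i].
Proof.
apply/eqP; rewrite eq_complex /expi ReM ImM /= cosD sinD; apply/andP; split; apply/eqP; ring.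
Qed.

Lemma expi_neq0 a : expi a != 0 :> R[i].
Proof.
apply/eqP => /eqP; rewrite eq_complex /= => /andP[/eqP c0 /eqP s0].
by have := cos2Dsin2 a; rewrite c0 s0 !expr0n /= addr0 => /eqP; rewrite eq_sym oner_eq0.
Qed.

(** Up to a factor 2 and a phase this is the chord: e^(ia) - e^(ib) = 2 i hsin(a - b) e^(i(a +
    b)/2). It turns the complex cross ratio into a real quotient. *)
Definition hsin u : R := sin (u / 2).

Lemma half_sum a b : a = (a + b) / 2 + (a - b) / 2 /\ b = (a + b) / 2 - (a - b) / 2.
Proof. by split; field. Qed.

Lemma cos_sub a b : cos a - cos b = - 2 * sin ((a + b) / 2) * hsin (a - b).
Proof.
have [Ea Eb] := half_sum a b.
have Ca := congr1 cos Ea; have Cb := congr1 cos Eb; rewrite cosD in Ca; rewrite cosB in Cb.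
by rewrite Ca Cb /hsin; ring.
Qed.

Lemma sin_sub a b : sin a - sin b = 2 * cos ((a + b) / 2) * hsin (a - b).
Proof.
have [Ea Eb] := half_sum a b.
have Ca := congr1 sin Ea; have Cb := congr1 sin Eb; rewrite sinD in Ca; rewrite sinB in Cb.
by rewrite Ca Cb /hsin; ring.
Qed.

Lemma expiB a b : expi a - expi b =
  (2 * hsin (a - b))%:C * ('i * expi ((a + b) / 2)) :> R[i].
Proof.
apply/eqP; rewrite eq_complex /expi !(ReM, ImM) /= cos_sub sin_sub.
by apply/andP; split; apply/eqP; ring.
Qed.

(** The numerator and the denominator carry the same total phase, with half-angle sum (a + b + c +
    d)/2, so the phases cancel. *)
Lemma cross_ratio_hsin a b c d :
  complex.Re (((expi a - expi d) * (expi b - expi c)) /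
              ((expi b - expi d) * (expi a - expi c))) =
  (hsin (a - d) * hsin (b - c)) / (hsin (b - d) * hsin (a - c)).
Proof.
have comb p q x y : (2 * p)%:C * ('i * expi x) * ((2 * q)%:C * ('i * expi y)) =
    (4 * (p * q))%:C * ('i * 'i * expi (x + y)) :> R[i].
  by rewrite expiD (_ : 4 * (p * q) = (2 * p) * (2 * q)) ?rmorphM; ring.
rewrite !expiB !comb.
have -> : (b + d) / 2 + (a + c) / 2 = (a + d) / 2 + (b + c) / 2 by field.
have n0 : 'i * 'i * expi ((a + d) / 2 + (b + c) / 2) != 0 :> R[i].
  rewrite !mulf_neq0 ?expi_neq0 //; rewrite eq_complex /= oner_eq0 andbF //.
set z := 'i * 'i * _ in n0 *.
rewrite invfM mulrACA divff // mulr1 -fmorphV -rmorphM /=.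
(* If the denominator vanishes, both sides are 0, since the inverse of 0 is 0. *)
have [E|E] := eqVneq (hsin (b - d) * hsin (a - c)) 0; first by rewrite E mulr0 invr0 !mulr0.
by move: E; rewrite mulf_eq0 negb_or => /andP[E1 E2]; field; rewrite E1 E2.
Qed.

Lemma hsin_gt0 u : 0 < u < 2 * pi -> 0 < hsin u.
Proof. by move=> /andP[u0 u1]; apply: sin_gt0_pi; apply/andP; split; qlra. Qed.

Lemma hsinN u : hsin (- u) = - hsin u.
Proof. by rewrite /hsin mulNr sinN. Qed.

Lemma hsin_eq0 u : - (2 * pi) < u < 2 * pi -> hsin u = 0 -> u = 0.
Proof.
move=> /andP[u1 u2] h; case: (ltgtP u 0) => // u0.
- have := @hsin_gt0 (- u); rewrite hsinN h oppr0 ltxx; move=> H.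
  by have : false by apply: H; apply/andP; qlra.
- by have := @hsin_gt0 u; rewrite h ltxx; move=> H; have : false by apply: H; rewrite u0.
Qed.

Lemma cos_sin_natperiod u (n : nat) :
  cos (u + 2 * pi * n%:R) = cos u /\ sin (u + 2 * pi * n%:R) = sin u.
Proof.
elim: n => [|n [IHc IHs]]; first by rewrite mulr0 addr0.
have -> : u + 2 * pi * n.+1%:R = (u + 2 * pi * n%:R) + pi *+ 2.
  by rewrite -natr1 -[pi *+ 2]mulr_natl; ring.
by split; [rewrite cosD cos2pi sin2pi mulr1 mulr0 subr0|
           rewrite sinD cos2pi sin2pi mulr1 mulr0 addr0].
Qed.

Lemma cos_sin_period u (k : int) :
  cos (u + 2 * pi * k%:~R) = cos u /\ sin (u + 2 * pi * k%:~R) = sin u.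
Proof.
case: k => n; first exact: cos_sin_natperiod.
have [c s] := cos_sin_natperiod (u + 2 * pi * (Negz n)%:~R) n.+1.
rewrite -c -s NegzE mulrNz -pmulrn mulrN subrK; split => //.
Qed.

Lemma cos_eq1 u : cos u = 1 -> exists k : int, u = 2 * pi * k%:~R.
Proof.
move=> cu; have p0 : 0 < 2 * pi :> R by rewrite mulr_gt0 // pi_gt0.
exists (Num.floor (u / (2 * pi))).
set k := Num.floor _.
have k1 : k%:~R <= u / (2 * pi) by apply: ge_floor.
have k2 : u / (2 * pi) < k%:~R + 1.
  by have := floorD1_gt (u / (2 * pi)); rewrite intrD.
rewrite ler_pdivlMr // in k1; rewrite ltr_pdivrMr // in k2.
pose v := u - 2 * pi * k%:~R.
suff : v = 0 by rewrite /v; qlra.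
have cv : cos v = 1.
  by have [+ _] := cos_sin_period v k; rewrite /v subrK cu.
apply: hsin_eq0; first by rewrite /v; apply/andP; qlra.
have := cos_sub v 0; rewrite cv cos0 subrr addr0 subr0.
by rewrite /hsin => /eqP; rewrite eq_sym !mulf_eq0 oppr_eq0 pnatr_eq0 /= orbb => /eqP.
Qed.

Definition kap (A B u : R) : R := (- A * sin u + B * cos u) / 2.

(** On the left stands the derivative of hsin(a - b) when both angles move by the first harmonic A
    cos + B sin. It is hsin(a - b) times a sum of one contribution per angle; a common drift drops
    out of the difference. *)
Lemma hsin_flow A B a b :
  1 / 2 * cos ((a - b) / 2) * ((A * cos a + B * sin a) - (A * cos b + B * sin b)) =
  hsin (a - b) * (kap A B a + kap A B b).
Proof.
have [Ea Eb] := half_sum a b.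
have Ca := congr1 cos Ea; have Cb := congr1 cos Eb; rewrite cosD in Ca; rewrite cosB in Cb.
have Sa := congr1 sin Ea; have Sb := congr1 sin Eb; rewrite sinD in Sa; rewrite sinB in Sb.
rewrite /kap Ca Cb Sa Sb /hsin; ring.
Qed.

(** Ptolemy's relation for four points of the circle. It yields both the complement 1 - Lambda and
    the injectivity of the cross ratios. *)
Lemma hsin_cross a b u w :
  hsin (a - u) * hsin (b - w) - hsin (a - w) * hsin (b - u) = hsin (a - b) * hsin (u - w).
Proof.
rewrite /hsin !mulrBl !sinB.
ring.
Qed.

Lemma smooth_hsin (V : normedModType R) k (U : set V) (f : V -> R^o) : open U ->
  Ck_on k U f -> Ck_on k U (fun x => hsin (f x) : R^o).
Proof.
move=> oU Hf; apply: (@Ck_on_comp1 R V k U (fun x => f x * (2^-1 : R^o) : R^o) (sin : R^o -> R^o)) => //.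
  by apply: Ck_on_mul => //; exact: Ck_on_cst.
by have [] := @Ck_sin_cos R k setT.
Qed.

End Trigonometry.

Lemma near_eps (R : realType) (V : normedModType R) (P : V -> Prop) (x : V) (d : R) :
  0 < d -> (forall y, `|y - x| < d -> P y) -> \forall y \near x, P y.
Proof.
move=> d0 H; apply/nbhs_ballP; exists d => // y.
by rewrite -ball_normE /= distrC => /H.
Qed.

Lemma eps_near (R : realType) (V : normedModType R) (P : V -> Prop) (x : V) :
  (\forall y \near x, P y) -> exists2 d : R, 0 < d & forall y, `|y - x| < d -> P y.
Proof.
move=> /nbhs_ballP[d /= d0 H]; exists d => // y yx; apply: H.
by rewrite -ball_normE /= distrC.
Qed.

Lemma open_eps (R : realType) (V : normedModType R) (A : set V) :
  (forall x, A x -> exists2 d : R, 0 < d & forall y, `|y - x| < d -> A y) -> open A.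
Proof. by move=> H; rewrite openE => x /H [d d0 Hd]; apply: (near_eps d0). Qed.

(** * Cross ratios of ordered configurations *)

Section Coordinates.
Context {R : realType} (N : nat).
Implicit Types (x y v theta : 'rV[R]_N).

Lemma coordE v (i : 'I_N) : coord v i = v 0 i.
Proof. by rewrite /coord valK. Qed.

Lemma coord_ord v k (kN : (k < N)%N) : coord v k = v 0 (Ordinal kN).
Proof. exact: (coordE v (Ordinal kN)). Qed.

Lemma coord_add v w k : coord (v + w) k = coord v k + coord w k :> R.
Proof. by rewrite /coord; case: insubP => [i _ _|_]; rewrite ?mxE ?addr0. Qed.

Lemma coord_scale a v k : coord (a *: v) k = a * coord v k :> R.
Proof. by rewrite /coord; case: insubP => [i _ _|_]; rewrite ?mxE ?mulr0. Qed.

Lemma coord_const (c : R) k : (k < N)%N -> coord (const_mx c : 'rV[R]_N) k = c.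
Proof. by move=> kN; rewrite (coord_ord _ kN) mxE. Qed.

Lemma coord_delta (i : 'I_N) k : (k < N)%N ->
  coord (delta_mx 0 i : 'rV[R]_N) k = (k == i)%:R.
Proof. by move=> kN; rewrite (coord_ord _ kN) mxE eqxx. Qed.

Lemma Ck_on_coordk k (U : set 'rV[R]_N) j : Ck_on k U (fun v => coord v j : R^o).
Proof.
rewrite /coord; case: insubP => [i _ _|_]; last exact: Ck_on_cst.
have H : Ck_on k setT (fun v : 'rV[R]_N => v 0 i : R^o).
  by have := (Ck_on_coord k (fun x : 'rV[R]_N => x) openT).1 (Ck_on_id k setT) i.
exact: Ck_on_sub H.
Qed.

Lemma Lambda_hsin theta (k : 'I_(N - 3)) : Lambda theta 0 k =
  (hsin (coord theta 0 - coord theta (k + 3)) * hsin (coord theta 1 - coord theta 2)) /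
  (hsin (coord theta 1 - coord theta (k + 3)) * hsin (coord theta 0 - coord theta 2)).
Proof. by rewrite mxE cross_ratio_hsin. Qed.

Hypothesis HN : (4 <= N)%N.

Lemma coord_ltN (k : 'I_(N - 3)) : (k + 3 < N)%N.
Proof. by rewrite addnC -ltn_subRL. Qed.

Lemma ordered_coord x i j : ordered x -> (i < j < N)%N ->
  0 < coord x j - coord x i < 2 * pi.
Proof.
move=> [mono wrap] /andP[ij jN]; have iN := ltn_trans ij jN.
have N0 : (0 < N)%N by apply: leq_trans HN.
have h1 : coord x i < coord x j.
  by rewrite (coord_ord _ iN) (coord_ord _ jN); apply: mono.
have h2 : coord x j <= coord x N.-1.
  have NN : (N.-1 < N)%N by rewrite prednK.
  rewrite (coord_ord _ jN) (coord_ord _ NN).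
  have : (j <= N.-1)%N by rewrite -ltnS prednK.
  rewrite leq_eqVlt => /predU1P[E|lt]; last by apply/ltW/mono.
  by rewrite (_ : Ordinal jN = Ordinal NN) //; apply: val_inj.
have h3 : coord x 0 <= coord x i.
  rewrite (coord_ord _ N0) (coord_ord _ iN).
  case: (posnP i) => [E|lt]; last by apply/ltW/mono.
  by rewrite (_ : Ordinal iN = Ordinal N0) //; apply: val_inj.
by apply/andP; split; qlra.
Qed.

Lemma open_ordered : open [set x : 'rV[R]_N | ordered x].
Proof.
have oT := @openT 'rV[R]_N.
have npos (F : 'rV[R]_N -> R^o) x : Ck_on 0 setT F -> 0 < F x ->
    exists2 d : R, 0 < d & forall y, `|y - x| < d -> 0 < F y.
  move=> cF Fx; have [d d0 Hd] := (cont_eps F x).1 (cF x I) _ Fx.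
  by exists d => // y /Hd; rewrite ltr_norml => /andP[? ?]; qlra.
suff H x : ordered x -> exists2 d : R, 0 < d & forall y, `|y - x| < d -> ordered y.
  exact: open_eps H.
move=> [mono wrap].
have [d1 d10 H1] : exists2 d, 0 < d & forall i : 'I_N, forall j : 'I_N, (i < j)%N ->
    forall y, `|y - x| < d -> y 0 i < y 0 j.
  apply: finite_eps => [i d d' _ dd' H j ij y yd|i].
    by apply: H => //; apply: lt_le_trans dd'.
  apply: (@finite_eps R N (fun j d => (i < j)%N -> forall y, `|y - x| < d -> y 0 i < y 0 j)).
    by move=> j d d' _ dd' H ij y yd; apply: H => //; apply: lt_le_trans dd'.
  move=> j; have [ij|/negbTE nij] := boolP (i < j)%N; last by exists 1.
  have [||d d0 Hd] := npos (fun y => coord y j - coord y i) x.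
  - exact: (Ck_on_add oT (Ck_on_coordk 0 setT j) (Ck_on_opp oT (Ck_on_coordk 0 setT i))).
  - by rewrite subr_gt0 !coordE; apply: mono.
  - by exists d => // _ y /Hd; rewrite subr_gt0 !coordE.
have [||d2 d20 H2] := npos (fun y => coord y 0 + 2 * pi - coord y N.-1) x.
- apply: (Ck_on_add oT) (Ck_on_opp oT (Ck_on_coordk 0 setT N.-1)).
  exact: (Ck_on_add oT (Ck_on_coordk 0 setT 0) (Ck_on_cst 0 setT (2 * pi))).
- by rewrite subr_gt0.
exists (Num.min d1 d2); first by rewrite lt_min d10.
move=> y; rewrite lt_min => /andP[y1 y2]; split.
  by move=> i j ij; apply: H1.
by rewrite -subr_gt0; apply: H2.
Qed.

End Coordinates.

Section Field.
Context {R : realType} (N : nat).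
Implicit Types (x y v : 'rV[R]_N).
Hypothesis HN : (4 <= N)%N.

Let Npos : 0 < N%:R :> R.
Proof. by rewrite ltr0n; apply: leq_trans HN. Qed.

Definition order_vec x : 'rV[R]_2 := \row_(j < 2)
  (if j == 0 then N%:R^-1 * \sum_i cos (x 0 i) else N%:R^-1 * \sum_i sin (x 0 i)).

Lemma order_parameterE x : order_parameter x = C_of_vec (order_vec x).
Proof.
apply/eqP; rewrite eq_complex /order_parameter /C_of_vec natCV ReM ImM Re_sum Im_sum /= !mxE /=.
by rewrite !mul0r subr0 addr0 !eqxx.
Qed.

Lemma sum_cos_sin x : (\sum_i cos (x 0 i)) ^+ 2 + (\sum_i sin (x 0 i)) ^+ 2 =
  \sum_i \sum_j cos (x 0 i - x 0 j).
Proof.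
rewrite !expr2 !mulr_suml -big_split; apply: eq_bigr => i _ /=.
by rewrite !mulr_sumr -big_split; apply: eq_bigr => j _; rewrite cosB.
Qed.

(** The squared modulus of the sum of the e^(i x_j) is the double sum of cos(x_i - x_j). It is
    strictly below N^2 because the first two angles differ modulo 2 pi. This keeps Z where f and g
    are smooth. *)
Lemma disk_order_parameter x : ordered x -> disk (order_parameter x).
Proof.
move=> ox; rewrite order_parameterE /disk /C_of_vec /= !mxE /=.
rewrite !exprMn -mulrDr sum_cos_sin exprVn -ltr_pdivlMl ?invr_gt0 ?exprn_gt0 //.
rewrite invrK mulr1.
have N0 : (0 < N)%N by apply: leq_trans HN.
have N1 : (1 < N)%N by apply: leq_trans HN.
have E : N%:R ^+ 2 = \sum_(i < N) \sum_(j < N) (1 : R).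
  by rewrite !sumr_const !card_ord expr2 mulr_natl.
rewrite E -subr_gt0 -sumrB.
under eq_bigr do rewrite -sumrB.
pose i0 := Ordinal N0; pose i1 := Ordinal N1.
have c1 u : 0 <= 1 - cos u :> R by rewrite subr_ge0 cos_le1.
rewrite (bigD1 i1) //= (bigD1 i0) //=.
apply: ltr_pwDl; last by apply: sumr_ge0 => i _; apply: sumr_ge0.
apply: ltr_pwDl; last by apply: sumr_ge0.
have /andP[d0 d1] : 0 < coord x 1 - coord x 0 < 2 * pi.
  by apply: (ordered_coord HN ox); rewrite N1.
have -> : x 0 i1 - x 0 i0 = coord x 1 - coord x 0 by rewrite (coord_ord _ N1) (coord_ord _ N0).
have h := @hsin_gt0 R (coord x 1 - coord x 0); rewrite d0 d1 in h.
have := cos_sub (coord x 1 - coord x 0) 0; rewrite cos0 addr0 subr0 => E2.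
rewrite -opprB E2 /hsin; have := h isT; rewrite /hsin => h2.
by rewrite !mulNr opprK !mulr_gt0.
Qed.

Lemma smooth_order_vec k U : open U -> Ck_on k U order_vec.
Proof.
move=> oU; apply/(Ck_on_coord _ _ oU) => j.
have sc (F : R^o -> R^o) : Ck_on k setT F ->
    Ck_on k U (fun x : 'rV[R]_N => N%:R^-1 * (\sum_i F (x 0 i)) : R^o).
  move=> cF; apply: Ck_on_mul => //; first exact: Ck_on_cst.
  apply: Ck_on_bigsum => // i; apply: (Ck_on_comp1 (f := fun x : 'rV[R]_N => x 0 i : R^o)) => //.
  by have := (Ck_on_coord k (fun x : 'rV[R]_N => x) oU).1 (Ck_on_id k U) i.
have [cs cc] := @Ck_sin_cos R k setT.
have [E|E] := eqVneq j 0.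
  by apply: (Ck_on_ext oU _ (sc _ cc)) => x _; rewrite mxE E.
by apply: (Ck_on_ext oU _ (sc _ cs)) => x _; rewrite mxE (negbTE E).
Qed.

Variables (f : R[i] -> R[i]) (g : R[i] -> R) (h : R -> R).
Hypotheses (Hf : smooth_disk_C f) (Hg : smooth_disk_R g).

(** Real Fourier coefficients, of cos here and of sin in [fieldB], of f e^(i phi) plus its complex
    conjugate. *)
Definition fieldA x : R := 2 * complex.Re (f (order_parameter x)).
Definition fieldB x : R := - 2 * complex.Im (f (order_parameter x)).

Lemma fieldE x j : vector_field f g h 0 x 0 j =
  fieldA x * cos (x 0 j) + fieldB x * sin (x 0 j) + g (order_parameter x).
Proof.
rewrite mxE mul0r addr0 !ReD !ReM /fieldA /fieldB.
by case: (f _) => p q /=; rewrite cosN sinN; ring.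
Qed.

Lemma open_disk_vec : open [set v : 'rV[R]_2 | disk (C_of_vec v)].
Proof.
pose F (v : 'rV[R]_2) : R^o := 1 - (v 0 0 * v 0 0 + v 0 1 * v 0 1).
have oT := @openT 'rV[R]_2.
have cc i : Ck_on 0 setT (fun v : 'rV[R]_2 => v 0 i : R^o).
  by have := (Ck_on_coord 0 (fun x : 'rV[R]_2 => x) oT).1 (Ck_on_id 0 setT) i.
have cF : Ck_on 0 setT F.
  apply: (Ck_on_add oT); first exact: Ck_on_cst.
  exact: (Ck_on_opp oT (Ck_on_add oT (Ck_on_mul oT (cc 0) (cc 0)) (Ck_on_mul oT (cc 1) (cc 1)))).
apply: open_eps => v; rewrite /disk /= !expr2 -subr_gt0 => Fv.
have [d d0 Hd] := (cont_eps F v).1 (cF v I) _ Fv.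
exists d => // w /Hd; rewrite ltr_norml /F => /andP[h1 h2].
by rewrite /disk /= !expr2; qlra.
Qed.

Lemma smooth_field : smooth_on [set x : 'rV[R]_N | ordered x] (vector_field f g h 0).
Proof.
move=> k; have oO := @open_ordered R N; have oD := open_disk_vec.
have zD x : [set x : 'rV[R]_N | ordered x] x -> [set v | disk (C_of_vec v)] (order_vec x).
  by move=> /disk_order_parameter; rewrite order_parameterE.
have Cf := Ck_on_comp oO oD zD (smooth_order_vec k oO) (Hf k).
have Cg := Ck_on_comp_real oO zD (smooth_order_vec k oO) (Hg k).
have [cs cc] := @Ck_sin_cos R k setT.
have cx i : Ck_on k [set x : 'rV[R]_N | ordered x] (fun x : 'rV[R]_N => x 0 i : R^o).
  by have := (Ck_on_coord k (fun x : 'rV[R]_N => x) oO).1 (Ck_on_id k _) i.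
have cA : Ck_on k [set x : 'rV[R]_N | ordered x] (fun x => fieldA x : R^o).
  apply: Ck_on_mul => //; first exact: Ck_on_cst.
  have := (Ck_on_coord _ _ oO).1 Cf 0; apply: Ck_on_ext => // x _.
  by rewrite mxE /= order_parameterE.
have cB : Ck_on k [set x : 'rV[R]_N | ordered x] (fun x => fieldB x : R^o).
  apply: Ck_on_mul => //; first exact: Ck_on_cst.
  have := (Ck_on_coord _ _ oO).1 Cf 1; apply: Ck_on_ext => // x _.
  by rewrite mxE /= order_parameterE.
apply/(Ck_on_coord _ _ oO) => j.
apply: (@Ck_on_ext _ _ _ k _ (fun x => fieldA x * cos (x 0 j) + fieldB x * sin (x 0 j) + g (order_parameter x))) => //.
  by move=> x _; rewrite fieldE.
apply: Ck_on_add => //; last first.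
  by apply: Ck_on_ext Cg => // x _; rewrite /= order_parameterE.
by apply: Ck_on_add => //; apply: Ck_on_mul => //; apply: Ck_on_comp1.
Qed.

Lemma translate_coord x k j : translate k x 0 j = x 0 j + 2 * pi * k%:~R.
Proof. by rewrite !mxE. Qed.

Lemma order_parameter_translate k x : order_parameter (translate k x) = order_parameter x.
Proof.
rewrite /order_parameter; congr (_ * _); apply: eq_bigr => j _.
by rewrite /expi translate_coord; have [-> ->] := cos_sin_period (x 0 j) k.
Qed.

Lemma field_translate k x :
  vector_field f g h 0 (translate k x) = vector_field f g h 0 x.
Proof.
apply/rowP => j; rewrite !fieldE /fieldA /fieldB order_parameter_translate translate_coord.
by have [-> ->] := cos_sin_period (x 0 j) k.
Qed.

End Field.

Section CrossRatios.
Context {R : realType} (N : nat).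
Implicit Types (x y v : 'rV[R]_N).
Hypothesis HN : (4 <= N)%N.

Lemma translate_ordered k x : ordered x -> ordered (translate k x).
Proof.
move=> [mono wrap]; split.
  by move=> i j ij; rewrite !translate_coord ltrD2r; apply: mono.
have N0 : (0 < N)%N by rewrite (leq_trans _ HN).
have N1 : (N.-1 < N)%N by rewrite prednK.
by rewrite /translate !coord_add !coord_const //; qlra.
Qed.

Lemma Lambda_translate k x : Lambda (translate k x) = Lambda x.
Proof.
have N0 i : (i < 3)%N -> (i < N)%N by move=> i3; rewrite (leq_trans i3) // ltnW.
apply/rowP => l; have kN := coord_ltN l.
have sb (a b c : R) : a + c - (b + c) = a - b by ring.
have cc i : (i < N)%N -> coord (translate k x) i = coord x i + 2 * pi * k%:~R.
  by move=> iN; rewrite /translate coord_add coord_const.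
by rewrite !Lambda_hsin !(cc _ kN) !(cc _ (N0 _ _)) // !sb.
Qed.

Lemma hsin_ordered_lt0 x i j : ordered x -> (i < j < N)%N -> hsin (coord x i - coord x j) < 0.
Proof.
by move=> ox ij; rewrite -opprB hsinN oppr_lt0 hsin_gt0 // ordered_coord.
Qed.

Let lt3 i (k : 'I_(N - 3)) : (i < 3)%N -> (i < k + 3 < N)%N.
Proof. by move=> i3; rewrite (leq_trans i3) ?leq_addl //= coord_ltN. Qed.

Lemma Lambda_denominator x (k : 'I_(N - 3)) : ordered x ->
  hsin (coord x 1 - coord x (k + 3)) != 0 /\ hsin (coord x 0 - coord x 2) != 0.
Proof.
move=> ox; split; apply/ltr0_neq0/hsin_ordered_lt0 => //; first exact: lt3.
by rewrite (leq_trans _ HN).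
Qed.

Lemma smooth_Lambda : smooth_on [set x : 'rV[R]_N | ordered x] (@Lambda R N).
Proof.
move=> k; have oO := @open_ordered R N.
apply/(Ck_on_coord _ _ oO) => l.
have ch i j : Ck_on k [set x : 'rV[R]_N | ordered x]
    (fun x => hsin (coord x i - coord x j) : R^o).
  apply: smooth_hsin => //; apply: Ck_on_add => //; first exact: Ck_on_coordk.
  by apply: Ck_on_opp => //; exact: Ck_on_coordk.
apply: (@Ck_on_ext _ _ _ k _ (fun x =>
  (hsin (coord x 0 - coord x (l + 3)) * hsin (coord x 1 - coord x 2)) *
  (hsin (coord x 1 - coord x (l + 3)) * hsin (coord x 0 - coord x 2))^-1 : R^o)) => //.
  by move=> x _; rewrite Lambda_hsin.
apply: Ck_on_mul => //; first by apply: Ck_on_mul; [|exact: ch|exact: ch].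
apply: Ck_on_inv => //; last by apply: Ck_on_mul; [|exact: ch|exact: ch].
by move=> x ox; have [n1 n2] := Lambda_denominator l ox; rewrite mulf_neq0.
Qed.

(** With three angles fixed, each cross ratio is a Moebius function of one further angle. Equal
    values give hsin(a - b) hsin(u - w) = 0 by [hsin_cross], and u - w lies strictly between -2 pi
    and 2 pi. *)
Lemma Lambda_injective x y : ordered x -> ordered y -> Lambda x = Lambda y ->
  (forall i, (i < 3)%N -> coord x i = coord y i) -> x = y.
Proof.
move=> ox oy E E3; apply/rowP => j; rewrite -!coordE.
have [j3|j3] := ltnP j 3; first exact: E3.
have jN : (j - 3 < N - 3)%N by rewrite ltn_sub2r // (leq_trans _ HN).
have := congr1 (fun m : 'rV[R]_(N - 3) => m 0 (Ordinal jN)) E; rewrite !Lambda_hsin /= subnK //.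
have [nx1 nx2] := Lambda_denominator (Ordinal jN) ox.
have [ny1 ny2] := Lambda_denominator (Ordinal jN) oy.
rewrite /= subnK // in nx1 ny1.
rewrite -(E3 0%N) // -(E3 1%N) // -(E3 2%N) //; rewrite -(E3 1%N) // in ny1;
  rewrite -(E3 0%N) // -(E3 2%N) // in ny2.
move: nx1 nx2 ny1 ny2; set a := coord x 0; set b := coord x 1.
set c := coord x 2; set u := coord x j; set w := coord y j => nx1 nx2 ny1 ny2.
have ab : hsin (a - b) != 0.
  by apply/ltr0_neq0/hsin_ordered_lt0 => //; rewrite (leq_trans _ HN).
have bc : hsin (b - c) != 0.
  by apply/ltr0_neq0/hsin_ordered_lt0 => //; rewrite (leq_trans _ HN).
move=> E4.
have E5 : hsin (a - u) * hsin (b - w) = hsin (a - w) * hsin (b - u).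
  have E6 : hsin (a - u) * hsin (b - c) / (hsin (b - u) * hsin (a - c)) *
     (hsin (b - u) * hsin (b - w) * hsin (a - c) / hsin (b - c)) =
     hsin (a - w) * hsin (b - c) / (hsin (b - w) * hsin (a - c)) *
     (hsin (b - u) * hsin (b - w) * hsin (a - c) / hsin (b - c)) by rewrite E4.
  transitivity (hsin (a - u) * hsin (b - c) / (hsin (b - u) * hsin (a - c)) *
     (hsin (b - u) * hsin (b - w) * hsin (a - c) / hsin (b - c))).
    by field; rewrite bc nx1 nx2.
  by rewrite E6; field; rewrite bc ny1 nx2.
have := hsin_cross a b u w; rewrite E5 subrr => /eqP.
rewrite eq_sym mulf_eq0 (negbTE ab) /= => /eqP uw.
have ju : (0 < j < N)%N by rewrite (leq_trans _ j3) /=.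
have /andP[h1 h2] := ordered_coord HN ox ju.
have /andP[h3 h4] := ordered_coord HN oy ju.
rewrite -(E3 0%N) // -/a -/w in h3 h4; rewrite -/a -/u in h1 h2.
apply/eqP; rewrite -subr_eq0; apply/eqP; apply: hsin_eq0 => //.
by apply/andP; qlra.
Qed.

(** The angles agree up to multiples of 2 pi, and these multiples are all equal because each of the
    two configurations spans less than 2 pi. *)
Lemma same_point_cos x y : ordered x -> ordered y ->
  (forall j, cos (x 0 j - y 0 j) = 1) -> same_point y x.
Proof.
move=> ox oy H.
have [k Hk] := choice (fun j => cos_eq1 (H j)).
have N0 : (0 < N)%N by rewrite (leq_trans _ HN).
pose i0 := Ordinal N0.
have p0 := pi_gt0 R.
have kk j : k j = k i0.
  have [j0|j0] := posnP j; first by congr k; apply: val_inj.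
  have ju : (0 < j < N)%N by rewrite j0 /=.
  have /andP[h1 h2] := ordered_coord HN ox ju.
  have /andP[h3 h4] := ordered_coord HN oy ju.
  rewrite !coordE !(coord_ord _ N0) -/i0 in h1 h2 h3 h4.
  have := Hk j; have := Hk i0 => E0 Ej.
  have E : 2 * pi * ((k j)%:~R - (k i0)%:~R) = x 0 j - x 0 i0 - (y 0 j - y 0 i0) by qlra.
  have l1 : (k j)%:~R - (k i0)%:~R < 1 :> R.
    by rewrite -(ltr_pM2l (_ : 0 < 2 * pi)) ?mulr_gt0 // E; qlra.
  have l2 : (k i0)%:~R - (k j)%:~R < 1 :> R.
    by rewrite -(ltr_pM2l (_ : 0 < 2 * pi)) ?mulr_gt0 // -opprB mulrN E; qlra.
  by move: l1 l2; rewrite -!intrB -[1 in X in X -> _]/(1%:~R) -[1 in X in _ -> X -> _]/(1%:~R) !ltr_int; lia.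
exists (k i0); apply/rowP => j; rewrite translate_coord -(kk j) -Hk; ring.
Qed.

Lemma translateD k l x : translate k (translate l x) = translate (k + l) x.
Proof. by apply/rowP => j; rewrite !translate_coord intrD; ring. Qed.

Lemma translate0 x : translate 0 x = x.
Proof. by apply/rowP => j; rewrite translate_coord mulr0 addr0. Qed.

Lemma translateK k x : translate (- k) (translate k x) = x.
Proof. by rewrite translateD addNr translate0. Qed.

Lemma same_point_sym x y : same_point x y -> same_point y x.
Proof. by move=> [k ->]; exists (- k); rewrite translateK. Qed.

Lemma same_point_trans y x z : same_point x y -> same_point y z -> same_point x z.
Proof. by move=> [k ->] [l ->]; exists (l + k); rewrite translateD. Qed.

Lemma translateB k x y : translate k x - translate k y = x - y.
Proof. by apply/rowP => j; rewrite !sub_mxE !translate_coord; ring. Qed.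

Lemma cder_hsin_line (a b : R) :
  is_derive (0 : R^o) 1 ((fun t => hsin (a + t * b)) : R^o -> R^o) (1 / 2 * cos (a / 2) * b).
Proof.
have H : is_derive ((b / 2) * 0 + a / 2 : R^o) 1 (sin : R^o -> R^o) (cos ((b / 2) * 0 + a / 2)).
  exact: is_derive_sin.
have := @cder_affine R R^o sin (b / 2) (a / 2) 0 _ H.
rewrite mulr0 add0r (_ : (b / 2) *: cos (a / 2) = 1 / 2 * cos (a / 2) * b); last first.
  by rewrite -[_ *: _]/(b / 2 * cos (a / 2)); ring.
have -> // : (fun t : R => sin (b / 2 * t + a / 2)) = fun t => hsin (a + t * b).
by apply/funext => t; rewrite /hsin; congr sin; field.
Qed.

Lemma cder_quotient (p q r s : R -> R) (t p' q' r' s' : R) :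
  is_derive (t : R^o) 1 (p : R^o -> R^o) p' -> is_derive (t : R^o) 1 (q : R^o -> R^o) q' ->
  is_derive (t : R^o) 1 (r : R^o -> R^o) r' -> is_derive (t : R^o) 1 (s : R^o -> R^o) s' ->
  r t != 0 -> s t != 0 ->
  is_derive (t : R^o) 1 ((fun t => p t * q t / (r t * s t)) : R^o -> R^o)
    ((p' * q t + p t * q') / (r t * s t)
     - p t * q t * (r' * s t + r t * s') / (r t * s t) ^+ 2).
Proof.
move=> Hp Hq Hr Hs r0 s0.
have Hpq := @is_deriveM R R^o (p : R^o -> R^o) (q : R^o -> R^o) t 1 p' q' Hp Hq.
have Hrs := @is_deriveM R R^o (r : R^o -> R^o) (s : R^o -> R^o) t 1 r' s' Hr Hs.
have rs0 : ((r : R^o -> R^o) * (s : R^o -> R^o)) t != 0 by rewrite mulf_neq0.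
have Hi := @is_deriveV R _ t _ 1 rs0 Hrs.
have := @is_deriveM R R^o _ _ t 1 _ _ Hpq Hi.
move=> H; apply: (is_derive_eq H).
rewrite /GRing.scale /=.
rewrite !fctE; field; by rewrite r0 s0.
Qed.

Lemma cder_unique (W : normedModType R) (phi : R -> W) (s : R) (w w' : W) :
  is_derive (s : R^o) 1 (phi : R^o -> W) w -> is_derive (s : R^o) 1 (phi : R^o -> W) w' ->
  w = w'.
Proof. by move=> [_ <-] [_ <-]. Qed.

Lemma D_Lambda x v (k : 'I_(N - 3)) : ordered x ->
  let D i j := 1 / 2 * cos ((coord x i - coord x j) / 2) * (coord v i - coord v j) in
  let S i j := hsin (coord x i - coord x j) in
  ('D_v (@Lambda R N) x) 0 k =
    (D 0%N (k + 3)%N * S 1%N 2%N + S 0%N (k + 3)%N * D 1%N 2%N) / (S 1%N (k + 3)%N * S 0%N 2%N)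
     - S 0%N (k + 3)%N * S 1%N 2%N * (D 1%N (k + 3)%N * S 0%N 2%N + S 1%N (k + 3)%N * D 0%N 2%N)
        / (S 1%N (k + 3)%N * S 0%N 2%N) ^+ 2.
Proof.
move=> ox D S.
have dL : differentiable (@Lambda R N) x.
  by have [dL _] := smooth_Lambda 1; apply: dL.
have H1 : is_derive (0 : R^o) 1 ((fun t => Lambda (x + t *: v)) : R^o -> 'rV[R]_(N - 3))
    ('D_v (@Lambda R N) x).
  have := @cder_comp R _ _ (@Lambda R N) (fun t => x + t *: v) 0 v.
  rewrite scale0r addr0 deriveE //; apply => //.
  exact: cder_line.
have {}H1 := (cder_coord _ _ _).1 H1 k.
have hl i j : is_derive (0 : R^o) 1
    ((fun t => hsin (coord (x + t *: v) i - coord (x + t *: v) j)) : R^o -> R^o) (D i j).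
  have := cder_hsin_line (coord x i - coord x j) (coord v i - coord v j).
  have -> // : (fun t : R => hsin (coord x i - coord x j + t * (coord v i - coord v j))) =
    fun t => hsin (coord (x + t *: v) i - coord (x + t *: v) j).
  by apply/funext => t; rewrite !coord_add !coord_scale; congr hsin; ring.
have [n1 n2] := Lambda_denominator k ox.
have H2 := cder_quotient (hl 0%N (k + 3)%N) (hl 1%N 2%N) (hl 1%N (k + 3)%N) (hl 0%N 2%N).
rewrite scale0r addr0 in H2.
have {}H2 := H2 n1 n2.
have E : (fun t => Lambda (x + t *: v) 0 k) = (fun t =>
   hsin (coord (x + t *: v) 0 - coord (x + t *: v) (k + 3)) *
   hsin (coord (x + t *: v) 1 - coord (x + t *: v) 2) /
   (hsin (coord (x + t *: v) 1 - coord (x + t *: v) (k + 3)) *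
   hsin (coord (x + t *: v) 0 - coord (x + t *: v) 2))).
  by apply/funext => t; rewrite Lambda_hsin.
rewrite E in H1.
exact: (cder_unique H1 H2).
Qed.

(** By [hsin_flow] the logarithmic derivative of each factor is a sum over its two indices. Each of
    the four indices occurs once in the numerator and once in the denominator, so everything
    cancels. *)
Lemma Lambda_conserved (f : R[i] -> R[i]) (g : R[i] -> R) (h : R -> R) x : ordered x ->
  'D_(vector_field f g h 0 x) (@Lambda R N) x = 0.
Proof.
move=> ox; apply/rowP => k; rewrite D_Lambda // [RHS]mxE.
set X := vector_field f g h 0 x.
have [n1 n2] := Lambda_denominator k ox.
pose K i := kap (fieldA f x) (fieldB f x) (coord x i).
have E i j : (i < N)%N -> (j < N)%N ->
    1 / 2 * cos ((coord x i - coord x j) / 2) * (coord X i - coord X j) =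
    hsin (coord x i - coord x j) * (K i + K j).
  move=> iN jN; rewrite /K -hsin_flow (coord_ord X iN) (coord_ord X jN) !fieldE.
  by rewrite (coord_ord x iN) (coord_ord x jN); congr (_ * _); ring.
have kN := coord_ltN k.
have N0 i : (i < 3)%N -> (i < N)%N by move=> i3; rewrite (leq_trans i3) // ltnW.
rewrite !E ?kN ?(N0 0%N) ?(N0 1%N) ?(N0 2%N) //.
field; by rewrite n1 n2.
Qed.

Definition tail_index (k : 'I_(N - 3)) : 'I_N := Ordinal (coord_ltN k).

(** Only the first three angles and one further angle enter a cross ratio, so the derivative with
    respect to the last N - 3 angles is a diagonal matrix; by [D_Lambda_diag] it is invertible. *)
Lemma D_Lambda_tail x (k l : 'I_(N - 3)) : ordered x -> k != l ->
  ('D_(delta_mx 0 (tail_index l)) (@Lambda R N) x) 0 k = 0.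
Proof.
move=> ox kl; rewrite D_Lambda //.
have N0 i : (i < 3)%N -> (i < N)%N by move=> i3; rewrite (leq_trans i3) // ltnW.
have d0 i : (i < 3)%N -> coord (delta_mx 0 (tail_index l) : 'rV[R]_N) i = 0.
  move=> i3; rewrite coord_delta ?N0 //; case: eqP => // E.
  by move: i3; rewrite E /= -[X in (_ < X)%N]add0n ltn_add2r.
rewrite !(d0 0%N) // !(d0 1%N) // !(d0 2%N) // coord_delta ?coord_ltN //= eqn_add2r (_ : (k == l :> nat) = false); last exact: negbTE.
by rewrite !subrr !mulr0 !mul0r !addr0 !mulr0 !mul0r subrr.
Qed.

Lemma D_Lambda_diag x (k : 'I_(N - 3)) : ordered x ->
  ('D_(delta_mx 0 (tail_index k)) (@Lambda R N) x) 0 k != 0.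
Proof.
move=> ox; rewrite D_Lambda //.
have N0 i : (i < 3)%N -> (i < N)%N by move=> i3; rewrite (leq_trans i3) // ltnW.
have d0 i : (i < 3)%N -> coord (delta_mx 0 (tail_index k) : 'rV[R]_N) i = 0.
  move=> i3; rewrite coord_delta ?N0 //; case: eqP => // E.
  by move: i3; rewrite E /= -[X in (_ < X)%N]add0n ltn_add2r.
rewrite !(d0 0%N) // !(d0 1%N) // !(d0 2%N) // coord_delta ?coord_ltN //= eqxx.
have [n1 n2] := Lambda_denominator k ox.
have n3 : hsin (coord x 1 - coord x 2) != 0.
  by apply/ltr0_neq0/hsin_ordered_lt0 => //; rewrite N0.
have n4 : hsin (coord x 0 - coord x 1) != 0.
  by apply/ltr0_neq0/hsin_ordered_lt0 => //; rewrite N0.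
set a := coord x 0 in n2 n4 *; set b := coord x 1 in n1 n3 n4 *.
set c := coord x 2 in n2 n3 *; set d := coord x (k + 3) in n1 *.
have E : hsin (a - b) = sin ((a - d) / 2) * cos ((b - d) / 2) - cos ((a - d) / 2) * sin ((b - d) / 2).
  by rewrite -sinB /hsin; congr sin; field.
rewrite (_ : _ - _ = 1 / 2 * hsin (b - c) * hsin (a - b) / (hsin (a - c) * hsin (b - d) ^+ 2)).
  by rewrite !mulf_neq0 ?invr_neq0 ?mulf_neq0 ?expf_neq0 ?oner_neq0 ?pnatr_eq0.
rewrite (_ : true%:R = 1 :> R) // E -/(hsin (a - d)) -/(hsin (b - d)); field; by rewrite n1 n2.
Qed.

End CrossRatios.

(** * Calculus of Jacobian matrices *)

Section JacobianRules.
Context {R : realType}.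

Lemma jac_comp n m p (F : 'rV[R]_n -> 'rV[R]_m) (G : 'rV[R]_m -> 'rV[R]_p) (x : 'rV[R]_n) :
  differentiable F x -> differentiable G (F x) ->
  jac (fun y => G (F y)) x = jac F x *m jac G (F x).
Proof.
move=> dF dG; apply/matrixP => i j; rewrite !mxE.
have := derive_comp_row (delta_mx 0 i) dF dG; rewrite /comp => ->.
by rewrite summxE; apply: eq_bigr => k _; rewrite !mxE.
Qed.

Lemma ball_eq_derive (V W : normedModType R) (F G : V -> W) x v (d : R) : 0 < d ->
  (forall y, `|y - x| < d -> F y = G y) -> 'D_v F x = 'D_v G x.
Proof. by move=> d0 FG; apply: near_eq_derive; apply: (near_eps d0 FG). Qed.

Lemma jac_near n m (F G : 'rV[R]_n -> 'rV[R]_m) (x : 'rV[R]_n) (d : R) : 0 < d ->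
  (forall y : 'rV[R]_n, `|y - x| < d -> F y = G y) -> jac F x = jac G x.
Proof.
move=> d0 FG; apply/matrixP => i j; rewrite !mxE.
by rewrite (@ball_eq_derive 'rV[R]_n 'rV[R]_m F G x (delta_mx 0 i) d d0 FG).
Qed.

Lemma jac_unique n m (F : 'rV[R]_n -> 'rV[R]_m) (x : 'rV[R]_n) (M : 'M[R]_(n, m)) :
  (forall v : 'rV[R]_n, 'D_v F x = v *m M) -> jac F x = M.
Proof. by move=> H; apply/matrixP => i j; rewrite mxE H -rowE mxE. Qed.

Lemma jac_id n (x : 'rV[R]_n) : jac (fun y => y) x = 1%:M.
Proof. by apply: jac_unique => v; rewrite derive_id mulmx1. Qed.

Lemma jac_translate n m (F : 'rV[R]_n -> 'rV[R]_m) (x c : 'rV[R]_n) :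
  differentiable F (x + c) ->
  differentiable (fun y => F (y + c)) x /\ jac (fun y => F (y + c)) x = jac F (x + c).
Proof.
move=> dF; have [|dG DG] := @eps_jac R n m (fun y => F (y + c)) x (jac F (x + c)).
  move=> e e0; have [d d0 H] := jac_eps dF e0.
  exists d => // v vd; rewrite (_ : x + v + c = x + c + v); last by rewrite addrAC.
  exact: H.
exact: (conj dG (jac_unique DG)).
Qed.

Lemma jac_mulmxr n m p (F : 'rV[R]_n -> 'rV[R]_m) (B : 'M[R]_(m, p)) (x : 'rV[R]_n) :
  differentiable F x -> jac (fun y => F y *m B) x = jac F x *m B.
Proof.
move=> dF; have [_ D] := derive_mulmx B dF.
by apply: jac_unique => v; rewrite D jacP // mulmxA.
Qed.

Lemma jac_addr n m (F : 'rV[R]_n -> 'rV[R]_m) (x : 'rV[R]_n) c : differentiable F x ->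
  jac (fun y => F y + c) x = jac F x.
Proof.
move=> dF; have [|dG DG] := @eps_jac R n m (fun y => F y + c) x (jac F x).
  move=> e e0; have [d d0 H] := jac_eps dF e0.
  exists d => // v vd; rewrite (_ : F (x + v) + c - (F x + c) = F (x + v) - F x); last first.
    by rewrite opprD addrACA subrr addr0.
  exact: H.
exact: jac_unique.
Qed.

(** The bound is applied to small multiples of v, where the first order expansion is as accurate as
    desired, and then rescaled. *)
Lemma lip_jac n m (F : 'rV[R]_n -> 'rV[R]_m) (x : 'rV[R]_n) (L d : R) : 0 < d ->
  differentiable F x -> (forall v : 'rV[R]_n, `|v| < d -> `|F (x + v) - F x| <= L * `|v|) ->
  forall v : 'rV[R]_n, `|v *m jac F x| <= L * `|v|.
Proof.
move=> d0 dF H v; apply/ler_addgt0Pr => e e0.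
have [v0|v0] := eqVneq v 0; first by rewrite v0 mul0mx !normr0 mulr0 add0r ltW.
have vp : 0 < `|v| by rewrite normr_gt0.
have [d' d'0 H'] := jac_eps dF (divr_gt0 e0 vp).
pose s := Num.min d d' / (2 * `|v|).
have s0 : 0 < s by rewrite divr_gt0 ?mulr_gt0 // lt_min d0.
have sv : `|s *: v| < Num.min d d'.
  rewrite normrZ gtr0_norm // /s -mulrA invfM -[X in _ * (X * _)]mulrC.
  rewrite -!mulrA [X in _ * X](_ : _ = 2^-1); last by field; rewrite normr_eq0.
  by rewrite ltr_pdivrMr // mulrDr mulr1 ltrDl lt_min d0.
move: sv; rewrite lt_min => /andP[/H h1 /H' h2].
have : `|(s *: v) *m jac F x| <= L * `|s *: v| + e / `|v| * `|s *: v|.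
  apply: le_trans (lerD h1 h2); rewrite -[X in _ + X]normrN.
  apply: le_trans (ler_normD _ _).
  by rewrite opprB addrC subrK.
have ns : `|s| = s by exact: gtr0_norm.
have nZ k (w : 'rV[R]_k) : `|s *: w| = s * `|w| by rewrite normrZ ns.
rewrite -scalemxAl !nZ => h.
rewrite -(ler_pM2l s0); apply: le_trans h _.
rewrite mulrDr; apply: lerD; first by rewrite mulrCA.
by rewrite mulrCA mulfVK ?gt_eqF.
Qed.

Lemma jac_cont n m (F : 'rV[R]_n -> 'rV[R]_m) U (x : 'rV[R]_n) : Ck_on 1 U F -> U x ->
  forall e : R, 0 < e -> exists2 d : R, 0 < d & forall y, U y -> `|y - x| < d ->
  `|jac F y - jac F x| < e.
Proof.
move=> [_ C] Ux e e0; pose P (i : 'I_n) d := forall y, U y -> `|y - x| < d ->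
  `|'D_(delta_mx 0 i) F y - 'D_(delta_mx 0 i) F x| < e / 2.
have [||d d0 Hd] := finite_eps (P := P).
- move=> i d d' _ dd H y Uy yx; apply: H => //; exact: lt_le_trans yx dd.
- move=> i; have [|d d0 H] := (cont_eps _ _).1 (C (delta_mx 0 i) x Ux) (e / 2); first exact: divr_gt0.
  by exists d => // y _; apply: H.
exists d => // y Uy yx; apply: (@le_lt_trans _ _ (e / 2)); last by rewrite ltr_pdivrMr // mulr_natr mulr2n ltrDl.
apply: mx_norm_le => [|i j]; first by rewrite divr_ge0 // ltW.
rewrite sub_mxE !mxE -sub_mxE; apply: le_trans (mx_entry_le _ _ _) _.
by apply/ltW/Hd.
Qed.

Lemma row_mx0_norm n m (w : 'rV[R]_m) : `|row_mx (0 : 'rV[R]_n) w| <= `|w|.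
Proof.
apply: mx_norm_le => // i j; rewrite mxE.
by case: splitP => k _; rewrite ?mxE ?normr0 //; apply: mx_entry_le.
Qed.

End JacobianRules.

(** * Spectral projections *)

Section SpectralProjection.
Context {R : realType} (n : nat).
Implicit Types (A M : 'M[R]_n) (u v : 'rV[R]_n).

(** The square is needed because the return differential may have a Jordan block at 1: a vector v
    tangent to the family of orbits satisfies v A = v + c X, where c records the change of the
    period and X A = X. *)
Definition unip A : 'M[R]_n := (1 - A) * (1 - A).

Definition partial_proj A m : 'M[R]_n := \sum_(j < m) j.+1%:R *: (A ^+ j * unip A).

Definition proj_limit A M : Prop :=
  forall e : R, 0 < e -> exists m0, forall m, (m0 <= m)%N -> `|partial_proj A m - M| < e.

(* The sum over j of (j+1) A^j (1-A)^2 is the spectral projection along the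
   eigenvalue 1, since (1-z)^2 times the sum of (j+1) z^j is 1. *)
Definition spectral_proj A : 'M[R]_n := xget 0 [set M | proj_limit A M].

Lemma mx_norm_of_rows m M (c : R) : (forall v, `|v *m M| <= c * `|v|) -> n = m.+1 -> `|M| <= c.
Proof.
move=> H nm; have nd (i : 'I_n) : `|delta_mx 0 i : 'rV[R]_n| <= 1.
  by apply: mx_norm_le => // a b; rewrite mxE; case: (_ && _); rewrite ?normr1 ?normr0.
have i0 : 'I_n by rewrite nm; exact: ord0.
have c0 : 0 <= c.
  rewrite leNgt; apply/negP => c0.
  have := le_trans (normr_ge0 _) (H (delta_mx 0 i0)).
  rewrite nmulr_rge0 // normr_le0 => /eqP/rowP/(_ i0).
  by rewrite !mxE !eqxx => /eqP; rewrite oner_eq0.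
apply: mx_norm_le => // i j.
have -> : M i j = ((delta_mx 0 i : 'rV[R]_n) *m M) 0 j by rewrite -rowE mxE.
apply: le_trans (mx_entry_le _ _ _) _; apply: le_trans (H _) _.
by rewrite -[leRHS]mulr1 ler_wpM2l.
Qed.

Lemma row_mulmx_norm v M : `|v *m M| <= n%:R * `|M| * `|v|.
Proof. by apply: le_trans (mulmx_norm _ _) _; rewrite mulrAC. Qed.

Variables (A : 'M[R]_n) (K q : R).
Hypotheses (n0 : (0 < n)%N) (K0 : 0 <= K) (q01 : 0 < q < 1).
Hypothesis decay : forall m v, `|v *m (A ^+ m * unip A)| <= K * q ^+ m * `|v|.

Let q0 : 0 < q. Proof. by case/andP: q01. Qed.
Let q1 : q < 1. Proof. by case/andP: q01. Qed.
Let p0 : 0 < 1 - q. Proof. by rewrite subr_gt0. Qed.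

(** Closed form of the sum over j >= m of K (j + 1) q^j, which bounds the remainder of the series
    for the projection. *)
Definition proj_tail (m : nat) : R := K / (1 - q) * ((m%:R + (1 - q)^-1) * q ^+ m).

Lemma proj_tail_step m : proj_tail m - proj_tail m.+1 = K * (m.+1%:R * q ^+ m).
Proof. by rewrite /proj_tail exprS -natr1; field; rewrite gt_eqF. Qed.

Lemma proj_tail_ge0 m : 0 <= proj_tail m.
Proof.
rewrite /proj_tail !mulr_ge0 ?invr_ge0 ?exprn_ge0 ?(ltW q0) ?(ltW p0) //.
by rewrite addr_ge0 ?invr_ge0 ?(ltW p0).
Qed.

Lemma proj_tail_small (e : R) : 0 < e -> exists m0, forall m, (m0 <= m)%N -> proj_tail m < e.
Proof.
(* A ratio strictly between q and 1 absorbs the factor m: m q^m <= q / (r - q) r^m. *)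
move=> e0; pose r := (1 + q) / 2.
have hq0 := q0; have hq1 := q1.
have r01 : 0 <= r < 1 by rewrite /r; apply/andP; split; qlra.
have qr : q < r by rewrite /r; qlra.
have B m : (m%:R + (1 - q)^-1) * q ^+ m <= ((r - q)^-1 * q + (1 - q)^-1) * r ^+ m.
  have rq0 : 0 < r - q by rewrite subr_gt0.
  have H : m%:R * q ^+ m <= (r - q)^-1 * q * r ^+ m.
    rewrite -mulrA ler_pdivlMl //.
    elim: m => [|m IH]; first by rewrite mul0r mulr0 expr0 mulr1 ltW.
    have rm : q ^+ m <= r ^+ m by rewrite lerXn2r ?nnegrE ?ltW // (lt_trans q0).
    rewrite (_ : (r - q) * (m.+1%:R * q ^+ m.+1) = (r - q) * (m%:R * (q * q ^+ m)) + (r - q) * (q * q ^+ m)); last first.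
      by rewrite exprS -natr1; ring.
    have h1 : (r - q) * (m%:R * (q * q ^+ m)) <= q * (q * r ^+ m).
      by rewrite (_ : _ * _ = q * ((r - q) * (m%:R * q ^+ m))) ?ler_wpM2l ?(ltW q0) //; ring.
    have h2 : (r - q) * (q * q ^+ m) <= (r - q) * (q * r ^+ m).
      by rewrite !ler_wpM2l ?(ltW rq0) ?(ltW q0).
    apply: le_trans (lerD h1 h2) _; rewrite exprS.
    by rewrite le_eqVlt; apply/orP; left; apply/eqP; ring.
  rewrite mulrDl [leRHS]mulrDl; apply: lerD => //.
  by rewrite ler_wpM2l ?invr_ge0 ?(ltW p0) // lerXn2r ?nnegrE ?ltW // (lt_trans q0).
have [m0 H0] := geometric_small (K / (1 - q) * ((r - q)^-1 * q + (1 - q)^-1)) r01 e0.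
exists m0 => m /H0; apply: le_lt_trans.
rewrite /proj_tail -[leRHS]mulrA; apply: ler_wpM2l; last exact: B.
by rewrite divr_ge0 // ltW.
Qed.

Lemma decay_mx m : `|A ^+ m * unip A| <= K * q ^+ m.
Proof.
apply: (@mx_norm_of_rows n.-1); last by rewrite prednK.
exact: decay.
Qed.

Lemma spectral_proj_tail m : `|partial_proj A m - spectral_proj A| <= proj_tail m.
Proof.
have step k : `|partial_proj A k.+1 - partial_proj A k| <= proj_tail k - proj_tail k.+1.
  rewrite /partial_proj big_ord_recr /= addrAC subrr add0r normrZ normr_nat proj_tail_step.
  by rewrite mulrCA ler_wpM2l // decay_mx.
have [M HM] := telescoping_limit proj_tail_ge0 step.
have LM : proj_limit A M.
  move=> e e0; have [m0 H0] := proj_tail_small e0; exists m0 => k /H0.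
  by apply: le_lt_trans.
rewrite /spectral_proj; case: xgetP => [M' EM' LM'|/(_ M)] //.
suff -> : M' = M by [].
apply/eqP; rewrite -subr_eq0 -normr_le0; apply/ler_addgt0Pr => e e0; rewrite add0r.
have [m1 H1] := LM _ (divr_gt0 e0 (ltr0Sn R 1)).
have [m2 H2] := LM' _ (divr_gt0 e0 (ltr0Sn R 1)).
have h1 := H1 (maxn m1 m2) (leq_maxl _ _); have h2 := H2 (maxn m1 m2) (leq_maxr _ _).
have -> : M' - M = (partial_proj A (maxn m1 m2) - M) - (partial_proj A (maxn m1 m2) - M').
  by rewrite opprB [RHS]addrC addrA addrNK.
apply: le_trans (ler_normB _ _) _; rewrite [leRHS](splitr e); apply: lerD; exact/ltW.
Qed.

Lemma eq_of_tail p r (M M' : 'M[R]_(p, r)) (c : R) : 0 <= c ->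
  (forall m, `|M - M'| <= c * proj_tail m) -> M = M'.
Proof.
move=> c0 H; apply/eqP; rewrite -subr_eq0 -normr_le0; apply/ler_addgt0Pr => e e0.
rewrite add0r; have [m Hm] := proj_tail_small (divr_gt0 e0 (ltr_wpDl c0 ltr01)).
apply: le_trans (H m) _; apply: le_trans (_ : (c + 1) * (e / (c + 1)) <= _).
  apply: ler_pM => //; rewrite ?proj_tail_ge0 ?lerDl //.
  exact/ltW/Hm.
by rewrite mulrCA divff ?mulr1 // gt_eqF // ltr_wpDl.
Qed.

(** Telescoping leaves two powers of A. This form shows the effect of [unip A] on the limit and the
    continuity of the partial sums in A. *)
Lemma partial_projE m : partial_proj A m = 1 - (m.+1%:R *: A ^+ m - m%:R *: A ^+ m.+1).
Proof.
elim: m => [|m IH].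
  by rewrite /partial_proj big_ord0 scale1r scale0r subr0 expr0 subrr.
rewrite /partial_proj big_ord_recr /= -/(partial_proj A m) IH /unip mulrBl mul1r mulrBr mulrBr.
rewrite !mulrBr mulr1 !mulrA -!exprSr; set B := A ^+ m; set B1 := A ^+ m.+1; set B2 := A ^+ m.+2.
apply/matrixP => i j; rewrite mulr1 !mxE -!natr1; ring.
Qed.

Lemma unip_comm m : A ^+ m * unip A = unip A * A ^+ m.
Proof.
suff H : GRing.comm (unip A) A by rewrite (commrX m H).
by rewrite /unip; apply: commr_sym; apply: commrM; apply: commrB; [exact: commr1|exact: commr_refl|exact: commr1|exact: commr_refl].
Qed.

Let sAl (a : R) (B D : 'M[R]_n) : (a *: B) * D = a *: (B * D).
Proof. exact: (esym (scalemxAl a B D)). Qed.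

Let sAr (a : R) (B D : 'M[R]_n) : B * (a *: D) = a *: (B * D).
Proof. exact: (esym (scalemxAr a B D)). Qed.

Lemma partial_proj_comm m : partial_proj A m * unip A = unip A * partial_proj A m.
Proof.
rewrite /partial_proj mulr_suml mulr_sumr; apply: eq_bigr => j _.
by rewrite sAl sAr mulrA -unip_comm.
Qed.

(** After multiplication by [unip A] the two powers in [partial_projE] decay, and only the term 1
    survives. *)
Lemma unip_proj : unip A * spectral_proj A = unip A.
Proof.
apply: (@eq_of_tail _ _ _ _ (n%:R * `|unip A| + 2)) => [|m]; first by rewrite addr_ge0 ?mulr_ge0.
have h : `|unip A * partial_proj A m - unip A| <= 2 * proj_tail m.
  rewrite -partial_proj_comm partial_projE mulrBl mul1r addrC addrA addNr add0r normrN mulrBl.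
  rewrite !sAl; apply: le_trans (ler_normB _ _) _; rewrite !normrZ !normr_nat.
  have tail k : k.+1%:R * `|A ^+ k * unip A| <= proj_tail k.
    apply: le_trans (_ : proj_tail k - proj_tail k.+1 <= _).
      by rewrite proj_tail_step mulrCA ler_wpM2l // decay_mx.
    by rewrite lerBlDr lerDl proj_tail_ge0.
  rewrite [leRHS](_ : _ = proj_tail m + proj_tail m); last by ring.
  apply: lerD; first exact: tail.
  apply: le_trans (_ : m.+2%:R * `|A ^+ m.+1 * unip A| <= _).
    by rewrite ler_wpM2r // ler_nat !leqW.
  apply: le_trans (tail _) _; rewrite -subr_ge0 proj_tail_step.
  by rewrite !mulr_ge0 ?exprn_ge0 ?(ltW q0).
have -> : unip A * spectral_proj A - unip A =
   unip A * partial_proj A m - unip A - unip A * (partial_proj A m - spectral_proj A).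
  by rewrite mulrBr opprB [RHS]addrC addrA subrK.
apply: le_trans (ler_normB _ _) _; rewrite addrC mulrDl; apply: lerD => //.
apply: le_trans (mulmx_norm _ _) _; rewrite ler_wpM2l ?mulr_ge0 //.
exact: spectral_proj_tail.
Qed.

(** Every partial sum Q ends with the factor [unip A], which the limit P leaves unchanged, so Q P =
    Q; then Q tends to P. *)
Lemma spectral_proj_idem : spectral_proj A * spectral_proj A = spectral_proj A.
Proof.
apply: (@eq_of_tail _ _ _ _ (n%:R * `|spectral_proj A| + 1)) => [|m].
  by rewrite addr_ge0 ?mulr_ge0.
have E : partial_proj A m * spectral_proj A = partial_proj A m.
  rewrite /partial_proj mulr_suml; apply: eq_bigr => j _.
  by rewrite sAl -mulrA unip_proj.
set P := spectral_proj A in E *; set Q := partial_proj A m in E.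
have -> : P * P - P = (Q - P) - (Q - P) * P.
  by rewrite mulrBl E; apply/matrixP => i j; rewrite !mxE; ring.
have T : `|Q - P| <= proj_tail m := spectral_proj_tail m.
apply: le_trans (ler_normB _ _) _.
rewrite [leRHS](_ : _ = proj_tail m + n%:R * proj_tail m * `|P|); last by ring.
apply: lerD => //; apply: le_trans (mulmx_norm _ _) _.
by rewrite ler_wpM2r // ler_wpM2l.
Qed.

Lemma spectral_proj_unip : spectral_proj A * unip A = unip A.
Proof.
apply: (@eq_of_tail _ _ _ _ (n%:R * `|unip A| * 2)) => [|m]; first by rewrite !mulr_ge0.
have E := unip_proj; have C := partial_proj_comm m.
set P := spectral_proj A in E *; set Q := partial_proj A m in C.
have -> : P * unip A - unip A = unip A * (Q - P) - (Q - P) * unip A.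
  by rewrite mulrBl mulrBr E C; apply/matrixP => i j; rewrite !mxE; ring.
have T : `|Q - P| <= proj_tail m := spectral_proj_tail m.
apply: le_trans (ler_normB _ _) _.
rewrite [leRHS](_ : _ = n%:R * `|unip A| * proj_tail m + n%:R * proj_tail m * `|unip A|); last by ring.
apply: lerD; apply: le_trans (mulmx_norm _ _) _; first by rewrite ler_wpM2l ?mulr_ge0.
by rewrite ler_wpM2r // ler_wpM2l.
Qed.

Lemma spectral_proj_ker v : v *m spectral_proj A = 0 <-> v *m unip A = 0.
Proof.
split=> H; first by rewrite -spectral_proj_unip mulmxA H mul0mx.
have E m : v *m partial_proj A m = 0.
  rewrite /partial_proj mulmx_sumr big1 // => j _.
  by rewrite -scalemxAr unip_comm mulmxA H mul0mx scaler0.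
apply: (@eq_of_tail _ _ _ _ (n%:R * `|v|)) => [|m]; first by rewrite mulr_ge0.
rewrite subr0 (_ : v *m _ = - (v *m (partial_proj A m - spectral_proj A))); last first.
  by rewrite mulmxBr E sub0r opprK.
rewrite normrN; apply: le_trans (mulmx_norm _ _) _.
by rewrite ler_wpM2l ?mulr_ge0 // spectral_proj_tail.
Qed.

(** Multiplication by A^m shifts the series by m places, so each term of its majorant gains the
    factor q^m. *)
Lemma spectral_proj_decay v m : v *m spectral_proj A = v ->
  `|v *m A ^+ m| <= proj_tail 0 * q ^+ m * `|v|.
Proof.
move=> H; rewrite -[in leLHS]H; apply/ler_addgt0Pr => e e0.
pose c := n%:R * (n%:R * `|v|) * `|A ^+ m|.
have c0 : 0 <= c by rewrite !mulr_ge0.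
have [k Hk] := proj_tail_small (divr_gt0 e0 (ltr_wpDl c0 ltr01)).
set P := spectral_proj A; set Q := partial_proj A k.
have T : `|Q - P| <= proj_tail k := spectral_proj_tail k.
have -> : v *m P *m A ^+ m = v *m Q *m A ^+ m - v *m (Q - P) *m A ^+ m.
  by rewrite mulmxBr mulmxBl opprB addrC subrK.
apply: le_trans (ler_normB _ _) _; apply: lerD; last first.
  apply: le_trans (mulmx_norm _ _) _.
  apply: le_trans (_ : c * `|Q - P| <= _).
    rewrite /c -!mulrA ler_wpM2l // [leRHS]mulrC -[leRHS]mulrA.
    rewrite [leRHS](_ : _ = `|A ^+ m| * (n%:R * (`|v| * `|Q - P|))); last by ring.
    rewrite [leLHS]mulrC ler_wpM2l //; apply: le_trans (mulmx_norm _ _) _.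
    by rewrite -mulrA.
  apply: le_trans (_ : (c + 1) * (e / (c + 1)) <= _).
    apply: ler_pM => //; rewrite ?lerDl //.
    exact/(le_trans T)/ltW/Hk.
  by rewrite mulrCA divff ?mulr1 // gt_eqF // ltr_wpDl.
rewrite /Q /partial_proj mulmx_sumr mulmx_suml; apply: le_trans (ler_norm_sum _ _ _) _.
apply: le_trans (_ : \sum_(j < k) (proj_tail j - proj_tail j.+1) * (q ^+ m * `|v|) <= _).
  apply: ler_sum => j _; rewrite proj_tail_step -scalemxAr -scalemxAl normrZ normr_nat.
  have -> : v *m (A ^+ j * unip A) *m A ^+ m = v *m (A ^+ (j + m) * unip A).
    rewrite -mulmxA; congr (_ *m _); rewrite exprD -[RHS]mulrA (unip_comm m).
    exact: esym (mulmxA _ _ _).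
  have := ler_wpM2l (ler0n R j.+1) (decay (j + m) v); move/le_trans; apply.
  by rewrite exprD le_eqVlt; apply/orP; left; apply/eqP; ring.
rewrite -mulr_suml -mulrA ler_wpM2r ?mulr_ge0 ?exprn_ge0 ?(ltW q0) //.
rewrite -(big_mkord xpredT (fun j => proj_tail j - proj_tail j.+1)).
rewrite (eq_bigr (fun j => - (proj_tail j.+1 - proj_tail j))) => [|j _]; last by rewrite opprB.
by rewrite sumrN telescope_sumr // opprB lerBlDr lerDl proj_tail_ge0.
Qed.

End SpectralProjection.

Section UnipotentPart.
Context {R : realType} (n : nat).
Implicit Types (A B J : 'M[R]_n) (v : 'rV[R]_n).

(** On the kernel of (1 - A)^2, the matrix A - 1 maps into vectors fixed by A, so backward iterates
    are affine in m. Here the linear bound in backward time originates. *)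
Lemma unip_back A B v m : A *m B = 1%:M -> v *m unip A = 0 ->
  v *m B ^+ m = v - m%:R *: (v *m (A - 1)).
Proof.
move=> AB H; have H1 : v *m (A - 1) *m (A - 1) = 0.
  rewrite -H /unip -mulmxA; congr (_ *m _).
  by rewrite -[1 - A]opprB -[RHS]/(- (A - 1) * - (A - 1)) mulrNN.
have H2 : v *m (A - 1) *m B = v *m (A - 1).
  have E : v *m (A - 1) *m A = v *m (A - 1).
    by move/eqP: H1; rewrite mulmxBr mulmx1 subr_eq0 => /eqP.
  by rewrite -[in LHS]E -mulmxA AB mulmx1.
have H3 : v *m B = v - v *m (A - 1).
  have : v *m (A - 1) *m B = v - v *m B.
    by rewrite mulmxBr mulmx1 mulmxBl -mulmxA AB mulmx1.
  by rewrite H2 => ->; rewrite opprB addrC subrK.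
elim: m => [|m IH]; first by rewrite expr0 mulmx1 scale0r subr0.
rewrite exprSr -[X in _ *m X]/(B ^+ m *m B) mulmxA IH mulmxBl H3 -scalemxAl H2.
by apply/rowP => j; rewrite !mxE -natr1; ring.
Qed.

Lemma unip_conj A B J J' : J *m J' = 1%:M -> A *m J = J *m B -> unip A *m J = J *m unip B.
Proof.
move=> JJ E; have E1 : (1 - A) *m J = J *m (1 - B).
  by rewrite mulmxBl mulmxBr mul1mx mulmx1 E.
by rewrite /unip -[LHS]mulmxA E1 mulmxA E1 -mulmxA.
Qed.

(** A conjugation intertwines the partial sums; a number of terms common to both series makes both
    remainders small. *)
Lemma spectral_proj_conj (K q K' q' : R) A B J J' : (0 < n)%N ->
  0 <= K -> 0 < q < 1 -> (forall m v, `|v *m (A ^+ m * unip A)| <= K * q ^+ m * `|v|) ->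
  0 <= K' -> 0 < q' < 1 -> (forall m v, `|v *m (B ^+ m * unip B)| <= K' * q' ^+ m * `|v|) ->
  J *m J' = 1%:M -> A *m J = J *m B -> spectral_proj A *m J = J *m spectral_proj B.
Proof.
move=> n0 K0 q01 DA K'0 q'01 DB JJ E; have EU := unip_conj JJ E.
have EP m : A ^+ m *m J = J *m B ^+ m.
  elim: m => [|m IH]; first by rewrite !expr0 mul1mx mulmx1.
  by rewrite !exprS -[LHS]mulmxA IH mulmxA E -mulmxA.
have EQ m : partial_proj A m *m J = J *m partial_proj B m.
  rewrite /partial_proj mulmx_suml mulmx_sumr; apply: eq_bigr => j _.
  by rewrite -scalemxAl -scalemxAr -[_ *m J]mulmxA EU mulmxA EP -mulmxA.
apply/eqP; rewrite -subr_eq0 -normr_le0; apply/ler_addgt0Pr => e e0; rewrite add0r.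
pose c := n%:R * `|J| + 1; have c0 : 0 < c by rewrite ltr_wpDl // mulr_ge0.
have [m1 H1] := proj_tail_small K0 q01 (divr_gt0 (divr_gt0 e0 (ltr0Sn R 1)) c0).
have [m2 H2] := proj_tail_small K'0 q'01 (divr_gt0 (divr_gt0 e0 (ltr0Sn R 1)) c0).
set m := maxn m1 m2.
have h1 := le_lt_trans (spectral_proj_tail n0 K0 q01 DA m) (H1 m (leq_maxl _ _)).
have h2 := le_lt_trans (spectral_proj_tail n0 K'0 q'01 DB m) (H2 m (leq_maxr _ _)).
have -> : spectral_proj A *m J - J *m spectral_proj B =
    J *m (partial_proj B m - spectral_proj B) - (partial_proj A m - spectral_proj A) *m J.
  by rewrite mulmxBr mulmxBl EQ; apply/matrixP => i j; rewrite !mxE; ring.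
have bound (M : 'M[R]_n) : `|M| < e / 2 / c -> n%:R * `|J| * `|M| <= e / 2.
  move=> h; apply: le_trans (_ : c * (e / 2 / c) <= _).
    by apply: ler_pM; rewrite ?mulr_ge0 ?lerDl // ltW.
  by rewrite mulrCA divff ?mulr1 // gt_eqF.
rewrite [leRHS](splitr e); apply: le_trans (ler_normB _ _) _; apply: lerD.
  by apply: le_trans (mulmx_norm _ _) _; apply: bound.
apply: le_trans (mulmx_norm _ _) _.
by have := bound _ h1; rewrite mulrAC.
Qed.

End UnipotentPart.

(** * Return times, distances to orbits, division by the field *)

Section Orbits.
Context {R : realType} (N : nat) (X : 'rV[R]_N -> 'rV[R]_N).
Implicit Types (x y : 'rV[R]_N).

Definition ret_time x (T : R) : Prop := [/\ 0 < T,
  exists k, reaches X x T (translate k x) &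
  forall s k, 0 < s < T -> ~ reaches X x s (translate k x)].

Definition orbit x : set 'rV[R]_N :=
  [set y | exists t : R, exists2 z, reaches X x t z & same_point z y].

Definition flow_total x : Prop := forall t, reaches X x t (flow X t x).

Lemma dist_to_le (C : set 'rV[R]_N) x c : C c -> dist_to C x <= `|x - c|.
Proof.
move=> Cc; apply: ge_inf; last by exists c.
by exists 0 => _ [z _ <-].
Qed.

Lemma dist_to_lt (C : set 'rV[R]_N) x (r : R) : C !=set0 -> dist_to C x < r ->
  exists2 c, C c & `|x - c| < r.
Proof.
move=> [c0 Cc0] h; have [|z [c Cc <-] zr] := inf_lt _ h; last by exists c.
by exists `|x - c0|; exists c0.
Qed.

Lemma dist_to_ge0 (C : set 'rV[R]_N) x : C !=set0 -> 0 <= dist_to C x.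
Proof.
by move=> [c0 Cc0]; apply: lb_le_inf => [|_ [z _ <-] //]; exists `|x - c0|, c0.
Qed.

(** The projection onto the hyperplane v_i = 0 along w, provided w_i is not 0. It is the concrete
    form of the quotient by the line of w. *)
Definition along (w : 'rV[R]_N) i : 'M[R]_N := 1%:M - delta_mx i 0 *m ((w 0 i)^-1 *: w).

Lemma mul_delta (v : 'rV[R]_N) i : v *m delta_mx i (0 : 'I_1) = (v 0 i)%:M.
Proof.
apply/rowP => j; rewrite !ord1 !mxE eqxx mulr1n (bigD1 i) //= mxE !eqxx mulr1.
by rewrite big1 ?addr0 // => k /negbTE ki; rewrite mxE ki mulr0.
Qed.

Lemma alongE (w : 'rV[R]_N) i (v : 'rV[R]_N) : v *m along w i = v - (v 0 i / w 0 i) *: w.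
Proof.
rewrite mulmxBr mulmx1 mulmxA -scalemxAr; congr (_ - _).
by rewrite mul_delta mul_scalar_mx scalerA mulrC.
Qed.

Lemma along_self (w : 'rV[R]_N) i : w 0 i != 0 -> w *m along w i = 0.
Proof. by move=> h; rewrite alongE divff // scale1r subrr. Qed.

(** With t a return time, this is the linear counterpart of exponential stability of the orbit
    inside its level set; [along] divides out the direction of the field. *)
Definition contracts (x : 'rV[R]_N) (t : R) i (K q : R) : Prop :=
  [/\ X x 0 i != 0, 0 <= K, 0 < q < 1 & forall m (u : 'rV[R]_N),
    u *m jac (@Lambda R N) x = 0 ->
    `|u *m jac (flow X t) x ^+ m *m along (X x) i| <= K * q ^+ m * `|u|].

End Orbits.

Section MatrixContinuity.
Context {R : realType} (V : normedModType R).

Definition mcont m n (F : R -> V -> 'M[R]_(m, n)) (t : R) (x : V) : Prop :=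
  forall e : R, 0 < e -> exists2 d : R, 0 < d & forall s y, `|s - t| < d -> `|y - x| < d ->
    `|F s y - F t x| < e.

Lemma mcont_mul m n p (F : R -> V -> 'M[R]_(m, n)) (G : R -> V -> 'M[R]_(n, p)) t x :
  mcont F t x -> mcont G t x -> mcont (fun s y => F s y *m G s y) t x.
Proof.
move=> HF HG e e0; pose c := n%:R * (`|F t x| + `|G t x| + 1) + 1.
have c0 : 0 < c by rewrite ltr_wpDl // mulr_ge0 // !addr_ge0.
pose e1 := Num.min 1 (e / c).
have e10 : 0 < e1 by rewrite lt_min ltr01 divr_gt0.
have [e11 e1e] : e1 <= 1 /\ e1 <= e / c by rewrite /e1 !ge_min !lexx orbT.
have [d1 d10 H1] := HF e1 e10; have [d2 d20 H2] := HG e1 e10.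
exists (Num.min d1 d2); first by rewrite lt_min d10.
move=> s y; rewrite !lt_min => /andP[s1 s2] /andP[y1 y2].
have h1 := H1 s y s1 y1; have h2 := H2 s y s2 y2.
have -> : F s y *m G s y - F t x *m G t x = (F s y - F t x) *m (G s y - G t x) +
    (F s y - F t x) *m G t x + F t x *m (G s y - G t x).
  by rewrite !mulmxBl !mulmxBr; apply/matrixP => i j; rewrite !mxE; ring.
apply: (@le_lt_trans _ _ (n%:R * (`|F t x| + `|G t x| + 1) * e1)); last first.
  apply: lt_le_trans (_ : c * e1 <= _); first by rewrite ltr_pM2r // /c ltrDl.
  by rewrite mulrC -ler_pdivlMr.
apply: le_trans (ler_normD _ _) _; apply: le_trans (lerD (ler_normD _ _) (lexx _)) _.
have a1 : `|(F s y - F t x) *m (G s y - G t x)| <= n%:R * e1.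
  apply: le_trans (mulmx_norm _ _) _; rewrite -mulrA ler_wpM2l //.
  rewrite -[leRHS]mulr1; apply: ler_pM => //; [exact: ltW|exact/ltW/(lt_le_trans h2)].
have a2 : `|(F s y - F t x) *m G t x| <= n%:R * (e1 * `|G t x|).
  by apply: le_trans (mulmx_norm _ _) _; rewrite -mulrA ler_wpM2l // ler_wpM2r // ltW.
have a3 : `|F t x *m (G s y - G t x)| <= n%:R * (`|F t x| * e1).
  by apply: le_trans (mulmx_norm _ _) _; rewrite -mulrA ler_wpM2l // ler_wpM2l // ltW.
apply: le_trans (lerD (lerD a1 a2) a3) _.
by rewrite le_eqVlt; apply/orP; left; apply/eqP; ring.
Qed.

Lemma mcont_pow n (F : R -> V -> 'M[R]_n) t x k : mcont F t x ->
  mcont (fun s y => F s y ^+ k) t x.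
Proof.
move=> HF; elim: k => [|k IH]; last first.
  move=> e /(mcont_mul HF IH)[d d0 H]; exists d => // s y sd yd.
  by rewrite !exprS; exact: H.
by move=> e e0; exists 1 => // s y _ _; rewrite !expr0 subrr normr0.
Qed.

End MatrixContinuity.

(** * Coordinates mixing angles and cross ratios *)

Section Gather.
Context {R : realType} (N : nat).
Implicit Types (x u v : 'rV[R]_N) (l : 'rV[R]_(N - 3)).
Hypothesis HN : (4 <= N)%N.

Definition head_mx : 'M[R]_N := \matrix_(i, j) ((i == j) && (i < 3)%N)%:R.
Definition tail_mx : 'M[R]_(N - 3, N) := \matrix_(k, j) (j == (k + 3)%N :> nat)%:R.

(** Three angles are kept from [u] and the remaining N - 3 places are filled with [l]. This squares
    up systems in which the cross ratios replace redundant angles. *)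
Definition gather u l : 'rV[R]_N := u *m head_mx + l *m tail_mx.

Lemma gather_head u l (j : 'I_N) : (j < 3)%N -> gather u l 0 j = u 0 j.
Proof.
move=> j3; rewrite !mxE (bigD1 j) //= mxE eqxx j3 mulr1 big1 => [|i /negbTE ij]; last first.
  by rewrite mxE ij mulr0.
rewrite big1 ?addr0 // => k _; rewrite mxE; case: eqP => [E|]; last by rewrite mulr0.
by move: j3; rewrite E ltnNge leq_addl.
Qed.

Lemma gather_tail u l (k : 'I_(N - 3)) : gather u l 0 (tail_index k) = l 0 k.
Proof.
rewrite !mxE [X in X + _]big1 => [|i _]; last first.
  rewrite mxE; case: eqP => [->|]; last by rewrite mulr0.
  by rewrite /= ltnNge leq_addl mulr0.
rewrite add0r (bigD1 k) //= mxE eqxx mulr1 big1 ?addr0 // => j /negbTE jk.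
by rewrite mxE /= eqn_add2r [(k == j :> nat)](_ : _ = (k == j)) // eq_sym jk mulr0.
Qed.

Lemma head_or_tail (j : 'I_N) : (j < 3)%N \/ exists k, j = tail_index k.
Proof.
have [|j3] := ltnP j 3; [by left|right].
have jN : (j - 3 < N - 3)%N by rewrite ltn_sub2r // (leq_ltn_trans j3).
by exists (Ordinal jN); apply/val_inj; rewrite /= subnK.
Qed.

Lemma gather_inj u u' l l' : gather u l = gather u' l' ->
  l = l' /\ forall j : 'I_N, (j < 3)%N -> u 0 j = u' 0 j.
Proof.
move=> E; split=> [|j j3]; last by rewrite -(gather_head u l j3) E gather_head.
by apply/rowP => k; rewrite -(gather_tail u l k) E gather_tail.
Qed.

Lemma gatherD u u' l l' : gather (u + u') (l + l') = gather u l + gather u' l'.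
Proof. by rewrite /gather !mulmxDl addrACA. Qed.

Lemma gatherZ (a : R) u l : gather (a *: u) (a *: l) = a *: gather u l.
Proof. by rewrite /gather -!scalemxAl scalerDr. Qed.

Lemma Lambda_right_inverse x : ordered x ->
  exists M : 'M[R]_(N - 3, N), M *m jac (@Lambda R N) x = 1%:M.
Proof.
move=> ox; pose dg k := jac (@Lambda R N) x (tail_index k) k.
exists (\matrix_(k, j) (if j == tail_index k then (dg k)^-1 else 0)).
apply/matrixP => k l; rewrite !mxE (bigD1 (tail_index k)) //= big1 ?addr0 => [|j /negbTE jk]; last first.
  by rewrite mxE jk mul0r.
rewrite mxE eqxx; have [->|kl] := eqVneq k l.
  by rewrite mulVf // /dg mxE; exact: D_Lambda_diag.
by rewrite mxE D_Lambda_tail ?mulr0 // eq_sym.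
Qed.

(** The last N - 3 angles enter through an invertible diagonal block, so a kernel vector is
    determined by its first three entries. *)
Lemma Lambda_kernel x v : ordered x -> v *m jac (@Lambda R N) x = 0 ->
  (forall j : 'I_N, (j < 3)%N -> v 0 j = 0) -> v = 0.
Proof.
move=> ox vL v3; apply/rowP => j; rewrite [RHS]mxE.
have [j3|[k ->]] := head_or_tail j; first exact: v3.
have := congr1 (fun w : 'rV[R]_(N - 3) => w 0 k) vL; rewrite mxE [RHS]mxE.
rewrite (bigD1 (tail_index k)) //= big1 ?addr0 => [|i ik]; last first.
  have [i3|[l E]] := head_or_tail i; first by rewrite v3 ?mul0r.
  rewrite E mxE D_Lambda_tail ?mulr0 //; apply: contra_neq ik => kl.
  by rewrite E kl.
rewrite mxE => /eqP; rewrite mulf_eq0 (negbTE (D_Lambda_diag HN k ox)) orbF.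
by move/eqP.
Qed.

Definition section_chart (i : 'I_N) x : 'rV[R]_(1 + (N - 3)) :=
  row_mx (x *m delta_mx i 0) (Lambda x).

Lemma smooth_section_chart i : smooth_on [set x : 'rV[R]_N | ordered x] (section_chart i).
Proof.
move=> k; have oU := @open_ordered R N; apply: (Ck_on_row_mx oU); last exact: smooth_Lambda.
by apply: (Ck_on_mulmx _ oU); exact: Ck_on_id.
Qed.

Definition base_chart x : 'rV[R]_N := gather x (Lambda x).

Lemma smooth_base_chart : smooth_on [set x : 'rV[R]_N | ordered x] base_chart.
Proof.
move=> k; have oU := @open_ordered R N; apply: Ck_on_add => //; apply: Ck_on_mulmx => //.
  exact: Ck_on_id.
exact: smooth_Lambda.
Qed.

Lemma D_base_chart x v : ordered x ->
  'D_v base_chart x = gather v (v *m jac (@Lambda R N) x).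
Proof.
move=> ox; have [D1 _] := smooth_Lambda (R := R) HN 1%N; have dL := D1 x ox.
have [d2 E2] := derive_mulmx tail_mx dL.
have d1 : differentiable (fun y : 'rV[R]_N => y) x by [].
have [d1' E1] := derive_mulmx head_mx d1.
have := deriveD (v := v) (diff_derivable d1' (v := v)) (diff_derivable d2 (v := v)).
by rewrite E1 E2 derive_id -jacP // => <-.
Qed.

(** Stability speaks only of points of the level set, so a kernel vector must be realized by such
    points. They arise by inverting [base_chart] along a segment on which the cross ratio entries
    are constant. *)
Lemma level_curve x u : ordered x -> u *m jac (@Lambda R N) x = 0 ->
  forall e : R, 0 < e -> exists2 d : R, 0 < d & forall s, 0 < s < d ->
  exists y, [/\ ordered y, Lambda y = Lambda x & `|y - x - s *: u| <= e * s].
Proof.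
move=> ox uL e e0; have oU := @open_ordered R N.
have [|G [rho [eps [rho0 eps0 rU inj [GF CG]]]]] :=
    @inverse_function R N 0 base_chart _ x oU (smooth_base_chart 1%N) ox.
  move=> v; rewrite D_base_chart // => H.
  have [|L0 v3] := @gather_inj v 0 (v *m jac (@Lambda R N) x) 0.
    by rewrite H /gather !mul0mx addr0.
  by apply: Lambda_kernel L0 _ => // j /v3; rewrite mxE.
have Gx : G (base_chart x) = x.
  have [|h1 h2] := GF (base_chart x); first by rewrite subrr normr0.
  by apply: inj => //; rewrite subrr normr0.
have dG : differentiable G (base_chart x) by apply: CG.1; rewrite /= subrr normr0.
have [dF _] := smooth_base_chart 1%N; have dFx := dF x ox.
have J1 : jac G (base_chart x) *m jac base_chart x = 1%:M.
  rewrite -[in X in _ *m X]Gx -jac_comp ?Gx // -[RHS](jac_id (base_chart x)).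
  by apply: (jac_near eps0) => y /GF[].
have J2 := mulmx1C J1.
have bE : gather u 0 *m jac G (base_chart x) = u.
  by rewrite -uL -D_base_chart // jacP // -mulmxA J2 mulmx1.
pose b := gather u 0; pose nb := `|b| + 1.
have nb0 : 0 < nb by rewrite ltr_wpDl.
have [d d0 Hd] := jac_eps dG (divr_gt0 e0 nb0).
exists (Num.min d eps / nb); first by rewrite divr_gt0 // lt_min d0.
move=> s /andP[s0 sd].
have sb : `|s *: b| < Num.min d eps.
  rewrite normrZ gtr0_norm //; apply: le_lt_trans (_ : s * nb < _).
    by rewrite ler_wpM2l ?(ltW s0) // lerDl.
  by rewrite -ltr_pdivlMr.
move: sb; rewrite lt_min => /andP[sb1 sb2].
have [|h1 h2] := GF (base_chart x + s *: b); first by rewrite addrAC subrr add0r.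
have oy := rU _ h1.
exists (G (base_chart x + s *: b)); split=> //.
  have := h2; rewrite /b -[X in _ = _ + X]gatherZ scaler0 -gatherD addr0.
  by move/gather_inj => [].
have := Hd _ sb1; rewrite Gx -scalemxAl bE => /le_trans; apply.
rewrite normrZ gtr0_norm // (_ : e / nb * (s * `|b|) = e * s * (`|b| / nb)); last by ring.
by rewrite ler_piMr ?mulr_ge0 ?(ltW e0) ?(ltW s0) // ler_pdivrMr // mul1r lerDl.
Qed.

End Gather.

Section ReturnMap.
Context {R : realType} (N : nat) (X : 'rV[R]_N -> 'rV[R]_N).

Definition joint_flow (z : 'rV[R]_(1 + N)) : 'rV[R]_N := flow X (lsubmx z 0 0) (rsubmx z).

(** By conservation of the cross ratios it suffices to keep three components of the return equation.
    The cross ratios take the place of the others, and the i-th angle fixes the phase, so there are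
    as many components as unknowns (t, y). *)
Definition return_map (i : 'I_N) (k : int) (z : 'rV[R]_(1 + N)) : 'rV[R]_(1 + N) :=
  row_mx (rsubmx z *m delta_mx i 0)
    (gather (joint_flow z - translate k (rsubmx z)) (Lambda (rsubmx z))).

End ReturnMap.

Section ChordalDistance.
Context {R : realType} (N : nat).
Hypothesis HN : (4 <= N)%N.
Implicit Types (x y : 'rV[R]_N).

(** A continuous substitute for the distance on the torus: insensitive to translations of the second
    lift and, on ordered lifts, zero only at the same point. *)
Definition chordal x y : R := \sum_j (1 - cos (y 0 j - x 0 j)).

Lemma chordal_translate x l y : chordal x (translate l y) = chordal x y.
Proof.
apply: eq_bigr => j _; rewrite translate_coord addrAC.
by have [-> _] := cos_sin_period (y 0 j - x 0 j) l.
Qed.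

Lemma chordal_ge0 x y : 0 <= chordal x y.
Proof. by apply: sumr_ge0 => j _; rewrite subr_ge0 cos_le1. Qed.

Lemma chordal_self x : chordal x x = 0.
Proof. by rewrite /chordal big1 // => j _; rewrite subrr cos0 subrr. Qed.

Lemma chordal_eq0 x y : ordered x -> ordered y -> chordal x y = 0 -> same_point x y.
Proof.
move=> ox oy Z; apply: (same_point_cos HN) => // j.
have : 1 - cos (y 0 j - x 0 j) = 0.
  apply/eqP; move: Z => /eqP; rewrite psumr_eq0 => [/allP/(_ j)|i _]; last by rewrite subr_ge0 cos_le1.
  by rewrite mem_index_enum => /(_ isT).
by move/eqP; rewrite subr_eq0 eq_sym => /eqP.
Qed.

Lemma chordal_cont x y : {for y, continuous (chordal x : 'rV[R]_N -> R^o)}.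
Proof.
suff C : Ck_on 0 [set: 'rV[R]_N] (chordal x : 'rV[R]_N -> R^o) by apply: (Ck_on_cont C).
have oT := @openT 'rV[R]_N.
apply: (Ck_on_sum oT) => j; apply: (Ck_on_add oT); first exact: Ck_on_cst.
apply: (Ck_on_opp oT).
apply: (@Ck_on_comp1 _ _ 0 _ (fun z : 'rV[R]_N => z 0 j - x 0 j) _ oT); last by case: (@Ck_sin_cos R 0 setT).
apply: (Ck_on_add oT); last exact: Ck_on_cst.
exact: (Ck_on_coord 0 (fun z : 'rV[R]_N => z) oT).1 (Ck_on_id _ _) j.
Qed.

End ChordalDistance.

Section StableFamilies.
Context {R : realType} (N : nat) (X : 'rV[R]_N -> 'rV[R]_N).

(** Continuity at [lam] of the orbits together with their minimal periods. [stable_orbit] by itself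
    does not relate the orbits of neighbouring levels. *)
Definition continuous_orbits (C : 'rV[R]_(N - 3) -> set 'rV[R]_N) lam : Prop :=
  forall x (T e : R), C lam x -> ret_time X x T -> 0 < e -> exists2 d : R, 0 < d &
  forall mu, `|mu - lam| < d -> exists (y : 'rV[R]_N) (T' : R),
    [/\ C mu y, `|y - x| < e, ret_time X y T' & `|T' - T| < e].

Definition stable_family (W : set 'rV[R]_(N - 3)) (C : 'rV[R]_(N - 3) -> set 'rV[R]_N) : Prop :=
  forall lam, W lam -> stable_orbit X lam (C lam) /\ continuous_orbits C lam.

Definition hyperbolic (x : 'rV[R]_N) (T : R) (k : int) (i : 'I_N) (K q : R) : Prop :=
  [/\ 0 < T, reaches X x T (translate k x) & contracts X x T i K q].

Definition period (x : 'rV[R]_N) : R := xget 0 [set T | ret_time X x T].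

Definition normal_proj (x : 'rV[R]_N) : 'M[R]_N := spectral_proj (jac (flow X (period x)) x).

(* The returning points near x form the graph of a function of the i-th coordinate and of
   the cross ratios; Pm projects onto this graph and tau is the return time there. *)
Definition graph_map (x : 'rV[R]_N) (T : R) (k : int) (i : 'I_N) (m : nat) (d : R)
    (Pm : 'rV[R]_N -> 'rV[R]_N) (tau : 'rV[R]_N -> R) : Prop :=
  [/\ 0 < d,
    forall y, `|y - x| < d -> [/\ ordered y, reaches X (Pm y) (tau y) (translate k (Pm y)),
      Lambda (Pm y) = Lambda y & Pm y 0 i = y 0 i],
    forall (y : 'rV[R]_N) t l, `|y - x| < d -> `|t - T| < d ->
      reaches X y t (translate l y) -> Pm y = y /\ tau y = t &
    Ck_on m [set y | `|y - x| < d] Pm /\ Ck_on m [set y | `|y - x| < d] (tau : _ -> R^o)].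

End StableFamilies.

Section SlideIndices.
Context {R : realType} (N : nat).
Hypothesis HN : (4 <= N)%N.
Variable i : 'I_N.
Hypothesis i3 : (i < 3)%N.

(** The order of coordinates in charts: the N - 3 cross ratios, then the angle i, and at the end the
    two other head angles, because [model] wants the vanishing coordinates last. *)
Definition slide_val (j : nat) : nat :=
  if (j < N - 3)%N then (j + 3)%N else ((i + (j - (N - 3))) %% 3)%N.

Lemma slide_ltN (j : 'I_N) : (slide_val j < N)%N.
Proof.
rewrite /slide_val; case: (ltnP j (N - 3)) => [h|_]; first by lia.
exact: (leq_trans (ltn_pmod _ (isT : (0 < 3)%N)) (ltnW HN)).
Qed.

Definition slide (j : 'I_N) : 'I_N := Ordinal (slide_ltN j).

Lemma slide_surj (a : 'I_N) : exists j, slide j = a.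
Proof.
have aN := ltn_ord a; have [a3|a3] := ltnP a 3.
  have jN : (N - 3 + (a + 3 - i) %% 3 < N)%N by have := ltn_pmod (a + 3 - i) (isT : (0 < 3)%N); lia.
  exists (Ordinal jN); apply/val_inj; rewrite /= /slide_val ltnNge leq_addr /= addKn.
  by move: i3 a3; case: (nat_of_ord i) => [|[|[|]]] //; case: (nat_of_ord a) => [|[|[|]]].
have jN : (a - 3 < N)%N by lia.
exists (Ordinal jN); apply/val_inj; rewrite /= /slide_val; case: ltnP => /=; lia.
Qed.

Lemma slide_end (j : 'I_N) : (N - 2 <= j)%N -> (slide j < 3)%N /\ slide j != i.
Proof.
move=> jN; have jlt := ltn_ord j.
have jE : j = (N - 3 + (j - (N - 3)))%N :> nat by lia.
have : (j - (N - 3) = 1 \/ j - (N - 3) = 2)%N by lia.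
have E : slide j = ((i + (j - (N - 3))) %% 3)%N :> nat.
  by rewrite /= /slide_val ltnNge (_ : (N - 3 <= j)%N) //; lia.
rewrite -[slide j != i]/(nat_of_ord (slide j) != i) E.
by move: i3; case: (nat_of_ord i) => [|[|[|]]] // _ [] ->.
Qed.

Lemma slide_end_surj (a : 'I_N) : (a < 3)%N -> a != i -> exists2 j, slide j = a & (N - 2 <= j)%N.
Proof.
move=> a3 ai; have [j E] := slide_surj a; exists j => //; rewrite leqNgt; apply/negP => jN.
move: ai a3; rewrite -E -val_eqE /= /slide_val; case: ltnP => h; first by lia.
have -> : (j - (N - 3) = 0)%N by lia.
by rewrite addn0 modn_small // eqxx.
Qed.

Definition slide_mx : 'M[R]_N := \matrix_(a, j) (a == slide j)%:R.

Lemma slide_mxE (v : 'rV[R]_N) j : (v *m slide_mx) 0 j = v 0 (slide j).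
Proof.
rewrite mxE (bigD1 (slide j)) //= mxE eqxx mulr1 big1 ?addr0 // => a /negbTE aj.
by rewrite mxE aj mulr0.
Qed.

End SlideIndices.

Section Generalities.
Context {R : realType}.

(** In a half-space chart only one side of a direction is available; a one-sided difference quotient
    still determines the differential. *)
Lemma one_sided_jac n m (F : 'rV[R]_n -> 'rV[R]_m) (z w : 'rV[R]_n) (d : R) : 0 < d ->
  differentiable F z -> (forall s : R, 0 < s < d -> F (z + s *: w) = F z) -> w *m jac F z = 0.
Proof.
move=> d0 dF H; apply/eqP; rewrite -normr_le0; apply/ler_addgt0Pl => e e0; rewrite addr0.
pose c := `|w| + 1; have c0 : 0 < c by rewrite ltr_wpDl.
have [d1 d10 H1] := jac_eps dF (divr_gt0 e0 c0).
have [s s0 [sd sd1]] : exists2 s : R, 0 < s & s < d /\ s * c < d1.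
  exists (Num.min (d / 2) (d1 / (2 * c))); first by rewrite lt_min !divr_gt0 // mulr_gt0.
  split; first by rewrite gt_min; apply/orP; left; qlra.
  rewrite -ltr_pdivlMr // gt_min; apply/orP; right; rewrite ltr_pM2l // ltf_pV2 ?posrE //; [qlra|].
  exact: mulr_gt0.
have [|] := boolP (0 < s < d); last by rewrite s0 sd.
have swd : `|s *: w| < d1.
  by rewrite normrZ gtr0_norm //; apply: le_lt_trans sd1; rewrite ler_pM2l // /c lerDl.
move=> /H Fs; have := H1 _ swd; rewrite Fs subrr add0r normrN -scalemxAl !normrZ gtr0_norm //.
rewrite mulrCA ler_pM2l // => /le_trans; apply.
rewrite -mulrA ler_piMr ?(ltW e0) // mulrC ler_pdivrMr // mul1r /c lerDl.
exact: ler01.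
Qed.

Lemma positive_margin (I : finType) (P : I -> R) : (forall i, 0 < P i) ->
  exists2 d : R, 0 < d & forall i, d <= P i.
Proof.
move=> P0; exists (\big[Num.min/1]_i P i); first exact: lt_bigmin.
by move=> i; exact: bigmin_le_cond.
Qed.

End Generalities.

(** * Cyclic relabelling *)

Section Rotation.
Context {R : realType} (N : nat).
Hypothesis HN : (4 <= N)%N.
Implicit Types (x y v : 'rV[R]_N) (lam : 'rV[R]_(N - 3)).

Definition shift_mx : 'M[R]_N := \matrix_(i, j) (i == ordS j)%:R.

Definition wrap : 'rV[R]_N := \row_j (2 * pi * (j.+1 == N)%:R).

(* The cyclic relabelling of the oscillators, on lifts. *)
Definition sigma x : 'rV[R]_N := x *m shift_mx + wrap.

Lemma shift_mxE v (j : 'I_N) : (v *m shift_mx) 0 j = v 0 (ordS j).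
Proof.
rewrite mxE (bigD1 (ordS j)) //= mxE eqxx mulr1 big1 ?addr0 // => i /negbTE ij.
by rewrite mxE ij mulr0.
Qed.

Lemma sigma_coord x k : (k.+1 < N)%N -> coord (sigma x) k = coord x k.+1.
Proof.
move=> kN; rewrite (coord_ord _ (ltnW kN)) (coord_ord _ kN) mxE shift_mxE mxE /=.
rewrite ltn_eqF // mulr0 addr0; congr (x 0 _).
by apply/val_inj; rewrite /= modn_small.
Qed.

Lemma sigma_last x : coord (sigma x) N.-1 = coord x 0 + 2 * pi.
Proof.
have N0 : (0 < N)%N by apply: leq_trans HN.
have lN : (N.-1 < N)%N by rewrite prednK.
rewrite (coord_ord _ lN) (coord_ord _ N0) mxE shift_mxE mxE /= prednK // eqxx mulr1.
by congr (x 0 _ + _); apply/val_inj; rewrite /= prednK // modnn.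
Qed.

Lemma orderedP x : ordered x <->
  (forall i j, (i < j < N)%N -> coord x i < coord x j) /\ coord x N.-1 < coord x 0 + 2 * pi.
Proof.
split=> [[H W]|[H W]]; split=> //.
  move=> i j /andP[ij jN]; rewrite (coord_ord _ (ltn_trans ij jN)) (coord_ord _ jN).
  exact: H.
by move=> i j ij; rewrite -!coordE; apply: H; rewrite ij ltn_ord.
Qed.

Lemma coord_ext x y : (forall k, (k < N)%N -> coord x k = coord y k) -> x = y.
Proof. by move=> H; apply/rowP => j; rewrite -!coordE H. Qed.

Lemma sigma_ordered x : ordered x -> ordered (sigma x).
Proof.
move=> /orderedP[H W]; apply/orderedP; split=> [i j /andP[ij jN]|].
  rewrite sigma_coord; last exact: leq_ltn_trans ij jN.
  have [jN'|] := ltnP j.+1 N; first by rewrite sigma_coord //; apply: H; rewrite ltnS ij.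
  move=> Nj; have -> : j = N.-1 by lia.
  rewrite sigma_last; have [iN|] := ltnP i.+1 N.-1.
    by apply: lt_trans W; apply: H; rewrite iN; lia.
  by move=> h; have -> : i.+1 = N.-1 by lia.
rewrite sigma_last sigma_coord; last by lia.
by rewrite ltrD2r; apply: H; lia.
Qed.

Definition sigma_inv y : 'rV[R]_N :=
  \row_j (if j == 0%N :> nat then coord y N.-1 - 2 * pi else coord y j.-1).

Lemma sigma_inv_coord y k : (k.+1 < N)%N -> coord (sigma_inv y) k.+1 = coord y k.
Proof. by move=> kN; rewrite (coord_ord _ kN) mxE. Qed.

Lemma sigma_inv0 y : coord (sigma_inv y) 0 = coord y N.-1 - 2 * pi.
Proof. by rewrite (coord_ord _ (leq_trans (isT : (0 < 4)%N) HN)) mxE. Qed.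

Lemma sigma_invK y : sigma (sigma_inv y) = y.
Proof.
apply: coord_ext => k kN; have [kN'|Nk] := ltnP k.+1 N.
  by rewrite sigma_coord // sigma_inv_coord.
have -> : k = N.-1 by lia.
by rewrite sigma_last sigma_inv0 subrK.
Qed.

Lemma sigma_inv_ordered y : ordered y -> ordered (sigma_inv y).
Proof.
move=> /orderedP[H W]; have lN : N.-1 = N.-2.+1 by lia.
have W' k : (k < N)%N -> coord y N.-1 - 2 * pi < coord y k.
  move=> kN; rewrite ltrBlDr; apply: lt_le_trans W _; rewrite lerD2r.
  by case: k kN => // k kN; rewrite ltW // H.
apply/orderedP; split=> [i j /andP[ij jN]|].
  case: j ij jN => // j ij jN; rewrite sigma_inv_coord //.
  case: i ij => [|i] ij; first by rewrite sigma_inv0; apply: W'; exact: ltnW.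
  by rewrite sigma_inv_coord; [apply: H; lia|lia].
rewrite sigma_inv0 subrK {1}lN sigma_inv_coord; last by lia.
by apply: H; lia.
Qed.

Lemma shift_norm v : `|v *m shift_mx| = `|v|.
Proof.
apply/le_anti/andP; split; apply: mx_norm_le => // i j; rewrite (ord1 i).
  by rewrite shift_mxE; exact: mx_entry_le.
by rewrite -(ord_predK j) -shift_mxE; exact: mx_entry_le.
Qed.

Lemma sigmaB x y : sigma x - sigma y = (x - y) *m shift_mx.
Proof. by rewrite /sigma opprD addrACA subrr addr0 mulmxBl. Qed.

Lemma sigma_translate k x : sigma (translate k x) = translate k (sigma x).
Proof.
rewrite /sigma /translate mulmxDl addrAC; congr (_ + _).
by apply/rowP => j; rewrite shift_mxE !mxE.
Qed.

Lemma sigma_inj x y : sigma x = sigma y -> x = y.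
Proof.
move=> E; apply/eqP; rewrite -subr_eq0 -normr_eq0 -shift_norm -sigmaB E subrr.
by rewrite normr0.
Qed.

(** The last entry relies on [coord] being 0 beyond the last index: there the first oscillator
    reappears after a full turn, and the entry is 1 - lam_0. *)
Definition cross_shift lam : 'rV[R]_(N - 3) :=
  \row_k ((1 - coord lam 0) / (1 - coord lam k.+1)).

Let S x i j : R := hsin (coord x i - coord x j).

Lemma S_neq0 x i j : ordered x -> (i < j < N)%N -> S x i j != 0.
Proof. by move=> ox ij; rewrite lt_eqF //; exact: hsin_ordered_lt0 ox ij. Qed.

Lemma coord_Lambda x k : (k + 3 < N)%N ->
  coord (Lambda x) k = (S x 0 (k + 3) * S x 1 2) / (S x 1 (k + 3) * S x 0 2).
Proof.
move=> kN; have kN' : (k < N - 3)%N by lia.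
by rewrite (coord_ord _ kN') Lambda_hsin.
Qed.

Lemma one_sub_Lambda x k : ordered x -> (k + 3 < N)%N ->
  1 - coord (Lambda x) k = (S x 0 1 * S x 2 (k + 3)) / (S x 1 (k + 3) * S x 0 2).
Proof.
move=> ox kN; rewrite coord_Lambda //.
have E : S x 0 2 * S x 1 (k + 3) - S x 0 (k + 3) * S x 1 2 = S x 0 1 * S x 2 (k + 3).
  exact: hsin_cross.
rewrite -E.
have n1 : S x 1 (k + 3) != 0 by apply: S_neq0 => //; lia.
have n2 : S x 0 2 != 0 by apply: S_neq0 => //; lia.
by field; rewrite n1 n2.
Qed.

Lemma coord_beyond m (v : 'rV[R]_m) k : (m <= k)%N -> coord v k = 0.
Proof. by move=> mk; rewrite /coord insubN // -leqNgt. Qed.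

Lemma one_sub_coord_neq0 x k : ordered x -> 1 - coord (Lambda x) k != 0.
Proof.
move=> ox; have [kN|Nk] := ltnP (k + 3) N; last first.
  by rewrite coord_beyond ?subr0 ?oner_eq0 //; lia.
by rewrite one_sub_Lambda // mulf_neq0 ?invr_eq0 ?mulf_neq0 // S_neq0 //; lia.
Qed.

Lemma hsin_wrap (u w : R) : hsin (u - (w + 2 * pi)) = hsin (w - u).
Proof.
rewrite /hsin; have -> : (u - (w + 2 * pi)) / 2 = - ((w - u) / 2 + pi) by field.
by rewrite sinN sinDpi opprK.
Qed.

Lemma Lambda_sigma x : ordered x -> Lambda (sigma x) = cross_shift (Lambda x).
Proof.
move=> ox; apply/rowP => k; have kN := coord_ltN k; rewrite [RHS]mxE -coordE coord_Lambda //.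
have os := sigma_ordered ox; rewrite one_sub_Lambda; [|by []|by lia].
have E0 : coord (sigma x) 0 = coord x 1 by apply: sigma_coord; lia.
have E1 : coord (sigma x) 1 = coord x 2 by apply: sigma_coord; lia.
have E2 : coord (sigma x) 2 = coord x 3 by apply: sigma_coord; lia.
have n01 : S x 0 1 != 0 by apply: S_neq0 => //; lia.
have n02 : S x 0 2 != 0 by apply: S_neq0 => //; lia.
have n13 : S x 1 3 != 0 by apply: S_neq0 => //; lia.
have n23 : S x 2 3 != 0 by apply: S_neq0 => //; lia.
have [kN'|Nk] := ltnP (k + 4) N.
  have n1k : S x 1 (k + 4) != 0 by apply: S_neq0 => //; lia.
  have n2k : S x 2 (k + 4) != 0 by apply: S_neq0 => //; lia.
  rewrite one_sub_Lambda; [|by []|by lia].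
  have -> : (k.+1 + 3 = k + 4)%N by lia.
  have Ek : coord (sigma x) (k + 3) = coord x (k + 4) by rewrite sigma_coord -addnS.
  rewrite {1 2 3 4}/S E0 E1 E2 Ek -/(S x 1 (k + 4)) -/(S x 2 3) -/(S x 2 (k + 4)) -/(S x 1 3).
  by rewrite add0n; field; rewrite n01 n02 n13 n1k n2k.
(* The relabelled angle here is the first one plus 2 pi; [hsin_wrap] brings it back. *)
rewrite coord_beyond; last by lia.
have kE : (k + 3 = N.-1)%N by lia.
rewrite subr0 invr1 mulr1 kE {1 2 3 4}/S E0 E1 E2 sigma_last !hsin_wrap.
rewrite -/(S x 0 1) -/(S x 2 3) -/(S x 0 2) -/(S x 1 3) add0n.
by field; rewrite n02 n13.
Qed.

Lemma cross_shift_inj x y : ordered x -> ordered y ->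
  cross_shift (Lambda x) = cross_shift (Lambda y) -> Lambda x = Lambda y.
Proof.
move=> ox oy E.
have H k : (k < N - 3)%N -> (1 - coord (Lambda x) 0) / (1 - coord (Lambda x) k.+1) =
    (1 - coord (Lambda y) 0) / (1 - coord (Lambda y) k.+1).
  by move=> kN; move/rowP: E => /(_ (Ordinal kN)); rewrite !mxE.
(* The last entry of [cross_shift] is 1 - lam_0; once lam_0 is known, the other entries determine
   the remaining cross ratios. *)
have E0 : coord (Lambda x) 0 = coord (Lambda y) 0.
  have lN : ((N - 3).-1 < N - 3)%N by lia.
  have := H _ lN; rewrite !(@coord_beyond _ _ (N - 3).-1.+1); [|lia|lia].
  by rewrite subr0 !divr1 => /addrI/oppr_inj.
apply/rowP => k; rewrite -!coordE; have := ltn_ord k; case: (nat_of_ord k) => // l lN.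
have := H l (ltnW lN); rewrite E0 => /(mulfI (one_sub_coord_neq0 0 oy))/invr_inj.
by move=> /addrI/oppr_inj.
Qed.

Lemma smooth_cross_shift n : Ck_on n [set lam | forall k, 1 - coord lam k != 0] cross_shift.
Proof.
have oV : open [set lam : 'rV[R]_(N - 3) | forall k, 1 - coord lam k != 0].
  apply: open_eps => lam H.
  have [|d d0 Hd] := @positive_margin R 'I_(N - 3) (fun k => `|1 - coord lam k|).
    by move=> k; rewrite normr_gt0.
  exists d => // mu md k; have [kN|kN] := ltnP k (N - 3); last first.
    by rewrite coord_beyond ?subr0 ?oner_eq0.
  apply/eqP => Z; have := Hd (Ordinal kN); rewrite leNgt => /negP; apply.
  apply: le_lt_trans md; have -> : 1 - coord lam (Ordinal kN) = (mu - lam) 0 (Ordinal kN).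
    by rewrite sub_mxE -!coordE -[1](subrK (coord mu k)) Z add0r.
  exact: mx_entry_le.
apply/(Ck_on_coord _ _ oV) => k.
have C j : Ck_on n [set lam : 'rV[R]_(N - 3) | forall k, 1 - coord lam k != 0] (fun lam => 1 - coord lam j : R^o).
  by apply: (Ck_on_add oV); [exact: Ck_on_cst|apply: (Ck_on_opp oV); exact: Ck_on_coordk].
have CI := Ck_on_inv oV (fun lam (h : forall k, 1 - coord lam k != 0) => h k.+1) (C k.+1).
by apply: (Ck_on_ext oV _ (Ck_on_mul oV (C 0%N) CI)) => lam _; rewrite mxE.
Qed.

Lemma diff_cross_shift x : ordered x -> differentiable cross_shift (Lambda x).
Proof.
by move=> ox; have [D _] := smooth_cross_shift 1; apply: D => k; exact: one_sub_coord_neq0.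
Qed.

Lemma jac_sigma x : ordered x ->
  shift_mx *m jac (@Lambda R N) (sigma x) = jac (@Lambda R N) x *m jac cross_shift (Lambda x).
Proof.
move=> ox; have oU := @open_ordered R N; have [DL _] := smooth_Lambda (R := R) HN 1%N.
have dL := DL x ox; have dLs := DL _ (sigma_ordered ox).
have dI : differentiable (fun y : 'rV[R]_N => y) x by [].
have [dS _] := derive_mulmx shift_mx dI.
have ds : differentiable sigma x by apply: differentiableD.
have Js : jac sigma x = shift_mx.
  rewrite /sigma (jac_addr wrap dS) (jac_mulmxr shift_mx dI).
  by rewrite jac_id mul1mx.
rewrite -Js -(jac_comp ds dLs) -(jac_comp dL (diff_cross_shift ox)).
have [d d0 Hd] := eps_near (open_nbhs_nbhs (conj oU ox)).
by apply: (jac_near d0) => y /Hd; exact: Lambda_sigma.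
Qed.

Lemma theta_star_coord k : (k < N)%N -> coord (@theta_star R N) k = - pi + 2 * pi / N%:R * k%:R.
Proof. by move=> kN; rewrite (coord_ord _ kN) mxE. Qed.

Let N0 : 0 < N%:R :> R.
Proof. by rewrite ltr0n; apply: leq_trans HN. Qed.

Let last_angle : 2 * pi / N%:R * N.-1%:R + 2 * pi / N%:R = 2 * pi :> R.
Proof.
have NE : N.-1%:R + 1 = N%:R :> R by rewrite natr1 prednK //; apply: leq_trans HN.
by rewrite -[X in _ + X]mulr1 -mulrDr NE divfK // gt_eqF.
Qed.

Lemma theta_star_ordered : ordered (@theta_star R N).
Proof.
have p0 : 0 < 2 * pi / N%:R :> R by rewrite divr_gt0 // mulr_gt0 // pi_gt0.
apply/orderedP; split=> [i j /andP[ij jN]|].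
  rewrite !theta_star_coord //; last exact: ltn_trans jN.
  by rewrite ltrD2l ltr_pM2l // ltr_nat.
rewrite !theta_star_coord; [|by lia|by lia].
by rewrite mulr0 addr0 ltrD2l -[X in _ < X]last_angle ltrDl.
Qed.

Lemma sigma_theta_star : sigma (@theta_star R N) = @theta_star R N + const_mx (2 * pi / N%:R).
Proof.
apply: coord_ext => k kN; rewrite coord_add coord_const //.
have [kN'|Nk] := ltnP k.+1 N.
  by rewrite sigma_coord // !theta_star_coord // -natr1; ring.
have -> : k = N.-1 by lia.
rewrite sigma_last !theta_star_coord; [|by lia|by lia].
by rewrite mulr0 addr0 -addrA last_angle.
Qed.

Lemma Lambda_rotate x c : Lambda (x + const_mx c) = Lambda x.
Proof.
apply/rowP => k; rewrite !Lambda_hsin; have kN := coord_ltN k.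
have E i j : (i < N)%N -> (j < N)%N ->
    coord (x + const_mx c) i - coord (x + const_mx c) j = coord x i - coord x j.
  by move=> iN jN; rewrite !coord_add !coord_const //; ring.
by rewrite !E //; lia.
Qed.

Lemma ordered_rotate x c : ordered x -> ordered (x + const_mx c).
Proof.
move=> [H W]; split=> [i j ij|]; first by rewrite !mxE ltrD2r; exact: H.
by rewrite !coord_add !coord_const; [rewrite addrAC ltrD2r|lia|lia].
Qed.

Lemma jac_Lambda_rotate x c : ordered x ->
  jac (@Lambda R N) (x + const_mx c) = jac (@Lambda R N) x.
Proof.
move=> ox; have [DL _] := smooth_Lambda (R := R) HN 1%N.
have [_ <-] := jac_translate (DL _ (ordered_rotate c ox)).
by apply: (jac_near ltr01) => y _; exact: Lambda_rotate.
Qed.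

Lemma jac_Lambda_const x (c : R) : ordered x -> (const_mx c : 'rV[R]_N) *m jac (@Lambda R N) x = 0.
Proof.
move=> ox; have [DL _] := smooth_Lambda (R := R) HN 1%N.
apply: (one_sided_jac ltr01 (DL x ox)) => s _.
have -> : s *: const_mx c = const_mx (s * c) :> 'rV[R]_N by apply/rowP => j; rewrite !mxE.
exact: Lambda_rotate.
Qed.

Lemma shift_pow v k (j : 'I_N) : (v *m shift_mx ^+ k) 0 j = v 0 (iter k (@ordS N) j).
Proof.
elim: k j => [|k IH] j; first by rewrite expr0 mulmx1.
rewrite exprSr -[_ * _]/(_ *m _) mulmxA shift_mxE IH; congr (v 0 _).
by rewrite -iterSr.
Qed.

Lemma iter_ordS k (j : 'I_N) : iter k (@ordS N) j = ((j + k) %% N)%N :> nat.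
Proof.
elim: k => [|k IH]; first by rewrite addn0 modn_small.
by rewrite /= IH -[(_ %% _).+1]addn1 modnDml addn1 addnS.
Qed.

(** The cyclic shifts move each index through all positions exactly once. *)
Lemma sum_shifts v : \sum_(k < N) v *m shift_mx ^+ k = const_mx (\sum_j v 0 j).
Proof.
apply/rowP => j; rewrite summxE mxE.
under eq_bigr => k _ do rewrite shift_pow.
rewrite [RHS](reindex (fun k : 'I_N => iter k (@ordS N) j)) //=.
have inj : injective (fun k : 'I_N => iter k (@ordS N) j).
  move=> k l /(congr1 val) /=; rewrite !iter_ordS => E; apply/val_inj.
  have := ltn_ord k; have := ltn_ord l => lN kN.
  move/eqP: E; rewrite eqn_modDl => /eqP.
  by rewrite !modn_small.
exact: onW_bij (injF_bij inj).
Qed.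

Lemma cross_shift_star : cross_shift (lambda_star R N) = lambda_star R N.
Proof.
by rewrite /lambda_star -(Lambda_sigma theta_star_ordered) sigma_theta_star Lambda_rotate.
Qed.

(* A fixed vector is the image of some v under the differential of the cross ratios at
   theta_star, hence also of the average of the cyclic shifts of v, a constant vector. *)
Lemma cross_shift_fixed (u : 'rV[R]_(N - 3)) :
  u *m jac cross_shift (lambda_star R N) = u -> u = 0.
Proof.
move=> uQ; have os := theta_star_ordered; have [M MA] := Lambda_right_inverse HN os.
have JS := jac_sigma os; rewrite sigma_theta_star (jac_Lambda_rotate _ os) in JS.
pose v := u *m M; set A := jac _ _ in MA JS.
have vA k : v *m shift_mx ^+ k *m A = u.
  elim: k => [|k IH]; first by rewrite expr0 mulmx1 -mulmxA MA mulmx1.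
  by rewrite exprSr -[_ * _]/(_ *m _) !mulmxA -[_ *m _ *m _ *m A]mulmxA JS mulmxA IH uQ.
have : (\sum_(k < N) v *m shift_mx ^+ k) *m A = N%:R *: u.
  rewrite mulmx_suml (eq_bigr (fun _ => u)) => [|k _]; last exact: vA.
  by rewrite sumr_const card_ord scaler_nat.
rewrite sum_shifts (jac_Lambda_const _ os) => /esym/eqP; rewrite scaler_eq0 gt_eqF //=.
by move/eqP.
Qed.

Lemma cross_shift_four : N = 4%N -> cross_shift = (fun lam => const_mx 1 - lam).
Proof.
move=> N4; apply/funext => lam; apply/rowP => k; rewrite !mxE.
have k0 : k = 0%N :> nat by have := ltn_ord k; lia.
by rewrite -[lam 0 k]coordE k0 [coord lam 1]coord_beyond; [rewrite subr0 divr1|lia].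
Qed.

Lemma jac_cross_shift_four lam : N = 4%N -> jac cross_shift lam = - 1%:M.
Proof.
move=> N4; rewrite (cross_shift_four N4); apply: jac_unique => v.
have dI : differentiable (fun y : 'rV[R]_(N - 3) => y) lam by [].
rewrite deriveB; [|exact: derivable_cst|exact: diff_derivable].
by rewrite derive_cst derive_id sub0r mulmxN mulmx1.
Qed.

End Rotation.

(** * The forcing term and its symmetries *)

Section Forcing.
Context {R : realType} (N : nat).
Hypothesis HN : (4 <= N)%N.
Variable h : R -> R.
Hypotheses (sh : smooth_on setT (h : R^o -> R^o))
  (ph : forall x (k : int), h (x + 2 * pi * k%:~R) = h x).
Implicit Types (x y v : 'rV[R]_N).

Definition forcing x : 'rV[R]_N := \row_j h (x 0 j).

Lemma DLambda_hE x : DLambda_h h x = forcing x *m jac (@Lambda R N) x.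
Proof.
apply/rowP => k; rewrite summxE !mxE; apply: eq_bigr => j _.
by rewrite !mxE.
Qed.

Lemma smooth_DLambda_h : smooth_on [set x : 'rV[R]_N | ordered x] (DLambda_h h).
Proof.
move=> n; have oU := @open_ordered R N; apply: (Ck_on_sum oU) => j.
have [_ CD] := smooth_Lambda (R := R) HN n.+1.
have Cx := (Ck_on_coord n (fun x : 'rV[R]_N => x) oU).1 (Ck_on_id n _) j.
have Ch := Ck_on_comp1 oU Cx (sh n).
apply/(Ck_on_coord _ _ oU) => k; have Ck := (Ck_on_coord n _ oU).1 (CD (delta_mx 0 j)) k.
by apply: (Ck_on_ext oU _ (Ck_on_mul oU Ch Ck)) => x _; rewrite [RHS]mxE.
Qed.

Lemma DLambda_h_translate k x : DLambda_h h (translate k x) = DLambda_h h x.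
Proof.
apply: eq_bigr => j _; rewrite translate_coord ph; apply: (congr1 (GRing.scale (h (x 0 j)))).
(* The derivatives are compared as limits of equal difference quotients, which works for every x,
   ordered or not. *)
apply: (congr1 (fun F : R^o -> 'rV[R]_(N - 3) => lim (F @ 0^'))); apply/funext => t /=.
rewrite (Lambda_translate HN); congr (_ *: (_ - _)).
by rewrite -(Lambda_translate HN k (_ + x)) /translate addrA.
Qed.

(** The chain rule for the cross ratios of a relabelled configuration; the jump by 2 pi of one angle
    is invisible to h. *)
Lemma DLambda_h_sigma x : ordered x ->
  DLambda_h h (sigma x) = DLambda_h h x *m jac (@cross_shift R N) (Lambda x).
Proof.
move=> ox; rewrite !DLambda_hE -mulmxA -(jac_sigma HN ox) mulmxA; congr (_ *m _).
apply/rowP => j; rewrite shift_mxE !mxE -/(mulmx x (shift_mx N)).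
have -> : \sum_j0 x 0 j0 * (shift_mx N) j0 j = x 0 (ordS j) by rewrite -shift_mxE mxE.
have -> : 2 * pi * (j.+1 == N)%:R = 2 * pi * (Posz (j.+1 == N))%:~R :> R by [].
exact: ph.
Qed.

End Forcing.

Lemma forcing_periodic (R : realType) (a b : nat -> R) h x (k : int) :
  normalized_forcing a b h -> h (x + 2 * pi * k%:~R) = h x.
Proof.
move=> [_ H _ _]; have /cvg_lim H1 := H x; have /cvg_lim H2 := H (x + 2 * pi * k%:~R).
rewrite -H1 // -H2 //; apply: (congr1 (fun u : nat -> R => lim (u @ \oo))); apply/funext => n.
apply: eq_bigr => m _.
have -> : m%:R * (x + 2 * pi * k%:~R) = m%:R * x + 2 * pi * (m%:Z * k)%:~R by rewrite intrM; ring.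
by have [-> ->] := cos_sin_period (m%:R * x) (m%:Z * k).
Qed.

Lemma field_sigma (R : realType) (N : nat) f g h (x : 'rV[R]_N) :
  vector_field f g h 0 (sigma x) = vector_field f g h 0 x *m shift_mx N.
Proof.
have P j : cos (sigma x 0 j) = cos (x 0 (ordS j)) /\ sin (sigma x 0 j) = sin (x 0 (ordS j)).
  by rewrite mxE shift_mxE mxE; exact: cos_sin_natperiod.
have E : order_parameter (sigma x) = order_parameter x.
  rewrite /order_parameter; congr (_ * _); rewrite [RHS](reindex_inj (@ordS_inj N)).
  by apply: eq_bigr => j _; rewrite /expi; have [-> ->] := P j.
apply/rowP => j; rewrite shift_mxE !fieldE /fieldA /fieldB E.
by have [-> ->] := P j.
Qed.

Lemma star_in_nbhd (R : realType) (N : nat) (delta : R) : 0 <= delta ->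
  closed_nbhd_star delta (lambda_star R N).
Proof.
move=> d0; rewrite /closed_nbhd_star /= big1 ?sqrtr0 // => k _.
by rewrite subrr expr0n.
Qed.

(** * Stable periodic orbits and their families *)

Section TorusFlow.
Context {R : realType} (N : nat).
Implicit Types (x y v : 'rV[R]_N) (s t : R).
Hypothesis HN : (4 <= N)%N.
Variable X : 'rV[R]_N -> 'rV[R]_N.
Hypotheses (sX : smooth_on [set x : 'rV[R]_N | ordered x] X)
  (tX : forall k x, X (translate k x) = X x)
  (cX : forall x, ordered x -> 'D_(X x) (@Lambda R N) x = 0).

Let oU := @open_ordered R N.
Local Set Default Proof Using "HN sX tX cX".

(** * The flow on lifts and its linearization *)

Lemma reaches_domain x t y : reaches X x t y -> ordered x /\ ordered y.
Proof. exact: (@reach_domain _ _ _ [set x | ordered x]). Qed.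

Lemma flowE x t y : reaches X x t y -> flow X t x = y.
Proof. exact: (flow_inE oU sX). Qed.

Lemma reaches_flow x t y : reaches X x t y -> reaches X x t (flow X t x).
Proof. by move=> H; rewrite (flowE H). Qed.

Lemma reaches_unique x t y z : reaches X x t y -> reaches X x t z -> y = z.
Proof. by move=> /flowE <- /flowE. Qed.

Lemma reaches0 x : ordered x -> reaches X x 0 x.
Proof. exact: (reach0 oU sX). Qed.

Lemma flow0 x : ordered x -> flow X 0 x = x.
Proof. by move/reaches0/flowE. Qed.

Lemma reaches_trans x s y t z : reaches X x s y -> reaches X y t z -> reaches X x (s + t) z.
Proof. exact: (reach_trans oU sX). Qed.

Lemma reaches_opp x t y : reaches X x t y -> reaches X y (- t) x.
Proof. exact: (@reach_opp _ _ _ [set x | ordered x]). Qed.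

Lemma reaches_translate k x t y : reaches X x t y ->
  reaches X (translate k x) t (translate k y).
Proof.
move=> [phi [c [d [c0 ct H p0 pt]]]]; exists (fun s => translate k (phi s)), c, d.
split=> // [s /H[os ds]||]; [|by rewrite p0|by rewrite pt].
split; first exact: translate_ordered.
by rewrite tX -[X (phi s)]addr0; exact: (cderD ds (cder_cst _ _)).
Qed.

Lemma flow_translate k x t y : reaches X x t y ->
  flow X t (translate k x) = translate k (flow X t x).
Proof. by move=> H; rewrite (flowE (reaches_translate k H)) (flowE H). Qed.

Lemma flow_diff x t y : reaches X x t y -> differentiable (flow X t) x.
Proof.
move=> H; have [r r0 [_ [C _]]] := flow_local oU sX 1 H.
by apply: C; rewrite /= subrr normr0.
Qed.

Lemma reaches_near x t y : reaches X x t y ->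
  exists2 r : R, 0 < r & forall x', `|x' - x| < r -> reaches X x' t (flow X t x').
Proof. by move=> H; have [r r0 [A _]] := flow_local oU sX 0 H; exists r. Qed.

Lemma flow_cont x t y : reaches X x t y -> forall e, 0 < e -> exists2 d : R, 0 < d &
  forall x', `|x' - x| < d -> `|flow X t x' - flow X t x| < e.
Proof.
move=> H; have [r r0 [_ C]] := flow_local oU sX 0 H.
by apply/cont_eps; apply: (Ck_on_cont C); rewrite /= subrr normr0.
Qed.

Lemma jac_flow_trans x s y t z : reaches X x s y -> reaches X y t z ->
  jac (flow X (s + t)) x = jac (flow X s) x *m jac (flow X t) y.
Proof.
move=> H1 H2; have [r1 r10 A1] := reaches_near H1; have [r2 r20 A2] := reaches_near H2.
have [r3 r30 A3] := flow_cont H1 r20.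
have dt : differentiable (flow X t) (flow X s x) by rewrite (flowE H1); apply: flow_diff H2.
rewrite -[in RHS](flowE H1) -(jac_comp (flow_diff H1) dt).
have m0 : 0 < Num.min r1 r3 by rewrite lt_min r10.
apply: (jac_near m0) => x'; rewrite lt_min => /andP[/A1 h1 /A3 h3].
rewrite (flowE H1) in h3.
exact: (flowE (reaches_trans h1 (A2 _ h3))).
Qed.

Lemma jac_flow0 x : ordered x -> jac (flow X 0) x = 1%:M.
Proof.
move=> ox; rewrite -(jac_id x); have [r r0 A] := reaches_near (reaches0 ox).
by apply: (jac_near r0) => y /A/reaches_domain[/flow0].
Qed.

Lemma jac_flow_unit x t y : reaches X x t y ->
  jac (flow X t) x *m jac (flow X (- t)) y = 1%:M.
Proof.
move=> H; rewrite -(jac_flow_trans H (reaches_opp H)) subrr jac_flow0 //.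
by case: (reaches_domain H).
Qed.

Lemma jac_flow_translate k x t y : reaches X x t y ->
  jac (flow X t) (translate k x) = jac (flow X t) x.
Proof.
move=> H; have dT := flow_diff (reaches_translate k H).
have [_ <-] := jac_translate dT.
rewrite -(jac_addr (const_mx (2 * pi * k%:~R)) (flow_diff H)).
have [r r0 A] := reaches_near H; apply: (jac_near r0) => x' /A h.
exact: (flow_translate k h).
Qed.

Lemma Lambda_diff x : ordered x -> differentiable (@Lambda R N) x.
Proof. by move=> ox; have [D _] := smooth_Lambda (R := R) HN 1%N; exact: D. Qed.

Lemma jac_Lambda_translate k x : ordered x ->
  jac (@Lambda R N) (translate k x) = jac (@Lambda R N) x.
Proof.
move=> ox; have dT := Lambda_diff (translate_ordered HN k ox).
have [_ <-] := jac_translate dT.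
by apply: (jac_near (@ltr01 R)) => x' _; apply: Lambda_translate.
Qed.

Lemma reaches_path x t y : reaches X x t y -> exists phi : R -> 'rV[R]_N,
  [/\ phi 0 = x, phi t = y & forall s, Num.min 0 t <= s <= Num.max 0 t ->
    reaches X x s (phi s) /\ is_derive (s : R^o) 1 (phi : R^o -> _) (X (phi s))].
Proof.
move=> [phi [c [d [/andP[c0 d0] /andP[ct td] H p0 pt]]]]; exists phi; split=> // s.
rewrite ge_min le_max => /andP[s1 s2].
have cs : c < s < d.
  apply/andP; split.
    by case/orP: s1; apply: lt_le_trans.
  by case/orP: s2 => h; apply: le_lt_trans h _.
split; last by case: (H s cs).
by exists phi, c, d; split; rewrite ?c0.
Qed.

Lemma reaches_Lambda x t y : reaches X x t y -> Lambda y = Lambda x.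
Proof.
move=> /reaches_path[phi [p0 pt H]].
have D s : Num.min 0 t <= s <= Num.max 0 t ->
    is_derive (s : R^o) 1 ((fun t => Lambda (phi t)) : R^o -> _) (0 : 'rV[R]_(N - 3)).
  move=> /H[/reaches_domain[_ os] ds].
  have := cder_comp (Lambda_diff os) ds.
  by rewrite -(cX os) deriveE //; exact: Lambda_diff.
have h0 : Num.min 0 t <= 0 <= Num.max 0 t by rewrite ge_min le_max lexx.
have ht : Num.min 0 t <= t <= Num.max 0 t by rewrite ge_min le_max lexx !orbT.
have := curve_mvt_abs (M := 0) D _ (lexx 0) h0 ht.
rewrite p0 pt mul0r => H0; apply/eqP; rewrite -subr_eq0 -normr_le0; apply: H0 => s _.
by rewrite normr0.
Qed.

Lemma jac_flow_Lambda x t y : reaches X x t y ->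
  jac (flow X t) x *m jac (@Lambda R N) y = jac (@Lambda R N) x.
Proof.
move=> H; have [ox oy] := reaches_domain H.
have dt : differentiable (@Lambda R N) (flow X t x) by rewrite (flowE H); apply: Lambda_diff.
rewrite -[in LHS](flowE H) -(jac_comp (flow_diff H) dt).
have [r r0 A] := reaches_near H; apply: (jac_near r0) => x' /A h.
exact: reaches_Lambda h.
Qed.

Lemma flow_cder x (c d : R) : (forall s, c < s < d -> exists y, reaches X x s y) ->
  forall s, c < s < d -> ordered (flow X s x) /\
    is_derive (s : R^o) 1 ((fun u => flow X u x) : R^o -> _) (X (flow X s x)).
Proof.
move=> H s cs; have [y Hy] := H s cs; have [_ oy] := reaches_domain Hy.
rewrite (flowE Hy); split=> //.
move: Hy => [phi [c' [d' [c0 /andP[ct td] T p0 pt]]]].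
have m0 : 0 < Num.min (s - c') (d' - s) by rewrite lt_min !subr_gt0 ct.
have := (T s _).2; rewrite pt => /(_ _); rewrite ct td => /(_ isT).
apply: (cder_near m0) => u; rewrite lt_min !ltr_distl => /andP[/andP[u1 _] /andP[_ u2]].
apply/esym/flowE; exists phi, c', d'; split=> //.
by apply/andP; split; qlra.
Qed.

(** The flow map of time t sends the solution through x to the same solution shifted by t;
    differentiating this at 0 gives the claim. *)
Lemma jac_flow_field x t y : reaches X x t y -> X x *m jac (flow X t) x = X y.
Proof.
move=> H; have dF := flow_diff H; move: (H) => [phi [c [d [c0 ct T p0 pt]]]].
have {c0} /andP[c0 d0] := c0; have {ct} /andP[ct td] := ct.
pose e := Num.min (Num.min (- c) d) (Num.min (t - c) (d - t)).
have e0 : 0 < e by rewrite !lt_min oppr_gt0 c0 d0 !subr_gt0 ct td.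
have T0 : is_derive (0 : R^o) 1 (phi : R^o -> _) (X x).
  by rewrite -p0; apply: (T 0 _).2; rewrite c0.
have Tt : is_derive (0 : R^o) 1 ((fun s => phi (s + t)) : R^o -> _) (X y).
  by rewrite -pt; apply: cder_shift; rewrite add0r; apply: (T t _).2; rewrite ct.
rewrite -p0 in dF; have D1 := cder_comp dF T0.
rewrite -(deriveE _ dF) (jacP _ dF) p0 in D1.
apply: (cder_unique D1); apply: (cder_near e0) Tt => s; rewrite subr0 !lt_min !ltr_norml.
move=> /andP[/andP[/andP[s1 s2] /andP[s3 s4]] /andP[/andP[s5 s6] /andP[s7 s8]]].
apply/esym/flowE/(trajectory_reach T); apply/andP; split; qlra.
Qed.

Lemma pair_norm_lt (t t0 : R) x x0 (r : R) : `|t - t0| < r -> `|x - x0| < r ->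
  `|row_mx t%:M x - row_mx t0%:M x0| < r.
Proof.
move=> tr xr; rewrite opp_row_mx add_row_mx; apply: row_mx_norm_lt => //.
apply: le_lt_trans tr; apply: mx_norm_le => // i j.
by rewrite !ord1 sub_mxE !scalar_mx00.
Qed.

Lemma jac_flow_cont x0 t0 y0 : reaches X x0 t0 y0 -> forall e, 0 < e ->
  exists2 d : R, 0 < d & forall t x, `|t - t0| < d -> `|x - x0| < d ->
    reaches X x t (flow X t x) /\ `|jac (flow X t) x - jac (flow X t0) x0| < e.
Proof.
move=> H e e0; have [r r0 [A C]] := flow_joint oU sX 1 H.
pose F (z : 'rV[R]_(1 + N)) := flow X (lsubmx z 0 0) (rsubmx z); rewrite -[X in Ck_on _ _ X]/F in C; pose J : 'M[R]_(N, 1 + N) := row_mx 0 1%:M.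
(* At fixed time the flow is a slice of the joint flow, so its Jacobian is a block of the joint one,
   and the latter is continuous. *)
have E t x : `|t - t0| < r -> `|x - x0| < r -> jac (flow X t) x = J *m jac F (row_mx t%:M x).
  move=> tr xr; pose c : 'rV[R]_(1 + N) := row_mx t%:M 0.
  have JE y : y *m J + c = row_mx t%:M y.
    by rewrite /c mul_mx_row mulmx0 mulmx1 add_row_mx add0r addr0.
  have dF : differentiable F (x *m J + c).
    by apply: C.1; rewrite JE; exact: pair_norm_lt.
  have [|dJ DJ] := @eps_jac R N (1 + N) (fun x => x *m J + c) x J.
    move=> e' e'0; exists 1 => // v _; rewrite mulmxDl.
    rewrite (_ : _ - _ - _ = 0) ?normr0; first by rewrite mulr_ge0 // ltW.
    by apply/rowP => j; rewrite !mxE; ring.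
  have := jac_comp dJ dF; rewrite (jac_unique DJ).
  rewrite JE => <-; apply: (jac_near (@ltr01 R)) => y _.
  by rewrite JE /F row_mxKl row_mxKr scalar_mx00.
have [k [k0 Hk]] : exists k : R, 0 < k /\ forall M : 'M[R]_(1 + N, N), `|J *m M| <= k * `|M|.
  exists ((1 + N)%:R * `|J| + 1); split; first by rewrite ltr_wpDl // mulr_ge0.
  move=> M; apply: le_trans (mulmx_norm _ _) _.
  by rewrite mulrDl lerDl mul1r.
have B0 : [set z | `|z - row_mx t0%:M x0| < r] (row_mx t0%:M x0).
  by rewrite /= subrr normr0.
have [d d0 Hd] := jac_cont C B0 (divr_gt0 e0 k0).
exists (Num.min r d); first by rewrite lt_min r0.
move=> t x; rewrite !lt_min => /andP[tr td] /andP[xr xd]; split; first exact: A.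
have h0 : `|t0 - t0| < r by rewrite subrr normr0.
have h1 : `|x0 - x0| < r by rewrite subrr normr0.
rewrite (E t x tr xr) (E t0 x0 h0 h1) -mulmxBr; apply: le_lt_trans (Hk _) _.
rewrite mulrC -(ltr_pdivlMr _ _ k0).
have h2 := pair_norm_lt td xd; have h3 := pair_norm_lt tr xr.
exact: (Hd _ h3 h2).
Qed.

(** A compactness argument in the form of a continuation: P c says that one radius and one Lipschitz
    constant work for all parameters in [a, c]. *)
Lemma flow_uniform (a b : R) (q : R -> 'rV[R]_N) (u : R -> R) : a <= b ->
  (forall s, a <= s <= b -> {for s, continuous q}) ->
  (forall s, a <= s <= b -> {for s, continuous (u : R -> R^o)}) ->
  (forall s, a <= s <= b -> exists y, reaches X (q s) (u s) y) ->
  exists eta L : R, [/\ 0 < eta, 0 <= L,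
    forall s x, a <= s <= b -> `|x - q s| < eta -> reaches X x (u s) (flow X (u s) x) &
    forall s x x', a <= s <= b -> `|x - q s| < eta -> `|x' - q s| < eta ->
      `|flow X (u s) x - flow X (u s) x'| <= L * `|x - x'|].
Proof.
move=> ab cq cu H.
pose P (c : R) := exists eta L : R, [/\ 0 < eta, 0 <= L,
    forall s x, a <= s <= c -> `|x - q s| < eta -> reaches X x (u s) (flow X (u s) x) &
    forall s x x', a <= s <= c -> `|x - q s| < eta -> `|x' - q s| < eta ->
      `|flow X (u s) x - flow X (u s) x'| <= L * `|x - x'|].
have loc c : a <= c <= b -> exists e eta L : R, [/\ 0 < e, 0 < eta, 0 <= L,
    forall s x, `|s - c| < e -> `|x - q s| < eta -> reaches X x (u s) (flow X (u s) x) &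
    forall s x x', `|s - c| < e -> `|x - q s| < eta -> `|x' - q s| < eta ->
      `|flow X (u s) x - flow X (u s) x'| <= L * `|x - x'|].
  move=> cab; have [y Hy] := H c cab.
  have [r r0 [A C]] := flow_joint oU sX 1 Hy.
  have oB := @open_dist R (1 + N) (row_mx (u c)%:M (q c)) r.
  have B0 : [set z | `|z - row_mx (u c)%:M (q c)| < r] (row_mx (u c)%:M (q c)).
    by rewrite /= subrr normr0.
  have [r' [L [r'0 L0 _ _ HL]]] := loc_lip oB C B0.
  pose m := Num.min r r' / 2.
  have m0 : 0 < m by rewrite divr_gt0 // lt_min r0.
  have m2 : m + m = Num.min r r' by rewrite /m -splitr.
  have mr : m + m <= r by rewrite m2 ge_min lexx.
  have mr' : m + m <= r' by rewrite m2 ge_min lexx orbT.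
  have [d1 d10 H1] := (cont_eps _ _).1 (cq c cab) m m0.
  have [d2 d20 H2] := (cont_eps _ _).1 (cu c cab) m m0.
  exists (Num.min d1 d2), m, L; split=> //; first by rewrite lt_min d10.
    move=> s x; rewrite lt_min => /andP[/H1 s1 /H2 s2] xq; apply: A; first by apply: lt_trans s2 _; qlra.
    by rewrite -(subrKA (q s)); apply: le_lt_trans (ler_normD _ _) _; qlra.
  move=> s x x'; rewrite lt_min => /andP[/H1 s1 /H2 s2] xq xq'.
  have near z : `|z - q s| < m -> `|row_mx (u s)%:M z - row_mx (u c)%:M (q c)| <= r'.
    move=> zq; apply/ltW/pair_norm_lt; first by apply: lt_trans s2 _; qlra.
    by rewrite -(subrKA (q s)); apply: le_lt_trans (ler_normD _ _) _; qlra.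
  have := HL _ _ (near _ xq) (near _ xq').
  rewrite !row_mxKl !row_mxKr !scalar_mx00 => /le_trans; apply.
  rewrite ler_wpM2l // opp_row_mx add_row_mx subrr; exact: row_mx0_norm.
suff [eta [L [eta0 L0 A B]]] : P b by exists eta, L; split=> // s.
apply: (@seg_locally_const _ a b P _ a b); rewrite ?lexx ?ab //; last first.
  have [|e [eta [L [e0 eta0 L0 A B]]]] := loc a; first by rewrite lexx.
  exists eta, L; split=> // s x => [|x'] /andP[s1 s2].
    by apply: A; rewrite (le_anti (introT andP (conj s2 s1))) subrr normr0.
  by apply: B; rewrite (le_anti (introT andP (conj s2 s1))) subrr normr0.
move=> c cab; have [e [eta [L [e0 eta0 L0 A B]]]] := loc c cab.
exists e => // s' s'' s'ab s''ab cs' cs'' [eta' [L' [eta'0 L'0 A' B']]].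
exists (Num.min eta eta'), (Num.max L L'); split.
- by rewrite lt_min eta0.
- by rewrite le_max L0.
- move=> s x /andP[s1 s2]; rewrite lt_min => /andP[x1 x2].
  have [ss|ss] := leP s s'; first by apply: A' => //; rewrite s1.
  apply: A => //; move: cs' cs''; rewrite !ltr_norml; qlra.
- move=> s x x' /andP[s1 s2]; rewrite !lt_min => /andP[x1 x2] /andP[x3 x4].
  have [ss|ss] := leP s s'.
    apply: le_trans (B' _ _ _ _ x2 x4) _; first by rewrite s1.
    by rewrite ler_wpM2r // le_max lexx orbT.
  apply: le_trans (B _ _ _ _ x1 x3) _; last by rewrite ler_wpM2r // le_max lexx.
  move: cs' cs''; rewrite !ltr_norml; qlra.
Qed.

(** * Returns and periodic orbits *)

Lemma ret_opp x T k : reaches X x T (translate k x) -> reaches X x (- T) (translate (- k) x).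
Proof.
move=> /reaches_opp/(reaches_translate (- k)).
by rewrite translateK.
Qed.

Lemma ret_nat x T k m : reaches X x T (translate k x) ->
  reaches X x (m%:R * T) (translate (k *+ m) x).
Proof.
move=> H; have [ox _] := reaches_domain H.
elim: m => [|m IH]; first by rewrite mul0r mulr0n translate0; apply: reaches0.
have := reaches_trans IH (reaches_translate (k *+ m) H).
by rewrite translateD -mulrSr -natr1 mulrDl mul1r.
Qed.

Lemma ret_int x T k (m : int) : reaches X x T (translate k x) ->
  reaches X x (m%:~R * T) (translate (k * m) x).
Proof.
case: m => m H; first by have := ret_nat m H; rewrite -[k *+ m]mulr_natr natz.
rewrite NegzE mulrN mulrNz mulNr; apply: ret_opp.
by have := ret_nat m.+1 H; rewrite -[k *+ m.+1]mulr_natr natz.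
Qed.

Lemma ret_reduce x T k t : 0 < T -> reaches X x T (translate k x) ->
  exists s (m : int) y, [/\ 0 <= s < T, t = s + m%:~R * T, reaches X x s y &
    reaches X x t (translate (k * m) y)].
Proof.
move=> T0 H; pose m := Num.floor (t / T).
have /andP[m1 m2] := floor_itv (t / T).
have s0 : 0 <= t - m%:~R * T by rewrite subr_ge0 -ler_pdivlMr.
have s1 : t - m%:~R * T < T.
  by rewrite ltrBlDr -[X in X + _]mul1r -mulrDl -ltr_pdivrMr // addrC -[X in _ + X]/(1%:~R) -intrD.
have [phi [p0 pT P]] := reaches_path H.
have [|Hs _] := P (t - m%:~R * T).
  by rewrite ge_min le_max s0 (ltW s1) orbT.
exists (t - m%:~R * T), m, (phi (t - m%:~R * T)); split=> //.
- by rewrite s0.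
- by rewrite subrK.
have := reaches_trans (ret_int m H) (reaches_translate (k * m) Hs).
by rewrite addrC subrK.
Qed.

Lemma ret_total x T k : 0 < T -> reaches X x T (translate k x) -> flow_total X x.
Proof.
move=> T0 H t; have [s [m [y [_ _ _ /reaches_flow]]]] := ret_reduce t T0 H.
by [].
Qed.

Lemma total_cder x : flow_total X x -> forall s, ordered (flow X s x) /\
  is_derive (s : R^o) 1 ((fun u => flow X u x) : R^o -> _) (X (flow X s x)).
Proof.
move=> H s; apply: (@flow_cder x (s - 1) (s + 1)); last by apply/andP; split; qlra.
by move=> u _; exists (flow X u x).
Qed.

Lemma total_cont x : flow_total X x -> forall s, {for s, continuous (fun u => flow X u x)}.
Proof. by move=> H s; have [_ D] := total_cder H s; exact: cder_cont D. Qed.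

Lemma total_flow x s t : flow_total X x -> reaches X (flow X s x) t (flow X (s + t) x).
Proof.
by move=> H; have := reaches_trans (reaches_opp (H s)) (H (s + t)); rewrite addrA addNr add0r.
Qed.

Lemma ret_flow x T k s y : reaches X x T (translate k x) -> reaches X x s y ->
  reaches X y T (translate k y).
Proof.
move=> H1 H2; have := reaches_trans (reaches_opp H2) H1.
by move/reaches_trans => /(_ _ _ (reaches_translate k H2)); rewrite addrAC addNr add0r.
Qed.

Lemma ret_translate l x T k : reaches X x T (translate k x) ->
  reaches X (translate l x) T (translate k (translate l x)).
Proof. by move/(reaches_translate l); rewrite !translateD addrC. Qed.

Lemma ret_time_flow x T s y : ret_time X x T -> reaches X x s y -> ret_time X y T.
Proof.
move=> [T0 [k H] min] xy; split=> //; first by exists k; apply: ret_flow H xy.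
move=> u l uT /ret_flow/(_ (reaches_opp xy)); exact: min.
Qed.

Lemma ret_time_translate l x T : ret_time X x T -> ret_time X (translate l x) T.
Proof.
move=> [T0 [k H] min]; split=> //; first by exists k; apply: ret_translate.
by move=> u l' uT /(ret_translate (- l)); rewrite translateK; apply: min.
Qed.

Lemma ret_time_unique x T T' : ret_time X x T -> ret_time X x T' -> T = T'.
Proof.
move=> [T0 [k H] min] [T'0 [k' H'] min'].
have [TT|TT|//] := ltgtP T T'; first by case: (min' _ k _ H); rewrite T0.
by case: (min _ k' _ H'); rewrite T'0.
Qed.

Lemma ret_time_total x T : ret_time X x T -> flow_total X x.
Proof. by move=> [T0 [k H] _]; apply: ret_total T0 H. Qed.

Lemma global_reaches (phi : R -> 'rV[R]_N) t : global_solution X phi ->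
  reaches X (phi 0) t (phi t).
Proof.
move=> H; exists phi, (- (`|t| + 1)), (`|t| + 1).
have h := normr_ge0 t; have h1 := ler_norm t; have h2 := lerNnormlW (lexx `|t|).
split=> //; apply/andP; split; qlra.
Qed.

Lemma solution_ret x phi T : solution_from X x phi T ->
  ret_time X x T /\ phi = fun t => flow X t x.
Proof.
move=> [G p0 [T0 per min]]; have H t : reaches X x t (phi t) by rewrite -p0; apply: global_reaches.
split; last by apply/funext => t; rewrite (flowE (H t)).
split=> //.
  have [k] := per 0; rewrite add0r p0 => E.
  by exists k; rewrite -E.
move=> s k sT h; apply: (min s sT) => t; exists k.
by rewrite -(flowE (H (t + s))) addrC (flowE (reaches_trans h (reaches_translate k (H t)))).
Qed.

Lemma ret_solution x T : ret_time X x T -> solution_from X x (fun t => flow X t x) T.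
Proof.
move=> RT; have tot := ret_time_total RT; move: (RT) => [T0 [k H] min].
have [ox _] := reaches_domain H; split; first exact: total_cder.
  by rewrite flow0.
split=> // [t|s sT per].
  exists k; rewrite addrC; apply: flowE; apply: reaches_trans H _.
  exact: reaches_translate.
have [l] := per 0; rewrite add0r flow0 // => E.
by apply: (min s l sT); rewrite -E.
Qed.

Lemma orbit_self x : ordered x -> orbit X x x.
Proof. by move=> ox; exists 0, x; [apply: reaches0|exists 0; rewrite translate0]. Qed.

Lemma orbit_flow x t : flow_total X x -> orbit X x (flow X t x).
Proof. by move=> H; exists t, (flow X t x) => //; exists 0; rewrite translate0. Qed.

Lemma orbit_sym x y : orbit X x y -> orbit X y x.
Proof.
move=> [t [z xz [k ->]]]; exists (- t), (translate k x); last by exists (- k); rewrite translateK.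
exact/reaches_translate/reaches_opp.
Qed.

Lemma orbit_trans x y z : orbit X x y -> orbit X y z -> orbit X x z.
Proof.
move=> [t [w xw [k ->]]] [s [u wu [l ->]]]; exists (t + s), (translate (- k) u).
  apply: reaches_trans xw _; have := reaches_translate (- k) wu.
  by rewrite translateK.
by exists (k + l); rewrite translateD addrAC subrr add0r.
Qed.

Lemma orbit_eq x y : orbit X x y -> orbit X x = orbit X y.
Proof.
move=> H; apply/seteqP; split=> z; last exact: orbit_trans.
by apply: orbit_trans; apply: orbit_sym.
Qed.

Lemma orbit_ordered x y : orbit X x y -> ordered y.
Proof. by move=> [t [z /reaches_domain[_ oz] [k ->]]]; apply: translate_ordered. Qed.

Lemma orbit_Lambda x y : orbit X x y -> Lambda y = Lambda x.
Proof. by move=> [t [z /reaches_Lambda E [k ->]]]; rewrite Lambda_translate. Qed.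

Lemma orbit_ret x y T : ret_time X x T -> orbit X x y -> ret_time X y T.
Proof. by move=> H [t [z xz [k ->]]]; apply/ret_time_translate/ret_time_flow/xz. Qed.

Lemma orbit_same x y z : orbit X x y -> same_point y z -> orbit X x z.
Proof.
by move=> [t [w xw wy]] yz; exists t, w => //; apply: same_point_trans wy yz.
Qed.

Lemma periodic_orbitP C x : periodic_orbit X C -> C x ->
  exists2 T, ret_time X x T & C = orbit X x.
Proof.
move=> [phi [T [G M ->]]] [t0 px].
have [|RT E] := @solution_ret (phi 0) phi T; first by split.
have O : orbit X (phi 0) x by exists t0, (phi t0) => //; apply: global_reaches.
exists T; first exact: orbit_ret O.
rewrite -(orbit_eq O); apply/seteqP; split=> y; first by move=> [t py]; exists t, (phi t) => //; apply: global_reaches.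
by move=> [t [z xz zy]]; exists t; rewrite -(reaches_unique xz (global_reaches t G)).
Qed.

Lemma ret_periodic_orbit x T : ret_time X x T -> periodic_orbit X (orbit X x).
Proof.
move=> RT; have [G p0 M] := ret_solution RT; exists (fun t => flow X t x), T; split=> //.
have tot := ret_time_total RT.
apply/seteqP; split=> y [t]; last by move=> h; exists t, (flow X t x).
by move=> [z /flowE <- zy]; exists t.
Qed.

Lemma orbit_nonempty C : periodic_orbit X C -> exists x, C x.
Proof.
by move=> [phi [T [_ _ ->]]]; exists (phi 0), 0, 0; rewrite translate0.
Qed.

Lemma flow_joint_cont x0 t0 y0 : reaches X x0 t0 y0 -> forall e, 0 < e ->
  exists2 d : R, 0 < d & forall t x, `|t - t0| < d -> `|x - x0| < d ->
    reaches X x t (flow X t x) /\ `|flow X t x - y0| < e.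
Proof.
move=> H e e0; have [r r0 [A C]] := flow_joint oU sX 0 H.
have B0 : [set z : 'rV[R]_(1 + N) | `|z - row_mx t0%:M x0| < r] (row_mx t0%:M x0).
  by rewrite /= subrr normr0.
have [d d0 Hd] := (cont_eps _ _).1 (Ck_on_cont C B0) e e0.
exists (Num.min r d); first by rewrite lt_min r0.
move=> t x; rewrite !lt_min => /andP[tr td] /andP[xr xd]; split; first exact: A.
have := Hd _ (pair_norm_lt td xd); rewrite !row_mxKl !row_mxKr !scalar_mx00.
by rewrite -[flow_in X _ t0 x0]/(flow X t0 x0) (flowE H).
Qed.

Lemma field_cont x : ordered x -> forall e, 0 < e -> exists2 d : R, 0 < d &
  forall y, `|y - x| < d -> `|X y - X x| < e.
Proof. by move=> ox; apply/cont_eps; apply: (Ck_on_cont (sX 0%N)). Qed.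

(** Along short solutions the field stays e-close to its value at x; hence a first order expansion
    that is uniform in the starting point. *)
Lemma flow_linear x : ordered x -> forall e, 0 < e -> exists2 d : R, 0 < d &
  forall y s, `|y - x| < d -> `|s| < d ->
    reaches X y s (flow X s y) /\ `|flow X s y - y - s *: X x| <= e * `|s|.
Proof.
move=> ox e e0; have [r r0 Hr] := field_cont ox e0.
have [d d0 Hd] := flow_joint_cont (reaches0 ox) r0.
exists d => // y s yd sd; have [|ys _] := Hd s y _ yd; first by rewrite subr0.
split=> //; have oy := (reaches_domain ys).1.
have D u : - d < u < d -> is_derive (u : R^o) 1 ((fun u => flow X u y - u *: X x) : R^o -> _)
    (X (flow X u y) - X x).
  move=> ud; have [|_ D1] := flow_cder (x := y) (c := - d) (d := d) _ ud.
    by move=> v vd; exists (flow X v y); apply: (Hd v y _ yd).1; rewrite subr0 ltr_norml.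
  have D2 := cder_line (0 : 'rV[R]_N) (X x) u.
  have := cderB D1 D2; apply: cder_near (@ltr01 R) _ => v _.
  by rewrite add0r.
have h0 : Num.min 0 s <= 0 <= Num.max 0 s by rewrite ge_min le_max lexx.
have hs : Num.min 0 s <= s <= Num.max 0 s by rewrite ge_min le_max lexx !orbT.
have box u : Num.min 0 s <= u <= Num.max 0 s -> `|u| < d.
  rewrite ge_min le_max => /andP[u1 u2]; move: sd; rewrite !ltr_norml.
  case/orP: u1 => u1; case/orP: u2 => u2; qlra.
have D' u : Num.min 0 s <= u <= Num.max 0 s -> is_derive (u : R^o) 1
    ((fun u => flow X u y - u *: X x) : R^o -> _) (X (flow X u y) - X x).
  by move=> /box; rewrite ltr_norml; apply: D.
have B u : Num.min 0 s <= u <= Num.max 0 s -> `|X (flow X u y) - X x| <= e.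
  move=> /box ud; apply/ltW/Hr; apply: (Hd u y _ yd).2; by rewrite subr0.
have := curve_mvt_abs D' B (ltW e0) h0 hs.
by rewrite subr0 scale0r subr0 flow0 // addrAC.
Qed.

(** At a short return the i-th angle would change by 0, although its speed is not 0, or by at least
    2 pi, which takes too long. *)
Lemma small_return x (i : 'I_N) : ordered x -> X x 0 i != 0 ->
  exists2 e : R, 0 < e & forall y s k, `|y - x| < e -> 0 < `|s| < e ->
    ~ reaches X y s (translate k y).
Proof.
move=> ox Xi; pose a := `|X x 0 i|; have a0 : 0 < a by rewrite normr_gt0.
have [d d0 Hd] := flow_linear ox (divr_gt0 a0 (ltr0Sn R 1)).
exists (Num.min d (1 / (2 * a))); first by rewrite lt_min d0 divr_gt0 // mulr_gt0.
move=> y s k; rewrite !lt_min => /andP[yd _] /andP[s0 /andP[sd sa]] ys.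
have [_] := Hd y s yd sd; rewrite (flowE ys).
rewrite (_ : translate k y - y = const_mx (2 * pi * k%:~R)); last first.
  by rewrite /translate addrAC subrr add0r.
move=> /(le_trans (mx_entry_le _ 0 i)); rewrite !mxE => H.
have pi2 := @pi_ge2 R.
have h1 : `|s * X x 0 i| = `|s| * a by rewrite normrM.
have sa' : `|s| * a < 1 / 2.
  by rewrite -ltr_pdivlMr // (_ : 1 / 2 / a = 1 / (2 * a)) //; field; rewrite gt_eqF.
have sa0 : 0 < `|s| * a by rewrite mulr_gt0.
have [k0|k0] := eqVneq k 0.
  move: H; rewrite k0 mulr0z mulr0 sub0r normrN h1; qlra.
have k1 : 1 <= `|k%:~R : R|.
  rewrite -intr_norm -[1]/(1%:~R) ler_int -gtz0_ge1 normr_gt0 //.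
have := ler_normB (2 * pi * k%:~R) (2 * pi * k%:~R - s * X x 0 i).
rewrite opprB addrC subrK h1 normrM => H2.
have H3 : `|2 * pi * k%:~R| <= a / 2 * `|s| + `|s| * a.
  rewrite -[2 * pi * k%:~R](subrK (s * X x 0 i)); apply: le_trans (ler_normD _ _) _.
  by rewrite h1; apply: lerD.
move: H3; rewrite normrM (gtr0_norm (_ : 0 < 2 * pi)); last qlra.
have : 2 * pi * 1 <= 2 * pi * `|k%:~R : R| by rewrite ler_wpM2l //; qlra.
qlra.
Qed.

Lemma translate_small (l : int) x z : `|translate l z - x| < 1 -> `|z - x| < 1 -> l = 0.
Proof.
move=> h1 h2; have [//|l0] := eqVneq l 0.
have l1 : 1 <= `|l%:~R : R|.
  rewrite -intr_norm -[1]/(1%:~R) ler_int -gtz0_ge1 normr_gt0 //.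
have iN : (0 < N)%N by apply: leq_trans HN.
have pi2 := @pi_ge2 R.
have := le_lt_trans (mx_entry_le _ 0 (Ordinal iN)) h1.
have := le_lt_trans (mx_entry_le _ 0 (Ordinal iN)) h2.
rewrite !sub_mxE translate_coord; set c := z 0 _ - _ => h3.
rewrite addrAC -/c => h4.
have : `|2 * pi * l%:~R : R| < 2.
  rewrite -[2 * pi * _](addrK c) [_ + c]addrC; apply: le_lt_trans (ler_normB _ _) _.
  rewrite (_ : 2 = 1 + 1) //; exact: ltrD.
rewrite normrM (gtr0_norm (_ : 0 < 2 * pi)); last qlra.
have : 2 * pi * 1 <= 2 * pi * `|l%:~R : R| by rewrite ler_wpM2l //; qlra.
by move=> h5 h6; exfalso; qlra.
Qed.

(** Orbit points close to x lie on the short arc through x: for times that stay away from the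
    multiples of T, the chordal distance to x is bounded below. *)
Lemma local_return x T : ret_time X x T -> forall e, 0 < e -> exists2 eta : R, 0 < eta &
  forall t l y, reaches X x t y -> `|translate l y - x| < eta ->
    exists2 t', `|t'| < e & reaches X x t' (translate l y).
Proof.
move=> RT e e0; have tot := ret_time_total RT; move: (RT) => [T0 [k H] min].
have [ox _] := reaches_domain H.
have [d d0 Hd] := flow_joint_cont (reaches0 ox) (@ltr01 R).
pose c := Num.min (Num.min d e) (T / 3).
have c0 : 0 < c by rewrite !lt_min d0 e0 divr_gt0.
have cT : c <= T / 3 by rewrite /c ge_min lexx orbT.
have [cd ce] : c <= d /\ c <= e by rewrite /c !ge_min !lexx !orbT.
pose D := chordal x; have Dt := chordal_translate x; have D0 := chordal_ge0 x.
have Dx := chordal_self x; have Dc z := @chordal_cont R N x z.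
rewrite -/D in Dt D0 Dx Dc.
have cTc : c <= T - c by qlra.
have [|s0 + Hs0] := @EVT_min R (fun s => D (flow X s x)) c (T - c) cTc.
  apply: continuous_in_subspaceT => s _.
  exact: (@continuous_comp R^o _ R^o (fun s => flow X s x) D s (total_cont tot (s := s)) (Dc _)).
rewrite in_itv /= => /andP[s01 s02].
(* A zero of the chordal distance would be a return strictly between the times 0 and T. *)
have m0 : 0 < D (flow X s0 x).
  rewrite lt_def D0 andbT; apply/negP => /eqP Z.
  have [l E] := chordal_eq0 HN ox (total_cder tot s0).1 Z.
  apply: (min s0 l); last by rewrite -E; apply: tot.
  by apply/andP; split; qlra.
have [r r0 Hr] := (cont_eps _ _).1 (Dc x) _ m0.
exists (Num.min r 1); first by rewrite lt_min r0 ltr01.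
move=> t l y xy; rewrite lt_min => /andP[/Hr + h1].
rewrite Dx subr0 Dt ger0_norm // => Dy.
have [s [m [z [/andP[sz sT] E xs xt]]]] := ret_reduce t T0 H.
have Ey := reaches_unique xy xt; have Ez := flowE xs.
have near s' w : `|s'| < c -> reaches X x s' w -> `|w - x| < 1.
  move=> s'c xw; have [||_] := Hd s' x; rewrite ?subr0 ?subrr ?normr0 ?(flowE xw) //.
  exact: lt_le_trans s'c cd.
have [sc|sc] := ltP s c.
  have l0 : l + k * m = 0.
    have zx : `|z - x| < 1 by apply: near xs; rewrite ger0_norm.
    have h : `|translate (l + k * m) z - x| < 1 by rewrite -translateD -Ey.
    exact: translate_small h zx.
  by exists s; [rewrite ger0_norm // (lt_le_trans sc ce)|rewrite Ey translateD l0 translate0].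
have [sTc|sTc] := ltP (T - c) s.
  have xs' : reaches X x (s - T) (translate (- k) z).
    rewrite addrC; apply: reaches_trans (ret_opp H) _.
    exact: reaches_translate.
  have l0 : l + k * m + k = 0.
    have zx : `|translate (- k) z - x| < 1.
      by apply: near xs'; rewrite ltr_norml; apply/andP; split; qlra.
    have h : `|translate (l + k * m + k) (translate (- k) z) - x| < 1.
      by rewrite translateD addrK -translateD -Ey.
    exact: translate_small h zx.
  exists (s - T); first by rewrite ltr_norml; apply/andP; split; qlra.
  by rewrite Ey translateD (_ : l + k * m = - k) //; apply/eqP; rewrite -addr_eq0 l0.
have : D (flow X s0 x) <= D (flow X s x) by apply: Hs0; rewrite in_itv /= sc.
rewrite Ez => /le_lt_trans /(_ _); move: Dy; rewrite Ey Dt => Dy /(_ _ Dy).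
by rewrite ltxx.
Qed.

Lemma field_neq0 x T : ret_time X x T -> X x != 0.
Proof.
move=> [T0 [k H] min]; apply/eqP => X0; have [ox _] := reaches_domain H.
have xT : reaches X x (T / 2) x.
  exists (fun=> x), (- T), T; split; rewrite ?oppr_lt0 ?T0 //; first by apply/andP; split; qlra.
  move=> s _; split=> //; rewrite X0; exact: cder_cst.
apply: (min (T / 2) 0); last by rewrite translate0.
by apply/andP; split; qlra.
Qed.

(** * The linearized return map *)

Lemma jac_Lambda_field x : ordered x -> X x *m jac (@Lambda R N) x = 0.
Proof. by move=> ox; rewrite -jacP ?cX //; exact: Lambda_diff. Qed.

(** The field lies in the kernel of the derivative of the cross ratios, where the first three
    entries cannot all vanish. An index below 3 is wanted for the charts, in which this angle is a
    coordinate of its own. *)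
Lemma field_head x T : ret_time X x T -> exists2 i : 'I_N, (i < 3)%N & X x 0 i != 0.
Proof.
move=> RT; have [ox _] : ordered x /\ ordered x.
  by move: RT => [_ [k /reaches_domain[]]].
have [//|H] := pselect (exists2 i : 'I_N, (i < 3)%N & X x 0 i != 0).
have := field_neq0 RT; rewrite (Lambda_kernel HN ox (jac_Lambda_field ox)) ?eqxx // => j j3.
by apply/eqP/negPn/negP => Xj; apply: H; exists j.
Qed.

Lemma jac_ret_field x T k : reaches X x T (translate k x) -> X x *m jac (flow X T) x = X x.
Proof. by move=> H; rewrite (jac_flow_field H) tX. Qed.

Lemma jac_ret_Lambda x T k : reaches X x T (translate k x) ->
  jac (flow X T) x *m jac (@Lambda R N) x = jac (@Lambda R N) x.
Proof.
move=> H; have [ox _] := reaches_domain H.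
by rewrite -[in RHS](jac_flow_Lambda H) jac_Lambda_translate.
Qed.

Lemma jac_ret_pow x T k m : reaches X x T (translate k x) ->
  jac (flow X (m%:R * T)) x = jac (flow X T) x ^+ m.
Proof.
move=> H; have [ox _] := reaches_domain H.
elim: m => [|m IH]; first by rewrite mul0r expr0 jac_flow0.
rewrite -natr1 mulrDl mul1r exprSr -IH.
rewrite (jac_flow_trans (ret_nat m H) (reaches_translate (k *+ m) H)).
by rewrite (jac_flow_translate _ H).
Qed.

(** Stability is applied to a point of the level set at x + s u + o(s). After m periods it is within
    about K0 q^m s |u| of the orbit. By [local_return] the orbit point realizing this lies on the
    short arc through the base point, hence differs from it by a multiple of the field up to o(s).
    Projecting along the field leaves a bound for the linearization. *)
Lemma linear_contraction x T i : ret_time X x T ->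
  exp_stable_in X (level (Lambda x)) (orbit X x) -> X x 0 i != 0 ->
  exists K q : R, [/\ 0 <= K, 0 < q < 1 & forall m (u : 'rV[R]_N), u *m jac (@Lambda R N) x = 0 ->
    `|u *m jac (flow X T) x ^+ m *m along (X x) i| <= K * q ^+ m * `|u|].
Proof.
move=> RT [eta0 [K0 [mu [eta00 K00 mu0 ES]]]] Xi.
have tot := ret_time_total RT; move: (RT) => [T0 [k H] _].
have [ox _] := reaches_domain H.
pose P := along (X x) i; have [cP cP0 HP] := mulmxr_bound P.
pose q := expR (- mu * T).
have q01 : 0 < q < 1 by rewrite expR_gt0 /= -expR0 ltr_expR mulNr oppr_lt0 mulr_gt0.
have qm m : expR (- mu * (m%:R * T)) = q ^+ m by rewrite mulrCA expRM_natl.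
have [q0 q1] := andP q01; have qm0 m : 0 <= q ^+ m by rewrite exprn_ge0 // ltW.
exists (cP * K0), q; split=> //; first by rewrite mulr_ge0 ?ltW.
move=> m u uL; have Hm := ret_nat m H; rewrite -(jac_ret_pow m H).
set B := jac _ x; have [cB cB0 HB] := mulmxr_bound B.
set F := flow X (m%:R * T) in B HB *; set x' := translate (k *+ m) x in Hm.
apply/ler_addgt0Pr => e e0.
(* The errors below add up to e1 c1, and e1 is chosen to make this at most e. *)
pose c1 := cP * (cB + `|u| + K0 * q ^+ m + 3).
have c10 : 0 < c1 by rewrite mulr_gt0 // ltr_wpDl // ?addr_ge0 ?mulr_ge0 // ltW.
pose e1 := Num.min 1 (e / c1).
have e10 : 0 < e1 by rewrite lt_min ltr01 divr_gt0.
have [e11 e1e] : e1 <= 1 /\ e1 <= e / c1 by rewrite /e1 !ge_min !lexx orbT.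
have [d1 d10 HF] := jac_eps (flow_diff Hm) e10.
have [r r0 HR] := reaches_near Hm.
pose beta := K0 * q ^+ m * (`|u| + e1) + e1.
have beta0 : 0 < beta by rewrite ltr_wpDl // mulr_ge0 ?mulr_ge0 ?addr_ge0 ?(ltW K00) ?(ltW e10).
(* The product s gam bounds the distance of the orbit point c from the base point x'. *)
pose gam := beta + (cB + 1) * (`|u| + 1).
have gam0 : 0 < gam by rewrite ltr_wpDr // mulr_ge0 ?addr_ge0 ?(ltW cB0).
have a0 : 0 < `|X x 0 i| by rewrite normr_gt0.
set a := `|X x 0 i| in a0.
pose e2 := Num.min (a / 2) (e1 * a / (2 * gam)).
have e20 : 0 < e2 by rewrite lt_min !divr_gt0 ?mulr_gt0.
have [e2a e2b] : e2 <= a / 2 /\ e2 <= e1 * a / (2 * gam) by rewrite /e2 !ge_min !lexx orbT.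
have [d2 d20 HL] := flow_linear ox e20.
have [eta eta_gt0 LR] := local_return RT d20.
have [d3 d30 LC] := level_curve HN ox uL e10.
pose u1 := `|u| + 1; have u10 : 0 < u1 by rewrite ltr_wpDl.
pose s := Num.min (Num.min (d3 / 2) (eta / (2 * gam))) (Num.min (eta0 / (2 * u1)) (Num.min (d1 / (2 * u1)) (r / (2 * u1)))).
have s0 : 0 < s by rewrite !lt_min !divr_gt0 ?mulr_gt0.
have small (w b : R) : 0 < w -> 0 < b -> s <= w / (2 * b) -> s * b < w.
  move=> w0 b0 /(ler_wpM2r (ltW b0)) => h; apply: le_lt_trans h _.
  rewrite (_ : w / (2 * b) * b = w / 2); first qlra.
  by field; rewrite gt_eqF.
have sd3 : s < d3.
  have : s <= d3 / 2 by rewrite /s !ge_min lexx.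
  qlra.
have seta : s * gam < eta by apply: small => //; rewrite /s !ge_min lexx orbT.
have seta0 : s * u1 < eta0 by apply: small => //; rewrite /s !ge_min lexx !orbT.
have sd1 : s * u1 < d1 by apply: small => //; rewrite /s !ge_min lexx !orbT.
have sr : s * u1 < r by apply: small => //; rewrite /s !ge_min lexx !orbT.
have [|y [oy Ly yu]] := LC s; first by rewrite s0.
pose v := y - x; have yE : y = x + v by rewrite /v addrC subrK.
have vle : `|v| <= s * (`|u| + e1).
  rewrite -[v](subrK (s *: u)); apply: le_trans (ler_normD _ _) _.
  rewrite normrZ gtr0_norm //; qlra.
have vu1 : `|v| <= s * u1 by apply: le_trans vle _; rewrite ler_wpM2l ?(ltW s0) // lerD2l.
have yreach : reaches X y (m%:R * T) (F y) by apply: HR; apply: le_lt_trans vu1 sr.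
have Fx : F x = x' := flowE Hm.
have HFv := HF v (le_lt_trans vu1 sd1); rewrite -yE -/F Fx -/B in HFv.
have E1 : `|F y - x' - s *: (u *m B)| <= s * (e1 * (cB + `|u| + 1)).
  have -> : F y - x' - s *: (u *m B) = (F y - x' - v *m B) + (v - s *: u) *m B.
    by rewrite (mulmxBl v (s *: u) B) -scalemxAl addrA subrK.
  apply: le_trans (ler_normD _ _) _.
  have h1 : `|(v - s *: u) *m B| <= cB * (e1 * s).
    by apply: le_trans (HB _) _; rewrite ler_wpM2l // ltW.
  have h2 : e1 * `|v| <= e1 * (s * u1) by rewrite ler_wpM2l // ltW.
  have := le_trans HFv h2; rewrite /u1 => h3.
  rewrite (_ : s * _ = e1 * (s * (`|u| + 1)) + cB * (e1 * s)); last by ring.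
  exact: lerD.
have ne : orbit X x !=set0 by exists x; apply: orbit_self.
have dy : dist_to (orbit X x) y <= s * (`|u| + e1).
  by apply: le_trans vle; apply: dist_to_le; apply: orbit_self.
have [|||z yz dz] := ES y _ _ (m%:R * T) _; first by split; rewrite ?Ly.
- apply: le_lt_trans dy _; apply: le_lt_trans seta0.
  by rewrite ler_wpM2l ?(ltW s0) // lerD2l.
- by rewrite mulr_ge0 // ltW.
move: dz; rewrite -(reaches_unique yreach yz) qm => dz.
have [|c Cc zc] := @dist_to_lt R N (orbit X x) (F y) (s * beta) ne.
  apply: le_lt_trans dz _; apply: le_lt_trans (_ : K0 * q ^+ m * (s * (`|u| + e1)) < _).
    by rewrite ler_wpM2l ?mulr_ge0 ?(ltW K00).
  rewrite [ltRHS](_ : _ = K0 * q ^+ m * (s * (`|u| + e1)) + s * e1); last by rewrite /beta; ring.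
  by rewrite ltrDl mulr_gt0.
have E2 : `|c - x'| <= s * gam.
  have -> : c - x' = - (F y - c) + ((F y - x' - s *: (u *m B)) + s *: (u *m B)).
    by apply/rowP => j; rewrite !mxE; ring.
  apply: le_trans (ler_normD _ _) _; rewrite normrN.
  apply: le_trans (lerD (ltW zc) (le_trans (ler_normD _ _) (lerD E1 (lexx _)))) _.
  rewrite normrZ gtr0_norm // -!mulrDr ler_wpM2l ?(ltW s0) // /gam lerD2l.
  have h1 : `|u *m B| <= cB * `|u| := HB u.
  have h2 : e1 * (cB + `|u| + 1) <= 1 * (cB + `|u| + 1).
    by rewrite ler_wpM2r // !addr_ge0 // ltW.
  apply: le_trans (lerD h2 h1) _; rewrite le_eqVlt; apply/orP; left; apply/eqP; ring.
have [t [w xw [l cE]]] := Cc.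
have Ec : translate (l - k *+ m) w - x = c - x'.
  by rewrite cE /x' -(translateB (- (k *+ m)) (translate l w)) translateD translateK [l - _]addrC.
have [|t' t'd xt'] := LR t (l - k *+ m) w xw; first by rewrite Ec; apply: le_lt_trans E2 seta.
have [|_ EL] := HL x t' _ t'd; first by rewrite subrr normr0.
rewrite (flowE xt') Ec in EL.
(* The i-th component of the field is not 0, so the displacement along the arc controls the time
   t'. *)
have t'b : `|t'| * a <= 2 * gam * s.
  have h1 : `|t'| * a = `|(t' *: X x) 0 i| by rewrite mxE normrM.
  have h2 : `|(t' *: X x) 0 i| <= `|c - x'| + e2 * `|t'|.
    apply: le_trans (mx_entry_le _ _ _) _.
    rewrite -[t' *: X x](subrK (c - x')) addrC -[X in _ <= X + _]addr0.
    apply: le_trans (ler_normD _ _) _; rewrite addr0 lerD2l -normrN opprB; exact: EL.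
  have h3 : e2 * `|t'| <= a / 2 * `|t'| by rewrite ler_wpM2r.
  rewrite h1; qlra.
have E3 : `|c - x' - t' *: X x| <= s * e1.
  apply: le_trans EL _; apply: le_trans (_ : e1 * a / (2 * gam) * `|t'| <= _).
    by rewrite ler_wpM2r.
  rewrite (_ : _ * _ = e1 / (2 * gam) * (`|t'| * a)); last by ring.
  apply: le_trans (_ : e1 / (2 * gam) * (2 * gam * s) <= _).
    by rewrite ler_wpM2l // divr_ge0 ?mulr_ge0 ?ltW.
  by rewrite le_eqVlt; apply/orP; left; apply/eqP; field; rewrite gt_eqF.
have key : s * `|u *m B *m P| <= s * (cP * (e1 * (cB + `|u| + 1) + beta + e1)).
  have -> : s * `|u *m B *m P| = `|(s *: (u *m B)) *m P|.
    by rewrite -scalemxAl normrZ gtr0_norm.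
  have -> : (s *: (u *m B)) *m P =
     ((F y - c) + (c - x' - t' *: X x) - (F y - x' - s *: (u *m B))) *m P.
    have XP : X x *m P = 0 by apply: along_self.
    have -> : (F y - c) + (c - x' - t' *: X x) - (F y - x' - s *: (u *m B)) =
        s *: (u *m B) - t' *: X x by apply/rowP => j; rewrite !mxE; ring.
    by rewrite mulmxBl -[X in _ - X]scalemxAl XP scaler0 subr0.
  apply: le_trans (HP _) _.
  rewrite [s * (cP * _)]mulrCA; apply: ler_wpM2l; first exact: ltW.
  rewrite [leRHS](_ : _ = s * beta + s * e1 + s * (e1 * (cB + `|u| + 1))); last by ring.
  apply: le_trans (ler_normB _ _) _; apply: lerD E1.
  by apply: le_trans (ler_normD _ _) _; apply: lerD E3; apply: ltW.
rewrite (ler_pM2l s0) in key; apply: le_trans key _.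
rewrite /beta (_ : cP * _ = cP * K0 * q ^+ m * `|u| + e1 * (cP * (cB + `|u| + K0 * q ^+ m + 3))); last by ring.
by rewrite lerD2l -/c1 -ler_pdivlMr.
Qed.

Lemma field_along_cont x i (T : R) : ordered x -> X x 0 i != 0 ->
  mcont (fun (_ : R) y => along (X y) i) T x.
Proof.
move=> ox Xi e e0.
have C j : {for x, continuous (fun y => X y 0 j / X y 0 i : R^o)}.
  have Cj k : {for x, continuous (fun y => X y 0 k : R^o)}.
    have C0 := Ck_on_cont (sX 0%N) ox.
    exact: (continuous_comp C0 (@continuous_coord R N k (X x))).
  apply: (@continuousM _ _ (fun y => X y 0 j) (fun y => (X y 0 i)^-1)); first exact: Cj.
  exact: (@continuousV _ _ (fun y => X y 0 i)).
pose P j (d : R) := forall y, `|y - x| < d -> `|X y 0 j / X y 0 i - X x 0 j / X x 0 i| < e / 2.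
have [||d d0 Hd] := finite_eps (P := P).
- by move=> j d d' _ dd H y yx; apply: H; exact: lt_le_trans yx dd.
- by move=> j; have [d d0 H] := (cont_eps _ _).1 (C j) _ (divr_gt0 e0 (ltr0Sn R 1)); exists d.
exists d => // _ y _ yx; apply: (@le_lt_trans _ _ (e / 2)); last by qlra.
apply: mx_norm_le => [|a b]; first by rewrite divr_ge0 // ltW.
rewrite (_ : _ a b = ((delta_mx 0 a : 'rV[R]_N) *m (along (X y) i - along (X x) i)) 0 b); last first.
  by rewrite -rowE [RHS]mxE.
rewrite mulmxBr !alongE !mxE; have := Hd b y yx; set p := X y 0 b / _; set p' := X x 0 b / _ => H.
rewrite (_ : _ - _ = (delta_mx (0 : 'I_1) a : 'rV[R]_N) 0 i * (p' - p)); last first.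
  by rewrite /p /p' !mxE; ring.
rewrite normrM mxE eqxx /= distrC; case: eqP => _; rewrite ?normr1 ?mul1r ?normr0 ?mul0r; first exact: ltW.
by rewrite divr_ge0 // ltW.
Qed.

Lemma bernoulli (a : R) n : 0 <= a <= 1 -> 1 - n%:R * a <= (1 - a) ^+ n.
Proof.
move=> /andP[a0 a1]; elim: n => [|n IH]; first by rewrite mul0r subr0 expr0.
rewrite exprS; apply: le_trans (_ : (1 - a) * (1 - n%:R * a) <= _).
  rewrite -natr1 -subr_ge0 (_ : _ - _ = n%:R * a ^+ 2); last by ring.
  by rewrite mulr_ge0 // sqr_ge0.
by rewrite ler_wpM2l // subr_ge0.
Qed.

(** The return differential fixes the field, so removing a multiple of the field halfway does not
    change the result modulo the field. *)
Lemma quotient_step z t k i m b (u : 'rV[R]_N) : reaches X z t (translate k z) ->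
  X z 0 i != 0 ->
  u *m jac (flow X t) z ^+ (m + b) *m along (X z) i =
  u *m jac (flow X t) z ^+ m *m along (X z) i *m jac (flow X t) z ^+ b *m along (X z) i.
Proof.
move=> H Xi; set A := jac (flow X t) z; set P := along _ i.
have XA c : X z *m A ^+ c = X z.
  elim: c => [|c IH]; first by rewrite expr0 mulmx1.
  by rewrite exprS mulmxA (jac_ret_field H).
rewrite exprD mulmxA; set w := u *m A ^+ m.
rewrite [w *m P]alongE mulmxBl -scalemxAl XA mulmxBl -scalemxAl.
by rewrite along_self // scaler0 subr0.
Qed.

Lemma jac_pow_kernel z t k i m (u : 'rV[R]_N) : reaches X z t (translate k z) ->
  u *m jac (@Lambda R N) z = 0 ->
  u *m jac (flow X t) z ^+ m *m along (X z) i *m jac (@Lambda R N) z = 0.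
Proof.
move=> H uL; have [oz _] := reaches_domain H; set A := jac (flow X t) z.
have AL c : A ^+ c *m jac (@Lambda R N) z = jac (@Lambda R N) z.
  elim: c => [|c IH]; first by rewrite expr0 mul1mx.
  by rewrite exprS -mulmxA IH (jac_ret_Lambda H).
by rewrite alongE mulmxBl -scalemxAl jac_Lambda_field // scaler0 subr0 -mulmxA AL.
Qed.

Lemma contraction_iterate z t k i n (c : R) : reaches X z t (translate k z) -> X z 0 i != 0 ->
  0 <= c -> (0 < n)%N ->
  (forall b (v : 'rV[R]_N), (b <= n)%N ->
    `|v *m (jac (flow X t) z ^+ b *m along (X z) i)| <= c * `|v|) ->
  (forall u : 'rV[R]_N, u *m jac (@Lambda R N) z = 0 ->
    `|u *m (jac (flow X t) z ^+ n *m along (X z) i)| <= 1 / 2 * `|u|) ->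
  contracts X z t i (c * c * 2) (1 - 1 / (2 * n%:R)).
Proof.
move=> Hz Xz c0 n0 FB half; set A := jac (flow X t) z in FB half *; set P := along _ i in FB half *.
pose q : R := 1 - 1 / (2 * n%:R).
have nge1 : 1 <= n%:R :> R by rewrite ler1n.
have n1 : 0 < n%:R :> R by rewrite ltr0n.
have h12 : 1 / (2 * n%:R) <= 1 / 2 :> R.
  rewrite ler_pdivrMr ?mulr_gt0 // (_ : 1 / 2 * (2 * n%:R) = n%:R) //.
  by field.
have h10 : 0 < 1 / (2 * n%:R) :> R by rewrite divr_gt0 ?mulr_gt0.
have qn01 : 0 <= (1 / (2 * n%:R) : R) <= 1 by apply/andP; split; qlra.
have qn : 1 / 2 <= q ^+ n.
  apply: le_trans (bernoulli n qn01); rewrite le_eqVlt; apply/orP; left; apply/eqP.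
  by field; rewrite gt_eqF.
have [qp q1] : 0 < q /\ q < 1 by rewrite /q; split; qlra.
split=> //; [by rewrite !mulr_ge0|by rewrite -/q qp|].
rewrite -/q -/A -/P => m u uL; clearbody q.
have -> : m = (n * (m %/ n) + m %% n)%N by rewrite mulnC -divn_eq.
have : (m %% n < n)%N by rewrite ltn_mod.
move: (m %/ n)%N (m %% n)%N => a b bn {m}.
have pows l : `|u *m A ^+ (n * l) *m P| <= (1 / 2) ^+ l * (c * `|u|).
  elim: l => [|l IH].
    by have := FB 0%N u (leq0n n); rewrite muln0 !expr0 mul1r -mulmxA.
  rewrite mulnS addnC (quotient_step _ _ _ Hz) // -/A -/P -[X in `|X|]mulmxA.
  apply: le_trans (half _ (jac_pow_kernel _ _ Hz uL)) _.
  by rewrite [_ ^+ l.+1]exprS -[leRHS]mulrA; apply: ler_wpM2l.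
rewrite (quotient_step _ _ _ Hz) // -/A -/P -[X in `|X|]mulmxA.
apply: le_trans (FB b _ (ltnW bn)) _; rewrite -!mulrA; apply: ler_wpM2l => //.
apply: le_trans (pows a) _; rewrite mulrCA; apply: ler_wpM2l => //.
rewrite mulrA; apply: ler_wpM2r => //.
rewrite exprD exprM.
have h1 : (1 / 2) ^+ a <= q ^+ n ^+ a by rewrite lerXn2r ?nnegrE ?exprn_ge0 // ltW.
have h2 : 1 / 2 <= q ^+ b.
  apply: le_trans qn _; rewrite -(subnK (ltnW bn)) exprD ler_piMl //.
    by rewrite exprn_ge0 // ltW.
  by rewrite exprn_ile1 // ltW.
have h3 : 0 <= q ^+ n ^+ a by rewrite !exprn_ge0 // ltW.
apply: le_trans h1 _; have := ler_wpM2l h3 h2; qlra.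
Qed.

(** The right inverse M of L corrects a vector of the nearby kernel into the kernel of L. *)
Lemma near_kernel p r (L L' : 'M[R]_(p, r)) M (u : 'rV[R]_p) (e : R) : M *m L = 1%:M ->
  u *m L' = 0 -> `|L' - L| <= e ->
  exists2 w, `|w| <= r%:R * `|M| * (p%:R * e) * `|u| & (u - w) *m L = 0.
Proof.
move=> HM uL He; exists (u *m L *m M); last by rewrite mulmxBl -!mulmxA HM mulmx1 subrr.
have E : u *m L = u *m (L - L') by rewrite mulmxBr uL subr0.
apply: le_trans (mulmx_norm _ _) _.
rewrite (_ : r%:R * `|M| * (p%:R * e) * `|u| = r%:R * (p%:R * `|u| * e) * `|M|); last by ring.
apply: ler_wpM2r => //; apply: ler_wpM2l => //; rewrite E.
apply: le_trans (mulmx_norm _ _) _; apply: ler_wpM2l; first by rewrite mulr_ge0.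
by rewrite distrC.
Qed.

(** Contraction is an open condition once a single power expresses it. Only the powers up to a fixed
    n are compared with those at x, and [contraction_iterate] recovers all others with constants
    common to all nearby returning points. *)
Lemma robust_contraction x T k i K0 q0 : reaches X x T (translate k x) ->
  contracts X x T i K0 q0 -> exists d K q : R, 0 < d /\
    forall (z : 'rV[R]_N) t l, `|z - x| < d -> `|t - T| < d -> reaches X z t (translate l z) ->
      contracts X z t i K q.
Proof.
move=> H [Xi K00 q01 LC]; have [ox _] := reaches_domain H.
have {}q01 : 0 <= q0 < 1 by case/andP: q01 => /ltW -> ->.
have [M HM] := Lambda_right_inverse HN ox.
pose L := jac (@Lambda R N) x.
pose cM := (N - 3)%:R * `|M|; have cM0 : 0 <= cM by rewrite mulr_ge0.
have [n0 Hn] := geometric_small (8 * K0 * 2) q01 (@ltr01 R).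
have [n nE] : exists n, n = n0.+1 by exists n0.+1.
have npos : (0 < n)%N by rewrite nE.
have nK : K0 * q0 ^+ n * 2 <= 1 / 8 by have := Hn n; rewrite nE leqnSn => /(_ isT); qlra.
pose F b (t : R) (z : 'rV[R]_N) := jac (flow X t) z ^+ b *m along (X z) i.
have FC b : mcont (F b) T x.
  apply: mcont_mul; last exact: field_along_cont.
  apply: mcont_pow => e e0; have [d d0 Hd] := jac_flow_cont H e0.
  by exists d => // s y sd yd; case: (Hd s y sd yd).
pose cF := N%:R * (\sum_(b < n.+1) `|F b T x| + 1).
have cF0 : 0 <= cF by rewrite mulr_ge0 // addr_ge0 // sumr_ge0.
pose e1 : R := 1 / (16 * (N%:R + 1)).
have N0 : 0 < N%:R + 1 :> R by rewrite ltr_wpDl.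
have e10 : 0 < e1 by rewrite divr_gt0 // mulr_gt0.
have e11 : e1 <= 1.
  by rewrite /e1 ler_pdivrMr ?mulr_gt0 // mul1r; have := ler0n R N; qlra.
pose Q (b : 'I_n.+1) (d : R) := forall z t, `|z - x| < d -> `|t - T| < d ->
  `|F b t z - F b T x| < e1.
have [||d1 d10 H1] := finite_eps (P := Q).
- by move=> b d d' _ dd HQ z t zd td; apply: HQ; [exact: lt_le_trans zd dd|exact: lt_le_trans td dd].
- by move=> b; have [d d0 Hd] := FC b e1 e10; exists d => // z t zd td; apply: Hd.
pose e2 : R := 1 / (4 * (cM + 1) * (cF + 1) * (N%:R + 1)).
have e20 : 0 < e2.
  by rewrite divr_gt0 // !mulr_gt0 // ltr_wpDl.
have [d2 d20 H2] := jac_cont (smooth_Lambda (R := R) HN 1%N) ox e20.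
have [d3 d30 H3] : exists2 d : R, 0 < d & forall z, `|z - x| < d -> X z 0 i != 0.
  have C0 := Ck_on_cont (sX 0%N) ox.
  have X0 : 0 < `|X x 0 i| by rewrite normr_gt0.
  have [d d0 Hd] := (cont_eps _ _).1 C0 _ X0; exists d => // z /Hd h.
  apply/eqP => Z; have := le_lt_trans (mx_entry_le (X z - X x) 0 i) h.
  by rewrite sub_mxE Z sub0r normrN ltxx.
exists (Num.min d1 (Num.min d2 d3)), (cF * cF * 2), (1 - 1 / (2 * n%:R)); split; first by rewrite !lt_min d10 d20 d30.
move=> z t l; rewrite !lt_min => /andP[z1 /andP[z2 z3]] /andP[t1 /andP[t2 t3]] Hz.
have [oz _] := reaches_domain Hz; have Xz := H3 z z3.
have FB (b : nat) (v : 'rV[R]_N) : (b <= n)%N -> `|v *m F b t z| <= cF * `|v|.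
  rewrite -ltnS => bn; apply: le_trans (row_mulmx_norm _ _) _; apply: ler_wpM2r => //.
  apply: ler_wpM2l => //; have := H1 (Ordinal bn) z t z1 t1; rewrite /= => h.
  rewrite -[F b t z](subrK (F b T x)); apply: le_trans (ler_normD _ _) _; rewrite addrC.
  apply: lerD; first by rewrite (bigD1 (Ordinal bn)) //= lerDl sumr_ge0.
  exact: le_trans (ltW h) e11.
(* 1/2 = 1/8 + 1/8 + 1/4: the contraction at x, the change of the n-th power, and the correction of
   u into the kernel at x. *)
have half (u : 'rV[R]_N) : u *m jac (@Lambda R N) z = 0 -> `|u *m F n t z| <= 1 / 2 * `|u|.
  move=> uL.
  have [r rle u'L] := near_kernel HM uL (ltW (H2 z oz z2)).
  rewrite -/cM in rle.
  have [u' u'E] : exists u', u' = u - r by exists (u - r).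
  rewrite -u'E in u'L.
  have e2N : N%:R * e2 * (cM + 1) * (cF + 1) <= 1 / 4.
    have -> : 1 / 4 = (N%:R + 1) * e2 * (cM + 1) * (cF + 1) :> R.
      by rewrite /e2; field; rewrite !gt_eqF // ltr_wpDl.
    by rewrite !ler_wpM2r ?addr_ge0 ?(ltW e20) // lerDl.
  have g0 : 0 <= N%:R * e2 by rewrite mulr_ge0 // ltW.
  have gM0 : 0 <= N%:R * e2 * cM by rewrite mulr_ge0.
  have gF0 : 0 <= N%:R * e2 * cF by rewrite mulr_ge0.
  have gMF0 : 0 <= N%:R * e2 * cM * cF by rewrite mulr_ge0.
  have un := normr_ge0 u.
  have rle' : `|r| <= 1 / 4 * `|u|.
    apply: le_trans rle _; rewrite ler_wpM2r //; move: e2N; qlra.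
  have rF : cF * `|r| <= 1 / 4 * `|u|.
    apply: le_trans (ler_wpM2l cF0 rle) _; rewrite mulrA ler_wpM2r //; move: e2N; qlra.
  have u'le : `|u'| <= 2 * `|u|.
    by rewrite u'E; apply: le_trans (ler_normB _ _) _; qlra.
  have -> : u *m F n t z = u' *m F n T x + u' *m (F n t z - F n T x) + r *m F n t z.
    have ur : u' + r = u by rewrite u'E subrK.
    by rewrite (mulmxBr u') [u' *m F n T x + _]addrC subrK -mulmxDl ur.
  apply: le_trans (ler_normD _ _) _; apply: le_trans (lerD (ler_normD _ _) (lexx _)) _.
  have b1 : `|u' *m F n T x| <= 1 / 8 * `|u|.
    rewrite mulmxA; apply: le_trans (LC n u' u'L) _.
    apply: le_trans (_ : K0 * q0 ^+ n * (2 * `|u|) <= _).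
      by rewrite ler_wpM2l // mulr_ge0 // exprn_ge0 //; case/andP: q01.
    by rewrite mulrA ler_wpM2r.
  have b2 : `|u' *m (F n t z - F n T x)| <= 1 / 8 * `|u|.
    apply: le_trans (row_mulmx_norm _ _) _.
    have h : `|F n t z - F n T x| <= e1 by apply/ltW/(H1 ord_max).
    apply: le_trans (_ : (N%:R + 1) * e1 * (2 * `|u|) <= _).
      by apply: ler_pM; rewrite ?mulr_ge0 //; apply: ler_pM; rewrite ?lerDl.
    by rewrite /e1 le_eqVlt; apply/orP; left; apply/eqP; field; rewrite gt_eqF.
  have b3 := le_trans (FB n r (leqnn n)) rF.
  apply: le_trans (lerD (lerD b1 b2) b3) _; qlra.
exact: (contraction_iterate Hz Xz cF0 npos FB half).
Qed.

(** The factor 1 - A maps into the kernel of the derivative of the cross ratios and kills the field.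
    The two factors of [unip] therefore give decay on all vectors, without passing to a quotient. *)
Lemma contracts_decay z t k i K q : reaches X z t (translate k z) -> contracts X z t i K q ->
  forall m (v : 'rV[R]_N), `|v *m (jac (flow X t) z ^+ m * unip (jac (flow X t) z))| <=
    K * (1 + N%:R * `|jac (flow X t) z|) ^+ 2 * q ^+ m * `|v|.
Proof.
move=> H [Xi K0 q01 HC] m v; set A := jac (flow X t) z in HC *; pose c := 1 + N%:R * `|A|.
have c0 : 0 <= c by rewrite addr_ge0 // mulr_ge0.
have B (w : 'rV[R]_N) : `|w *m (1 - A)| <= c * `|w|.
  rewrite mulmxBr mulmx1; apply: le_trans (ler_normB _ _) _.
  by rewrite /c mulrDl mul1r lerD2l row_mulmx_norm.
pose u := v *m (1 - A).
have uL : u *m jac (@Lambda R N) z = 0.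
  by rewrite /u mulmxBr mulmx1 mulmxBl -mulmxA (jac_ret_Lambda H) subrr.
have XA : X z *m (1 - A) = 0 by rewrite mulmxBr mulmx1 (jac_ret_field H) subrr.
have C1 : A ^+ m *m (1 - A) = (1 - A) *m A ^+ m.
  by rewrite mulmxBr mulmxBl mulmx1 mul1mx -[_ *m A]/(A ^+ m * A) -[A *m _]/(A * A ^+ m) -exprS -exprSr.
have -> : v *m (A ^+ m * unip A) = u *m A ^+ m *m along (X z) i *m (1 - A).
  rewrite alongE mulmxBl -scalemxAl XA scaler0 subr0 /u -!mulmxA; congr (_ *m _).
  by rewrite (mulmxA (1 - A)) -C1 -[RHS]mulmxA.
apply: le_trans (B _) _; rewrite (_ : K * _ * _ * _ = c * (K * q ^+ m * (c * `|v|))); last by rewrite /c; ring.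
apply: ler_wpM2l => //; apply: le_trans (HC m u uL) _; apply: ler_wpM2l (B v).
by rewrite mulr_ge0 // exprn_ge0 // ltW; case/andP: q01.
Qed.

(** The generalized eigenspace of 1 meets the directions of fixed cross ratios and fixed i-th angle
    only in 0. A vector tangent to the level set that A fixes up to a multiple of the field is not
    contracted, so it is itself a multiple of the field; this is used first for u (1 - A) and then
    for u. *)
Lemma contracts_kernel z t k i K q (u : 'rV[R]_N) : reaches X z t (translate k z) ->
  contracts X z t i K q -> u *m jac (@Lambda R N) z = 0 -> u 0 i = 0 ->
  u *m unip (jac (flow X t) z) = 0 -> u = 0.
Proof.
move=> H [Xi K0 q01 HC] uL ui uS; set A := jac (flow X t) z in uS HC; pose P := along (X z) i.
have AL := jac_ret_Lambda H; have XA : X z *m A = X z := jac_ret_field H.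
have [oz _] := reaches_domain H.
have q01' : 0 <= q < 1 by case/andP: q01 => /ltW -> ->.
have fixed (w : 'rV[R]_N) (c : R) : w *m jac (@Lambda R N) z = 0 -> w *m A = w - c *: X z ->
    w = (w 0 i / X z 0 i) *: X z.
  move=> wL wA; have wP m : w *m A ^+ m *m P = w *m P.
    suff [a ->] : exists a : R, w *m A ^+ m = w - a *: X z.
      by rewrite mulmxBl -scalemxAl along_self // scaler0 subr0.
    elim: m => [|m [a IH]]; first by exists 0; rewrite expr0 mulmx1 scale0r subr0.
    exists (c + a); rewrite exprSr -[_ *m (_ * A)]/(w *m (A ^+ m *m A)) mulmxA IH mulmxBl wA.
    by rewrite -scalemxAl XA scalerDl opprD addrA.
  have : `|w *m P| <= 0.
    apply: (@le_of_geometric R _ 0 (K * `|w|) q q01') => m; rewrite add0r mulrAC -(wP m).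
    exact: HC.
  by rewrite normr_le0 alongE subr_eq0 => /eqP.
pose w := u *m (1 - A).
have wL : w *m jac (@Lambda R N) z = 0.
  by rewrite /w mulmxBr mulmx1 mulmxBl -mulmxA AL subrr.
have wA : w *m A = w - 0 *: X z.
  have : w *m (1 - A) = 0 by rewrite /w -mulmxA.
  by rewrite mulmxBr mulmx1 scale0r subr0 => /eqP; rewrite subr_eq0 => /eqP.
have uA : u *m A = u - (w 0 i / X z 0 i) *: X z.
  by rewrite -(fixed _ _ wL wA) /w mulmxBr mulmx1 opprB addrC subrK.
by rewrite (fixed _ _ uL uA) ui mul0r scale0r.
Qed.

(** * Solving the return equation *)

Lemma D_curve n m (F : 'rV[R]_n -> 'rV[R]_m) (z w : 'rV[R]_n) l : differentiable F z ->
  is_derive (0 : R^o) 1 ((fun s : R => F (z + s *: w)) : R^o -> _) l -> 'D_w F z = l.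
Proof.
move=> dF D; have dF' : differentiable F (z + 0 *: w) by rewrite scale0r addr0.
have D1 := cder_comp dF' (cder_line z w 0).
by rewrite -(deriveE _ dF') scale0r addr0 in D1; exact: cder_unique D1 D.
Qed.

Lemma joint_flow_D x0 t0 y0 (a : R) (v : 'rV[R]_N) : reaches X x0 t0 y0 ->
  differentiable (joint_flow X) (row_mx t0%:M x0) /\
  'D_(row_mx a%:M v) (joint_flow X) (row_mx t0%:M x0) = a *: X y0 + v *m jac (flow X t0) x0.
Proof.
move=> H; have [r r0 [A C]] := flow_joint oU sX 1 H.
have dF : differentiable (joint_flow X) (row_mx t0%:M x0).
  by apply: C.1; rewrite /= subrr normr0.
split; first exact: dF.
have Dt : 'D_(row_mx 1%:M 0) (joint_flow X) (row_mx t0%:M x0) = X y0.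
  apply: D_curve => //.
  have [||_] := @flow_cder x0 (t0 - r) (t0 + r) _ t0.
  - move=> s sr; exists (flow X s x0); apply: A; last by rewrite subrr normr0.
    by rewrite ltr_distl.
  - by apply/andP; split; qlra.
  rewrite (flowE H) -{1}[t0]add0r => /cder_shift; apply: (cder_near (@ltr01 R)) => s _.
  rewrite /joint_flow scale_row_mx scaler0 add_row_mx addr0 row_mxKl row_mxKr.
  by rewrite !mxE eqxx !mulr1n mulr1 addrC.
have Dx : 'D_(row_mx 0 v) (joint_flow X) (row_mx t0%:M x0) = v *m jac (flow X t0) x0.
  transitivity ('D_v (flow X t0) x0); last exact: (jacP v (flow_diff H)).
  apply/esym/(D_curve (flow_diff H)).
  have dF' : differentiable (joint_flow X) (row_mx t0%:M x0 + 0 *: row_mx 0 v).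
    by rewrite scale0r addr0.
  have D1 := cder_comp dF' (cder_line (row_mx t0%:M x0) (row_mx 0 v) 0).
  rewrite -(deriveE _ dF') scale0r addr0 in D1.
  apply: (cder_near (@ltr01 R)) D1 => s _.
  by rewrite /joint_flow scale_row_mx scaler0 add_row_mx addr0 row_mxKl row_mxKr scalar_mx00.
have -> : row_mx a%:M v = a *: row_mx 1%:M 0 + row_mx 0 v.
  by rewrite scale_row_mx scaler0 add_row_mx addr0 add0r scalemx1.
by rewrite (jacP _ dF) mulmxDl -scalemxAl -(jacP (row_mx 1%:M 0) dF) -(jacP (row_mx 0 v) dF) Dt Dx.
Qed.

Lemma return_map_D i k x T a (v : 'rV[R]_N) : reaches X x T (translate k x) ->
  differentiable (return_map X i k) (row_mx T%:M x) ->
  'D_(row_mx a%:M v) (return_map X i k) (row_mx T%:M x) =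
  row_mx (v *m delta_mx i 0)
    (gather (a *: X x + v *m jac (flow X T) x - v) (v *m jac (@Lambda R N) x)).
Proof.
move=> H dG; have [ox _] := reaches_domain H; apply: D_curve => //.
have [dF DF] := joint_flow_D a v H; rewrite tX in DF.
set z := row_mx T%:M x in dF DF dG *; set w := row_mx a%:M v in DF *.
have Fz : (z + 0 *: w) = z by rewrite scale0r addr0.
have D1 : is_derive (0 : R^o) 1 ((fun s : R => joint_flow X (z + s *: w)) : R^o -> _)
    (a *: X x + v *m jac (flow X T) x).
  have dF' : differentiable (joint_flow X) (z + 0 *: w) by rewrite Fz.
  have := cder_comp dF' (cder_line z w 0).
  by rewrite -(deriveE _ dF') Fz DF.
have D2 : is_derive (0 : R^o) 1 ((fun s : R => rsubmx (z + s *: w)) : R^o -> _) v.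
  apply: (cder_near (@ltr01 R)) (cder_line x v 0) => s _.
  by rewrite linearD linearZ /= !row_mxKr.
have rz : rsubmx (z + 0 *: w) = x by rewrite Fz row_mxKr.
have D3 : is_derive (0 : R^o) 1 ((fun s : R => Lambda (rsubmx (z + s *: w))) : R^o -> _)
    (v *m jac (@Lambda R N) x).
  have dL : differentiable (@Lambda R N) (rsubmx (z + 0 *: w)) by rewrite rz; apply: Lambda_diff.
  have := cder_comp dL D2.
  by rewrite -(deriveE _ dL) rz jacP //; exact: Lambda_diff.
have D4 := cder_mulmx (row_mx 1%:M (0 : 'M[R]_(1, N))) (cder_mulmx (delta_mx i (0 : 'I_1)) D2).
have D5 := cderB D1 (cderD D2 (cder_cst (const_mx (2 * pi * k%:~R) : 'rV[R]_N) 0)).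
have D6 := cderD (cder_mulmx (head_mx N) D5) (cder_mulmx (tail_mx N) D3).
have D7 := cderD D4 (cder_mulmx (row_mx (0 : 'M[R]_(N, 1)) 1%:M) D6).
rewrite [X in is_derive _ _ _ X]row_mxE /gather -[in X in is_derive _ _ _ X](addr0 v).
rewrite addr0.
have E : (fun s : R => rsubmx (z + s *: w) *m delta_mx i (0 : 'I_1) *m row_mx 1%:M (0 : 'M[R]_(1, N)) +
    ((joint_flow X (z + s *: w) - (rsubmx (z + s *: w) + const_mx (2 * pi * k%:~R))) *m head_mx N +
     Lambda (rsubmx (z + s *: w)) *m tail_mx N) *m row_mx (0 : 'M[R]_(N, 1)) 1%:M) =
     (fun s : R => return_map X i k (z + s *: w)).
  by apply/funext => s; rewrite /return_map [RHS]row_mxE.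
by rewrite -E; move: D7; rewrite addr0.
Qed.

Lemma Ck_return_map m (U : set 'rV[R]_(1 + N)) i k : open U -> Ck_on m U (joint_flow X) ->
  (forall z, U z -> ordered (rsubmx z)) -> Ck_on m U (return_map X i k).
Proof.
move=> oB C oz.
have Cr : Ck_on m U (fun z : 'rV[R]_(1 + N) => rsubmx z).
  by apply: (Ck_on_rsubmx oB); exact: Ck_on_id.
have CL : Ck_on m U (fun z : 'rV[R]_(1 + N) => Lambda (rsubmx z)).
  exact: (@Ck_on_comp _ _ _ _ _ U [set x : 'rV[R]_N | ordered x] _ (@Lambda R N) oB oU oz Cr (smooth_Lambda HN m)).
apply: (Ck_on_row_mx oB); first exact: (Ck_on_mulmx _ oB).
apply: (Ck_on_add oB); apply: (Ck_on_mulmx _ oB) => //.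
apply: (Ck_on_add oB C); apply: (Ck_on_opp oB); apply: (Ck_on_add oB Cr).
exact: Ck_on_cst.
Qed.

(** [return_map] is inverted at (T, x) on targets whose three return components are 0; what remains
    as parameters are the i-th angle and the cross ratios. *)
Lemma family_points m x T k i K q : reaches X x T (translate k x) -> contracts X x T i K q ->
  exists (p : 'rV[R]_(1 + (N - 3)) -> 'rV[R]_N) (tau : 'rV[R]_(1 + (N - 3)) -> R) (d : R),
  [/\ 0 < d,
    forall zeta, `|zeta - section_chart i x| < d -> reaches X (p zeta) (tau zeta) (translate k (p zeta)) /\
      section_chart i (p zeta) = zeta,
    forall (y : 'rV[R]_N) t l, `|y - x| < d -> `|t - T| < d -> reaches X y t (translate l y) ->
      p (section_chart i y) = y /\ tau (section_chart i y) = t &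
    Ck_on m [set zeta | `|zeta - section_chart i x| < d] p /\
    Ck_on m [set zeta | `|zeta - section_chart i x| < d] (tau : _ -> R^o)].
Proof.
move=> H HC; have [ox _] := reaches_domain H; have [Xi _ _ _] := HC.
have [r1 r10 [A C]] := flow_joint oU sX m.+1 H.
rewrite -[X in Ck_on _ _ X]/(joint_flow _) in C.
pose z0 : 'rV[R]_(1 + N) := row_mx T%:M x.
pose U := [set z : 'rV[R]_(1 + N) | `|z - z0| < r1].
have oB : open U := @open_dist R (1 + N) z0 r1.
have zU z : U z -> `|lsubmx z 0 0 - T| < r1 /\ `|rsubmx z - x| < r1.
  move=> zr; split.
    apply: le_lt_trans zr.
    have := le_trans (mx_entry_le (lsubmx (z - z0)) 0 0) (lsubmx_norm _).
    by rewrite linearB /= row_mxKl sub_mxE scalar_mx00.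
  apply: le_lt_trans zr; have := rsubmx_norm (z - z0).
  by rewrite linearB /= row_mxKr.
have zreach z : U z -> reaches X (rsubmx z) (lsubmx z 0 0) (joint_flow X z).
  by move=> /zU[h1 h2]; exact: A.
have CG : Ck_on m.+1 U (return_map X i k).
  by apply: Ck_return_map oB C _ => z /zreach/reaches_domain[].
have Uz0 : U z0 by rewrite /U /= subrr normr0.
have dG : differentiable (return_map X i k) z0 by apply: CG.1.
have [|G [rho [eps [rho0 eps0 rU inj [GF CGi]]]]] := @inverse_function R _ m _ U z0 oB CG Uz0.
  move=> w; rewrite -(hsubmxK w); have -> : lsubmx w = (lsubmx w 0 0)%:M.
    by apply/rowP => j; rewrite (ord1 j) [RHS]mxE eqxx mulr1n.
  move: (lsubmx w 0 0) (rsubmx w) => a v {w}; rewrite return_map_D // => E.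
  have [E1 E2] : v *m delta_mx i (0 : 'I_1) = 0 /\
      gather (a *: X x + v *m jac (flow X T) x - v) (v *m jac (@Lambda R N) x) = 0.
    by apply: eq_row_mx; rewrite E row_mx0.
  have vi : v 0 i = 0.
    by move: E1; rewrite mul_delta => /rowP/(_ 0); rewrite scalar_mx00 mxE.
  have [|vL v3] := @gather_inj R N (a *: X x + v *m jac (flow X T) x - v) 0 (v *m jac (@Lambda R N) x) 0.
    by rewrite E2 /gather !mul0mx addr0.
  have e0 : a *: X x + v *m jac (flow X T) x - v = 0.
    apply: (Lambda_kernel HN ox) => [|j /v3]; last by rewrite [RHS]mxE.
    rewrite mulmxBl mulmxDl -scalemxAl jac_Lambda_field // scaler0 add0r.
    by rewrite -mulmxA (jac_ret_Lambda H) subrr.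
  (* Here v (1 - A) is a multiple of the field, so (1 - A)^2 kills v. *)
  have v0 : v = 0.
    apply: (contracts_kernel H HC vL vi); rewrite /unip -[_ * _]/(_ *m _) mulmxA.
    have -> : v *m (1 - jac (flow X T) x) = a *: X x.
      by apply/eqP; rewrite mulmxBr mulmx1 -subr_eq0 -opprB oppr_eq0 opprB addrA e0.
    by rewrite mulmxBr mulmx1 -scalemxAl (jac_ret_field H) subrr.
  move: e0; rewrite v0 mul0mx addr0 subr0 => /rowP/(_ i); rewrite !mxE => /eqP.
  rewrite mulf_eq0 (negbTE Xi) orbF => /eqP ->.
  by rewrite raddf0 row_mx0.
pose E (zeta : 'rV[R]_(1 + (N - 3))) : 'rV[R]_(1 + N) :=
  row_mx (lsubmx zeta) (gather 0 (rsubmx zeta)).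
have Ec (y : 'rV[R]_N) t : reaches X y t (translate k y) ->
    return_map X i k (row_mx t%:M y) = E (section_chart i y).
  move=> Hy; rewrite /return_map /E /section_chart /joint_flow !row_mxKl !row_mxKr scalar_mx00.
  by rewrite (flowE Hy) subrr.
have CE l V : open V -> Ck_on l V E.
  move=> oV; have Ci := @Ck_on_id R l _ V; apply: Ck_on_row_mx => //; first exact: Ck_on_lsubmx.
  apply: Ck_on_add => //; first by rewrite mul0mx; exact: Ck_on_cst.
  by apply: Ck_on_mulmx => //; apply: Ck_on_rsubmx.
have Ex := Ec x T H.
have Ecx : {for section_chart i x, continuous E} by apply: (Ck_on_cont (CE 0%N setT (@openT _))).
have [d1 d10 Hd1] := (cont_eps _ _).1 Ecx _ eps0; rewrite -Ex in Hd1.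
have [d2 d20 Hd2] := (cont_eps _ _).1 (Ck_on_cont CG Uz0) _ eps0.
have [d3 d30 Hd3] := flow_joint_cont H (@ltr01 R).
pose d := Num.min (Num.min d1 d2) (Num.min (Num.min d3 1) rho).
have d0 : 0 < d by rewrite !lt_min d10 d20 d30 ltr01.
exists (fun zeta => rsubmx (G (E zeta))), (fun zeta => lsubmx (G (E zeta)) 0 0), d; split=> //.
- move=> zeta; rewrite !lt_min => /andP[/andP[/Hd1/GF[h1 h2] _] _].
  have Uz := rU _ h1; have Hz := zreach _ Uz; set z := G (E zeta) in h1 h2 Uz Hz *.
  have [E1 E2] : rsubmx z *m delta_mx i (0 : 'I_1) = lsubmx zeta /\
      gather (joint_flow X z - translate k (rsubmx z)) (Lambda (rsubmx z)) = gather 0 (rsubmx zeta).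
    exact: eq_row_mx.
  have [L3 h3] := gather_inj E2.
  have [oz of_] := reaches_domain Hz.
  (* The inverse provides equality of three angles only; the others follow from the equality of the
     cross ratios. *)
  have Ef : joint_flow X z = translate k (rsubmx z).
    apply: (Lambda_injective HN of_ (translate_ordered HN k oz)).
      by rewrite (reaches_Lambda Hz) Lambda_translate.
    move=> j j3; have jN : (j < N)%N by rewrite (leq_trans j3) // ltnW.
    rewrite !(coord_ord _ jN); apply/eqP; rewrite -subr_eq0 -sub_mxE h3 //.
    by rewrite mxE.
  split; first by rewrite -Ef.
  by rewrite /section_chart E1 L3 hsubmxK.
- move=> y t l; rewrite !lt_min => /andP[/andP[_ y2] /andP[/andP[y3 y1] yrho]].
  move=> /andP[/andP[_ t2] /andP[/andP[t3 _] trho]] Hy.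
  (* Near x the winding number is determined, since distinct translates of a lift are at least 2 pi
     apart. *)
  have kl : l = k.
    have [_] := Hd3 t y t3 y3; rewrite (flowE Hy) => h.
    have h' : `|translate (l - k) y - x| < 1.
      by rewrite -(translateB k) translateD [k + _]addrC subrK.
    by have /eqP := translate_small h' y1; rewrite subr_eq0 => /eqP.
  rewrite kl in Hy; rewrite -(Ec y t Hy).
  have h := Hd2 _ (pair_norm_lt t2 y2); have [h1 h2] := GF _ h.
  have -> : G (return_map X i k (row_mx t%:M y)) = row_mx t%:M y.
    by apply: inj h2 => //; exact: pair_norm_lt.
  by rewrite row_mxKl row_mxKr scalar_mx00.
have oV := @open_dist R (1 + (N - 3)) (section_chart i x) d.
have oW := @open_dist R (1 + N) (return_map X i k z0) eps.
have CGE : Ck_on m [set zeta | `|zeta - section_chart i x| < d] (fun zeta => G (E zeta)).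
  apply: (@Ck_on_comp _ _ _ _ _ _ _ E G oV oW _ (CE m _ oV)); last exact: Ck_on_pred CGi.
  by move=> zeta; rewrite /mkset !lt_min => /andP[/andP[/Hd1 + _] _].
split; first exact: Ck_on_rsubmx.
exact: (Ck_on_coord m _ oV).1 (Ck_on_lsubmx oV CGE) 0.
Qed.

(** * From linear contraction back to stability *)

(** The component of the displacement along the field is not contracted. It is matched by moving the
    comparison point along the orbit of x, by the time c that makes the i-th entries agree to first
    order. *)
Lemma nonlinear_contraction x T k i K q : reaches X x T (translate k x) -> flow_total X x ->
  contracts X x T i K q -> forall th : R, 0 < th -> exists (n : nat) (eta : R), 0 < eta /\
  forall y, ordered y -> Lambda y = Lambda x -> `|y - x| < eta ->
    reaches X y (n%:R * T) (flow X (n%:R * T) y) /\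
    exists2 c, orbit X x c & `|flow X (n%:R * T) y - c| <= th * `|y - x|.
Proof.
move=> H tot [Xi K0 q01 HC] th th0; have [ox _] := reaches_domain H.
have q01' : 0 <= q < 1 by case/andP: q01 => /ltW -> ->.
have [n Hn] := geometric_small (8 * K) q01' th0.
have Kn : K * q ^+ n * 2 <= th / 4 by have := Hn n (leqnn n); qlra.
have Hm := ret_nat n H; have Jm := jac_ret_pow n H.
have [M HM] := Lambda_right_inverse HN ox.
move: Hm Jm (HC n); set S := n%:R * T; set x' := translate (k *+ n) x.
move=> Hm Jm; rewrite -Jm; set B := jac (flow X S) x => HCn.
have [cB cB0 HB] := mulmxr_bound B; have [cM cM0 HMc] := mulmxr_bound M.
have a0 : 0 < `|X x 0 i| by rewrite normr_gt0.
pose g := 2 * cB / `|X x 0 i|; have g0 : 0 < g by rewrite divr_gt0 ?mulr_gt0.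
have t80 : 0 < th / 8 by rewrite divr_gt0.
have [d1 d10 H1] := jac_eps (flow_diff Hm) t80.
have e20 : 0 < th / 8 / g by rewrite divr_gt0.
have [d2 d20 H2] := flow_linear ox e20.
pose e3 := Num.min 1 (th / 8 / cB) / cM.
have e30 : 0 < e3 by rewrite divr_gt0 // lt_min ltr01 divr_gt0.
have [d3 d30 H3] := jac_eps (Lambda_diff ox) e30.
have [d4 d40 H4] := reaches_near Hm.
exists n, (Num.min (Num.min d1 (d2 / g)) (Num.min d3 d4)).
split; first by rewrite !lt_min d10 divr_gt0 // d30 d40.
move=> y oy Ly; rewrite !lt_min => /andP[/andP[y1 y2] /andP[y3 y4]].
have Hy := H4 y y4; split=> //.
have [v vE] : exists v, v = y - x by exists (y - x).
rewrite -vE in y1 y2 y3 *; have yE : y = x + v by rewrite vE addrC subrK.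
have vL : `|v *m jac (@Lambda R N) x| <= e3 * `|v|.
  by have := H3 v y3; rewrite -yE Ly subrr sub0r normrN.
have [r rv uL] : exists2 r, `|r| <= cM * e3 * `|v| & (v - r) *m jac (@Lambda R N) x = 0.
  exists (v *m jac (@Lambda R N) x *m M); last by rewrite mulmxBl -!mulmxA HM mulmx1 subrr.
  by apply: le_trans (HMc _) _; rewrite -mulrA; apply: ler_wpM2l => //; apply: ltW.
have vn := normr_ge0 v.
have ce3 : cM * e3 = Num.min 1 (th / 8 / cB) by rewrite /e3 mulrC divfK // gt_eqF.
have rv1 : `|r| <= `|v|.
  by apply: le_trans rv _; rewrite ce3 ler_piMl // ge_min lexx.
have rvB : `|r *m B| <= th / 8 * `|v|.
  apply: le_trans (HB r) _; apply: le_trans (ler_wpM2l (ltW cB0) rv) _.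
  rewrite mulrA; apply: ler_wpM2r => //; rewrite ce3 mulrC -ler_pdivlMr //.
  by rewrite ge_min lexx orbT.
have [u uE] : exists u, u = v - r by exists (v - r).
rewrite -uE in uL.
have u2 : `|u| <= 2 * `|v| by rewrite uE; apply: le_trans (ler_normB _ _) _; qlra.
pose c := (u *m B) 0 i / X x 0 i.
have cv : `|c| <= g * `|v|.
  rewrite normrM normfV ler_pdivrMr // /g mulrAC divfK ?gt_eqF //.
  apply: le_trans (mx_entry_le _ _ _) _; apply: le_trans (HB u) _.
  by rewrite [2 * cB]mulrC -mulrA; apply: ler_wpM2l => //; apply: ltW.
have cd2 : `|c| < d2 by apply: le_lt_trans cv _; rewrite mulrC -ltr_pdivlMr.
have [|_ Hc] := H2 x c _ cd2; first by rewrite subrr normr0.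
exists (translate (k *+ n) (flow X c x)).
  by apply: (orbit_same (orbit_flow c tot)); exists (k *+ n).
have -> : flow X S y - translate (k *+ n) (flow X c x) =
    (flow X S y - x' - v *m B) + r *m B + u *m B *m along (X x) i - (flow X c x - x - c *: X x).
  rewrite alongE -/c -{1}(translateB (k *+ n) (flow X c x)) -/x'.
  have -> : v *m B = u *m B + r *m B by rewrite -mulmxDl uE subrK.
  by apply/rowP => j; rewrite !mxE; ring.
have b1 : `|flow X S y - x' - v *m B| <= th / 8 * `|v|.
  by have := H1 v y1; rewrite -yE (flowE Hm).
have b2 : `|u *m B *m along (X x) i| <= th / 4 * `|v|.
  apply: le_trans (HCn u uL) _; apply: le_trans (_ : K * q ^+ n * (2 * `|v|) <= _).
    by apply: ler_wpM2l => //; rewrite mulr_ge0 // exprn_ge0 //; case/andP: q01'.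
  by rewrite mulrA; apply: ler_wpM2r.
have b3 : `|flow X c x - x - c *: X x| <= th / 8 * `|v|.
  apply: le_trans Hc _; apply: le_trans (ler_wpM2l (ltW e20) cv) _.
  by rewrite mulrA divfK // gt_eqF.
apply: le_trans (ler_normB _ _) _; apply: le_trans (lerD (ler_normD _ _) b3) _.
apply: le_trans (lerD (lerD (ler_normD _ _) b2) (lexx _)) _.
apply: le_trans (lerD (lerD (lerD b1 rvB) (lexx _)) (lexx _)) _.
rewrite -!mulrDl; apply: ler_wpM2r => //; qlra.
Qed.

Lemma total_range x a b : flow_total X x -> a <= b -> exists eta L : R,
  [/\ 0 < eta, 1 <= L, forall s y, a <= s <= b -> `|y - x| < eta -> reaches X y s (flow X s y) &
    forall s y y', a <= s <= b -> `|y - x| < eta -> `|y' - x| < eta ->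
      `|flow X s y - flow X s y'| <= L * `|y - y'|].
Proof.
move=> tot ab; have [|||eta [L [eta0 L0 A B]]] := @flow_uniform a b (fun=> x) (fun s => s) ab.
- by move=> s _; exact: cvg_cst.
- by move=> s _; exact: cvg_id.
- by move=> s _; exists (flow X s x).
exists eta, (L + 1); split=> //; first by rewrite lerDr.
move=> s y y' h1 h2 h3; apply: le_trans (B s y y' h1 h2 h3) _.
by apply: ler_wpM2r => //; rewrite lerDl.
Qed.

Lemma return_phase x T k : 0 < T -> reaches X x T (translate k x) -> exists eta L : R,
  [/\ 0 < eta, 1 <= L & forall s y, 0 <= s <= T -> `|y - flow X s x| < eta ->
    reaches X y (T - s) (flow X (T - s) y) /\
    `|flow X (T - s) y - translate k x| <= L * `|y - flow X s x|].
Proof.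
move=> T0 H; have tot := ret_total T0 H.
have [|||eta [L [eta0 L0 A B]]] := @flow_uniform 0 T (fun s => flow X s x) (fun s => T - s) (ltW T0).
- by move=> s _; exact: total_cont.
- by move=> s _; apply: continuousB; [exact: cvg_cst|exact: cvg_id].
- by move=> s _; exists (flow X T x); have := total_flow s (T - s) tot; rewrite [s + _]addrC subrK.
exists eta, (L + 1); split=> //; first by rewrite lerDr.
move=> s y h1 h2; split; first exact: A.
have Es : flow X (T - s) (flow X s x) = translate k x.
  by rewrite (flowE (total_flow s (T - s) tot)) addrC subrK (flowE H).
rewrite -Es; apply: le_trans (B s y (flow X s x) h1 h2 _) _; first by rewrite subrr normr0.
by apply: ler_wpM2r => //; rewrite lerDl.
Qed.

Lemma orbit_phase x T k c : 0 < T -> reaches X x T (translate k x) -> orbit X x c ->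
  exists s l, 0 <= s <= T /\ c = translate l (flow X s x).
Proof.
move=> T0 H [t [z xz [l ->]]]; have [s [m [y [/andP[s0 sT] tE xy xt]]]] := ret_reduce t T0 H.
exists s, (l + k * m); rewrite s0 ltW //; split=> //.
by rewrite (reaches_unique xz xt) translateD (flowE xy).
Qed.

Lemma orbit_dist_step x T k i K q : 0 < T -> reaches X x T (translate k x) ->
  contracts X x T i K q -> exists S eta L : R, [/\ 0 < S, 0 < eta, 0 < L &
    forall y, ordered y -> Lambda y = Lambda x -> dist_to (orbit X x) y < eta ->
      (forall t, 0 <= t <= S -> reaches X y t (flow X t y) /\
        dist_to (orbit X x) (flow X t y) <= L * dist_to (orbit X x) y) /\
      dist_to (orbit X x) (flow X S y) <= 1 / 2 * dist_to (orbit X x) y].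
Proof.
move=> T0 H HC; have tot := ret_total T0 H; have [ox _] := reaches_domain H.
have ne : orbit X x !=set0 by exists x; apply: orbit_self.
have [e1 [L1 [e10 L11 P1]]] := return_phase T0 H.
have [e2 [L2 [e20 L21 A2 B2]]] := total_range tot (ltW T0).
have L10 : 0 < L1 by apply: lt_le_trans L11.
have L20 : 0 < L2 by apply: lt_le_trans L21.
(* The transports to and from the base point expand by at most L1 and L2; the contraction has to
   outweigh both and leave 1/2. *)
pose th := 1 / (2 * L1 * L2).
have th0 : 0 < th by rewrite divr_gt0 // !mulr_gt0.
have [n [e3 [e30 H3]]] := nonlinear_contraction H tot HC th0.
pose S := n%:R * T + T.
have nT0 : 0 <= n%:R * T by rewrite mulr_ge0 // ltW.
have [|e4 [L4 [e40 L41 A4 B4]]] := @total_range x (- T) S tot; first by rewrite /S; qlra.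
have L40 : 0 < L4 by apply: lt_le_trans L41.
pose xn := translate (k *+ n) x.
have Hn := ret_nat n H.
have [e5 e50 H5] := flow_cont Hn (divr_gt0 e20 (ltr0Sn R 1)).
pose eta := Num.min e1 (Num.min (Num.min e3 e4) (Num.min e5 (e2 / (2 * th)) ) / L1).
have eta0 : 0 < eta.
  by rewrite lt_min e10 divr_gt0 // !lt_min e30 e40 e50 divr_gt0 // mulr_gt0.
exists S, eta, (L4 * L1); split; [by rewrite /S ltr_wpDl|exact: eta0|by rewrite mulr_gt0|].
move=> y oy Ly; set dy := dist_to (orbit X x) y => dye.
(* All estimates are proved for d slightly larger than the distance of y to the orbit. *)
have key d : dy < d -> d < eta ->
    (forall t, 0 <= t <= S -> reaches X y t (flow X t y) /\
      dist_to (orbit X x) (flow X t y) <= L4 * L1 * d) /\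
    dist_to (orbit X x) (flow X S y) <= 1 / 2 * d.
  move=> dyd; rewrite lt_min => /andP[de1]; rewrite ltr_pdivlMr // !lt_min.
  move=> /andP[/andP[de3 de4] /andP[de5 de2]].
  have [c Cc ycd] := dist_to_lt ne dyd.
  have [s [l [s01 cE]]] := orbit_phase T0 H Cc.
  have d0 : 0 < d by apply: le_lt_trans ycd.
  have yE : `|translate (- l) y - flow X s x| = `|y - c|.
    by rewrite -(translateB l) translateD subrr translate0 cE.
  have [|Hw wd] := P1 s (translate (- l) y) s01; first by rewrite yE (lt_trans ycd).
  rewrite yE in wd.
  have [w wE] : exists w, w = flow X (T - s) (translate (- l) y) by exists (flow X (T - s) (translate (- l) y)).
  rewrite -wE in Hw wd.
  have [z zE] : exists z, z = translate (- k) w by exists (translate (- k) w).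
  have zx : `|z - x| <= L1 * `|y - c|.
    by rewrite zE -{1}(translateK k x) translateB.
  have zxd : `|z - x| < d * L1.
    by apply: le_lt_trans zx _; rewrite mulrC ltr_pM2r.
  have Hyz : reaches X y (T - s) (translate (l + k) z).
    have := reaches_translate l Hw; rewrite translateD subrr translate0.
    by rewrite zE translateD addrK.
  have [oz _] : ordered z /\ ordered z.
    by rewrite zE; have := translate_ordered HN (- k) (reaches_domain Hw).2.
  have Lz : Lambda z = Lambda x.
    by rewrite -Ly -(reaches_Lambda Hyz) Lambda_translate.
  have yt t : - T <= t - (T - s) <= S -> reaches X y t (translate (l + k) (flow X (t - (T - s)) z)) .
    move=> tS; have h := A4 _ z tS (lt_trans zxd de4).
    by have := reaches_trans Hyz (reaches_translate (l + k) h); rewrite addrC subrK.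
  have orb t m : orbit X x (translate m (flow X t x)).
    by apply: (orbit_same (orbit_flow t tot)); exists m.
  have [s0 sT] := andP s01.
  split.
    move=> t /andP[t0 tS]; have tr : - T <= t - (T - s) <= S by apply/andP; split; qlra.
    have h := yt t tr; split; first exact: reaches_flow h.
    rewrite (flowE h); apply: le_trans (dist_to_le _ (orb (t - (T - s)) (l + k))) _.
    rewrite translateB; apply: le_trans (B4 _ _ _ tr (lt_trans zxd de4) _) _.
      by rewrite subrr normr0.
    rewrite -mulrA; apply: ler_wpM2l; first exact: ltW.
    by rewrite [leRHS]mulrC; apply: ltW.
  have [Hzn [c2 Cc2 zc2]] := H3 z oz Lz (lt_trans zxd de3).
  have zn : `|flow X (n%:R * T) z - xn| < e2 / 2.
    by have := H5 z (lt_trans zxd de5); rewrite (flowE Hn).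
  have zc2' : `|flow X (n%:R * T) z - c2| < e2 / 2.
    apply: le_lt_trans zc2 _; apply: lt_trans (_ : th * (d * L1) < _); first by rewrite ltr_pM2l.
    by rewrite mulrC -ltr_pdivlMr // -mulrA -invfM.
  have c2n : `|c2 - xn| < e2.
    rewrite -(subrKA (flow X (n%:R * T) z)); apply: le_lt_trans (ler_normD _ _) _.
    rewrite distrC; qlra.
  have Hs := A2 s (translate (- (k *+ n)) c2) s01.
  have c2x : `|translate (- (k *+ n)) c2 - x| < e2 by rewrite -{1}(translateK (k *+ n) x) translateB.
  have znx : `|translate (- (k *+ n)) (flow X (n%:R * T) z) - x| < e2.
    rewrite -{1}(translateK (k *+ n) x) translateB; apply: lt_trans zn _; qlra.
  have Hs1 := A2 s _ s01 znx; have Hs2 := A2 s _ s01 c2x.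
  have bound := B2 s _ _ s01 znx c2x; rewrite translateB in bound.
  have HS : reaches X y S (translate (l + k + (k *+ n)) (flow X s (translate (- (k *+ n)) (flow X (n%:R * T) z)))).
    have h1 := reaches_trans Hyz (reaches_translate (l + k) Hzn).
    have h2 := reaches_translate (l + k + (k *+ n)) Hs1.
    rewrite translateD addrK in h2.
    have := reaches_trans h1 h2; rewrite (_ : T - s + n%:R * T + s = S) //.
    by rewrite /S; ring.
  rewrite (flowE HS).
  have Oc : orbit X x (translate (l + k + k *+ n) (flow X s (translate (- (k *+ n)) c2))).
    apply: orbit_trans Cc2 _; exists s.
    exists (translate (k *+ n) (flow X s (translate (- (k *+ n)) c2))).
      by have := reaches_translate (k *+ n) Hs2; rewrite translateD subrr translate0.
    by exists (l + k); rewrite translateD.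
  apply: le_trans (dist_to_le _ Oc) _; rewrite translateB; apply: le_trans bound _.
  apply: le_trans (_ : L2 * (th * (d * L1)) <= _).
    by apply: ler_wpM2l; [exact: ltW|apply: le_trans zc2 _; apply: ler_wpM2l; exact: ltW].
  by rewrite /th le_eqVlt; apply/orP; left; apply/eqP; field; rewrite !gt_eqF.
pose d j := dy + (eta - dy) / (j%:R + 2).
have dyj c b : 0 <= c -> (forall e, dy < e -> e < eta -> b <= c * e) -> b <= c * dy.
  move=> c0 hb; apply/ler_addgt0Pr => e e0.
  pose e' := Num.min (e / (c + 1)) ((eta - dy) / 2).
  have e'0 : 0 < e' by rewrite lt_min !divr_gt0 ?subr_gt0 // ltr_wpDl.
  have e'1 : e' <= (eta - dy) / 2 by rewrite /e' ge_min lexx orbT.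
  apply: le_trans (hb (dy + e') _ _) _; [by rewrite ltrDl|by qlra|].
  rewrite mulrDr lerD2l; apply: le_trans (_ : (c + 1) * e' <= _).
    by apply: ler_wpM2r; [exact: ltW|rewrite lerDl].
  by rewrite mulrC -ler_pdivlMr ?ltr_wpDl // /e' ge_min lexx.
have [d0 dd0 de0] : exists2 d, dy < d & d < eta by exists ((dy + eta) / 2); qlra.
split=> [t t0S|]; last by apply: dyj => [|e h1 h2]; [qlra|exact: (key e h1 h2).2].
split; first exact: ((key d0 dd0 de0).1 t t0S).1.
apply: dyj => [|e h1 h2]; first by rewrite mulr_ge0 // ltW.
exact: ((key e h1 h2).1 t t0S).2.
Qed.

Lemma contracts_exp_stable x T k i K q : 0 < T -> reaches X x T (translate k x) ->
  contracts X x T i K q -> exp_stable_in X (level (Lambda x)) (orbit X x).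
Proof.
move=> T0 H HC; have [ox _] := reaches_domain H.
have [S [eta [L [S0 eta0 L0 P]]]] := orbit_dist_step T0 H HC.
have ne : orbit X x !=set0 by exists x; apply: orbit_self.
(* The distance is halved in each time S; the factor 2 L pays for the last, incomplete step. *)
pose mu := ln 2 / S; have ln20 : 0 < ln 2 :> R by rewrite ln_gt0 // ltr1n.
have mu0 : 0 < mu by rewrite divr_gt0.
exists eta, (2 * L), mu; split=> //; first by rewrite mulr_gt0.
move=> y [oy Ly] dy t t0.
have iter m : exists z, [/\ reaches X y (m%:R * S) z, Lambda z = Lambda x &
    dist_to (orbit X x) z <= (1 / 2) ^+ m * dist_to (orbit X x) y].
  elim: m => [|m [z [Hz Lz dz]]].
    by exists y; rewrite mul0r expr0 mul1r; split=> //; apply: reaches0.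
  have dz' : dist_to (orbit X x) z < eta.
    apply: le_lt_trans dz _; apply: le_lt_trans dy; rewrite ler_piMl ?dist_to_ge0 //.
    by rewrite exprn_ile1 //; qlra.
  have [h1 h2] := P z (reaches_domain Hz).2 Lz dz'.
  have [|hr _] := h1 S; first by rewrite lexx ltW.
  exists (flow X S z); split.
  - by have := reaches_trans Hz hr; rewrite -natr1 mulrDl mul1r.
  - by rewrite (reaches_Lambda hr).
  by apply: le_trans h2 _; rewrite [_ ^+ m.+1]exprS -[leRHS]mulrA; apply: ler_wpM2l dz; qlra.
pose m := Num.truncn (t / S).
have /andP[m1 m2] : m%:R <= t / S < m.+1%:R by apply: truncn_itv; rewrite divr_ge0 // ltW.
have [z [Hz Lz dz]] := iter m.
have r0 : 0 <= t - m%:R * S by rewrite subr_ge0 -ler_pdivlMr.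
have rS : t - m%:R * S <= S.
  by rewrite lerBlDr -[X in X + _]mul1r -mulrDl addrC natr1 -ler_pdivrMr // ltW.
have dz' : dist_to (orbit X x) z < eta.
  apply: le_lt_trans dz _; apply: le_lt_trans dy; rewrite ler_piMl ?dist_to_ge0 //.
  by rewrite exprn_ile1 //; qlra.
have [h1 _] := P z (reaches_domain Hz).2 Lz dz'.
have [|hr hd] := h1 (t - m%:R * S); first by rewrite r0.
exists (flow X (t - m%:R * S) z).
  by have := reaches_trans Hz hr; rewrite addrC subrK.
apply: le_trans hd _; apply: le_trans (ler_wpM2l (ltW L0) dz) _.
rewrite mulrA; apply: ler_wpM2r; first exact: dist_to_ge0.
have E : (1 / 2) ^+ m.+1 <= expR (- mu * t).
  have -> : (1 / 2) ^+ m.+1 = expR (- ln 2 * m.+1%:R) :> R.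
    by rewrite [- ln 2 * _]mulrC expRM_natl expRN lnK ?posrE // div1r.
  rewrite ler_expR !mulNr lerN2 /mu mulrAC ler_pdivrMr // -mulrA; apply: ler_wpM2l; first exact: ltW.
  by rewrite -ler_pdivrMr // ltW.
rewrite (_ : L * (1 / 2) ^+ m = 2 * L * (1 / 2) ^+ m.+1); last by rewrite exprS; field.
by apply: ler_wpM2l => //; rewrite mulr_ge0 // ltW.
Qed.

(** * Local uniqueness and persistence of stable orbits *)

(** One period covers the orbit on the torus, and over this compact time interval the chordal
    distance to y has a positive minimum. *)
Lemma orbit_far x T y : ret_time X x T -> ordered y -> ~ orbit X x y ->
  exists2 r : R, 0 < r & forall c, orbit X x c -> r <= `|c - y|.
Proof.
move=> RT oy ny; have tot := ret_time_total RT; move: (RT) => [T0 [k H] _].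
have [|s0 _ Hs0] := @EVT_min R (fun s => chordal y (flow X s x)) 0 T (ltW T0).
  apply: continuous_in_subspaceT => s _.
  exact: (@continuous_comp R^o _ R^o (fun s => flow X s x) (chordal y) s (total_cont tot (s := s)) (@chordal_cont R N y _)).
have m0 : 0 < chordal y (flow X s0 x).
  rewrite lt_def chordal_ge0 andbT; apply/negP => /eqP Z; apply: ny.
  apply: (orbit_same (orbit_flow s0 tot)); apply: same_point_sym.
  by have := chordal_eq0 HN oy (total_cder tot s0).1 Z.
have [r r0 Hr] := (cont_eps _ _).1 (@chordal_cont R N y y) _ m0.
exists r => // c /(orbit_phase T0 H)[s [l [s01 cE]]]; rewrite leNgt; apply/negP => /Hr.
rewrite chordal_self subr0 ger0_norm ?chordal_ge0 // cE chordal_translate => h.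
by have := lt_le_trans h (Hs0 s s01); rewrite ltxx.
Qed.

Lemma hyperbolic_point lam D x : stable_orbit X lam D -> D x -> exists T k i K q,
  [/\ hyperbolic X x T k i K q, ret_time X x T, D = orbit X x & Lambda x = lam].
Proof.
move=> [PO DL ES] Dx; have [T RT E] := periodic_orbitP PO Dx.
have [ox Lx] := DL x Dx; have [i _ Xi] := field_head RT.
have := RT => -[T0 [k H] _].
have [|K [q [K0 q01 HC]]] := linear_contraction RT _ Xi; first by rewrite Lx -E.
by exists T, k, i, K, q; split.
Qed.

Lemma hyperbolic_stable x T k i K q : hyperbolic X x T k i K q -> ret_time X x T ->
  stable_orbit X (Lambda x) (orbit X x).
Proof.
move=> [T0 H HC] RT; split; first exact: ret_periodic_orbit RT.
  by move=> y Oy; split; [exact: orbit_ordered Oy|exact: orbit_Lambda].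
exact: contracts_exp_stable T0 H HC.
Qed.

(** Near x the i-th angle moves with nonzero speed, so by the intermediate value theorem it takes a
    prescribed nearby value after a short time. *)
Lemma align x i : ordered x -> X x 0 i != 0 -> forall e, 0 < e -> exists2 d : R, 0 < d &
  forall (y : 'rV[R]_N) s, `|y - x| < d -> `|s - x 0 i| < d -> exists t z,
    [/\ `|t| < e, reaches X y t z, z 0 i = s & `|z - x| < e].
Proof.
move=> ox Xi e e0; pose a := `|X x 0 i|; have a0 : 0 < a by rewrite normr_gt0.
have [d1 d10 H1] := flow_linear ox (divr_gt0 a0 (ltr0Sn R 1)).
have [d2 d20 H2] := flow_joint_cont (reaches0 ox) e0.
pose h := Num.min (e / 2) (Num.min (d1 / 2) (d2 / 2)).
have h0 : 0 < h by rewrite !lt_min !divr_gt0.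
have [he hd1 hd2] : [/\ h <= e / 2, h <= d1 / 2 & h <= d2 / 2].
  by rewrite /h !ge_min !lexx !orbT.
pose d := Num.min (Num.min d1 d2) (h * a / 4).
have d0 : 0 < d by rewrite !lt_min d10 d20 divr_gt0 // mulr_gt0.
exists d => // y s; rewrite !lt_min => /andP[/andP[y1 y2] y3] /andP[_ s3].
have reach t : `|t| <= h -> reaches X y t (flow X t y) /\ `|flow X t y - x| < e.
  by move=> th; apply: H2 => //; rewrite subr0; apply: le_lt_trans th _; qlra.
pose f t := flow X t y 0 i.
have D t : - d1 < t < d1 -> is_derive (t : R^o) 1 ((fun t => flow X t y) : R^o -> _) (X (flow X t y)).
  move=> td; have [|_ //] := @flow_cder y (- d1) d1 _ t td.
  by move=> u ud; exists (flow X u y); apply: (H1 y u y1 _).1; rewrite ltr_norml.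
have near t : `|t| <= h -> `|f t - y 0 i - t * X x 0 i| <= a / 2 * `|t|.
  move=> th; have [|_ hh] := H1 y t y1; first by apply: le_lt_trans th _; qlra.
  by apply: le_trans hh; apply: le_trans (mx_entry_le _ 0 i); rewrite !mxE.
have hh : `|h| <= h by rewrite gtr0_norm.
have hN : `|- h| <= h by rewrite normrN gtr0_norm.
have yi : `|y 0 i - x 0 i| < h * a / 4.
  by apply: le_lt_trans y3; have := mx_entry_le (y - x) 0 i; rewrite sub_mxE.
have [|||t th ft] := @IVT R f (- h) h s.
- by qlra.
- apply: continuous_in_subspaceT => t; rewrite inE /= in_itv /= => /andP[t1 t2].
  apply: (@continuous_comp R^o _ R^o (fun t => flow X t y) (fun z : 'rV[R]_N => z 0 i : R^o)).
    by apply: (cder_cont (D t _)); apply/andP; split; qlra.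
  exact: continuous_coord.
- have := near h hh; have := near (- h) hN; rewrite normrN (gtr0_norm h0) !ler_distl mulNr.
  move: yi s3; rewrite !ltr_distl ge_min le_max => /andP[yi1 yi2] /andP[s1 s2] /andP[n1 n2] /andP[n3 n4].
  have ha : `|h * X x 0 i| = h * a by rewrite normrM gtr0_norm.
  have [X0|X0] := ltP 0 (h * X x 0 i).
    rewrite gtr0_norm // in ha; apply/andP; split; apply/orP; [left|right]; qlra.
  rewrite ler0_norm // in ha; apply/andP; split; apply/orP; [right|left]; qlra.
move: th; rewrite in_itv /= -ler_norml => th; have [r1 r2] := reach t th.
by exists t, (flow X t y); split=> //; apply: le_lt_trans th _; qlra.
Qed.

(** After y has been slid along its orbit to the i-th angle of y', both points have the same
    [section_chart], and [family_points] allows only one returning point there. *)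
Lemma local_unique_orbit x T k i K q : hyperbolic X x T k i K q -> exists2 d : R, 0 < d &
  forall (y y' : 'rV[R]_N) t t' l l', `|y - x| < d -> `|y' - x| < d -> `|t - T| < d ->
    `|t' - T| < d -> reaches X y t (translate l y) -> reaches X y' t' (translate l' y') ->
    Lambda y = Lambda y' -> orbit X y y' /\ t = t'.
Proof.
move=> [T0 H HC]; have [ox _] := reaches_domain H.
have [p [tau [d1 [d10 _ U _]]]] := family_points 0 H HC.
have [d2 d20 H2] := align ox (let: And4 h _ _ _ := HC in h) d10.
exists (Num.min d1 d2); first by rewrite lt_min d10.
move=> y y' t t' l l'; rewrite !lt_min => /andP[y1 y2] /andP[y'1 y'2] /andP[t1 _] /andP[t'1 _] Hy Hy' LL.
have si : `|y' 0 i - x 0 i| < d2.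
  by apply: le_lt_trans y'2; have := mx_entry_le (y' - x) 0 i; rewrite sub_mxE.
have [s [z [_ yz zi zx]]] := H2 y (y' 0 i) y2 si.
have Hz := ret_flow Hy yz.
have [pz tz] := U z t l zx t1 Hz; have [py ty] := U y' t' l' y'1 t'1 Hy'.
have E : section_chart i z = section_chart i y'.
  by rewrite /section_chart !mul_delta zi (reaches_Lambda yz) LL.
split; last by rewrite -tz -ty E.
exists s, z => //; exists 0; rewrite translate0.
by rewrite -py -E pz.
Qed.

(** The point is minimality of the return time t. A much shorter return, or its complement in t, is
    excluded by [small_return]; a return at an intermediate time brings x itself close to its start,
    and [local_return] corrects this to a return of x before T. *)
Lemma persistence x T k i K q : hyperbolic X x T k i K q -> ret_time X x T ->
  exists d K' q' : R, 0 < d /\ forall (y : 'rV[R]_N) t l, `|y - x| < d -> `|t - T| < d ->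
    reaches X y t (translate l y) -> hyperbolic X y t l i K' q' /\ ret_time X y t.
Proof.
move=> [T0 H HC] RT; have [ox _] := reaches_domain H; have tot := ret_time_total RT.
have Xi : X x 0 i != 0 by case: HC.
have [d1 [K' [q' [d10 H1]]]] := robust_contraction H HC.
have [e1 e10 H2] := small_return ox Xi.
pose e := Num.min e1 (T / 2).
have e0 : 0 < e by rewrite lt_min e10 divr_gt0.
have [ee1 eT] : e <= e1 /\ e <= T / 2 by rewrite /e !ge_min !lexx orbT.
have e20 : 0 < e / 2 by rewrite divr_gt0.
have [eta eta0 LR] := local_return RT e20.
have [|d3 [L [d30 L1 A3 B3]]] := @total_range x 0 (T + 1) tot; first by qlra.
have L0 : 0 < L by apply: lt_le_trans L1.
pose d := Num.min (Num.min d1 e1) (Num.min (Num.min (e / 2) d3) (Num.min 1 (eta / (L + 1)))).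
exists d, K', q'.
have d0 : 0 < d by rewrite !lt_min d10 e10 e20 d30 ltr01 divr_gt0 // ltr_wpDl // ltW.
split; first exact: d0.
move=> y t l; rewrite !lt_min => /andP[/andP[y1 y2] /andP[/andP[_ y3] /andP[_ y4]]].
move=> /andP[/andP[t1 _] /andP[/andP[t2 _] /andP[t3 _]]] Hy.
move: t2 t3; rewrite !ltr_distl => /andP[t2 t2'] /andP[t3 t3'].
have tp : 0 < t by qlra.
split; first exact: (And3 tp Hy (H1 y t l y1 t1 Hy)).
suff min' : forall s m, 0 < s < t -> ~ reaches X y s (translate m y).
  by apply: And3 tp _ min'; exists l.
move=> s m /andP[s0 st] Hs.
have [se|se] := ltP s e1.
  by apply: (H2 y s m y2 _ Hs); rewrite gtr0_norm // s0.
have [te|te] := ltP (t - s) e1.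
  have tsp : 0 < t - s by rewrite subr_gt0.
  apply: (H2 y (t - s) (- m + l) y2); first by rewrite gtr0_norm // tsp.
  have h1 := reaches_translate (- m) (reaches_opp Hs); rewrite translateK in h1.
  have := reaches_trans h1 (reaches_translate (- m) Hy).
  by rewrite translateD [- s + t]addrC.
have sT : 0 <= s <= T + 1 by apply/andP; split; qlra.
have close := B3 s x y sT; rewrite subrr normr0 in close.
have {}close := close d30 y3.
rewrite (flowE Hs) in close.
have near : `|translate (- m) (flow X s x) - x| < eta.
  rewrite -{2}(translateK m x) translateB.
  rewrite -(subrKA (translate m y)) translateB.
  apply: le_lt_trans (ler_normD _ _) _.
  apply: (@le_lt_trans _ _ ((L + 1) * `|y - x|)).
    by rewrite mulrDl mul1r lerD2r [X in _ * X]distrC.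
  by rewrite mulrC -ltr_pdivlMr // ltr_wpDl // ltW.
have [t' t'e xt'] := LR s (- m) (flow X s x) (tot s) near.
move: t'e; rewrite ltr_norml => /andP[t'1 t'2].
have back : reaches X x (s - t') (translate m x).
  have h := reaches_translate m (reaches_opp xt').
  rewrite translateD subrr translate0 in h; exact: reaches_trans (tot s) h.
have [_ _ min] := RT; apply: (min (s - t') m _ back); apply/andP; split; qlra.
Qed.

Lemma local_family lam D : stable_orbit X lam D -> exists2 d : R, 0 < d & exists C,
  C lam = D /\ stable_family X [set mu | `|mu - lam| < d] C.
Proof.
move=> SO; have [PO _ _] := SO; have [x Dx] := orbit_nonempty PO.
have [T [k [i [K [q [Hyp RT DE Lx]]]]]] := hyperbolic_point SO Dx.
have [T0 H HC] := Hyp.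
have [d1 [K' [q' [d10 H1]]]] := persistence Hyp RT.
have [p [tau [d2 [d20 P U [Cp Ct]]]]] := family_points 0 H HC.
have cx : [set zeta | `|zeta - section_chart i x| < d2] (section_chart i x).
  by rewrite /= subrr normr0.
have [||px taux] := U x T k _ _ H; rewrite ?subrr ?normr0 //.
have [d3 d30 H3] := (cont_eps _ _).1 (Ck_on_cont Cp cx) _ d10.
have [d4 d40 H4] := (cont_eps _ _).1 (Ck_on_cont Ct cx) _ d10.
pose d := Num.min d2 (Num.min d3 d4).
have d0 : 0 < d by rewrite !lt_min d20 d30 d40.
pose z mu : 'rV[R]_(1 + (N - 3)) := row_mx (x 0 i)%:M mu.
have zlam : z lam = section_chart i x by rewrite /z /section_chart mul_delta Lx.
have zd mu mu' : `|z mu - z mu'| <= `|mu - mu'|.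
  rewrite /z opp_row_mx add_row_mx subrr; exact: row_mx0_norm.
have zball mu e : `|mu - lam| < e -> `|z mu - section_chart i x| < e.
  by rewrite -zlam; apply: le_lt_trans.
have good mu : `|mu - lam| < d -> [/\ hyperbolic X (p (z mu)) (tau (z mu)) k i K' q',
    ret_time X (p (z mu)) (tau (z mu)) & Lambda (p (z mu)) = mu].
  rewrite !lt_min => /andP[m2 /andP[m3 m4]].
  have [Hz Ez] := P (z mu) (zball _ _ m2).
  have h3 := H3 _ (zball _ _ m3); have h4 := H4 _ (zball _ _ m4).
  rewrite px in h3; rewrite taux in h4.
  have [hy rt] := H1 _ _ _ h3 h4 Hz; split=> //.
  by have [_] := eq_row_mx Ez.
exists d => //; exists (fun mu => orbit X (p (z mu))); split; first by rewrite zlam px.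
move=> mu md; have [hy rt Lm] := good mu md; split.
  by rewrite -[X in stable_orbit _ X]Lm; exact: hyperbolic_stable hy rt.
move=> y T' e Oy RT' e0.
have ET : T' = tau (z mu) := ret_time_unique RT' (orbit_ret rt Oy).
have [t [w pw [l yE]]] := Oy.
have [d5 d50 H5] := flow_cont pw e0.
have zmu : [set zeta | `|zeta - section_chart i x| < d2] (z mu).
  have md' : `|mu - lam| < d := md.
  by apply: zball; move: md'; rewrite lt_min => /andP[].
have [d6 d60 H6] := (cont_eps _ _).1 (Ck_on_cont Cp zmu) _ d50.
have [d7 d70 H7] := (cont_eps _ _).1 (Ck_on_cont Ct zmu) _ e0.
exists (Num.min (d - `|mu - lam|) (Num.min d6 d7)); first by rewrite !lt_min subr_gt0 md d60 d70.
move=> nu; rewrite !lt_min => /andP[n1 /andP[n6 n7]].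
have nd : `|nu - lam| < d.
  by rewrite -(subrKA mu); apply: le_lt_trans (ler_normD _ _) _; qlra.
have [hy' rt' _] := good nu nd; have tot' := ret_time_total rt'.
exists (translate l (flow X t (p (z nu)))), (tau (z nu)); split.
- by apply: (orbit_same (orbit_flow t tot')); exists l.
- rewrite yE translateB -(flowE pw); apply: H5; apply: H6.
  exact: le_lt_trans (zd _ _) n6.
- exact: ret_time_translate (ret_time_flow rt' (tot' t)).
rewrite ET; apply: H7; exact: le_lt_trans (zd _ _) n7.
Qed.

Lemma stable_ret_time lam D x y T : stable_orbit X lam D -> D x -> D y -> ret_time X x T ->
  ret_time X y T.
Proof.
move=> SO Dx Dy RT; have [_ [_ [_ [_ [_ [_ _ DE _]]]]]] := hyperbolic_point SO Dx.
by apply: orbit_ret RT _; rewrite -DE.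
Qed.

(** Agreement of two families is an open and closed condition: equal orbits stay equal by
    [local_unique_orbit], distinct ones stay distinct because a periodic orbit keeps its distance
    from points off it. *)
Lemma families_equiv lam C1 C2 : stable_orbit X lam (C1 lam) -> stable_orbit X lam (C2 lam) ->
  continuous_orbits X C1 lam -> continuous_orbits X C2 lam ->
  (exists2 d : R, 0 < d & forall mu, `|mu - lam| < d ->
    stable_orbit X mu (C1 mu) /\ stable_orbit X mu (C2 mu)) ->
  exists2 d : R, 0 < d & forall mu, `|mu - lam| < d -> C1 mu = C2 mu <-> C1 lam = C2 lam.
Proof.
move=> S1 S2 c1 c2 [d0 d00 S].
have [x1 D1] : exists x, C1 lam x by have [/orbit_nonempty] := S1.
have [x2 D2] : exists x, C2 lam x by have [/orbit_nonempty] := S2.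
have [T1 [k1 [i1 [K1 [q1 [Hyp1 RT1 E1 L1]]]]]] := hyperbolic_point S1 D1.
have [T2 [k2 [i2 [K2 [q2 [Hyp2 RT2 E2 L2]]]]]] := hyperbolic_point S2 D2.
have [EC|NC] := pselect (C1 lam = C2 lam).
  have [e e0 He] := local_unique_orbit Hyp1.
  have D1' : C2 lam x1 by rewrite -EC.
  have [d1 d10 H1] := c1 x1 T1 e D1 RT1 e0.
  have [d2 d20 H2] := c2 x1 T1 e D1' RT1 e0.
  exists (Num.min d0 (Num.min d1 d2)); first by rewrite !lt_min d00 d10 d20.
  move=> mu; rewrite !lt_min => /andP[m0 /andP[m1 m2]]; split=> // _.
  have [y1 [t1 [Cy1 yx1 rt1 tT1]]] := H1 mu m1; have [y2 [t2 [Cy2 yx2 rt2 tT2]]] := H2 mu m2.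
  have [_ [l1 h1] _] := rt1; have [_ [l2 h2] _] := rt2.
  have [SO1 SO2] := S mu m0.
  have [_ [_ [_ [_ [_ [_ _ F1 M1]]]]]] := hyperbolic_point SO1 Cy1.
  have [_ [_ [_ [_ [_ [_ _ F2 M2]]]]]] := hyperbolic_point SO2 Cy2.
  have [|O _] := He y1 y2 t1 t2 l1 l2 yx1 yx2 tT1 tT2 h1 h2; first by rewrite M1 M2.
  by rewrite F1 F2; exact: orbit_eq.
have nx2 : ~ orbit X x1 x2.
  move=> O; apply: NC; rewrite E1 E2; exact: orbit_eq.
have ox2 : ordered x2 by case: S2 => _ /(_ x2 D2)[].
have [r r0 far] := orbit_far RT1 ox2 nx2.
have tot1 := ret_time_total RT1; have T10 : 0 < T1 by case: RT1.
have [|e3 [L [e30 LL1 A3 B3]]] := @total_range x1 0 (T1 + 1) tot1; first by qlra.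
have L0 : 0 < L by apply: lt_le_trans LL1.
pose e := Num.min (Num.min 1 e3) (r / (2 * L)).
have e0 : 0 < e by rewrite !lt_min ltr01 e30 divr_gt0 // mulr_gt0.
have r20 : 0 < r / 2 by rewrite divr_gt0.
have [d1 d10 H1] := c1 x1 T1 e D1 RT1 e0.
have [d2 d20 H2] := c2 x2 T2 (r / 2) D2 RT2 r20.
exists (Num.min d0 (Num.min d1 d2)); first by rewrite !lt_min d00 d10 d20.
move=> mu; rewrite !lt_min => /andP[m0 /andP[m1 m2]]; split=> // EC; exfalso.
have [y1 [t1 [Cy1 + rt1 +]]] := H1 mu m1; have [y2 [t2 [Cy2 yx2 rt2 _]]] := H2 mu m2.
rewrite !lt_min => /andP[/andP[_ y1e] y1r] /andP[/andP[t1T _] _].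
have [SO1 SO2] := S mu m0; have [t10 [l1 h1] _] := rt1.
have [_ [_ [_ [_ [_ [_ _ F1 M1]]]]]] := hyperbolic_point SO1 Cy1.
have Oy2 : orbit X y1 y2 by rewrite -F1 EC.
have [s [l [/andP[s0 st] y2E]]] := orbit_phase t10 h1 Oy2.
have sT : 0 <= s <= T1 + 1 by move: t1T; rewrite ltr_distl => /andP[_ ?]; apply/andP; split; qlra.
have Oc : orbit X x1 (translate l (flow X s x1)).
  by apply: (orbit_same (orbit_flow s tot1)); exists l.
have := far _ Oc; rewrite leNgt => /negP; apply.
rewrite -(subrKA y2); apply: le_lt_trans (ler_normD _ _) _.
rewrite {1}y2E translateB.
have close := B3 s x1 y1 sT; rewrite subrr normr0 in close.
have {}close := close e30 y1e.
have : L * `|x1 - y1| < r / 2.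
  by rewrite distrC mulrC -ltr_pdivlMr // -mulrA -invfM.
qlra.
Qed.

Lemma families_agree W1 W2 C1 C2 lam mu : open W1 -> open W2 ->
  stable_family X W1 C1 -> stable_family X W2 C2 ->
  (forall s : R, 0 <= s <= 1 -> W1 (lam + s *: (mu - lam)) /\ W2 (lam + s *: (mu - lam))) ->
  C1 lam = C2 lam -> C1 mu = C2 mu.
Proof.
move=> oW1 oW2 F1 F2 seg E; pose g (s : R) := lam + s *: (mu - lam).
have g0 : g 0 = lam by rewrite /g scale0r addr0.
have g1 : g 1 = mu by rewrite /g scale1r addrC subrK.
have c01 : 0 <= (0 : R) <= 1 by apply/andP; split; qlra.
have c11 : 0 <= (1 : R) <= 1 by apply/andP; split; qlra.
rewrite -g1; apply: (@seg_locally_const R 0 1 (fun s => C1 (g s) = C2 (g s)) _ 0 1 c01 c11); last by rewrite g0.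
move=> s s01; have [w1 w2] := seg s s01.
have [S1 K1] := F1 _ w1; have [S2 K2] := F2 _ w2.
have [|d d0 Hd] := families_equiv S1 S2 K1 K2.
  have [e1 e10 H1] := eps_near (open_nbhs_nbhs (conj oW1 w1)).
  have [e2 e20 H2] := eps_near (open_nbhs_nbhs (conj oW2 w2)).
  exists (Num.min e1 e2); first by rewrite lt_min e10.
  by move=> nu; rewrite lt_min => /andP[/H1/F1[? _] /H2/F2[? _]].
pose n := `|mu - lam| + 1; have n0 : 0 < n by rewrite ltr_wpDl.
exists (d / n); first by rewrite divr_gt0.
have near u : `|s - u| < d / n -> `|g u - g s| < d.
  move=> su; rewrite /g opprD addrACA subrr add0r -scalerBl normrZ distrC.
  apply: (@le_lt_trans _ _ (`|s - u| * n)); first by rewrite ler_wpM2l // lerDl.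
  by rewrite -ltr_pdivlMr.
move=> u v _ _ /near/Hd h1 /near/Hd h2 /h1 h; exact/h2.
Qed.

Lemma periodE x T : ret_time X x T -> period X x = T.
Proof.
move=> RT; rewrite /period; case: xgetP => [T' _ RT'|/(_ T)] //.
exact: ret_time_unique RT' RT.
Qed.

(** * The union of the orbits as a submanifold *)

Lemma graph_map_exists m x T k i K q : hyperbolic X x T k i K q ->
  exists d Pm tau, graph_map X x T k i m d Pm tau.
Proof.
move=> [T0 H HC]; have [ox _] := reaches_domain H.
have [p [tau [d1 [d10 P U [Cp Ct]]]]] := family_points m H HC.
have oB1 := @open_dist R (1 + (N - 3)) (section_chart i x) d1.
have [d2 d20 H2] := (cont_eps _ _).1 (Ck_on_cont (smooth_section_chart HN i 0%N) ox) _ d10.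
have [d3 d30 H3] := eps_near (open_nbhs_nbhs (conj oU ox)).
pose d := Num.min d1 (Num.min d2 d3).
have d0 : 0 < d by rewrite !lt_min d10 d20 d30.
exists d, (fun y => p (section_chart i y)), (fun y => tau (section_chart i y)).
split=> //.
- move=> y; rewrite !lt_min => /andP[_ /andP[/H2 h2 /H3 oy]].
  have [Hp E] := P _ h2; have [E1 E2] := eq_row_mx E; split=> //.
  by have := congr1 (fun B : 'M[R]_1 => B 0 0) E1; rewrite !mul_delta !scalar_mx00.
- by move=> y t l; rewrite !lt_min => /andP[y1 _] /andP[t1 _]; apply: U.
have oB := @open_dist R N x d.
have sub y : [set y | `|y - x| < d] y -> [set zeta | `|zeta - section_chart i x| < d1] (section_chart i y).
  by rewrite /mkset !lt_min => /andP[_ /andP[/H2]].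
have Cs : Ck_on m [set y | `|y - x| < d] (section_chart i).
  by apply: Ck_on_sub (smooth_section_chart HN i m) => y; rewrite /mkset !lt_min => /andP[_ /andP[_ /H3]].
split; first exact: (Ck_on_comp oB oB1 sub Cs Cp).
exact: (Ck_on_comp_real oB sub Cs Ct).
Qed.

Lemma graph_map_self x T k i m d Pm tau : reaches X x T (translate k x) ->
  graph_map X x T k i m d Pm tau -> Pm x = x /\ tau x = T.
Proof. by move=> H [d0 _ U _]; apply: U H; rewrite subrr normr0. Qed.

(** Differentiating the return equation along the graph gives b X + v A = v for every v in the range
    of the differential of [Pm], hence v (1 - A)^2 = 0. *)
Lemma graph_map_jac x T k i m d Pm tau : reaches X x T (translate k x) ->
  graph_map X x T k i m.+1 d Pm tau ->
  [/\ differentiable Pm x, jac Pm x *m unip (jac (flow X T) x) = 0,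
    jac Pm x *m jac (@Lambda R N) x = jac (@Lambda R N) x &
    forall v : 'rV[R]_N, (v *m jac Pm x) 0 i = v 0 i].
Proof.
move=> H G; have [Px tx] := graph_map_self H G; have [ox _] := reaches_domain H.
have [d0 P _ [Cp Ct]] := G; have oB := @open_dist R N x d.
have Bx : [set y | `|y - x| < d] x by rewrite /= subrr normr0.
have dP : differentiable Pm x by apply: Cp.1.
have JL : jac Pm x *m jac (@Lambda R N) x = jac (@Lambda R N) x.
  have dL : differentiable (@Lambda R N) (Pm x) by rewrite Px; apply: Lambda_diff.
  transitivity (jac Pm x *m jac (@Lambda R N) (Pm x)); first by rewrite Px.
  rewrite -(jac_comp dP dL); apply: (jac_near d0) => y yd.
  by have [_ _ h _] := P y yd.
have Ji (v : 'rV[R]_N) : (v *m jac Pm x) 0 i = v 0 i.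
  have E : jac Pm x *m delta_mx i (0 : 'I_1) = delta_mx i 0.
    have dI : differentiable (fun y : 'rV[R]_N => y) x by [].
    have E1 := jac_mulmxr (delta_mx i (0 : 'I_1)) dP.
    have E2 := jac_mulmxr (delta_mx i (0 : 'I_1)) dI; rewrite jac_id mul1mx in E2.
    apply: (etrans (esym E1)); apply: etrans E2.
    by apply: (jac_near d0) => y yd; have [_ _ _] := P y yd; rewrite !mul_delta => ->.
  have := congr1 (fun B : 'M[R]_(N, 1) => (v *m B) 0 0) E.
  by rewrite mulmxA !mul_delta !scalar_mx00.
split=> //.
pose z (y : 'rV[R]_N) : 'rV[R]_(1 + N) := row_mx (tau y)%:M (Pm y).
have Cz : Ck_on m.+1 [set y | `|y - x| < d] z.
  apply: (Ck_on_row_mx oB) => //; apply/(Ck_on_coord _ _ oB) => j.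
  by apply: (Ck_on_ext oB _ Ct) => y _; rewrite (ord1 j) scalar_mx00.
have dz : differentiable z x by apply: Cz.1.
have zx : z x = row_mx T%:M x by rewrite /z Px tx.
have rz : jac z x *m col_mx 0 1%:M = jac Pm x.
  rewrite -(jac_mulmxr _ dz); apply: (jac_near d0) => y _.
  by rewrite -rsubmxE /z row_mxKr.
have dF : differentiable (joint_flow X) (z x) by rewrite zx; exact: (joint_flow_D 0 0 H).1.
have E1 : jac z x *m jac (joint_flow X) (z x) = jac Pm x.
  rewrite -(jac_comp dz dF) -(jac_addr (const_mx (2 * pi * k%:~R)) dP).
  apply: (jac_near d0) => y yd; have [_ h _ _] := P y yd.
  by rewrite /joint_flow /z row_mxKl row_mxKr scalar_mx00 (flowE h).
apply/row_matrixP => a; rewrite row0 rowE mulmxA; set v := _ *m jac Pm x.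
have [b Eb] : exists b : R, delta_mx 0 a *m jac z x = row_mx b%:M v.
  pose w : 'rV[R]_(1 + N) := delta_mx 0 a *m jac z x.
  exists (lsubmx w 0 0); rewrite -[LHS](@hsubmxK R 1 1 N w); congr row_mx.
    by apply/rowP => j; rewrite (ord1 j) [RHS]mxE eqxx mulr1n.
  by rewrite rsubmxE -mulmxA rz.
have vA : b *: X x + v *m jac (flow X T) x = v.
  have [_ D2] := joint_flow_D b v H; rewrite -zx (jacP _ dF) -Eb -mulmxA E1 tX in D2.
  by rewrite -D2.
rewrite /unip -[_ * _]/(_ *m _) mulmxA.
have -> : v *m (1 - jac (flow X T) x) = b *: X x.
  by rewrite mulmxBr mulmx1 -{1}vA addrK.
by rewrite mulmxBr mulmx1 -scalemxAl (jac_ret_field H) subrr.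
Qed.

(** The difference of v and its image under [jac Pm] has no cross ratio component and no i-th entry,
    so [contracts_kernel] makes it 0. *)
Lemma graph_map_tangent x T k i K q m d Pm tau (v : 'rV[R]_N) : hyperbolic X x T k i K q ->
  graph_map X x T k i m.+1 d Pm tau ->
  v *m unip (jac (flow X T) x) = 0 <-> v *m jac Pm x = v.
Proof.
move=> [_ H HC] /(graph_map_jac H)[_ JS JL Ji]; split=> [vS|<-]; last by rewrite -mulmxA JS mulmx0.
apply/eqP; rewrite eq_sym -subr_eq0; apply/eqP; apply: (contracts_kernel H HC).
- by rewrite mulmxBl -mulmxA JL subrr.
- by rewrite sub_mxE Ji subrr.
by rewrite mulmxBl vS -mulmxA JS mulmx0 subrr.
Qed.

(** By continuity of the periods, points of the union near x are fixed by [Pm]. Conversely a fixed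
    point returns at a time near T, and local uniqueness identifies its orbit with the member of the
    family that has its cross ratios. *)
Lemma graph_map_union W C lam x T k i K q m d Pm tau : open W -> stable_family X W C -> W lam ->
  C lam x -> hyperbolic X x T k i K q -> ret_time X x T -> graph_map X x T k i m d Pm tau ->
  exists2 d' : R, 0 < d' & d' <= d /\
    forall y, `|y - x| < d' -> orbit_union W C y <-> Pm y = y.
Proof.
move=> oW F Wl Cx Hyp RT G; have [T0 H HC] := Hyp; have [ox _] := reaches_domain H.
have [S1 c1] := F lam Wl; have [_ CL _] := S1; have Lx := (CL x Cx).2.
have [Px tx] := graph_map_self H G; have [d0 P U [Cp Ct]] := G.
have Bx : [set y | `|y - x| < d] x by rewrite /= subrr normr0.
have [d1 d10 H1] := local_unique_orbit Hyp.
pose e := Num.min d d1; have e0 : 0 < e by rewrite lt_min d0 d10.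
have [ed ed1] : e <= d /\ e <= d1 by rewrite /e !ge_min !lexx orbT.
have [d2 d20 H2] := c1 x T e Cx RT e0.
have [d3 d30 H3] := eps_near (open_nbhs_nbhs (conj oW Wl)).
have m0 : 0 < Num.min d2 d3 by rewrite lt_min d20.
have [d4 d40 H4] := (cont_eps _ _).1 (Ck_on_cont (smooth_Lambda HN 0%N) ox) _ m0.
have [d5 d50 H5] := (cont_eps _ _).1 (Ck_on_cont Ct Bx) _ e0.
exists (Num.min e (Num.min d4 d5)); first by rewrite lt_min e0 lt_min d40.
split; first by rewrite ge_min ed.
move=> y; rewrite lt_min => /andP[ye]; rewrite lt_min => /andP[/H4 y4 /H5 y5].
rewrite Lx lt_min in y4; rewrite tx in y5; have [y2 y3] := andP y4.
have yd := lt_le_trans ye ed; have yd1 := lt_le_trans ye ed1.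
have Wy := H3 _ y3; have [S2 _] := F _ Wy.
have [y' [T' [Cy' y'x RT' TT]]] := H2 _ y2.
split=> [[mu Wmu Cy]|Py].
  have [Smu _] := F mu Wmu; have [_ /(_ y Cy)[_ Ly] _] := Smu.
  rewrite Ly in Cy'; have [_ [l Hy] _] := stable_ret_time Smu Cy' Cy RT'.
  by case: (U y T' l yd (lt_le_trans TT ed) Hy).
exists (Lambda y) => //.
have [_ [l' Hy'] _] := RT'; have [_ Hy _ _] := P y yd; rewrite Py in Hy.
have [_ [_ [_ [_ [_ [_ _ DE Ly']]]]]] := hyperbolic_point S2 Cy'.
have [Oy _] := H1 y' y T' (tau y) l' k (lt_le_trans y'x ed1) yd1 (lt_le_trans TT ed1) (lt_le_trans y5 ed1) Hy' Hy Ly'.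
by rewrite DE.
Qed.

Lemma graph_chart W C lam x T k i K q r Pm d tau : open W -> stable_family X W C -> W lam ->
  C lam x -> hyperbolic X x T k i K q -> (i < 3)%N -> ret_time X x T ->
  graph_map X x T k i r.+1 d Pm tau ->
  exists (U : set 'rV[R]_N) psi, [/\ U x, chart r.+1 (N - 2) false (orbit_union W C) U psi &
    forall v : 'rV[R]_N, v *m jac Pm x = v -> model (N - 2) false ('d psi x v)].
Proof.
move=> oW F Wl Cx Hyp i3 RT G; have [T0 H HC] := Hyp; have [ox _] := reaches_domain H.
have [dP JS JL Ji] := graph_map_jac H G; have [d1 d10 [d1d HU]] := graph_map_union oW F Wl Cx Hyp RT G.
have [Px tx] := graph_map_self H G; have [d0 P _ [Cp _]] := G.
pose U0 := [set y | `|y - x| < d1]; have oU0 : open U0 := @open_dist R N x d1.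
have U0d y : U0 y -> `|y - x| < d by move=> h; apply: lt_le_trans h d1d.
have U0x : U0 x by rewrite /U0 /= subrr normr0.
(* [Pm] keeps the i-th angle, so the i-th entry of y - Pm y is 0 and is free to hold that angle as a
   coordinate. The two other head entries vanish together exactly on the manifold. *)
pose head y : 'rV[R]_N := y - Pm y + y *m delta_mx i i.
pose psi y : 'rV[R]_N := gather (head y) (Lambda y) *m slide_mx HN i3.
have CP : Ck_on r.+1 U0 Pm by apply: Ck_on_sub Cp.
have CI : Ck_on r.+1 U0 (fun y : 'rV[R]_N => y) by apply: Ck_on_id.
have Ch : Ck_on r.+1 U0 head.
  apply: (Ck_on_add oU0); last exact: (Ck_on_mulmx _ oU0).
  exact: (Ck_on_add oU0 CI (Ck_on_opp oU0 CP)).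
have CL : Ck_on r.+1 U0 (@Lambda R N).
  by apply: Ck_on_sub (smooth_Lambda HN r.+1) => y /U0d/P[].
have Cpsi : Ck_on r.+1 U0 psi.
  by apply: (Ck_on_mulmx _ oU0); apply: (Ck_on_add oU0); exact: (Ck_on_mulmx _ oU0).
have dI : differentiable (fun y : 'rV[R]_N => y) x by [].
have dh : differentiable head x by apply: Ch.1.
have dL := Lambda_diff ox.
have dpsi : differentiable psi x by apply: Cpsi.1.
have Dh v : 'D_v head x = v - v *m jac Pm x + v *m delta_mx i i.
  have [d' D'] := derive_mulmx (delta_mx i i) dI.
  have dd : differentiable (fun y : 'rV[R]_N => y - Pm y) x by apply: differentiableB.
  rewrite deriveD; [|exact: diff_derivable|exact: diff_derivable].
  rewrite D' deriveB; [|exact: diff_derivable|exact: diff_derivable].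
  by rewrite derive_id jacP.
have Dpsi v : 'D_v psi x = gather ('D_v head x) (v *m jac (@Lambda R N) x) *m slide_mx HN i3.
  have [e1 E1] := derive_mulmx (head_mx N) dh.
  have [e2 E2] := derive_mulmx (tail_mx N) dL.
  have dg : differentiable (fun y => gather (head y) (Lambda y)) x by apply: differentiableD.
  have [_ ->] := derive_mulmx (slide_mx HN i3) dg; congr (_ *m _).
  rewrite deriveD; [|exact: diff_derivable|exact: diff_derivable].
  by rewrite E1 E2 (jacP _ dL).
have headE (w v : 'rV[R]_N) (a : 'I_N) : a != i -> (w + v *m delta_mx i i) 0 a = w 0 a.
  move=> ai; rewrite mxE [X in _ + X]mxE big1 ?addr0 // => b _.
  by rewrite mxE (negbTE ai) andbF mulr0.
have headi (w v : 'rV[R]_N) : (w + v *m delta_mx i i) 0 i = w 0 i + v 0 i.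
  rewrite mxE; congr (_ + _); rewrite mxE (bigD1 i) //= mxE !eqxx mulr1 big1 ?addr0 // => b bi.
  by rewrite mxE (negbTE bi) mulr0.
have [|G' [rho [eps [rho0 eps0 rU inj [GF CG]]]]] := @inverse_function R N r psi U0 x oU0 Cpsi U0x.
  move=> v; rewrite Dpsi => E.
  have Z a : gather ('D_v head x) (v *m jac (@Lambda R N) x) 0 a = 0.
    by have [j <-] := slide_surj HN i3 a; rewrite -slide_mxE E mxE.
  have vL : v *m jac (@Lambda R N) x = 0.
    by apply/rowP => l; rewrite -(gather_tail ('D_v head x) _ l) Z mxE.
  have v3 (a : 'I_N) : (a < 3)%N -> (v - v *m jac Pm x + v *m delta_mx i i) 0 a = 0.
    by move=> a3; rewrite -Dh -(gather_head _ (v *m jac (@Lambda R N) x) a3) Z.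
  have vi : v 0 i = 0.
    by have := v3 i i3; rewrite headi sub_mxE Ji subrr add0r.
  have vJ : v *m jac Pm x = 0.
    apply: (contracts_kernel H HC); [by rewrite -mulmxA JL|by rewrite Ji|].
    by rewrite -mulmxA JS mulmx0.
  apply: (Lambda_kernel HN ox vL) => a a3; have [->//|ai] := eqVneq a i.
  by have := v3 a a3; rewrite headE // vJ subr0.
pose U := [set y | `|y - x| < rho /\ `|psi y - psi x| < eps].
exists U, psi; split; first by split; rewrite subrr normr0.
  split.
    exists [set z | `|z - psi x| < eps], G'; split.
    - split; last exact: open_dist.
      apply: open_eps => y [y1 y2].
      have gap : 0 < eps - `|psi y - psi x| by rewrite subr_gt0.
      have [e' e'0 He'] := (cont_eps _ _).1 (Ck_on_cont Cpsi (rU y y1)) _ gap.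
      exists (Num.min (rho - `|y - x|) e'); first by rewrite lt_min subr_gt0 y1.
      move=> y'; rewrite lt_min => /andP[h1 /He' h2]; split.
        exact: ball_shift y1 h1.
      exact: ball_shift y2 h2.
    - by apply: Ck_on_sub Cpsi => y [/rU].
    - exact: CG.
    - move=> y [y1 y2]; split=> //; have [g1 g2] := GF _ y2.
      exact: inj.
    - by move=> z zr; have [g1 g2] := GF z zr; split=> //; split=> //; rewrite g2.
  move=> y [y1 _]; have yU := rU y y1; have yd := U0d y yU; have [oy Hy LPy Pyi] := P y yd.
  rewrite (HU y yU); split=> [Py|[M _]].
    split=> // j jN; have [j3 ji] := slide_end HN i3 jN.
    by rewrite slide_mxE gather_head // headE // Py subrr mxE.
  apply: (Lambda_injective HN) => //; first by case: (reaches_domain Hy).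
  move=> a a3; have aN : (a < N)%N by rewrite (leq_trans a3) // ltnW.
  rewrite !(coord_ord _ aN); have [->//|ai] := eqVneq (Ordinal aN) i.
  have [j E jN] := slide_end_surj HN i3 (a3 : (Ordinal aN < 3)%N) ai.
  have := M j jN; rewrite slide_mxE E gather_head // headE // sub_mxE => /eqP.
  by rewrite subr_eq0 eq_sym => /eqP.
move=> v vJ; split=> // j jN; have [j3 ji] := slide_end HN i3 jN.
rewrite -deriveE // Dpsi slide_mxE gather_head // Dh headE // vJ subrr mxE //.
Qed.

Lemma hyperbolic_head lam D x : stable_orbit X lam D -> D x -> exists T k (i : 'I_N) K q,
  (i < 3)%N /\ [/\ hyperbolic X x T k i K q, ret_time X x T, D = orbit X x & Lambda x = lam].
Proof.
move=> [PO DL ES] Dx; have [T RT E] := periodic_orbitP PO Dx.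
have [ox Lx] := DL x Dx; have [i i3 Xi] := field_head RT.
have := RT => -[T0 [k H] _].
have [|K [q [K0 q01 HC]]] := linear_contraction RT _ Xi; first by rewrite Lx -E.
by exists T, k, i, K, q; split.
Qed.

Lemma coord_line (y w : 'rV[R]_N) (s : R) :
  coord (y + s *: w) 0 = coord y 0 + s * coord w 0.
Proof.
have N0 : (0 < N)%N by apply: leq_trans HN.
by rewrite !(coord_ord _ N0) !mxE.
Qed.

(** In a half-space chart possibly only one of v and -v points into the manifold. Either suffices,
    because the conclusion drawn from the curve is linear in v. *)
Lemma chart_tangent_curve r M half U psi x (v : 'rV[R]_N) : M x -> U x ->
  chart r.+1 (N - 2) half M U psi -> model (N - 2) false ('d psi x v) ->
  exists (psi' : 'rV[R]_N -> 'rV[R]_N) (w : 'rV[R]_N) (d : R),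
    [/\ 0 < d, differentiable psi' (psi x), psi' (psi x) = x,
      w *m jac psi' (psi x) = v \/ w *m jac psi' (psi x) = - v &
      forall s, 0 < s < d -> M (psi' (psi x + s *: w))].
Proof.
move=> Mx Ux [[U' [psi' [[oU1 oU2] C1 C2 K1 K2]]] HM] Mv.
have [Ux' px] := K1 x Ux; have dpsi : differentiable psi x by apply: C1.1.
have dpsi' : differentiable psi' (psi x) by apply: C2.1.
pose w0 := 'd psi x v; have w0E : w0 *m jac psi' (psi x) = v.
  rewrite /w0 -(deriveE _ dpsi) (jacP _ dpsi) -mulmxA -jac_comp //.
  have [d d0 Hd] := eps_near (open_nbhs_nbhs (conj oU1 Ux)).
  have -> : jac (fun y => psi' (psi y)) x = jac (fun y => y) x.
    by apply: (jac_near d0) => y /Hd/K1[].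
  by rewrite jac_id mulmx1.
have [w [w00 wE wv]] : exists w : 'rV[R]_N, [/\ forall i : 'I_N, (N - 2 <= i)%N -> w 0 i = 0,
    0 <= coord w 0 & w *m jac psi' (psi x) = v \/ w *m jac psi' (psi x) = - v].
  have [c0|c0] := leP 0 (coord w0 0).
    by exists w0; split=> //; [case: Mv|left].
  exists (- w0); split; [|by rewrite -[- w0]add0r -scaleN1r coord_line mulN1r (coord_ord _ (leq_trans (isT : 0 < 4)%N HN)) mxE add0r oppr_ge0 ltW|].
    by move=> i iN; rewrite mxE (Mv.1 i iN) oppr0.
  by right; rewrite mulNmx w0E.
have [d d0 Hd] := eps_near (open_nbhs_nbhs (conj oU2 Ux')).
pose c := `|w| + 1; have c0 : 0 < c by rewrite ltr_wpDl.
exists psi', w, (d / c); split=> //; first exact: divr_gt0.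
move=> s /andP[s0 sd].
have U's : U' (psi x + s *: w).
  apply: Hd; rewrite addrAC subrr add0r normrZ gtr0_norm //.
  by apply: le_lt_trans (_ : s * c < _); [rewrite ler_pM2l // /c lerDl|rewrite -ltr_pdivlMr].
have [V1 V2] := K2 _ U's; apply/(HM _ V1); rewrite V2.
have [Z1 Z2] := (HM x Ux).1 Mx; split=> [i iN|hf].
  by rewrite mxE Z1 // mxE w00 // mulr0 addr0.
by rewrite coord_line addr_ge0 ?Z2 // mulr_ge0 // ltW.
Qed.

(** [tangent] admits every chart, also those with boundary. From left to right, the equation Pm y =
    y is differentiated along a one-sided curve in the manifold; the converse uses the chart of
    [graph_chart]. *)
Lemma family_tangent W C lam x r (v : 'rV[R]_N) : open W -> stable_family X W C -> W lam -> C lam x ->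
  tangent r.+1 (N - 2) (orbit_union W C) x v <-> v *m unip (jac (flow X (period X x)) x) = 0.
Proof.
move=> oW F Wl Cx; have [S1 _] := F lam Wl.
have [T [k [i [K [q [i3 [Hyp RT DE Lx]]]]]]] := hyperbolic_head S1 Cx.
have [d [Pm [tau G]]] := graph_map_exists r.+1 Hyp.
rewrite (periodE RT); have TG := graph_map_tangent _ Hyp G; rewrite TG.
have [U [psi [Ux CH HT]]] := graph_chart oW F Wl Cx Hyp i3 RT G.
have [T0 H HC] := Hyp; have [dP _ _ _] := graph_map_jac H G.
split=> [|/HT Mv]; last by exists false, U, psi.
move=> [half [U1 [psi1 [Ux1 CH1 Mv]]]].
have Mx : orbit_union W C x by exists lam.
have [psi' [w [e [e0 dpsi' px wE HM]]]] := chart_tangent_curve Mx Ux1 CH1 Mv.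
have [d1 d10 [_ HU]] := graph_map_union oW F Wl Cx Hyp RT G.
have [Px _] := graph_map_self H G.
have [e1 e10 He1] := (cont_eps _ _).1 (differentiable_continuous dpsi') _ d10.
pose c := `|w| + 1; have c0 : 0 < c by rewrite ltr_wpDl.
pose g (z : 'rV[R]_N) := psi' z - Pm (psi' z).
have dP' : differentiable Pm (psi' (psi1 x)) by rewrite px.
have dg1 : differentiable (fun z => Pm (psi' z)) (psi1 x) by apply: differentiable_comp.
have dg : differentiable g (psi1 x) by apply: differentiableB.
have jg : w *m jac g (psi1 x) = w *m jac psi' (psi1 x) - w *m jac psi' (psi1 x) *m jac Pm x.
  rewrite -(jacP _ dg) deriveB; [|exact: diff_derivable|exact: diff_derivable].
  by rewrite (jacP _ dpsi') (jacP _ dg1) (jac_comp dpsi' dP') px mulmxA.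
have m0 : 0 < Num.min e (e1 / c) by rewrite lt_min e0 divr_gt0.
have Z : w *m jac g (psi1 x) = 0.
  apply: (one_sided_jac m0 dg) => s; rewrite lt_min => /andP[s0 /andP[se sc]].
  have g0 : g (psi1 x) = 0 by rewrite /g px Px subrr.
  rewrite g0 /g; apply/eqP; rewrite subr_eq0 eq_sym; apply/eqP.
  have s1 : `|psi1 x + s *: w - psi1 x| < e1.
    rewrite addrAC subrr add0r normrZ gtr0_norm //.
    by apply: le_lt_trans (_ : s * c < _); [rewrite ler_pM2l // /c lerDl|rewrite -ltr_pdivlMr].
  have := He1 _ s1; rewrite px => /HU[h _]; apply: h; apply: HM.
  by rewrite s0.
rewrite jg in Z; have /eqP := Z; rewrite subr_eq0 => /eqP.
case: wE => ->; first by move/esym.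
by rewrite mulNmx => /oppr_inj/esym.
Qed.

(** * The invariant splitting *)

Lemma family_local_decay x T k i K0 q0 : reaches X x T (translate k x) -> contracts X x T i K0 q0 ->
  exists d K q : R, [/\ 0 < d, 0 <= K, 0 < q < 1 &
    forall (z : 'rV[R]_N) t l, `|z - x| < d -> `|t - T| < d -> reaches X z t (translate l z) ->
      forall m (v : 'rV[R]_N),
        `|v *m (jac (flow X t) z ^+ m * unip (jac (flow X t) z))| <= K * q ^+ m * `|v|].
Proof.
move=> H HC; have [d1 [K [q [d10 H1]]]] := robust_contraction H HC.
have [d2 d20 H2] := jac_flow_cont H ltr01.
have [|||_ K0' q01 _] := H1 x T k; rewrite ?subrr ?normr0 //.
pose c : R := 1 + N%:R * (`|jac (flow X T) x| + 1).
have c0 : 0 <= c by rewrite addr_ge0 // mulr_ge0 // addr_ge0.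
exists (Num.min d1 d2), (K * c ^+ 2), q; split=> //.
- by rewrite lt_min d10.
- by rewrite mulr_ge0 // exprn_ge0.
move=> z t l; rewrite !lt_min => /andP[z1 z2] /andP[t1 t2] Hz m v.
have Cz := H1 z t l z1 t1 Hz; have [_ jz] := H2 t z t2 z2.
apply: le_trans (contracts_decay Hz Cz m v) _.
have [q0' _] := andP q01.
apply: ler_wpM2r => //; apply: ler_wpM2r; first by rewrite exprn_ge0 // ltW.
have le1 : 1 + N%:R * `|jac (flow X t) z| <= c.
  rewrite lerD2l; apply: ler_wpM2l => //.
  rewrite -(subrK (jac (flow X T) x) (jac (flow X t) z)).
  by apply: le_trans (ler_normD _ _) _; rewrite addrC lerD2l ltW.
apply: ler_wpM2l => //; apply: lerXn2r => //; rewrite nnegrE //.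
Qed.

Lemma lin_flowE x t y (v : 'rV[R]_N) : reaches X x t y -> lin_flow X t x v = v *m jac (flow X t) x.
Proof. by move=> H; have dF := flow_diff H; rewrite /lin_flow -(deriveE _ dF) (jacP _ dF). Qed.

(** Both products are the differential of the flow over the time T + s, and translations do not
    change differentials. *)
Lemma flow_conj x T k s y : reaches X x T (translate k x) -> reaches X x s y ->
  jac (flow X T) x *m jac (flow X s) x = jac (flow X s) x *m jac (flow X T) y.
Proof.
move=> H Hs; have H1 := reaches_translate k Hs; have H2 := ret_flow H Hs.
have E1 := jac_flow_trans Hs H2; have E2 := jac_flow_trans H H1.
have E3 := jac_flow_translate k Hs; rewrite (addrC T s) in E2.
exact: (etrans (congr1 (mulmx (jac (flow X T) x)) (esym E3)) (etrans (esym E2) E1)).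
Qed.

Lemma stable_decay lam D x T : stable_orbit X lam D -> D x -> ret_time X x T ->
  exists K q : R, [/\ 0 <= K, 0 < q < 1 & forall m (v : 'rV[R]_N),
    `|v *m (jac (flow X T) x ^+ m * unip (jac (flow X T) x))| <= K * q ^+ m * `|v|].
Proof.
move=> S Dx RT; have [T' [k [i [K [q [[T0 H HC] RT' _ _]]]]]] := hyperbolic_point S Dx.
rewrite (ret_time_unique RT RT'); have [d [K' [q' [d0 K0 q01 HD]]]] := family_local_decay H HC.
by exists K', q'; split=> //; apply: (HD x T' k); rewrite ?subrr ?normr0.
Qed.

Lemma orbit_flow_stable lam D x s y : stable_orbit X lam D -> D x -> reaches X x s y -> D y.
Proof.
move=> [PO _ _] Dx Hs; have [T RT DE] := periodic_orbitP PO Dx.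
by rewrite DE; exists s, y => //; exists 0; rewrite translate0.
Qed.

Lemma normal_proj_flow lam D x s y : stable_orbit X lam D -> D x -> reaches X x s y ->
  normal_proj X x *m jac (flow X s) x = jac (flow X s) x *m normal_proj X y.
Proof.
move=> S Dx Hs; have [T [k [i [K [q [[T0 H HC] RT _ _]]]]]] := hyperbolic_point S Dx.
have Dy := orbit_flow_stable S Dx Hs; have RTy := ret_time_flow RT Hs.
rewrite /normal_proj (periodE RT) (periodE RTy).
have [K1 [q1 [K10 q10 D1]]] := stable_decay S Dx RT.
have [K2 [q2 [K20 q20 D2]]] := stable_decay S Dy RTy.
have N0 : (0 < N)%N by apply: leq_trans HN.
by apply: (spectral_proj_conj N0 K10 q10 D1 K20 q20 D2 (jac_flow_unit Hs)); exact: flow_conj H Hs.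
Qed.

Lemma unip_flow lam D x T s y : stable_orbit X lam D -> D x -> ret_time X x T -> reaches X x s y ->
  unip (jac (flow X T) x) *m jac (flow X s) x = jac (flow X s) x *m unip (jac (flow X T) y).
Proof.
move=> S Dx [T0 [k H] _] Hs; apply: (unip_conj (jac_flow_unit Hs)); exact: flow_conj H Hs.
Qed.

Lemma family_period W C lam x T : open W -> stable_family X W C -> W lam -> C lam x ->
  ret_time X x T -> forall e : R, 0 < e -> exists2 d : R, 0 < d &
  forall y, orbit_union W C y -> `|y - x| < d -> exists2 T', ret_time X y T' & `|T' - T| < e.
Proof.
move=> oW F Wl Cx RT e e0; have [S1 c1] := F lam Wl; have [_ CL _] := S1.
have [ox Lx] := CL x Cx; have [d1 d10 H1] := c1 x T e Cx RT e0.
have [d2 d20 H2] := (cont_eps _ _).1 (Ck_on_cont (smooth_Lambda HN 0%N) ox) _ d10.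
exists d2 => // y [mu Wm Cy] /H2; rewrite Lx; have [S2 _] := F mu Wm.
have [_ /(_ y Cy)[_ ->] _] := S2 => /H1[y' [T' [Cy' _ RT' TT]]].
by exists T' => //; exact: stable_ret_time S2 Cy' Cy RT'.
Qed.

Lemma mcont_lincomb p n m (F G : R -> 'rV[R]_p -> 'M[R]_(n, m)) (a b t : R) (x : 'rV[R]_p) :
  mcont F t x -> mcont G t x -> mcont (fun s (y : 'rV[R]_p) => a *: F s y + b *: G s y) t x.
Proof.
move=> HF HG e e0; pose c := `|a| + `|b| + 1.
have c0 : 0 < c by rewrite ltr_wpDl // addr_ge0.
have ec : 0 < e / c by exact: divr_gt0.
have [d1 d10 H1] := HF _ ec; have [d2 d20 H2] := HG _ ec.
exists (Num.min d1 d2); first by rewrite lt_min d10.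
move=> s y; rewrite !lt_min => /andP[s1 s2] /andP[y1 y2].
have -> : a *: F s y + b *: G s y - (a *: F t x + b *: G t x) =
    a *: (F s y - F t x) + b *: (G s y - G t x).
  by rewrite !scalerBr; apply/matrixP => i j; rewrite !mxE; ring.
apply: le_lt_trans (ler_normD _ _) _; rewrite !normrZ.
have h1 := ltW (H1 s y s1 y1); have h2 := ltW (H2 s y s2 y2).
apply: le_lt_trans (_ : (`|a| + `|b|) * (e / c) < _).
  by rewrite mulrDl; apply: lerD; apply: ler_wpM2l.
by rewrite mulrA ltr_pdivrMr // mulrC ltr_pM2l // /c ltrDl.
Qed.

Lemma partial_proj_mcont (F : R -> 'rV[R]_N -> 'M[R]_N) t x m : mcont F t x ->
  mcont (fun s y => partial_proj (F s y) m) t x.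
Proof.
move=> HF; have c1 : mcont (fun _ (_ : 'rV[R]_N) => 1 : 'M[R]_N) t x.
  by move=> e e0; exists 1 => // s y _ _; rewrite subrr normr0.
have H := mcont_lincomb 1 (-1) c1 (mcont_lincomb m.+1%:R (- m%:R) (mcont_pow m HF) (mcont_pow m.+1 HF)).
move=> e /H[d d0 Hd]; exists d => // s y sd yd; have := Hd s y sd yd.
by rewrite !partial_projE !scale1r !scaleNr !scale1r.
Qed.

Lemma chain_norm p n (A A' B B' : 'M[R]_(p, n)) :
  `|A' - A| <= `|B' - A'| + `|B - B'| + `|B - A|.
Proof.
have h1 := ler_normD (A' - B') (B' - A); have h2 := ler_normD (B' - B) (B - A).
rewrite subrKA in h1; rewrite subrKA in h2; rewrite (distrC A' B') in h1; rewrite (distrC B' B) in h2; qlra.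
Qed.

(** Partial sums of the spectral projection depend continuously on the point and the period, and the
    remainder is uniformly small along the family near x. *)
Lemma normal_proj_cont W C : open W -> stable_family X W C ->
  {within orbit_union W C, continuous (normal_proj X)}.
Proof.
move=> oW F; apply/subspace_continuousP => x [lam Wl Cx].
have [S1 _] := F lam Wl.
have [T [k [i [K0 [q0 [[T0 H HC] RT _ _]]]]]] := hyperbolic_point S1 Cx.
have [d1 [K [q [d10 K1 q1 HD]]]] := family_local_decay H HC.
have N0 : (0 < N)%N by apply: leq_trans HN.
apply/cvgrPdist_lt => e e0; have e3 : 0 < e / 3 by qlra.
have third (c : R) : c < e / 3 -> c + e / 3 + c < e by qlra.
have [m Hm] := proj_tail_small K1 q1 e3; have tm := Hm m (leqnn m).
have mc : mcont (fun t y => jac (flow X t) y) T x.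
  by move=> e' /(jac_flow_cont H)[d d0 Hd]; exists d => // s y sd yd; case: (Hd s y sd yd).
have [d2 d20 H2] := partial_proj_mcont m mc e3.
have m0 : 0 < Num.min d1 d2 by rewrite lt_min d10.
have [d3 d30 H3] := family_period oW F Wl Cx RT m0.
have m3 : 0 < Num.min (Num.min d1 d2) d3 by rewrite lt_min m0.
suff : \forall y \near x, orbit_union W C y -> `|normal_proj X x - normal_proj X y| < e by [].
apply: (near_eps m3) => y; rewrite lt_min => /andP[y12 y3] My.
have [T' RT' TT] := H3 y My y3; move: y12 TT; rewrite !lt_min => /andP[y1 y2] /andP[T1 T2].
rewrite /normal_proj (periodE RT) (periodE RT').
have [_ [l Hy] _] := RT'.
have P1 := spectral_proj_tail N0 K1 q1 (HD y T' l y1 T1 Hy) m.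
have P2 : `|partial_proj (jac (flow X T) x) m - spectral_proj (jac (flow X T) x)| <= proj_tail K q m.
  by apply: (spectral_proj_tail N0 K1 q1 (HD x T k _ _ H)); rewrite subrr normr0.
have P3 := H2 T' y T2 y2.
apply: (le_lt_trans (chain_norm _ _ _ _)); apply: (le_lt_trans (lerD (lerD P2 (ltW P3)) P1)).
exact: third.
Qed.

Lemma family_total W C x : stable_family X W C -> orbit_union W C x -> flow_total X x.
Proof.
move=> F [lam Wl Cx]; have [[PO _ _] _] := F lam Wl; have [T RT _] := periodic_orbitP PO Cx.
exact: ret_time_total RT.
Qed.

Lemma family_translate W C k x : stable_family X W C -> orbit_union W C x ->
  orbit_union W C (translate k x).
Proof.
move=> F [lam Wl Cx]; have [[PO _ _] _] := F lam Wl; have [T RT E] := periodic_orbitP PO Cx.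
exists lam => //; rewrite E; apply: (orbit_same (orbit_self _)); last by exists k.
by have [_ [l H] _] := RT; case: (reaches_domain H).
Qed.

Lemma family_flow W C x t y : stable_family X W C -> orbit_union W C x -> reaches X x t y ->
  orbit_union W C y.
Proof.
by move=> F [lam Wl Cx] H; have [S _] := F lam Wl; exists lam => //; exact: orbit_flow_stable S Cx H.
Qed.

Lemma normal_proj_translate k x T : ret_time X x T -> normal_proj X (translate k x) = normal_proj X x.
Proof.
move=> RT; have [_ [l H] _] := RT.
by rewrite /normal_proj (periodE (ret_time_translate k RT)) (periodE RT) (jac_flow_translate k H).
Qed.

Lemma family_splitting W C r : open W -> stable_family X W C ->
  invariant_splitting r.+1 (N - 2) X (orbit_union W C) (normal_proj X).
Proof.
move=> oW F; have N0 : (0 < N)%N by apply: leq_trans HN.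
split; first exact: normal_proj_cont.
- move=> x y [lam Wl Cx] [k ->]; have [[PO _ _] _] := F lam Wl.
  by have [T RT _] := periodic_orbitP PO Cx; exact: normal_proj_translate RT.
- move=> x [lam Wl Cx]; have [S _] := F lam Wl; have [PO _ _] := S.
  have [T RT _] := periodic_orbitP PO Cx; have [K [q [K0 q0 HD]]] := stable_decay S Cx RT.
  split=> [|v]; first by rewrite /normal_proj (periodE RT); exact: (spectral_proj_idem N0 K0 q0 HD).
  rewrite (family_tangent r v oW F Wl Cx) /normal_proj (periodE RT).
  by have := spectral_proj_ker N0 K0 q0 HD v => -[h1 h2]; split.
- move=> t x v Mx; have Ht := family_total F Mx t; have [y Ey] : exists y, y = flow X t x by exists (flow X t x).
  have [lam Wl Cx] := Mx; have [S _] := F lam Wl; have [PO _ _] := S; rewrite -Ey in Ht *.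
  have [T RT _] := periodic_orbitP PO Cx; have Cy := orbit_flow_stable S Cx Ht.
  rewrite (family_tangent r v oW F Wl Cx) (lin_flowE v Ht) (family_tangent r _ oW F Wl Cy).
  rewrite (periodE RT) (periodE (ret_time_flow RT Ht)) => E.
  by rewrite -mulmxA -(unip_flow S Cx RT Ht) mulmxA E mul0mx.
move=> t x v Mx; have Ht := family_total F Mx t.
have [lam Wl Cx] := Mx; have [S _] := F lam Wl => E.
by rewrite (lin_flowE v Ht) -mulmxA -(normal_proj_flow S Cx Ht) mulmxA E.
Qed.

(** * Growth rates along the family *)

Lemma local_jac_bounds x T : flow_total X x -> 0 <= T ->
  exists d L : R, [/\ 0 < d, 1 <= L & forall y s, `|y - x| < d -> 0 <= s <= T ->
    [/\ reaches X y s (flow X s y), forall v : 'rV[R]_N, `|v *m jac (flow X s) y| <= L * `|v| &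
      forall v : 'rV[R]_N, `|v *m jac (flow X (- s)) (flow X s y)| <= L * `|v|]].
Proof.
move=> FT T0; have [d1 [L1 [d10 L10 H1 H2]]] := total_range FT T0.
have [|||d2 [L2 [d20 L20 H3 H4]]] :=
    @flow_uniform 0 T (fun s => flow X s x) (fun s => - s) T0.
- by move=> s _; exact: total_cont FT s.
- by move=> s _; exact: opp_continuous.
- by move=> s _; exists x; have := reaches_opp (FT s).
have L1p : 0 < L1 by apply: lt_le_trans L10.
exists (Num.min d1 (d2 / L1)), (Num.max L1 L2); split.
- by rewrite lt_min d10 divr_gt0.
- by rewrite le_max L10.
move=> y s; rewrite lt_min => /andP[y1 y2] sT; have Hs := H1 s y sT y1.
have Lm1 : L1 <= Num.max L1 L2 by rewrite le_max lexx.
have Lm2 : L2 <= Num.max L1 L2 by rewrite le_max lexx orbT.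
have x1 : `|x - x| < d1 by rewrite subrr normr0.
split=> // v.
  have gap : 0 < d1 - `|y - x| by rewrite subr_gt0.
  apply: le_trans (ler_wpM2r (normr_ge0 v) Lm1).
  apply: (lip_jac gap (flow_diff Hs)) => w wd; have := H2 s (y + w) y sT.
  rewrite [y + w]addrC addrK; apply=> //.
  rewrite -addrA; apply: le_lt_trans (ler_normD _ _) _; qlra.
have near2 : `|flow X s y - flow X s x| < d2.
  apply: le_lt_trans (H2 s y x sT y1 x1) _.
  by rewrite mulrC -ltr_pdivlMr.
have gap : 0 < d2 - `|flow X s y - flow X s x| by rewrite subr_gt0.
apply: le_trans (ler_wpM2r (normr_ge0 v) Lm2).
apply: (lip_jac gap (flow_diff (reaches_opp Hs))) => w wd.
have := H4 s (flow X s y + w) (flow X s y) sT.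
rewrite [flow X s y + w]addrC addrK; apply=> //.
by rewrite -addrA; apply: le_lt_trans (ler_normD _ _) _; qlra.
Qed.

Lemma jac_ret_trans x T k n s y : reaches X x T (translate k x) -> reaches X x s y ->
  jac (flow X (n%:R * T + s)) x = jac (flow X T) x ^+ n *m jac (flow X s) x.
Proof.
move=> H Hs; have Hn := ret_nat n H; have H2 := reaches_translate (k *+ n) Hs.
by rewrite (jac_flow_trans Hn H2) (jac_ret_pow n H) (jac_flow_translate _ Hs).
Qed.

Lemma exp_of_power (q T t : R) n : 0 < q < 1 -> 0 < T -> t / T - 1 <= n%:R ->
  q ^+ n <= q^-1 * expR (ln q / T * t).
Proof.
move=> /andP[q0 q1] T0 h; have E : q = expR (ln q) by rewrite lnK ?posrE.
have l0 : ln q < 0 by apply: ln_lt0; rewrite q0.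
rewrite {1 2}E -expRM_natl -expRN -expRD ler_expR.
have : n%:R * ln q <= (t / T - 1) * ln q by rewrite ler_nM2r.
move=> h1; apply: (le_trans h1); rewrite le_eqVlt; apply/orP; left; apply/eqP; ring.
Qed.

Lemma period_count (T t : R) : 0 < T -> exists (n : nat) (s : R),
  0 <= s < T /\ (t = n%:R * T + s \/ [/\ t < 0, t = n%:R * - T + s & n%:R <= 1 - t / T]).
Proof.
move=> T0; have /andP[m1 m2] := floor_itv (t / T).
pose m := Num.floor (t / T); rewrite -/m in m1 m2; pose s := t - m%:~R * T.
have s0 : 0 <= s by rewrite subr_ge0 -ler_pdivlMr.
have s1 : s < T.
  by rewrite ltrBlDr -[X in X + _]mul1r -mulrDl -ltr_pdivrMr // addrC -[X in _ + X]/(1%:~R) -intrD.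
have tE : t = m%:~R * T + s by rewrite addrC subrK.
clearbody s; case: m m1 m2 tE => n m1 m2 tE; first by exists n, s; split; [rewrite s0|left].
exists n.+1, s; split; first by rewrite s0.
have nE : (Negz n)%:~R = - n.+1%:R :> R by rewrite NegzE rmorphN.
rewrite nE in m1 m2 tE; right; split; last 1 first.
- qlra.
- rewrite -(pmulr_llt0 _ (_ : 0 < T^-1)) ?invr_gt0 //; apply: lt_le_trans m2 _.
  by rewrite intrD nE -natr1 opprD subrK oppr_le0.
by rewrite mulrN -mulNr.
Qed.

(** Estimates are available at one point y of each orbit, close to a fixed x. A vector at another
    point z is transported back to y over a time s of at most one period, and the splitting is
    respected. *)
Lemma orbit_transfer mu D y z T : stable_orbit X mu D -> D y -> D z -> ret_time X y T ->
  exists2 s, 0 <= s <= T & forall v : 'rV[R]_N, let v' := v *m jac (flow X (- s)) (flow X s y) in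
  [/\ forall t, v *m jac (flow X t) z = v' *m jac (flow X (s + t)) y,
    v *m normal_proj X z = v -> v' *m normal_proj X y = v' &
    v *m unip (jac (flow X (period X z)) z) = 0 -> v' *m unip (jac (flow X T) y) = 0].
Proof.
move=> S Dy Dz RT; have [PO _ _] := S; have [T2 _ DE] := periodic_orbitP PO Dy.
have [T0 [k Hy] _] := RT; have Oz : orbit X y z by rewrite -DE.
have [s [l [sT ->]]] := orbit_phase T0 Hy Oz.
have Hs := ret_time_total RT s; have Cw := orbit_flow_stable S Dy Hs.
have RTw := ret_time_flow RT Hs; have Hb := reaches_opp Hs.
exists s; first exact: sT.
move=> v v'; split=> [t|Ev|].
- have Ht := ret_time_total RTw t; rewrite (jac_flow_translate l Ht) (jac_flow_trans Hs Ht).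
  rewrite /v' -[RHS]mulmxA [X in _ = v *m X]mulmxA.
  by have := jac_flow_unit Hb; rewrite opprK => ->; rewrite mul1mx.
- rewrite /v' -mulmxA -(normal_proj_flow S Cw Hb) mulmxA; congr (_ *m _).
  by rewrite -{2}Ev (normal_proj_translate l RTw).
rewrite (periodE (ret_time_translate l RTw)) (jac_flow_translate l (ret_time_total RTw T)) => Ev.
by rewrite /v' -mulmxA -(unip_flow S Cw RTw Hb) mulmxA Ev mul0mx.
Qed.

(** Whole periods contract by [spectral_proj_decay]. The exponent is written with an upper bound T1
    of the period, so that neighbouring orbits share it. *)
Lemma forward_rate y T T1 K q L ct t (v : 'rV[R]_N) : ret_time X y T -> T <= T1 ->
  proj_tail K q 0 = ct -> 0 <= K -> 0 < q < 1 -> 0 <= L ->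
  (forall m (u : 'rV[R]_N),
    `|u *m (jac (flow X T) y ^+ m * unip (jac (flow X T) y))| <= K * q ^+ m * `|u|) ->
  (forall s (u : 'rV[R]_N), 0 <= s <= T -> `|u *m jac (flow X s) y| <= L * `|u|) ->
  0 <= t -> v *m normal_proj X y = v ->
  `|v *m jac (flow X t) y| <= L * (ct / q) * expR (ln q / T1 * (t - T)) * `|v|.
Proof.
move=> RT TT1 Ect K0 q01 L0 HD HL t0 Ev; have [T0 [k Hy] _] := RT.
have N0 : (0 < N)%N by apply: leq_trans HN.
have ct0 := proj_tail_ge0 K0 q01 0%N; rewrite Ect in ct0.
have T10 : 0 < T1 by apply: lt_le_trans TT1.
have [n [rho [rT tE]]] := period_count t T0.
case: tE => [tE|[/lt_geF]]; last by rewrite t0.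
have [r0 r1] := andP rT; have [q0 _] := andP q01.
rewrite {1}tE (jac_ret_trans n Hy (ret_time_total RT rho)) mulmxA.
rewrite /normal_proj (periodE RT) in Ev.
have h1 := spectral_proj_decay N0 K0 q01 HD n Ev; rewrite Ect in h1.
have rT' : 0 <= rho <= T by rewrite r0 ltW.
apply: le_trans (HL rho _ rT') _.
have h2 : q ^+ n <= q^-1 * expR (ln q / T1 * (t - T)).
  apply: (exp_of_power q01 T10); rewrite lerBlDr ler_pdivrMr // lerBlDr.
  apply: le_trans (_ : n%:R * T1 + rho <= _).
    by rewrite tE lerD2r; apply: ler_wpM2l.
  rewrite mulrDl mul1r -addrA lerD2l; apply: le_trans (ltW r1) _.
  by rewrite lerDr ltW.
apply: le_trans (_ : L * (ct * (q^-1 * expR (ln q / T1 * (t - T))) * `|v|) <= _).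
  apply: ler_wpM2l => //; apply: le_trans h1 _.
  by apply: ler_wpM2r => //; apply: ler_wpM2l.
by rewrite le_eqVlt; apply/orP; left; apply/eqP; ring.
Qed.

(** Whole backward periods act by [unip_back], so the growth is linear in their number. *)
Lemma backward_rate y T L t (v : 'rV[R]_N) : ret_time X y T -> 1 <= L ->
  (forall s (u : 'rV[R]_N), 0 <= s <= T -> `|u *m jac (flow X s) y| <= L * `|u|) ->
  t <= T -> v *m unip (jac (flow X T) y) = 0 ->
  `|v *m jac (flow X t) y| <= L * (1 + (L + 1) * (2 - t / T)) * `|v|.
Proof.
move=> RT L1 HL tT Ev; have [T0 [k Hy] _] := RT; have FT := ret_time_total RT.
have L0 : 0 <= L by apply: le_trans L1.
have c0 : 0 <= L + 1 by apply: addr_ge0.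
have tT1 : t / T <= 1 by rewrite ler_pdivrMr // mul1r.
have b0 : 0 <= 2 - t / T by qlra.
have p0 : 0 <= (L + 1) * (2 - t / T) by apply: mulr_ge0.
have [t0|t0] := leP 0 t.
  have tT' : 0 <= t <= T by rewrite t0.
  apply: le_trans (HL t v tT') _; rewrite -mulrA; apply: ler_wpM2l => //.
  by apply: ler_peMl => //; rewrite lerDl.
have [n [rho [rT tE]]] := period_count t T0; have [r0 r1] := andP rT.
have rT' : 0 <= rho <= T by rewrite r0 ltW.
have AB : jac (flow X T) y *m jac (flow X (- T)) y = 1%:M.
  by have := jac_flow_unit Hy; rewrite (jac_flow_translate k (FT (- T))).
case: tE => [tE|[_ tE nle]].
  by have := t0; rewrite tE ltNge addr_ge0 // mulr_ge0 // ltW.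
rewrite {1}tE (jac_ret_trans n (ret_opp Hy) (FT rho)) mulmxA.
apply: le_trans (HL rho _ rT') _; rewrite -mulrA; apply: ler_wpM2l => //.
rewrite (unip_back n AB Ev); apply: le_trans (ler_normB _ _) _.
rewrite normrZ ger0_norm // mulmxBr mulmx1.
have TT : 0 <= T <= T by rewrite lexx ltW.
have h1 : `|v *m jac (flow X T) y - v| <= (L + 1) * `|v|.
  by apply: le_trans (ler_normB _ _) _; rewrite mulrDl mul1r lerD2r; apply: HL.
apply: le_trans (lerD (lexx _) (ler_wpM2l (ler0n _ n) h1)) _.
rewrite mulrA -[X in X + _]mul1r -mulrDl; apply: ler_wpM2r => //; rewrite lerD2l mulrC.
by apply: ler_wpM2l => //; apply: le_trans nle _; rewrite lerD2r; qlra.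
Qed.

Lemma local_rates W C lam : open W -> stable_family X W C -> W lam ->
  exists d a L : R, [/\ 0 < d, a < 0, 0 < L & forall mu z, `|mu - lam| < d -> C mu z ->
    (forall t (v : 'rV[R]_N), 0 <= t -> v *m normal_proj X z = v ->
      `|v *m jac (flow X t) z| <= L * expR (a * t) * `|v|) /\
    (forall t (v : 'rV[R]_N), t <= 0 -> v *m unip (jac (flow X (period X z)) z) = 0 ->
      `|v *m jac (flow X t) z| <= L * (1 - t) * `|v|)].
Proof.
move=> oW F Wl; have [S c] := F lam Wl; have [PO _ _] := S; have [x Cx] := orbit_nonempty PO.
have [T [k [i [K0 [q0 [[T0 H HC] RT _ _]]]]]] := hyperbolic_point S Cx.
have [d1 [K [q [d10 K1 q1 HD]]]] := family_local_decay H HC.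
have T1 : 0 < T + 1 by qlra.
have lohi (u : R) : `|u - T| < 1 -> `|u - T| < T / 2 -> T / 2 < u /\ u <= T + 1.
  by rewrite !ltr_norml => /andP[_ a1] /andP[a2 _]; split; qlra.
have [d2 [L [d20 L1 HL]]] := local_jac_bounds (ret_time_total RT) (ltW T1).
pose e : R := Num.min (Num.min d1 d2) (Num.min 1 (T / 2)).
have e0 : 0 < e by rewrite !lt_min d10 d20 ltr01 divr_gt0.
have [d3 d30 H3] := c x T e Cx RT e0.
have [d4 d40 H4] := eps_near (open_nbhs_nbhs (conj oW Wl)).
have [q0' q1'] := andP q1; have L0 : 0 < L by apply: lt_le_trans L1.
have lq : ln q < 0 by apply: ln_lt0; rewrite q0'.
have [ct ctE] : exists ct, proj_tail K q 0 = ct by eexists.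
have ct0 := proj_tail_ge0 K1 q1 0%N; rewrite ctE in ct0.
(* The constant of [forward_rate], with a loss of at most T + 1 in time for the initial phase and
   the incomplete period, and a factor L for the transport to y; [cb] is its backward analogue. *)
have [cf [cf0 cfE]] : exists cf : R, 0 <= cf /\
    cf = L * (ct / q) * expR (ln q / (T + 1) * - (T + 1)) * L.
  eexists; split; last by []; apply: mulr_ge0; last exact: ltW.
  apply: mulr_ge0; last exact: expR_ge0.
  by apply: mulr_ge0; [exact: ltW|rewrite divr_ge0 // ltW].
have [cb [cb0 cbE]] : exists cb : R, 0 < cb /\ cb = L * (1 + (L + 1) * (2 + 2 / T)) * L.
  eexists; split; last by []; apply: mulr_gt0 => //; apply: mulr_gt0 => //.
  by rewrite addr_gt0 // mulr_gt0 // addr_gt0 // divr_gt0.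
exists (Num.min d3 d4), (ln q / (T + 1)), (cf + cb).
split; [by rewrite lt_min d30|by rewrite pmulr_llt0 // invr_gt0|exact: ltr_wpDl|].
move=> mu z; rewrite lt_min => /andP[m3 m4] Cz; have [y [T' [Cy yx RT' TT]]] := H3 mu m3.
have [Sm _] := F mu (H4 mu m4); have [T'0 [l' Hy] _] := RT'.
move: yx TT; rewrite /e !lt_min => /andP[/andP[y1 y2] _] /andP[/andP[t1 _] /andP[t3 t4]].
have [Tlo Thi] := lohi T' t3 t4.
have Dy := HD y T' l' y1 t1 Hy.
have sub s : 0 <= s <= T' -> 0 <= s <= T + 1.
  by move=> /andP[-> s1]; exact: le_trans Thi.
have HL1 s (u : 'rV[R]_N) : 0 <= s <= T' -> `|u *m jac (flow X s) y| <= L * `|u|.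
  by move=> /sub sT; have [_ h _] := HL y s y2 sT.
have [s sT Ht] := orbit_transfer Sm Cy Cz RT'; have [s0 s1] := andP sT.
have HL2 (u : 'rV[R]_N) : `|u *m jac (flow X (- s)) (flow X s y)| <= L * `|u|.
  by have [_ _ h] := HL y s y2 (sub s sT).
clear oW F Wl S c PO Cx H HC RT HD HL e e0 H3 H4 lohi d10 d20 d30 d40 m3 m4 Cz Cy Sm Hy y1 y2 t1 t3 t4 sub sT.
split=> t v t0 Ev; have [E0 E1 E2] := Ht v; rewrite E0.
  have st : 0 <= s + t by apply: addr_ge0.
  have := forward_rate RT' Thi ctE K1 q1 (ltW L0) Dy HL1 st (E1 Ev) => h; apply: le_trans h _.
  have c0 : 0 <= L * (ct / q).
    by apply: mulr_ge0; [exact: ltW|rewrite divr_ge0 // ltW].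
  apply: le_trans (_ : cf * expR (ln q / (T + 1) * t) * `|v| <= _); last first.
    apply: ler_wpM2r => //; apply: ler_wpM2r; first exact: expR_ge0.
    by rewrite lerDl ltW.
  have -> : cf * expR (ln q / (T + 1) * t) * `|v| =
    L * (ct / q) * expR (ln q / (T + 1) * (t - (T + 1))) * (L * `|v|).
    by rewrite cfE mulrBr expRD -mulrN; ring.
  apply: ler_pM => //; first by apply: mulr_ge0 => //; apply: expR_ge0.
  apply: ler_wpM2l => //; rewrite ler_expR; apply: ler_wnM2l; first by rewrite ltW // pmulr_llt0 // invr_gt0.
  qlra.
have st : s + t <= T' by qlra.
have := backward_rate RT' L1 HL1 st (E2 Ev) => h; apply: le_trans h _.
apply: le_trans (_ : cb * (1 - t) * `|v| <= _); last first.
  apply: ler_wpM2r => //; apply: ler_wpM2r; first by qlra.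
  by rewrite lerDr.
have -> : cb * (1 - t) * `|v| = L * (1 + (L + 1) * (2 + 2 / T)) * (1 - t) * (L * `|v|).
  by rewrite cbE; ring.
have g0 : 0 <= 2 / T by rewrite divr_ge0 // ltW.
have h1 : - ((s + t) / T') <= 2 / T * - t.
  rewrite -mulNr ler_pdivrMr //; apply: le_trans (_ : - t <= _); first by qlra.
  rewrite mulrAC ler_peMl //; first by qlra.
  by rewrite mulrAC ler_pdivlMr // mul1r; qlra.
have h2 : 2 - (s + t) / T' <= (2 + 2 / T) * (1 - t).
  have g1 : 0 <= 2 / T * - t by rewrite mulr_ge0 //; qlra.
  by set g := 2 / T in h1 g0 g1 *; rewrite mulrDl !mulrBr !mulr1; qlra.
have L2 : 0 <= L + 1 by qlra.
have h3 : (L + 1) * (2 - (s + t) / T') <= (L + 1) * (2 + 2 / T) * (1 - t).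
  by rewrite -mulrA; apply: ler_wpM2l.
have b0 : 0 <= 2 - (s + t) / T'.
  have : (s + t) / T' <= 1 by rewrite ler_pdivrMr // mul1r.
  by qlra.
apply: ler_pM => //.
  apply: mulr_ge0; first exact: ltW.
  by apply: addr_ge0 => //; apply: mulr_ge0.
rewrite -mulrA; apply: ler_wpM2l; first exact: ltW.
rewrite [leRHS]mulrDl mul1r; apply: lerD h3; qlra.
Qed.

(** * Attracting families and their gluing *)

(** The backward bound is kept linear: it is then stable under gluing, and the tangential exponent
    is chosen only at the end, depending on a and on the smoothness class. *)
Definition rates_on (W : set 'rV[R]_(N - 3)) (C : 'rV[R]_(N - 3) -> set 'rV[R]_N) (a L : R) : Prop :=
  forall mu z, W mu -> C mu z ->
    (forall t (v : 'rV[R]_N), 0 <= t -> v *m normal_proj X z = v ->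
      `|v *m jac (flow X t) z| <= L * expR (a * t) * `|v|) /\
    (forall t (v : 'rV[R]_N), t <= 0 -> v *m unip (jac (flow X (period X z)) z) = 0 ->
      `|v *m jac (flow X t) z| <= L * (1 - t) * `|v|).

Definition attracting_family (W : set 'rV[R]_(N - 3)) (C : 'rV[R]_(N - 3) -> set 'rV[R]_N) : Prop :=
  [/\ open W, W `<=` @V_set R N, stable_family X W C &
    exists a L : R, [/\ a < 0, 0 < L & rates_on W C a L]].

Lemma linear_le_exp (b t : R) : b < 0 -> t <= 0 -> 1 - t <= (1 - b^-1) * expR (b * t).
Proof.
move=> b0 t0; have u0 : 0 <= b * t by rewrite mulr_le0 // ltW.
have bV : b^-1 < 0 by rewrite invr_lt0.
apply: le_trans (_ : (1 - b^-1) * (1 + b * t) <= _); last first.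
  by apply: ler_wpM2l (expR_ge1Dx _); qlra.
have -> : (1 - b^-1) * (1 + b * t) = 1 + b * t - b^-1 - b^-1 * b * t by ring.
by rewrite mulVf ?lt_eqF // mul1r; qlra.
Qed.

Lemma family_manifold r W C : attracting_family W C ->
  normally_attracting r.+1 (N - 2) X (orbit_union W C).
Proof.
move=> [oW WV F [a [L [a0 L0 HR]]]].
have inM x : orbit_union W C x -> ordered x.
  by move=> [lam Wl Cx]; have [[_ CL _] _] := F lam Wl; case: (CL x Cx).
split.
- split=> // x y [k ->] Mx; exact: family_translate F Mx.
- move=> x [lam Wl Cx]; have [S _] := F lam Wl.
  have [T [k [i [K [q [i3 [Hyp RT DE Lx]]]]]]] := hyperbolic_head S Cx.
  have [d [Pm [tau G]]] := graph_map_exists r.+1 Hyp.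
  have [U [psi [Ux CH _]]] := graph_chart oW F Wl Cx Hyp i3 RT G.
  by exists false, U, psi.
- move=> t; split=> [x Mx|]; first by exists (flow X t x); exact: family_total F Mx t.
  apply/seteqP; split=> [_ [x Mx <-]|x Mx].
    exact: family_flow F Mx (family_total F Mx t).
  have H := family_total F Mx (- t); exists (flow X (- t) x); first exact: family_flow F Mx H.
  by have := reaches_opp H; rewrite opprK => /flowE.
exists (normal_proj X); split; first exact: family_splitting oW F.
(* This b satisfies a < (r + 1) b = a / 2 < 0, and b < 0 lets e^(b t) dominate the linear growth in
   backward time. *)
have b0 : a / (2 * r.+1%:R) < 0 by rewrite pmulr_llt0 // invr_gt0 mulr_gt0.
have [b [bE {}b0]] : exists b, b = a / (2 * r.+1%:R) /\ b < 0 by eexists; split; [reflexivity|].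
have rb : r.+1%:R * b = a / 2.
  have rn : r.+1%:R != 0 :> R by rewrite pnatr_eq0.
  by rewrite bE; field.
have c0 : 1 <= 1 - b^-1 by rewrite lerDl oppr_ge0 invr_le0 ltW.
exists a, b, (L * (1 - b^-1)); split; [by rewrite rb; qlra|by rewrite rb; qlra| | |].
- by rewrite mulr_gt0 // (lt_le_trans ltr01).
- move=> t x v t0 [lam Wl Cx] /(family_tangent r v oW F Wl Cx) Tv.
  have Mx : orbit_union W C x by exists lam.
  rewrite (lin_flowE v (family_total F Mx t)); have [_ H] := HR lam x Wl Cx.
  apply: le_trans (H t v t0 Tv) _; apply: ler_wpM2r => //; rewrite -mulrA.
  by apply: ler_wpM2l; [exact: ltW|exact: linear_le_exp].
move=> t x v t0 Mx Ev; have [lam Wl Cx] := Mx.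
rewrite (lin_flowE v (family_total F Mx t)); have [H _] := HR lam x Wl Cx.
apply: le_trans (H t v t0 Ev) _; apply: ler_wpM2r => //; apply: ler_wpM2r; first exact: expR_ge0.
by apply: ler_peMr => //; exact: ltW.
Qed.

Lemma continuous_orbits_near C1 C2 lam (d : R) : 0 < d ->
  (forall mu, `|mu - lam| < d -> C1 mu = C2 mu) ->
  continuous_orbits X C1 lam -> continuous_orbits X C2 lam.
Proof.
move=> d0 E c x T e Cx RT e0; have [|d1 d10 H1] := c x T e _ RT e0.
  by rewrite E // subrr normr0.
exists (Num.min d d1); first by rewrite lt_min d0.
move=> mu; rewrite lt_min => /andP[m0 /H1[y [T' [Cy yx RT' TT]]]].
by exists y, T'; split=> //; rewrite -E.
Qed.

Lemma attracting_glue W1 C1 W2 C2 : attracting_family W1 C1 -> attracting_family W2 C2 ->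
  (forall mu, W1 mu -> W2 mu -> C1 mu = C2 mu) ->
  exists C, [/\ attracting_family (W1 `|` W2) C, forall mu, W1 mu -> C mu = C1 mu &
    forall mu, W2 mu -> C mu = C2 mu].
Proof.
move=> [oW1 V1 F1 [a1 [L1 [a10 L10 R1]]]] [oW2 V2 F2 [a2 [L2 [a20 L20 R2]]]] E.
pose C mu := if pselect (W1 mu) then C1 mu else C2 mu.
have E1 mu : W1 mu -> C mu = C1 mu by rewrite /C; case: pselect.
have E2 mu : W2 mu -> C mu = C2 mu by rewrite /C; case: pselect => // h1 h2; exact: E.
exists C; split=> //; split; first exact: openU.
- by move=> mu [/V1|/V2].
- move=> mu [Wm|Wm].
    have [S c] := F1 mu Wm; rewrite E1 //; split=> //.
    have [d d0 Hd] := eps_near (open_nbhs_nbhs (conj oW1 Wm)).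
    by apply: (continuous_orbits_near d0) c => nu /Hd/E1.
  have [S c] := F2 mu Wm; rewrite E2 //; split=> //.
  have [d d0 Hd] := eps_near (open_nbhs_nbhs (conj oW2 Wm)).
  by apply: (continuous_orbits_near d0) c => nu /Hd/E2.
exists (Num.max a1 a2), (Num.max L1 L2); split; [by rewrite gt_max a10|by rewrite lt_max L10|].
have am1 : a1 <= Num.max a1 a2 by rewrite le_max lexx.
have am2 : a2 <= Num.max a1 a2 by rewrite le_max lexx orbT.
have Lm1 : L1 <= Num.max L1 L2 by rewrite le_max lexx.
have Lm2 : L2 <= Num.max L1 L2 by rewrite le_max lexx orbT.
move: (Num.max a1 a2) (Num.max L1 L2) am1 am2 Lm1 Lm2 => a L am1 am2 Lm1 Lm2.
have up (a' L' t : R) (v : 'rV[R]_N) : 0 <= L' -> a' <= a -> L' <= L -> 0 <= t ->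
    L' * expR (a' * t) * `|v| <= L * expR (a * t) * `|v|.
  move=> L'0 aa LL t0; apply: ler_wpM2r => //; apply: ler_pM => //.
  by rewrite ler_expR; apply: ler_wpM2r.
have up' (L' t : R) (v : 'rV[R]_N) : L' <= L -> t <= 0 ->
    L' * (1 - t) * `|v| <= L * (1 - t) * `|v|.
  by move=> LL t0; apply: ler_wpM2r => //; apply: ler_wpM2r => //; qlra.
move=> mu z [Wm|Wm].
  rewrite (E1 mu Wm) => /(R1 mu z Wm)[h1 h2]; split=> t v t0 Ev.
    by apply: le_trans (h1 t v t0 Ev) _; apply: up => //; exact: ltW.
  by apply: le_trans (h2 t v t0 Ev) _; exact: up'.
rewrite (E2 mu Wm) => /(R2 mu z Wm)[h1 h2]; split=> t v t0 Ev.
  by apply: le_trans (h1 t v t0 Ev) _; apply: up => //; exact: ltW.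
by apply: le_trans (h2 t v t0 Ev) _; exact: up'.
Qed.

Lemma open_V_set : open (@V_set R N).
Proof.
apply: open_eps => lam [H1 H2].
pose P (kl : 'I_(N - 3) * 'I_(N - 3)) :=
  Num.min (Num.min (lam 0 kl.1) (1 - lam 0 kl.1)) (if (kl.1 < kl.2)%N then lam 0 kl.1 - lam 0 kl.2 else 1).
have [kl|d d0 Hd] := @positive_margin R _ P.
  have /andP[a1 a2] := H1 kl.1; rewrite /P !lt_min a1 subr_gt0 a2 /=.
  by case: ifP => // /H2; rewrite subr_gt0.
exists (d / 2); first exact: divr_gt0.
move=> mu md; have Hc k : `|mu 0 k - lam 0 k| < d / 2.
  by rewrite -sub_mxE; apply: le_lt_trans md; exact: mx_entry_le.
split=> [k|k l kl].
  have := Hd (k, k); rewrite /P !le_min /= => /andP[/andP[a1 a2] _].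
  have := Hc k; rewrite ltr_norml => /andP[b1 b2]; apply/andP; split; qlra.
have := Hd (k, l); rewrite /P /= kl le_min => /andP[_ a].
have := Hc k; have := Hc l; rewrite !ltr_norml => /andP[b1 b2] /andP[b3 b4]; qlra.
Qed.

Lemma local_piece lam D (r0 : R) : stable_orbit X lam D -> @V_set R N lam -> 0 < r0 ->
  exists (d : R) (C : 'rV[R]_(N - 3) -> set 'rV[R]_N), [/\ 0 < d, d <= r0, C lam = D &
    attracting_family [set mu | `|mu - lam| < d] C].
Proof.
move=> S Vl r00; have [d1 d10 [C [CD F]]] := local_family S.
have ob d : open [set mu : 'rV[R]_(N - 3) | `|mu - lam| < d] by exact: open_dist.
have Bl : [set mu : 'rV[R]_(N - 3) | `|mu - lam| < d1] lam by rewrite /= subrr normr0.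
have [d2 [a [L [d20 a0 L0 HR]]]] := local_rates (ob d1) F Bl.
have [d3 d30 H3] := eps_near (open_nbhs_nbhs (conj open_V_set Vl)).
exists (Num.min (Num.min d1 d2) (Num.min d3 r0)), C; split=> //.
- by rewrite !lt_min d10 d20 d30.
- by rewrite !ge_min lexx !orbT.
split=> //.
- by move=> mu; rewrite /mkset !lt_min => /andP[_ /andP[/H3]].
- by move=> mu; rewrite /mkset !lt_min => /andP[/andP[m1 _] _]; exact: F.
exists a, L; split=> // mu z; rewrite /mkset !lt_min => /andP[/andP[_ m2] _] Cz.
by have [h1 h2] := HR mu z m2 Cz; split.
Qed.

(** * The closed ball and extensions of the given manifold *)

Lemma closed_nbhdE (delta : R) : 0 <= delta ->
  closed_nbhd_star delta = [set lam : 'rV[R]_(N - 3) |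
    \sum_k (lam 0 k - lambda_star R N 0 k) ^+ 2 <= delta ^+ 2].
Proof.
move=> d0; apply/seteqP; split=> lam; rewrite /closed_nbhd_star /=.
  rewrite -(ler_pXn2r (isT : (0 < 2)%N)) ?nnegrE ?sqrtr_ge0 // sqr_sqrtr //.
  by apply: sumr_ge0 => k _; exact: sqr_ge0.
by move=> /(ler_wsqrtr); rewrite sqrtr_sqr ger0_norm.
Qed.

Lemma closed_nbhd_convex (delta : R) (p q : 'rV[R]_(N - 3)) (s : R) : 0 <= delta ->
  closed_nbhd_star delta p -> closed_nbhd_star delta q -> 0 <= s <= 1 ->
  closed_nbhd_star delta (p + s *: (q - p)).
Proof.
move=> d0; rewrite closed_nbhdE //= => Hp Hq /andP[s0 s1].
apply: (@le_trans _ _ (\sum_k ((1 - s) * (p 0 k - lambda_star R N 0 k) ^+ 2 +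
    s * (q 0 k - lambda_star R N 0 k) ^+ 2))).
  apply: ler_sum => k _; have -> : (p + s *: (q - p)) 0 k = p 0 k + s * (q 0 k - p 0 k) by rewrite !mxE.
  move: (p 0 k) (q 0 k) (lambda_star R N 0 k) => a b c.
  rewrite -subr_ge0 (_ : _ - _ = s * (1 - s) * (a - b) ^+ 2); last by ring.
  by rewrite mulr_ge0 ?sqr_ge0 // mulr_ge0 // subr_ge0.
rewrite big_split /= -!mulr_sumr.
have s1' : 0 <= 1 - s by rewrite subr_ge0.
have := lerD (ler_wpM2l s1' Hp) (ler_wpM2l s0 Hq).
by rewrite -mulrDl subrK mul1r.
Qed.

Lemma closed_nbhd_closed (delta : R) : 0 <= delta -> closed (@closed_nbhd_star R N delta).
Proof.
move=> d0; rewrite closed_nbhdE //; pose F (lam : 'rV[R]_(N - 3)) : R^o := \sum_k (lam 0 k - lambda_star R N 0 k) ^+ 2.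
have oT := @openT 'rV[R]_(N - 3).
have CF : Ck_on 0 [set: 'rV[R]_(N - 3)] F.
  apply: (Ck_on_sum oT) => k; have C : Ck_on 0 [set: 'rV[R]_(N - 3)] (fun lam : 'rV[R]_(N - 3) => lam 0 k - lambda_star R N 0 k : R^o).
    apply: (Ck_on_add oT); last exact: Ck_on_cst.
    exact: (Ck_on_coord 0 (fun z : 'rV[R]_(N - 3) => z) oT).1 (Ck_on_id _ _) k.
  exact: (Ck_on_mul oT C C).
have cF : continuous F by move=> lam; exact: (Ck_on_cont CF).
suff : closed (F @^-1` [set x : R^o | x <= delta ^+ 2]) by [].
apply: preimage_closed; first by move=> lam _; exact: cF.
exact: closed_le.
Qed.

Lemma closed_nbhd_compact (delta : R) : 0 <= delta -> compact (@closed_nbhd_star R N delta).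
Proof.
move=> d0; apply: bounded_closed_compact; last exact: closed_nbhd_closed.
exists (`|lambda_star R N| + delta); split; first exact: num_real.
move=> M HM lam; rewrite closed_nbhdE //= => H; apply: le_trans (ltW HM).
apply: mx_norm_le => [|i k]; first exact: addr_ge0.
rewrite (ord1 i) -(subrK (lambda_star R N 0 k) (lam 0 k)) addrC.
apply: le_trans (ler_normD _ _) _; apply: lerD; first exact: mx_entry_le.
rewrite -(ler_pXn2r (isT : (0 < 2)%N)) ?nnegrE // real_normK ?num_real //.
apply: le_trans H; rewrite (bigD1 k) //= lerDl; apply: sumr_ge0 => l _; exact: sqr_ge0.
Qed.

Lemma ball_segment (p lam mu : 'rV[R]_(N - 3)) (d s : R) : `|lam - p| < d -> `|mu - p| < d ->
  0 <= s <= 1 -> `|lam + s *: (mu - lam) - p| < d.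
Proof.
move=> h1 h2 /andP[s0 s1].
have -> : lam + s *: (mu - lam) - p = (1 - s) *: (lam - p) + s *: (mu - p).
  by apply/rowP => k; rewrite !mxE; ring.
apply: le_lt_trans (ler_normD _ _) _; rewrite !normrZ (ger0_norm s0) ger0_norm ?subr_ge0 //.
have [->|s0'] := eqVneq s 0; first by rewrite subr0 mul1r mul0r addr0.
have s00 : 0 < s by rewrite lt_neqAle eq_sym s0'.
have : (1 - s) * `|lam - p| <= (1 - s) * d by rewrite ler_wpM2l ?subr_ge0 // ltW.
have : s * `|mu - p| < s * d by rewrite ltr_pM2l.
by move=> a b; apply: lt_le_trans (ler_ltD b a) _; rewrite -mulrDl subrK mul1r.
Qed.

(** When the balls around p and q meet, the point dividing the segment from p to q in the ratio d :
    e lies in both balls, and by convexity in the closed ball, where stable orbits are unique.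
    Agreement then spreads along segments inside the intersection. *)
Lemma pieces_agree (delta : R) C0 (p q mu : 'rV[R]_(N - 3)) (d e : R) C1 C2 : 0 <= delta ->
  (forall lam, closed_nbhd_star delta lam -> unique (stable_orbit X lam) (C0 lam)) ->
  closed_nbhd_star delta p -> closed_nbhd_star delta q -> 0 < d -> 0 < e ->
  stable_family X [set nu | `|nu - p| < d] C1 -> stable_family X [set nu | `|nu - q| < e] C2 ->
  `|mu - p| < d -> `|mu - q| < e -> C1 mu = C2 mu.
Proof.
move=> dl0 U Bp Bq d0 e0 F1 F2 mp mq.
have o1 : open [set nu : 'rV[R]_(N - 3) | `|nu - p| < d] by exact: open_dist.
have o2 : open [set nu : 'rV[R]_(N - 3) | `|nu - q| < e] by exact: open_dist.
have de : 0 < d + e by rewrite addr_gt0.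
have pq : `|p - q| < d + e.
  by rewrite -(subrKA mu); apply: le_lt_trans (ler_normD _ _) _; rewrite distrC ltrD.
pose s := d / (d + e); pose nu := p + s *: (q - p).
have s0 : 0 < s by rewrite divr_gt0.
have s1 : s <= 1 by rewrite ler_pdivrMr // mul1r lerDl ltW.
have Bnu : closed_nbhd_star delta nu by apply: closed_nbhd_convex; rewrite ?(ltW s0).
have np : `|nu - p| < d.
  rewrite /nu addrAC subrr add0r normrZ gtr0_norm // distrC.
  by rewrite /s mulrAC ltr_pdivrMr // ltr_pM2l.
have nq : `|nu - q| < e.
  have -> : nu - q = (1 - s) *: (p - q) by apply/rowP => k; rewrite !mxE; ring.
  have -> : 1 - s = e / (d + e) by rewrite /s -{1}(divff (lt0r_neq0 de)) -mulrBl addrAC subrr add0r.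
  rewrite normrZ gtr0_norm ?divr_gt0 //.
  by rewrite mulrAC ltr_pdivrMr // ltr_pM2l.
apply: (families_agree (lam := nu) o1 o2 F1 F2).
  by move=> t t01; split; apply: ball_segment.
have [_ Uq] := U nu Bnu; have [S1 _] := F1 nu np; have [S2 _] := F2 nu nq.
by rewrite -(Uq _ S1) -(Uq _ S2).
Qed.

Lemma attracting_empty : attracting_family set0 (fun _ => set0).
Proof.
split=> //.
by exists (-1), 1; split=> //; rewrite ltrN10.
Qed.

Lemma pieces_union (delta : R) C0 (rho : 'rV[R]_(N - 3) -> R)
    (Cp : 'rV[R]_(N - 3) -> 'rV[R]_(N - 3) -> set 'rV[R]_N) (s : seq 'rV[R]_(N - 3)) : 0 <= delta ->
  (forall lam, closed_nbhd_star delta lam -> unique (stable_orbit X lam) (C0 lam)) ->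
  (forall p, closed_nbhd_star delta p ->
    0 < rho p /\ attracting_family [set mu | `|mu - p| < rho p] (Cp p)) ->
  (forall p, p \in s -> closed_nbhd_star delta p) ->
  exists W C, [/\ attracting_family W C,
    forall p mu, p \in s -> `|mu - p| < rho p -> W mu /\ C mu = Cp p mu &
    forall mu, W mu -> exists2 p, p \in s & `|mu - p| < rho p].
Proof.
move=> dl0 U HP; elim: s => [|p s IH] Hs; first by exists set0, (fun=> set0); split=> //; exact: attracting_empty.
have [|W [C [A H1 H2]]] := IH; first by move=> q qs; apply: Hs; rewrite inE qs orbT.
have Bp : closed_nbhd_star delta p by apply: Hs; rewrite inE eqxx.
have [p0 Ap] := HP p Bp; have [_ _ Fp _] := Ap.
have [|C' [A' E1 E2]] := attracting_glue A Ap.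
  move=> mu Wm mp; have [q qs mq] := H2 mu Wm; have [_ ->] := H1 q mu qs mq.
  have Bq : closed_nbhd_star delta q by apply: Hs; rewrite inE qs orbT.
  have [q0 [_ _ Fq _]] := HP q Bq.
  exact: pieces_agree dl0 U Bq Bp q0 p0 Fq Fp mq mp.
exists (W `|` [set mu | `|mu - p| < rho p]), C'; split=> //.
  move=> q mu; rewrite inE => /orP[/eqP->|qs] mq; first by split; [right|exact: E2].
  by have [Wm Cm] := H1 q mu qs mq; split; [left|rewrite E1].
move=> mu [/H2[q qs mq]|mp]; first by exists q => //; rewrite inE qs orbT.
by exists p => //; rewrite inE eqxx.
Qed.

Lemma extension_through r (delta : R) C0 lam1 D1 : 0 < delta ->
  closed_nbhd_star delta `<=` @V_set R N ->
  (forall lam, closed_nbhd_star delta lam -> unique (stable_orbit X lam) (C0 lam)) ->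
  @V_set R N lam1 -> stable_orbit X lam1 D1 ->
  exists W C, [/\ extension r.+1 X delta C0 W C, W lam1, C lam1 = D1 & stable_family X W C].
Proof.
move=> dl0 BV U V1 S1; have dl0' := ltW dl0; set B := closed_nbhd_star delta in BV U *.
(* Pieces of radius at most r0 around points of the closed ball do not meet a piece of radius at
   most r0 around lam1, so there is no agreement to check. *)
have [r0 [r00 Hr0]] : exists r0 : R, 0 < r0 /\ (B lam1 \/ forall p, B p -> 2 * r0 <= `|p - lam1|).
  have [B1|B1] := pselect (B lam1); first by exists 1; split=> //; left.
  have oB : open (~` B) by apply: closed_openC; exact: closed_nbhd_closed.
  have [d d0 Hd] := eps_near (open_nbhs_nbhs (conj oB B1)).
  exists (d / 2); split; [exact: divr_gt0|right=> p Bp].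
  by rewrite mulrCA divff // mulr1 leNgt; apply/negP => /Hd.
have HP p : exists dC : R * ('rV[R]_(N - 3) -> set 'rV[R]_N), B p ->
    [/\ 0 < dC.1, dC.1 <= r0 & attracting_family [set mu | `|mu - p| < dC.1] dC.2].
  have [Bp|nB] := pselect (B p); last by exists (0, fun=> set0).
  have [Sp _] := U p Bp; have [d [C [d0 dr CD A]]] := local_piece Sp (BV p Bp) r00.
  by exists (d, C).
have [F HF] := choice HP.
have cB : compact B by exact: closed_nbhd_compact.
rewrite compact_cover in cB.
have [|p Bp|s sB Bs] := cB _ B (fun p => [set mu : 'rV[R]_(N - 3) | `|mu - p| < (F p).1]).
- by move=> p _; exact: open_dist.
- by exists p => //=; rewrite subrr normr0; case: (HF p Bp).
have HP' p : B p -> 0 < (F p).1 /\ attracting_family [set mu | `|mu - p| < (F p).1] (F p).2.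
  by move=> /HF[].
have sB' p : p \in finmap.enum_fset s -> B p by move=> ps; have := sB p ps; rewrite inE.
have [W [C [A H1 H2]]] := pieces_union dl0' U HP' sB'.
have BW lam : B lam -> W lam.
  by move=> /Bs[p /= ps lp]; case: (H1 p lam ps lp).
have fin W' C' : attracting_family W' C' -> W `<=` W' -> (W' lam1) -> C' lam1 = D1 ->
    exists W C, [/\ extension r.+1 X delta C0 W C, W lam1, C lam1 = D1 & stable_family X W C].
  move=> A' WW' W1 C1; have [oW' WV' F' _] := A'; exists W', C'; split=> //; split=> //.
  - by move=> lam /BW/WW'.
  - by move=> lam Bl; have [_ Ul] := U lam Bl; have [Sl _] := F' lam (WW' _ (BW _ Bl)); rewrite (Ul _ Sl).
  - by move=> lam /F'[].
  exact: family_manifold.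
case: Hr0 => [B1|far].
  apply: (fin W C) => //; first exact: BW.
  have [_ Ul] := U lam1 B1; have [_ _ FW _] := A; have [Sl _] := FW _ (BW _ B1).
  by rewrite -(Ul _ Sl) -(Ul _ S1).
have [d [C1 [d0 dr CD A1]]] := local_piece S1 V1 r00.
have [|C' [A' E1 E2]] := attracting_glue A A1.
  move=> mu /H2[p ps mp] /= m1; have Bp := sB' p ps; have [_ pr _] := HF p Bp.
  have := far p Bp; rewrite leNgt => /negP[].
  rewrite -(subrKA mu); apply: le_lt_trans (ler_normD _ _) _; rewrite distrC mulr2n mulrDl mul1r.
  by apply: ltrD; [exact: lt_le_trans pr|exact: lt_le_trans dr].
have B1 : [set mu : 'rV[R]_(N - 3) | `|mu - lam1| < d] lam1 by rewrite /= subrr normr0.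
apply: (fin _ C' A'); [by left|by right|by rewrite E2].
Qed.

(** Any stable orbit over V lies in some continuous extension, hence in the maximal union. Cross
    ratios recover the parameter of a point, so the maximal family agrees with this extension
    wherever the latter is defined; this yields uniqueness over each level and continuity at
    once. *)
Lemma largest_family r (delta : R) C0 W C : 0 < delta ->
  closed_nbhd_star delta `<=` @V_set R N ->
  (forall lam, closed_nbhd_star delta lam -> unique (stable_orbit X lam) (C0 lam)) ->
  largest_extension r.+1 X delta C0 W C ->
  stable_family X W C /\ forall lam D, @V_set R N lam -> stable_orbit X lam D -> W lam /\ C lam = D.
Proof.
move=> d0 BV U [[[oW WV] BW EB SW NA] LW].
have key lam D : @V_set R N lam -> stable_orbit X lam D ->
    [/\ W lam, C lam = D & continuous_orbits X C lam].
  move=> Vl SD; have [W' [C' [E' Wl' Cl' F']]] := extension_through r d0 BV U Vl SD.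
  have [WW UU] := LW W' C' E'.
  have agree mu : W' mu -> C mu = C' mu.
    move=> Wm; have [S' _] := F' mu Wm; have [PO' CL' _] := S'.
    have [x Cx] := orbit_nonempty PO'; have [_ Lx] := CL' x Cx.
    have [|nu Wn Cnx] := UU x; first by exists mu.
    have [PO CL _] := SW nu Wn; have [_ Ln] := CL x Cnx.
    rewrite Lx in Ln; rewrite -Ln in PO Cnx.
    by have [_ _ ->] := periodic_orbitP PO Cnx; have [_ _ ->] := periodic_orbitP PO' Cx.
  split; [exact: WW|by rewrite agree|].
  have [[oW' _] _ _ _ _] := E'; have [d dpos Hd] := eps_near (open_nbhs_nbhs (conj oW' Wl')).
  by have [_ c] := F' lam Wl'; apply: (continuous_orbits_near dpos) c => mu /Hd/agree.
split=> [lam Wl|lam D Vl SD]; last by case: (key lam D Vl SD).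
have S := SW lam Wl; by have [_ _ c] := key lam _ (WV _ Wl) S; split.
Qed.

(** * Averages over the orbits *)

(** Holding one angle fixed makes the cross ratios alone parametrize the points of [family_points];
    local uniqueness puts these points on the orbits of the given family. *)
Lemma family_section m W C lam : open W -> stable_family X W C -> W lam ->
  exists (d : R) (p : 'rV[R]_(N - 3) -> 'rV[R]_N) (tau : 'rV[R]_(N - 3) -> R),
  [/\ 0 < d, Ck_on m [set mu | `|mu - lam| < d] p,
    Ck_on m [set mu | `|mu - lam| < d] (tau : _ -> R^o) &
    forall mu, `|mu - lam| < d -> [/\ W mu, C mu (p mu) & ret_time X (p mu) (tau mu)]].
Proof.
move=> oW F Wl; have [S c] := F lam Wl; have [PO _ _] := S; have [x Cx] := orbit_nonempty PO.
have [T [k [i [K [q [Hyp RT DE Lx]]]]]] := hyperbolic_point S Cx; have [T0 H HC] := Hyp.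
have [p [tau [d1 [d10 P U [Cp Ct]]]]] := family_points m H HC.
have [px tx] : p (section_chart i x) = x /\ tau (section_chart i x) = T.
  by apply: U H; rewrite subrr normr0.
pose z (mu : 'rV[R]_(N - 3)) : 'rV[R]_(1 + (N - 3)) := row_mx (x *m delta_mx i 0) mu.
have zx : z lam = section_chart i x by rewrite /z /section_chart Lx.
have zd mu : `|mu - lam| < d1 -> `|z mu - section_chart i x| < d1.
  move=> h; rewrite -zx (_ : z mu - z lam = row_mx 0 (mu - lam)); last first.
    by rewrite /z opp_row_mx add_row_mx subrr.
  by apply: le_lt_trans h; exact: row_mx0_norm.
have ob (d : R) : open [set mu : 'rV[R]_(N - 3) | `|mu - lam| < d] by exact: open_dist.
have oz := @open_dist R (1 + (N - 3)) (section_chart i x) d1.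
have Cz (d : R) : Ck_on m [set mu : 'rV[R]_(N - 3) | `|mu - lam| < d] z.
  by apply: (Ck_on_row_mx (ob d)); [exact: Ck_on_cst|exact: Ck_on_id].
have Cpz : Ck_on m [set mu | `|mu - lam| < d1] (fun mu => p (z mu)).
  exact: (Ck_on_comp (ob d1) oz zd (Cz d1) Cp).
have Ctz : Ck_on m [set mu | `|mu - lam| < d1] ((fun mu => tau (z mu)) : _ -> R^o).
  exact: (Ck_on_comp_real (ob d1) zd (Cz d1) Ct).
have Bl : [set mu : 'rV[R]_(N - 3) | `|mu - lam| < d1] lam by rewrite /= subrr normr0.
have [d2 d20 H2] := local_unique_orbit Hyp.
have [d3 d30 H3] := c x T d2 Cx RT d20.
have [d4 d40 H4] := eps_near (open_nbhs_nbhs (conj oW Wl)).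
have [d5 d50 H5] := (cont_eps _ _).1 (Ck_on_cont Cpz Bl) _ d20.
have [d6 d60 H6] := (cont_eps _ _).1 (Ck_on_cont Ctz Bl) _ d20.
rewrite zx px in H5; rewrite zx tx in H6.
pose d := Num.min d1 (Num.min (Num.min d3 d4) (Num.min d5 d6)).
have d0 : 0 < d by rewrite !lt_min d10 d30 d40 d50.
have dd1 mu : `|mu - lam| < d -> `|mu - lam| < d1 by rewrite lt_min => /andP[].
exists d, (fun mu => p (z mu)), (fun mu => tau (z mu)).
split; [exact: d0|by apply: Ck_on_sub Cpz => mu /dd1|by apply: Ck_on_sub Ctz => mu /dd1|].
move=> mu md; have [Hm Em] := P _ (zd mu (dd1 mu md)).
move: md; rewrite !lt_min => /andP[m1 /andP[/andP[/H3 m3 /H4 Wm] /andP[/H5 m5 /H6 m6]]].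
have [y [T' [Cy yx RT' TT]]] := m3; have [Sm _] := F mu Wm.
have [POm CLm _] := Sm; have [_ Ly] := CLm y Cy; have [_ [l Hy] _] := RT'.
have Lp : Lambda (p (z mu)) = mu.
  by move: Em; rewrite /section_chart {2}/z => /eq_row_mx[].
have [Oy Et] := H2 y (p (z mu)) T' (tau (z mu)) l k yx m5 TT m6 Hy Hm (etrans Ly (esym Lp)).
have [T2 _ DEm] := periodic_orbitP POm Cy.
by split=> //; [rewrite DEm|rewrite -Et; exact: orbit_ret RT' Oy].
Qed.

(** The integral as the final value of an antiderivative along the solution: this is what flows and
    uniqueness arguments produce. [integral_Rintegral] identifies it with the Lebesgue integral. *)
Definition integral_along m (H : 'rV[R]_N -> 'rV[R]_m) (x : 'rV[R]_N) (T : R) (I : 'rV[R]_m) : Prop :=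
  exists G : R -> 'rV[R]_m, [/\ G 0 = 0, G T = I &
    forall s, 0 <= s <= T -> is_derive (s : R^o) 1 (G : R^o -> _) (H (flow X s x))].

Lemma const_of_derive0 m (G : R -> 'rV[R]_m) (a b : R) : a <= b ->
  (forall s, a <= s <= b -> is_derive (s : R^o) 1 (G : R^o -> _) 0) -> G b = G a.
Proof.
move=> ab D; apply/eqP; rewrite -subr_eq0 -normr_le0 -(mul0r (b - a)).
by apply: (curve_mvt_le ab D) => // s _; rewrite normr0.
Qed.

Lemma integral_unique m (H : 'rV[R]_N -> 'rV[R]_m) x T I J : 0 <= T ->
  integral_along H x T I -> integral_along H x T J -> I = J.
Proof.
move=> T0 [G [G0 GT DG]] [K [K0 KT DK]]; apply/eqP; rewrite -subr_eq0 -GT -KT; apply/eqP.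
have Z : G 0 - K 0 = 0 by rewrite G0 K0 subrr.
rewrite -Z; apply: (const_of_derive0 (G := fun s => G s - K s) T0) => s sT.
by have := cderB (DG s sT) (DK s sT); rewrite subrr.
Qed.

Lemma path_cont m (H : 'rV[R]_N -> 'rV[R]_m) x : smooth_on [set x : 'rV[R]_N | ordered x] H ->
  flow_total X x -> continuous (fun t => H (flow X t x)).
Proof.
move=> sH FT t; have [ox _] := total_cder FT t.
apply: (@continuous_comp R^o _ _ (fun t => flow X t x) H); first exact: total_cont FT t.
exact: (Ck_on_cont (sH 0%N) ox).
Qed.

Lemma integral_exists m (H : 'rV[R]_N -> 'rV[R]_m) x (c : R) :
  smooth_on [set x : 'rV[R]_N | ordered x] H -> flow_total X x ->
  exists G : R -> 'rV[R]_m, G 0 = 0 /\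
    forall s, `|s| < c -> is_derive (s : R^o) 1 (G : R^o -> _) (H (flow X s x)).
Proof. by move=> sH FT; apply: antiderivative; exact: path_cont. Qed.

Lemma integral_orbit m (H : 'rV[R]_N -> 'rV[R]_m) x y T I :
  smooth_on [set x : 'rV[R]_N | ordered x] H -> (forall k x, H (translate k x) = H x) ->
  ret_time X x T -> orbit X x y -> integral_along H x T I -> integral_along H y T I.
Proof.
move=> sH tH RT Oxy IxT; have [T0 [k HT] _] := RT; have FT := ret_time_total RT.
have [s [l [/andP[s0 sT] ->]]] := orbit_phase T0 HT Oxy.
have [G [G0 DG]] := @integral_exists m H x (2 * T + 1) sH FT.
have DG' u : 0 <= u <= 2 * T -> is_derive (u : R^o) 1 (G : R^o -> _) (H (flow X u x)).
  by move=> /andP[u0 u1]; apply: DG; rewrite ger0_norm //; qlra.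
have E : G T = I.
  apply: (integral_unique (ltW T0) _ IxT); exists G; split=> // u /andP[u0 u1].
  by apply: DG'; rewrite u0 /=; qlra.
have shift u : flow X (u + T) x = translate k (flow X u x).
  by have := reaches_trans HT (reaches_translate k (FT u)); rewrite addrC => /flowE.
(* The integrand has period T along the orbit, so the integral over a period does not depend on
   where it starts. *)
have C : G (s + T) - G s = G (0 + T) - G 0.
  apply: (const_of_derive0 (G := fun u => G (u + T) - G u) s0) => u /andP[u0 us].
  have D1 : is_derive (u + T : R^o) 1 (G : R^o -> _) (H (flow X (u + T) x)).
    by apply: DG'; apply/andP; split; qlra.
  have D2 : is_derive (u : R^o) 1 (G : R^o -> _) (H (flow X u x)).
    by apply: DG'; apply/andP; split; qlra.
  have := cderB (cder_shift D1) D2; by rewrite shift tH subrr.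
exists (fun u => G (u + s) - G s); split.
- by rewrite add0r subrr.
- by rewrite [T + s]addrC C G0 subr0 add0r.
move=> u /andP[u0 uT].
have D1 : is_derive (u + s : R^o) 1 (G : R^o -> _) (H (flow X (u + s) x)).
  by apply: DG'; apply/andP; split; qlra.
have := cderB (cder_shift D1) (cder_cst (G s) u); rewrite subr0.
have Hs := ret_time_total (ret_time_flow RT (FT s)) u.
have E2 := flowE (reaches_trans (FT s) Hs); rewrite [s + u]addrC in E2.
by rewrite (flow_translate l Hs) tH -E2.
Qed.

Lemma integral_Rintegral m (H : 'rV[R]_N -> 'rV[R]_m) x T I k :
  smooth_on [set x : 'rV[R]_N | ordered x] H -> flow_total X x -> 0 < T ->
  integral_along H x T I ->
  (@lebesgue_measure R).-integrable `[0, T] (EFin \o (fun t => H (flow X t x) 0 k)) /\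
  Rintegral (@lebesgue_measure R) `[0, T] (fun t => H (flow X t x) 0 k) = I 0 k.
Proof.
move=> sH FT T0 [G [G0 GT DG]]; pose f t := H (flow X t x) 0 k.
have cf : continuous (f : R^o -> R^o).
  move=> t; apply: (@continuous_comp R^o _ R^o (fun t => H (flow X t x)) (fun w : 'rV[R]_m => w 0 k)).
    exact: path_cont sH FT t.
  exact: continuous_coord.
have cw : {within `[0, T], continuous f} by apply: continuous_subspaceT.
split; first by apply: continuous_compact_integrable => //; exact: segment_compact.
have D s : 0 <= s <= T -> is_derive (s : R^o) 1 ((fun t => G t 0 k) : R^o -> R^o) (f s).
  by move=> /DG/cder_coord/(_ k).
have cG s : 0 <= s <= T -> {for s, continuous ((fun t => G t 0 k) : R^o -> R^o)}.
  by move=> /D/cder_cont.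
have i0 : 0 <= (0 : R) <= T by rewrite lexx ltW.
have iT : 0 <= T <= T by rewrite lexx ltW.
rewrite /Rintegral (@continuous_FTC2 R f (fun t => G t 0 k) 0 T T0 cw).
- by rewrite G0 GT /= mxE subr0.
- split; last 2 first.
  + by apply: cvg_at_right_filter; exact: cG.
  + by apply: cvg_at_left_filter; exact: cG.
  by move=> s; rewrite in_itv /= => /andP[s0 s1]; have [] := D s; rewrite ?(ltW s0) ?(ltW s1).
move=> s; rewrite in_itv /= => /andP[s0 s1]; rewrite derive1E.
by have [|_ ->] := D s; rewrite ?(ltW s0) ?(ltW s1).
Qed.

Lemma cder_row_mx n m (f : R -> 'rV[R]_n) (g : R -> 'rV[R]_m) (s : R) a b :
  is_derive (s : R^o) 1 (f : R^o -> _) a -> is_derive (s : R^o) 1 (g : R^o -> _) b ->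
  is_derive (s : R^o) 1 ((fun t => row_mx (f t) (g t)) : R^o -> _) (row_mx a b).
Proof.
move=> Df Dg; have E : (fun t => row_mx (f t) (g t)) =
    (fun t => f t *m row_mx 1%:M 0 + g t *m row_mx 0 1%:M).
  by apply/funext => t; rewrite -row_mxE.
by rewrite E row_mxE; exact: (cderD (cder_mulmx _ Df) (cder_mulmx _ Dg)).
Qed.

(** The integral is adjoined to the state: for the field (X, H) it is a component of the flow, whose
    joint smoothness is known. *)
Lemma integral_smooth n m (H : 'rV[R]_N -> 'rV[R]_m) x (T : R) :
  smooth_on [set x : 'rV[R]_N | ordered x] H -> flow_total X x ->
  exists (d : R) (J : 'rV[R]_(1 + N) -> 'rV[R]_m), [/\ 0 < d,
    Ck_on n [set z | `|z - row_mx T%:M x| < d] J &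
    forall t (y : 'rV[R]_N), `|t - T| < d -> `|y - x| < d -> 0 <= t ->
      integral_along H y t (J (row_mx t%:M y))].
Proof.
move=> sH FT; pose U := [set z : 'rV[R]_(N + m) | ordered (lsubmx z)].
have oU' : open U := open_lsubmx oU.
pose Y (z : 'rV[R]_(N + m)) : 'rV[R]_(N + m) := row_mx (X (lsubmx z)) (H (lsubmx z)).
have CL k : Ck_on k U (fun z : 'rV[R]_(N + m) => lsubmx z).
  by apply: (Ck_on_lsubmx oU'); exact: Ck_on_id.
have sY : smooth_on U Y.
  by move=> k; apply: (Ck_on_row_mx oU');
    [exact: (Ck_on_comp oU' oU _ (CL k) (sX k))|exact: (Ck_on_comp oU' oU _ (CL k) (sH k))].
have [G [G0 DG]] := @integral_exists m H x (`|T| + 1) sH FT.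
have c0 : 0 < `|T| + 1 by apply: ltr_wpDl.
have HT : reach_in Y U (row_mx x 0) T (row_mx (flow X T x) (G T)).
  exists (fun s => row_mx (flow X s x) (G s)), (- (`|T| + 1)), (`|T| + 1); split=> //.
  - by rewrite oppr_lt0 c0.
  - by rewrite -ltr_norml ltrDl.
  - move=> s; rewrite -ltr_norml => sc; have [os Ds] := total_cder FT s.
    rewrite /U /Y /= row_mxKl; split=> //; exact: (cder_row_mx Ds (DG s sc)).
  have [ox _] := reaches_domain (FT 0); by rewrite (flow0 ox) G0.
have [d d0 [Hd CJ]] := flow_joint oU' sY n HT.
pose e (z : 'rV[R]_(1 + N)) : 'rV[R]_(1 + (N + m)) := row_mx (lsubmx z) (row_mx (rsubmx z) 0).
have oB := @open_dist R (1 + N) (row_mx T%:M x) d.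
have Ce : Ck_on n [set z : 'rV[R]_(1 + N) | `|z - row_mx T%:M x| < d] e.
  apply: (Ck_on_row_mx oB); first by apply: (Ck_on_lsubmx oB); exact: Ck_on_id.
  apply: (Ck_on_row_mx oB); last exact: Ck_on_cst.
  by apply: (Ck_on_rsubmx oB); exact: Ck_on_id.
have sub z : `|z - row_mx T%:M x| < d -> `|e z - row_mx T%:M (row_mx x 0)| < d.
  move=> zd; rewrite /e !opp_row_mx !add_row_mx subr0.
  apply: row_mx_norm_lt; last apply: row_mx_norm_lt; rewrite ?normr0 //.
    apply: le_lt_trans zd; apply: le_trans (lsubmx_norm _).
    by rewrite linearB /= row_mxKl.
  apply: le_lt_trans zd; apply: le_trans (rsubmx_norm _).
  by rewrite linearB /= row_mxKr.
exists d, (fun z => rsubmx (flow_in Y U (lsubmx (e z) 0 0) (rsubmx (e z)))); split=> //.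
  apply: (Ck_on_rsubmx oB).
  have oB2 := @open_dist R (1 + (N + m)) (row_mx T%:M (row_mx x 0)) d.
  exact: (Ck_on_comp oB oB2 sub Ce CJ).
move=> t y td yd t0; rewrite /e row_mxKl !row_mxKr row_mxKl scalar_mx00.
have y0d : `|row_mx y (0 : 'rV[R]_m) - row_mx x 0| < d.
  by rewrite opp_row_mx add_row_mx subrr; apply: row_mx_norm_lt; rewrite ?normr0.
have [phi [a [b [/andP[a0 b0] /andP[at' tb] Hphi p0 pt]]]] := Hd t _ td y0d.
have Dl s : a < s < b -> ordered (lsubmx (phi s)) /\
    is_derive (s : R^o) 1 ((fun u => lsubmx (phi u)) : R^o -> _) (X (lsubmx (phi s))).
  move=> /Hphi[os Ds]; split=> //; have := cder_mulmx (col_mx 1%:M 0) Ds.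
  rewrite -lsubmxE row_mxKl; congr (is_derive _ _ _ _).
  by apply/funext => u; rewrite lsubmxE.
have Es s : 0 <= s <= t -> flow X s y = lsubmx (phi s).
  move=> /andP[s0 st]; apply: flowE; exists (fun u => lsubmx (phi u)), a, b; split=> //.
  - by rewrite a0.
  - by apply/andP; split; qlra.
  - by rewrite p0 row_mxKl.
exists (fun s => rsubmx (phi s)); split; first by rewrite p0 row_mxKr.
  by rewrite pt.
move=> s sT; have /andP[s0 st] := sT; have [|_ Ds] := Hphi s; first by apply/andP; split; qlra.
rewrite (Es s sT); have := cder_mulmx (col_mx 0 1%:M) Ds.
rewrite -rsubmxE row_mxKr; congr (is_derive _ _ _ _).
by apply/funext => u; rewrite rsubmxE.
Qed.

(** [family_section] provides smooth base points and periods, and the integral is smooth in both. As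
    it depends only on the orbit, any other choice of points yields the same smooth function. *)
Lemma average_smooth m (H : 'rV[R]_N -> 'rV[R]_m) (W : set 'rV[R]_(N - 3)) C (F : 'rV[R]_(N - 3) -> 'rV[R]_m) n :
  smooth_on [set x : 'rV[R]_N | ordered x] H -> (forall k x, H (translate k x) = H x) ->
  open W -> stable_family X W C ->
  (forall mu, W mu -> exists x T I, [/\ C mu x, ret_time X x T, integral_along H x T I & F mu = T^-1 *: I]) ->
  Ck_on n W F.
Proof.
move=> sH tH oW Fam HF; apply: Ck_on_local => lam Wl.
have [d1 [p [tau [d10 Cp Ct P]]]] := family_section n oW Fam Wl.
have Bl : [set mu : 'rV[R]_(N - 3) | `|mu - lam| < d1] lam by rewrite /= subrr normr0.
have [_ _ RT] := P lam Bl; have [d2 [J [d20 CJ HJ]]] := integral_smooth n (tau lam) sH (ret_time_total RT).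
have [d3 d30 H3] := (cont_eps _ _).1 (Ck_on_cont Cp Bl) _ d20.
have [d4 d40 H4] := (cont_eps _ _).1 (Ck_on_cont Ct Bl) _ d20.
pose d := Num.min d1 (Num.min d3 d4).
have d0 : 0 < d by rewrite !lt_min d10 d30.
have B1 (mu : 'rV[R]_(N - 3)) : `|mu - lam| < d -> `|mu - lam| < d1 by rewrite lt_min => /andP[].
have B3 (mu : 'rV[R]_(N - 3)) : `|mu - lam| < d -> `|p mu - p lam| < d2.
  by rewrite !lt_min => /andP[_ /andP[/H3]].
have B4 (mu : 'rV[R]_(N - 3)) : `|mu - lam| < d -> `|tau mu - tau lam| < d2.
  by rewrite !lt_min => /andP[_ /andP[_ /H4]].
pose A := [set mu : 'rV[R]_(N - 3) | `|mu - lam| < d]; have oA : open A by exact: open_dist.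
exists A; first by split=> //; rewrite /A /= subrr normr0.
have FE mu : A mu -> (tau mu)^-1 *: J (row_mx (tau mu)%:M (p mu)) = F mu.
  move=> Am; have [Wm Cpm RTm] := P mu (B1 mu Am); have [t0 _ _] := RTm.
  have [x [T [I [Cx RTx Ix ->]]]] := HF mu Wm; have [[PO _ _] _] := Fam mu Wm.
  have [T' _ DE] := periodic_orbitP PO Cx; have Oxp : orbit X x (p mu) by rewrite -DE.
  have E : T = tau mu by exact: (ret_time_unique (orbit_ret RTx Oxp) RTm).
  have Ip := integral_orbit sH tH RTx Oxp Ix; rewrite E in Ip *.
  by rewrite (integral_unique (ltW t0) Ip (HJ _ _ (B4 mu Am) (B3 mu Am) (ltW t0))).
apply: (Ck_on_ext oA FE); apply/(Ck_on_coord _ _ oA) => k.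
have CpA : Ck_on n A p by apply: Ck_on_sub Cp => mu /B1.
have CtA : Ck_on n A (tau : _ -> R^o) by apply: Ck_on_sub Ct => mu /B1.
have CJA : Ck_on n A (fun mu => J (row_mx (tau mu)%:M (p mu))).
  have oB := @open_dist R (1 + N) (row_mx (tau lam)%:M (p lam)) d2.
  apply: (Ck_on_comp oA oB _ _ CJ).
    by move=> mu Am; apply: pair_norm_lt; [exact: B4|exact: B3].
  apply: (Ck_on_row_mx oA) => //; apply/(Ck_on_coord _ _ oA) => j.
  by apply: (Ck_on_ext oA _ CtA) => mu _; rewrite (ord1 j) scalar_mx00.
have CI : Ck_on n A (fun mu => (tau mu)^-1 : R^o).
  by apply: (Ck_on_inv oA _ CtA) => mu /B1/P[_ _ [t0 _ _]]; rewrite gt_eqF.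
have CJk := (Ck_on_coord n _ oA).1 CJA k.
by apply: (Ck_on_ext oA _ (Ck_on_mul oA CI CJk)) => mu _; rewrite mxE.
Qed.

(** * Effect of the relabelling on orbits and averages *)

Lemma sigma_reaches x t y : (forall x, X (sigma x) = X x *m @shift_mx R N) ->
  reaches X x t y -> reaches X (sigma x) t (sigma y).
Proof.
move=> eX [phi [c [d [cd ct Hs p0 pt]]]]; exists (fun s => sigma (phi s)), c, d; split=> //.
- move=> s /Hs[os Ds]; split; first exact: sigma_ordered.
  by have := cderD (cder_mulmx (@shift_mx R N) Ds) (cder_cst (@wrap R N) s); rewrite addr0 eX.
- by rewrite p0.
by rewrite pt.
Qed.

Lemma sigma_ret_time x T : (forall x, X (sigma x) = X x *m @shift_mx R N) ->
  ret_time X x T -> ret_time X (sigma x) T.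
Proof.
move=> eX RT; have [T0 [k H] M] := RT; split=> //.
  by exists k; rewrite -sigma_translate; exact: sigma_reaches.
move=> s l sT Hs; have Hx := ret_time_total RT s; apply: (M s l sT).
have E := reaches_unique (sigma_reaches eX Hx) Hs; rewrite -sigma_translate in E.
by rewrite -(sigma_inj E).
Qed.

Lemma sigma_orbit x T : (forall x, X (sigma x) = X x *m @shift_mx R N) -> ret_time X x T ->
  @sigma R N @` orbit X x = orbit X (sigma x).
Proof.
move=> eX RT; apply/seteqP; split=> [_ [_ [t [z Hz [k ->]]] <-]|y [t [z Hz [k ->]]]].
  exists t, (sigma z); first exact: sigma_reaches.
  by exists k; rewrite sigma_translate.
have Ht := ret_time_total RT t; have E := reaches_unique (sigma_reaches eX Ht) Hz.
exists (translate k (flow X t x)); last by rewrite sigma_translate E.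
by exists t, (flow X t x) => //; exists k.
Qed.

Lemma sigma_dist (D : set 'rV[R]_N) x : dist_to (@sigma R N @` D) (sigma x) = dist_to D x.
Proof.
rewrite /dist_to; congr (inf _); apply/seteqP; split=> [_ [_ [c Dc <-] <-]|_ [c Dc <-]].
  by exists c => //; rewrite sigmaB shift_norm.
by exists (sigma c); [exists c|rewrite sigmaB shift_norm].
Qed.

(** The relabelling is an isometry that commutes with the flow. It maps the level set onto the one
    over the shifted cross ratios, since [cross_shift] is injective on cross ratios of ordered
    configurations. *)
Lemma sigma_stable lam D : (forall x, X (sigma x) = X x *m @shift_mx R N) ->
  stable_orbit X lam D -> stable_orbit X (cross_shift lam) (@sigma R N @` D).
Proof.
move=> eX [PO DL [eta [K [mu [eta0 K0 mu0 ES]]]]].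
have [x Dx] := orbit_nonempty PO; have [T RT DE] := periodic_orbitP PO Dx.
have [ox Lx] := DL x Dx; split.
- by rewrite DE (sigma_orbit eX RT); exact: ret_periodic_orbit (sigma_ret_time eX RT).
- move=> _ [z Dz <-]; have [oz Lz] := DL z Dz; split; first exact: sigma_ordered.
  by rewrite (Lambda_sigma HN oz) Lz.
exists eta, K, mu; split=> // y [oy Ly] dy t t0.
have [z [zE oz]] : exists z, y = sigma z /\ ordered z.
  by exists (sigma_inv y); rewrite sigma_invK //; split=> //; exact: sigma_inv_ordered.
have Lz : Lambda z = lam.
  by rewrite -Lx; apply: (cross_shift_inj HN oz ox); rewrite -(Lambda_sigma HN oz) -zE Ly Lx.
rewrite zE sigma_dist in dy *; have [w Hw dw] := ES z (conj oz Lz) dy t t0.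
by exists (sigma w); [exact: sigma_reaches|rewrite sigma_dist].
Qed.

Lemma sigma_integral (H : 'rV[R]_N -> 'rV[R]_(N - 3)) x T I :
  (forall x, X (sigma x) = X x *m @shift_mx R N) ->
  (forall y, ordered y -> H (sigma y) = H y *m jac (@cross_shift R N) (Lambda y)) ->
  flow_total X x -> integral_along H x T I ->
  integral_along H (sigma x) T (I *m jac (@cross_shift R N) (Lambda x)).
Proof.
move=> eX eH FT [G [G0 GT DG]]; exists (fun s => G s *m jac (@cross_shift R N) (Lambda x)).
split; [by rewrite G0 mul0mx|by rewrite GT|move=> s sT].
have [os _] := total_cder FT s.
rewrite (flowE (sigma_reaches eX (FT s))) (eH _ os) (reaches_Lambda (FT s)).
exact: cder_mulmx (DG s sT).
Qed.

Lemma sigma_average (H : 'rV[R]_N -> 'rV[R]_(N - 3)) lam D x y T T' I J :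
  smooth_on [set x : 'rV[R]_N | ordered x] H -> (forall k x, H (translate k x) = H x) ->
  (forall x, X (sigma x) = X x *m @shift_mx R N) ->
  (forall y, ordered y -> H (sigma y) = H y *m jac (@cross_shift R N) (Lambda y)) ->
  stable_orbit X lam D -> D x -> (@sigma R N @` D) y -> ret_time X x T -> ret_time X y T' ->
  integral_along H x T I -> integral_along H y T' J ->
  T' = T /\ J = I *m jac (@cross_shift R N) lam.
Proof.
move=> sH tH eX eH S Dx sDy RT RT' Ix Jy; have [PO DL _] := S; have [_ Lx] := DL x Dx.
have [_ _ DE] := periodic_orbitP PO Dx.
have RTs := sigma_ret_time eX RT; have Oy : orbit X (sigma x) y.
  by rewrite -(sigma_orbit eX RT) -DE.
have E : T' = T by exact: ret_time_unique RT' (orbit_ret RTs Oy).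
rewrite E in Jy; split=> //; have [T0 _ _] := RT.
have Is := integral_orbit sH tH RTs Oy (sigma_integral eX eH (ret_time_total RT) Ix).
by rewrite -Lx; exact: integral_unique (ltW T0) Jy Is.
Qed.

(** Uniqueness makes the stable orbit over [lambda_star] invariant under the relabelling. Its
    integral is therefore fixed by the differential of [cross_shift], which fixes only 0. *)
Lemma average_star (H : 'rV[R]_N -> 'rV[R]_(N - 3)) D x T I :
  smooth_on [set x : 'rV[R]_N | ordered x] H -> (forall k x, H (translate k x) = H x) ->
  (forall x, X (sigma x) = X x *m @shift_mx R N) ->
  (forall y, ordered y -> H (sigma y) = H y *m jac (@cross_shift R N) (Lambda y)) ->
  unique (stable_orbit X (lambda_star R N)) D -> D x -> ret_time X x T ->
  integral_along H x T I -> I = 0.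
Proof.
move=> sH tH eX eH [S U] Dx RT Ix; have S' := sigma_stable eX S.
rewrite (cross_shift_star HN) in S'; have DE := U _ S'.
have Dx' := Dx; rewrite DE in Dx'.
have [_ E] := sigma_average sH tH eX eH S Dx Dx' RT RT Ix Ix.
exact: (cross_shift_fixed HN (esym E)).
Qed.

Lemma averaged_drift r (delta : R) C0 W C (h : R -> R) :
  smooth_on setT (h : R^o -> R^o) -> (forall (u : R) (k : int), h (u + 2 * pi * k%:~R) = h u) ->
  (forall x, X (sigma x) = X x *m @shift_mx R N) -> 0 < delta ->
  closed_nbhd_star delta `<=` @V_set R N ->
  (forall lam, closed_nbhd_star delta lam -> unique (stable_orbit X lam) (C0 lam)) ->
  largest_extension r.+1 X delta C0 W C ->
  (forall lam theta, W lam -> C lam theta ->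
     exists phi T, [/\ solution_from X theta phi T, F_integrable h phi T &
       forall phi' T', solution_from X theta phi' T' -> phi' = phi /\ T' = T]) /\
  (forall theta phi T, parametrization X W C theta phi T ->
     let F := F_h h phi T in
     [/\ Ck_on 1 W F,
         forall theta' phi' T', parametrization X W C theta' phi' T' ->
           forall lam, W lam -> F_h h phi' T' lam = F lam,
         N = 4%N ->
           [/\ forall lam, W lam ->
                 W (const_mx 1 - lam) /\ F lam = - F (const_mx 1 - lam),
               lambda_star R N = const_mx (1 / 2) & F (lambda_star R N) = 0] &
         F (lambda_star R N) = 0]).
Proof.
move=> sh ph eX d0 BV U HW; have [[[oW WV] BW EB SW _] _] := HW.
have [H HE] : exists H, H = @DLambda_h R N h by eexists.
have sH : smooth_on [set x : 'rV[R]_N | ordered x] H by rewrite HE; exact (smooth_DLambda_h HN sh).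
have tH k x : H (translate k x) = H x by rewrite HE; exact (DLambda_h_translate HN ph k x).
have eH x : ordered x -> H (sigma x) = H x *m jac (@cross_shift R N) (Lambda x).
  by rewrite HE; exact (@DLambda_h_sigma R N HN h ph x).
have [Fam L] := largest_family d0 BV U HW.
have Bs : closed_nbhd_star delta (lambda_star R N) by apply: star_in_nbhd; exact: ltW.
have Ws := BW _ Bs.
have orb lam x : W lam -> C lam x -> exists T I, [/\ ret_time X x T, C lam = orbit X x,
    flow_total X x & integral_along H x T I].
  move=> Wl Cx; have [PO _ _] := SW lam Wl; have [T RT DE] := periodic_orbitP PO Cx.
  have FT := ret_time_total RT; have [T0 _ _] := RT.
  have [G [G0 DG]] := integral_exists (T + 1) sH FT.
  exists T, (G T); split=> //; exists G; split=> // s /andP[s0 sT].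
  by apply: DG; rewrite ger0_norm //; qlra.
split=> [lam x Wl Cx|].
  have [T [I [RT DE FT Ix]]] := orb lam x Wl Cx; have [T0 _ _] := RT.
  exists (fun t => flow X t x), T; split.
  - exact: ret_solution RT.
  - by move=> k; rewrite -HE; have [] := integral_Rintegral k sH FT T0 Ix.
  move=> phi' T' /(solution_ret)[RT' ->].
  by split=> //; exact: ret_time_unique RT' RT.
have value theta phi T : parametrization X W C theta phi T -> forall lam, W lam ->
    exists x I, [/\ C lam x, ret_time X x (T lam), integral_along H x (T lam) I &
      F_h h phi T lam = (T lam)^-1 *: I].
  move=> HP lam Wl; have [Cx Sx] := HP lam Wl.
  have [RT pE] := solution_ret Sx; have [T' [I [RT' DE FT Ix]]] := orb lam _ Wl Cx.
  have E : T' = T lam by exact: ret_time_unique RT' RT.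
  rewrite E in Ix; have [T0 _ _] := RT; exists (theta lam), I; split=> //.
  apply/rowP => k; rewrite !mxE pE -HE; congr (_ * _).
  by have [] := integral_Rintegral k sH FT T0 Ix.
have same lam x y T T' I J : W lam -> C lam x -> C lam y -> ret_time X x T -> ret_time X y T' ->
    integral_along H x T I -> integral_along H y T' J -> T' = T /\ J = I.
  move=> Wl Cx Cy RT RT' Ix Jy; have [T1 [_ [_ DE _ _]]] := orb lam x Wl Cx.
  have Oy : orbit X x y by rewrite -DE.
  have E : T' = T by exact: (ret_time_unique RT' (orbit_ret RT Oy)).
  rewrite E in Jy; split=> //; have [T0 _ _] := RT.
  exact: (integral_unique (ltW T0) Jy (integral_orbit sH tH RT Oy Ix)).
move=> theta phi T HP F.
have Fs : F (lambda_star R N) = 0.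
  have [x [I [Cx RT Ix]]] := value _ _ _ HP _ Ws; rewrite /F => ->.
  rewrite (EB _ Bs) in Cx.
  by rewrite (average_star sH tH eX eH (U _ Bs) Cx RT Ix) scaler0.
split; last exact: Fs.
- apply: (average_smooth 1 sH tH oW Fam) => mu Wm.
  by have [x [I [Cx RT Ix E]]] := value _ _ _ HP mu Wm; exists x, (T mu), I.
- move=> theta' phi' T' HP' lam Wl.
  have [x [I [Cx RT Ix E]]] := value _ _ _ HP lam Wl.
  have [y [J [Cy RT' Jy E']]] := value _ _ _ HP' lam Wl.
  by have [ET EI] := same lam x y _ _ I J Wl Cx Cy RT RT' Ix Jy; rewrite /F E E' ET EI.
move=> N4; have G4 := cross_shift_four HN N4; split; last exact: Fs.
  (* The relabelled orbit is stable over 1 - lam, so by maximality it is the member of the family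
     there. With N = 4 there is a single cross ratio and the monotonicity in [V_set] is void. *)
  move=> lam Wl; have SS := sigma_stable eX (SW lam Wl).
  have VG : V_set (const_mx 1 - lam).
    have [V1 _] := WV lam Wl; split=> [k|k l]; first by rewrite !mxE; have := V1 k; qlra.
    by have := ltn_ord k; have := ltn_ord l; lia.
  rewrite G4 in SS; have [Wl' Cl'] := L _ _ VG SS; split=> //.
  have [x [I [Cx RT Ix E]]] := value _ _ _ HP lam Wl.
  have [y [J [Cy RT' Jy E']]] := value _ _ _ HP _ Wl'.
  rewrite Cl' in Cy.
  have [ET EJ] := sigma_average sH tH eX eH (SW lam Wl) Cx Cy RT RT' Ix Jy.
  by rewrite /F E E' ET EJ (jac_cross_shift_four HN _ N4) mulmxN mulmx1 scalerN opprK.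
(* The point [lambda_star] is fixed under lam -> 1 - lam, which forces 1/2. *)
have := cross_shift_star (R := R) HN; rewrite G4; move: (lambda_star R N) => l E; apply/rowP => k.
rewrite [RHS]mxE; have := congr1 (fun v : 'rV[R]_(N - 3) => v 0 k) E; rewrite !mxE; qlra.
Qed.

End TorusFlow.

Theorem theorem5p1 (R : realType) (N : nat) (HN : (4 <= N)%N)
  (f : R[i] -> R[i]) (g : R[i] -> R) (a b : nat -> R) (h : R -> R)
  (Hf : smooth_disk_C f) (Hg : smooth_disk_R g)
  (Hh : normalized_forcing a b h)
  (r : nat) (Hr : (1 <= r)%N)
  (delta : R) (C0 : 'rV[R]_(N - 3) -> set 'rV[R]_N)
  (HM : M_delta_exists r f g (vector_field f g h 0) delta C0)
  (W : set 'rV[R]_(N - 3)) (C : 'rV[R]_(N - 3) -> set 'rV[R]_N)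
  (HW : largest_extension r (vector_field f g h 0) delta C0 W C) :
  let X := vector_field f g h 0 : 'rV[R]_N -> 'rV[R]_N in
  (* the ingredients of F_h exist and are unique *)
  (forall lam theta, W lam -> C lam theta ->
     exists phi T, [/\ solution_from X theta phi T, F_integrable h phi T &
       forall phi' T', solution_from X theta phi' T' -> phi' = phi /\ T' = T]) /\
  (forall theta phi T, parametrization X W C theta phi T ->
     let F := F_h h phi T in
     [/\ Ck_on 1 W F,
         forall theta' phi' T', parametrization X W C theta' phi' T' ->
           forall lam, W lam -> F_h h phi' T' lam = F lam,
         N = 4%N ->
           [/\ forall lam, W lam ->
                 W (const_mx 1 - lam) /\ F lam = - F (const_mx 1 - lam),
               lambda_star R N = const_mx (1 / 2) & F (lambda_star R N) = 0] &
         F (lambda_star R N) = 0]).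
Proof.
case: r Hr HM HW => [Hr0|r _ HM HW X]; first by case: (notF Hr0).
have [_ [d0 BV] U _ _] := HM; have [sh _ _ _] := Hh.
apply: (averaged_drift HN (smooth_field HN h Hf Hg) (fun k x => field_translate f g h k x)
  (Lambda_conserved HN f g h) sh _ _ d0 BV U HW).
  by move=> x k; exact: forcing_periodic Hh.
by move=> x; exact: field_sigma.
Qed.
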